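(* Let $\Theta$ be a bounded smooth domain in $\mathbb{R}^n$, $n\ge3$, $2^*:=\frac{2n}{n-2}$, and let $a\in\mathcal{C}^1(\overline\Theta)$, $b,c\in\mathcal{C}^0(\overline\Theta)$ be strictly positive on $\overline\Theta$. With $\lambda_m^{a,b}$, $T_m$, $J_\lambda$, $\mathcal{N}_\lambda$, $\ell_\lambda$, $\kappa^{a,c}$ and $\lambda_{m,*}^{a,b,c}$ as defined in the context, for every $m\in\mathbb{N}\cup\{0\}$ the following statements hold true: (a) The function $\lambda\mapsto\ell_\lambda$ is nonincreasing in $T_m$ and $0<\ell_\lambda\le\kappa^{a,c}$ for all $\lambda\in T_m$. (b) $\ell_\lambda$ is attained on $\mathcal{N}_\lambda$ (i.e. there is $u\in\mathcal{N}_\lambda$ with $J_\lambda(u)=\ell_\lambda$) if $\ell_\lambda<\kappa^{a,c}$. (c) The function $\lambda\mapsto\ell_\lambda$ is continuous in $T_m$ and $\lim_{\lambda\nearrow\lambda_{m+1}^{a,b}}\ell_\lambda=0$. Hence, $\lambda_{m,*}^{a,b,c}<\lambda_{m+1}^{a,b}$. (d) $\ell_\lambda$ is not attained if $\lambda\in(-\infty,\lambda_{0,*}^{a,b,c})$ or $\lambda\in[\lambda_m^{a,b},\lambda_{m,*}^{a,b,c})$, $m\ge1$, and is attained if $\lambda\in(\lambda_{m,*}^{a,b,c},\lambda_{m+1}^{a,b})$.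
   Context: These objects are associated with the problem $-\mathrm{div}(a(x)\nabla u)=\lambda b(x)u+c(x)|u|^{2^*-2}u$ in $\Theta$, $u=0$ on $\partial\Theta$, where $\lambda\in\mathbb{R}$. On $H_0^1(\Theta)$ use the scalar product $\langle u,v\rangle_a:=\int_\Theta a\,\nabla u\cdot\nabla v$ and norm $\|u\|_a:=(\int_\Theta a|\nabla u|^2)^{1/2}$; set $|u|_{b,2}:=(\int_\Theta b\,u^2)^{1/2}$ and $|u|_{c,2^*}:=(\int_\Theta c|u|^{2^*})^{1/2^*}$. Let $0<\lambda_1^{a,b}<\lambda_2^{a,b}\le\lambda_3^{a,b}\le\cdots$ be the eigenvalues of $-\mathrm{div}(a\nabla u)=\lambda b u$ in $\Theta$, $u=0$ on $\partial\Theta$, counted with their multiplicity, and let $e_1,e_2,e_3,\dots$ be the corresponding normalized eigenfunctions, i.e. $|e_j|_{b,2}=1$. Set $Z_0:=\{0\}$, $Z_m:=\mathrm{span}\{e_1,\dots,e_m\}$, $T_0:=(-\infty,\lambda_1^{a,b})$ and $T_m:=[\lambda_m^{a,b},\lambda_{m+1}^{a,b})$ for $m\in\mathbb{N}$. Define $J_\lambda:H_0^1(\Theta)\to\mathbb{R}$ by $$J_\lambda(u):=\tfrac12\|u\|_a^2-\tfrac{\lambda}{2}|u|_{b,2}^2-\tfrac1{2^*}|u|_{c,2^*}^{2^*}.$$ For $\lambda\in T_m$ define $$\mathcal{N}_\lambda:=\{u\in H_0^1(\Theta)\smallsetminus Z_m: J_\lambda'(u)u=0\text{ and }J_\lambda'(u)z=0\text{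 for all }z\in Z_m\},\qquad \ell_\lambda:=\inf_{\mathcal{N}_\lambda}J_\lambda .$$ Let $S$ be the best Sobolev constant for the embedding $H^1(\mathbb{R}^n)\hookrightarrow L^{2^*}(\mathbb{R}^n)$, i.e. the largest constant with $S\left(\int_{\mathbb{R}^n}|u|^{2^*}\right)^{2/2^*}\le\int_{\mathbb{R}^n}|\nabla u|^2$ for all $u\in H^1(\mathbb{R}^n)$. Set $$\kappa^{a,c}:=\Bigl(\min_{x\in\overline\Theta}\frac{a(x)^{n/2}}{c(x)^{(n-2)/2}}\Bigr)\frac1nS^{n/2},\qquad \lambda_{m,*}^{a,b,c}:=\inf\{\lambda\in T_m:\ell_\lambda<\kappa^{a,c}\}.$$
   Formalization: The limit and the inequality λ_{m,*}<λ_{m+1} in (c), and all of (d), are stated only when T_m is nonempty, i.e. m=0 or λ_m<λ_{m+1}; if λ_m=λ_{m+1} then T_m is empty, ℓ_λ is undefined and λ_{m,*}=inf ∅=+∞, so these clauses fail or have no meaning. *)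

(* Defs.v *)
From HB Require Import structures.
From mathcomp Require Import all_boot all_order all_algebra.
From mathcomp Require Import all_classical all_reals all_analysis.

Set Implicit Arguments.
Unset Strict Implicit.
Unset Printing Implicit Defensive.

Import Order.TTheory GRing.Theory Num.Theory.
Import numFieldNormedType.Exports.

Local Open Scope classical_set_scope.
Local Open Scope ring_scope.

(** * Lebesgue measure on R^n *)

(* The sigma-algebra on row vectors is generated by the coordinate maps, as for
   [n.-tuple T] in MathComp-Analysis; it is the Borel sigma-algebra of R^n. *)
Fact measure_rV_display : measure_display.
Proof. exact: (measure_tuple_display default_measure_display). Qed.

Section measurable_rV.
Context {R : realType} {n : nat}.

Definition rV_coord (i : 'I_n) (x : 'rV[R]_n) : measurableTypeR R := x ord0 i.

Let rV_set0 : g_sigma_preimage rV_coord set0.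
Proof. exact: sigma_algebra0. Qed.

Let rV_setC A : g_sigma_preimage rV_coord A -> g_sigma_preimage rV_coord (~` A).
Proof. exact: sigma_algebraC. Qed.

Let rV_bigcup (F : (set 'rV[R]_n)^nat) :
  (forall i, g_sigma_preimage rV_coord (F i)) ->
  g_sigma_preimage rV_coord (\bigcup_i (F i)).
Proof. exact: sigma_algebra_bigcup. Qed.

HB.instance Definition _ := @isMeasurable.Build measure_rV_display
  'rV[R]_n (g_sigma_preimage rV_coord) rV_set0 rV_setC rV_bigcup.

End measurable_rV.

Section rV_cons.
Context {R : realType} {n : nat}.

Definition rV_cons (p : measurableTypeR R * 'rV[R]_n) : 'rV[R]_n.+1 :=
  \row_i if unlift ord0 i is Some j then p.2 ord0 j else p.1.

Definition rV_uncons (x : 'rV[R]_n.+1) : measurableTypeR R * 'rV[R]_n :=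
  (x ord0 ord0, \row_j x ord0 (lift ord0 j)).

Lemma rV_consK : cancel rV_cons rV_uncons.
Proof.
move=> [r v]; rewrite /rV_uncons /rV_cons mxE unlift_none; congr pair.
by apply/rowP => j; rewrite !mxE liftK.
Qed.

Lemma measurable_rV_coord k (i : 'I_k) : measurable_fun setT (@rV_coord R k i).
Proof.
move=> _ Y mY; rewrite setTI; apply: sub_sigma_algebra => /=.
rewrite -bigcup_seq/=; exists i => /=; first by rewrite mem_index_enum.
by exists Y => //; rewrite setTI.
Qed.

Lemma measurable_fun_rV d (T : measurableType d) k (f : T -> 'rV[R]_k) :
  (forall i, measurable_fun setT (@rV_coord R k i \o f)) -> measurable_fun setT f.
Proof.
move=> mf _ A mA; rewrite setTI.
have sub : g_sigma_preimage (fun i => @rV_coord R k i \o f) `<=` measurable.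
  apply: smallest_sub; first exact: sigma_algebra_measurable.
  rewrite -bigcup_seq; apply: bigcup_sub => i _ B [C mC <-].
  exact: mf.
apply: sub; rewrite g_sigma_preimage_comp.
by exists A => //; rewrite setTI.
Qed.

Lemma measurable_rV_cons : measurable_fun setT rV_cons.
Proof.
apply: measurable_fun_rV => i; have [j ->|->] := unliftP ord0 i.
- rewrite (_ : _ \o _ = @rV_coord R n j \o snd).
    by apply: measurableT_comp; [exact: measurable_rV_coord|exact: measurable_snd].
  by apply/funext => p; rewrite /= /rV_coord mxE liftK.
- rewrite (_ : _ \o _ = fst); first exact: measurable_fst.
  by apply/funext => p; rewrite /= /rV_coord mxE unlift_none.
Qed.

Lemma measurable_rV_uncons : measurable_fun setT rV_uncons.
Proof.
apply/measurable_fun_pairP; split; first exact: measurable_rV_coord.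
apply: measurable_fun_rV => i.
rewrite (_ : _ \o _ = @rV_coord R n.+1 (lift ord0 i)).
  exact: measurable_rV_coord.
by apply/funext => x; rewrite /= /rV_coord mxE.
Qed.

End rV_cons.

Section lebesgue_rVS.
Local Open Scope ereal_scope.
Context {R : realType} {n : nat} (m : {sigma_finite_measure set 'rV[R]_n -> \bar R}).

Definition lebesgue_rVS : set 'rV[R]_n.+1 -> \bar R :=
  pushforward (@lebesgue_measure R \x m) (@rV_cons R n).

Let lebesgue_rVS0 : lebesgue_rVS set0 = 0.
Proof. by rewrite /lebesgue_rVS /pushforward preimage_set0 measure0. Qed.

Let lebesgue_rVS_ge0 A : 0 <= lebesgue_rVS A.
Proof. by apply: integral_ge0 => x _; exact: measure_ge0. Qed.

Let lebesgue_rVS_sigma_additive : semi_sigma_additive lebesgue_rVS.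
Proof.
move=> F mF tF mUF; rewrite /lebesgue_rVS /pushforward preimage_bigcup.
apply: measure_semi_sigma_additive.
- by move=> k; rewrite -[X in measurable X]setTI; exact: measurable_rV_cons.
- apply/trivIsetP => /= i j _ _ ij; rewrite -preimage_setI.
  by move/trivIsetP : tF => /(_ _ _ _ _ ij) ->//; rewrite preimage_set0.
- rewrite -preimage_bigcup -[X in measurable X]setTI.
  exact: measurable_rV_cons.
Qed.

HB.instance Definition _ := isMeasure.Build _ _ _ lebesgue_rVS
  lebesgue_rVS0 lebesgue_rVS_ge0 lebesgue_rVS_sigma_additive.

Let lebesgue_rVS_sigma_finite : sigma_finite setT lebesgue_rVS.
Proof.
have /sigma_finiteP[F [TF ndF Foo]] := sigma_finiteT (@lebesgue_measure R).
have /sigma_finiteP[G [TG ndG Goo]] := sigma_finiteT m.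
exists (fun k => rV_uncons @^-1` (F k `*` G k)).
  apply/esym; rewrite -subTset => x _.
  have [i _ Fi] : (\bigcup_i F i) (rV_uncons x).1 by rewrite -TF.
  have [j _ Gj] : (\bigcup_i G i) (rV_uncons x).2 by rewrite -TG.
  exists (maxn i j) => //; split.
  - by move: Fi; exact/subsetPset/ndF/leq_maxl.
  - by move: Gj; exact/subsetPset/ndG/leq_maxr.
move=> k; have [mF Fk] := Foo k; have [mG Gk] := Goo k; split.
  rewrite -[X in measurable X]setTI.
  by apply: measurable_rV_uncons => //; exact: measurableX.
rewrite /lebesgue_rVS /pushforward -comp_preimage.
rewrite (_ : _ \o _ = id); last by apply/funext => p; exact: rV_consK.
by rewrite preimage_id product_measure1E// lte_mul_pinfty// ge0_fin_numE.
Qed.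

HB.instance Definition _ := Measure_isSigmaFinite.Build _ _ _ lebesgue_rVS
  lebesgue_rVS_sigma_finite.

End lebesgue_rVS.

Fixpoint lebesgue_rV (R : realType) (n : nat) :
    {sigma_finite_measure set 'rV[R]_n -> \bar R} :=
  if n is k.+1 then lebesgue_rVS (lebesgue_rV R k)
  else @dirac _ 'rV[R]_0 0 R.

(** * Classical and weak derivatives *)

Section calculus.
Context {R : realType} {n : nat}.
Implicit Types (U : set 'rV[R]_n) (f g u v phi : 'rV[R]_n -> R).

Definition partial (i : 'I_n) f : 'rV[R]_n -> R :=
  fun x => 'D_(delta_mx ord0 i : 'rV[R]_n) f x.

(* [Ck k U f]: f is of class C^k on U, for U open. *)
Fixpoint Ck (k : nat) U f : Prop :=
  (forall x, U x -> {for x, continuous f}) /\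
  (if k is k'.+1 then forall i : 'I_n,
     (forall x, U x -> derivable f x (delta_mx ord0 i : 'rV[R]_n)) /\
     Ck k' U (partial i f)
   else True).

Definition smooth f : Prop := forall k, Ck k setT f.

Definition C0_closure U f : Prop := {within closure U, continuous f}.

(* f and its first partial derivatives on U extend continuously to the closure *)
Definition C1_closure U f : Prop :=
  [/\ C0_closure U f, Ck 1 U f &
      forall i, exists2 g, C0_closure U g & {in U, g =1 partial i f}].

Definition test_fun U phi : Prop :=
  smooth phi /\
  exists2 K, compact K /\ K `<=` U & forall x, ~ K x -> phi x = 0.

Local Notation mu := (lebesgue_rV R n).

Definition ae_eq_on U u v : Prop := {ae mu, forall x, U x -> u x = v x}.

Definition L2 U : set ('rV[R]_n -> R) :=
  [set u : 'rV[R]_n -> R | measurable_fun U u /\ (\int[mu]_(x in U) (u x ^+ 2)%:E < +oo)%E].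

Definition is_weak_partial U i u g : Prop :=
  L2 U g /\
  forall phi, test_fun U phi ->
    \int[mu]_(x in U) (u x * partial i phi x) =
    - \int[mu]_(x in U) (g x * phi x).

(* A representative of the weak derivative, which is unique up to a null set. *)
Definition weak_partial U i u : 'rV[R]_n -> R :=
  xget (cst 0) [set g : 'rV[R]_n -> R | is_weak_partial U i u g].

Definition H1 U : set ('rV[R]_n -> R) :=
  [set u : 'rV[R]_n -> R | L2 U u /\ forall i, exists g, is_weak_partial U i u g].

Definition H1_sqdist U u v : R :=
  (\int[mu]_(x in U) ((u x - v x) ^+ 2)) +
  \sum_(i < n) \int[mu]_(x in U) ((weak_partial U i u x - weak_partial U i v x) ^+ 2).

(* the closure of the test functions in H^1(U) *)
Definition H10 U : set ('rV[R]_n -> R) :=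
  [set u : 'rV[R]_n -> R | H1 U u /\
    forall eps, 0 < eps -> exists2 phi, test_fun U phi & H1_sqdist U u phi < eps].

End calculus.

(** * Bounded smooth domains *)

(* Near each of its boundary points, up to the choice of a coordinate axis and
   of its orientation, the set is the region above the graph of a smooth
   function of the other coordinates. *)
Definition smooth_boundary (R : realType) (n : nat) (U : set 'rV[R]_n) : Prop :=
  forall p, closure U p -> ~ U p ->
  exists (r : R) (i : 'I_n) (s : bool) (gamma : 'rV[R]_n.-1 -> R),
    [/\ 0 < r, smooth gamma &
        forall x, ball p r x -> U x <-> gamma (col' i x) < (-1) ^+ s * x ord0 i].

Definition bounded_smooth_domain (R : realType) (n : nat) (U : set 'rV[R]_n) : Prop :=
  [/\ open U, connected U, U !=set0, bounded_set U & smooth_boundary U].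

(** * The variational problem *)

Definition crit_exp (R : realType) (n : nat) : R := 2 * n%:R / (n%:R - 2).

Section variational.
Context {R : realType} {n : nat}.
Variables (Theta : set 'rV[R]_n) (a b c : 'rV[R]_n -> R).
Implicit Types (u v z : 'rV[R]_n -> R).

Local Notation mu := (lebesgue_rV R n).
Local Notation p := (crit_exp R n).

Definition dot_a u v : R :=
  \int[mu]_(x in Theta)
    (a x * \sum_(i < n) weak_partial Theta i u x * weak_partial Theta i v x).

Definition norm_a u : R := Num.sqrt (dot_a u u).

Definition dot_b u v : R := \int[mu]_(x in Theta) (b x * u x * v x).

Definition norm_b u : R := Num.sqrt (\int[mu]_(x in Theta) (b x * u x ^+ 2)).

Definition norm_c u : R :=
  (\int[mu]_(x in Theta) (c x * (`|u x| `^ p))) `^ p^-1.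

(* -div(a grad u) = l b u in Theta, u = 0 on the boundary, in the weak sense *)
Definition eigenfunction (l : R) u : Prop :=
  [/\ H10 Theta u, ~ ae_eq_on Theta u (cst 0) &
      forall v, H10 Theta v -> dot_a u v = l * dot_b u v].

(* Indices start at 0: [lam j] and [e j] are the (j+1)-st eigenvalue and
   eigenfunction.  The [e j] are linearly independent and those with [lam j = l]
   span the eigenspace of l, so that eigenvalues are repeated according to their
   multiplicity. *)
Definition eigen_enumeration (lam : nat -> R) (e : nat -> 'rV[R]_n -> R) : Prop :=
  [/\ [/\ 0 < lam 0%N, lam 0%N < lam 1%N & forall j, lam j <= lam j.+1],
      forall j, eigenfunction (lam j) (e j) /\ norm_b (e j) = 1,
      (forall N (k : 'I_N -> R),
        ae_eq_on Theta (fun x => \sum_(j < N) k j * e j x) (cst 0) ->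
        forall j, k j = 0) &
      (forall l u, eigenfunction l u -> exists N (k : 'I_N -> R),
        ae_eq_on Theta u (fun x => \sum_(j < N | lam j == l) k j * e j x))].

Definition J (l : R) u : R :=
  2^-1 * norm_a u ^+ 2 - l / 2 * norm_b u ^+ 2 - p^-1 * norm_c u `^ p.

(* J_l'(u)v *)
Definition dJ (l : R) u v : R := derive1 (fun t : R => J l (fun x => u x + t * v x)) 0.

Variables (lam : nat -> R) (e : nat -> 'rV[R]_n -> R).

Definition Z (m : nat) : set ('rV[R]_n -> R) :=
  [set z : 'rV[R]_n -> R | H10 Theta z /\ exists k : 'I_m -> R,
    ae_eq_on Theta z (fun x => \sum_(j < m) k j * e j x)].

Definition T (m : nat) : set R :=
  if m is k.+1 then `[lam k, lam k.+1[ else `]-oo, lam 0%N[.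

(* [m] is the index with [l \in T m] *)
Definition Nehari (m : nat) (l : R) : set ('rV[R]_n -> R) :=
  [set u : 'rV[R]_n -> R | [/\ H10 Theta u, ~ Z m u, dJ l u u = 0 &
               forall z, Z m z -> dJ l u z = 0]].

Definition ell (m : nat) (l : R) : \bar R :=
  ereal_inf [set (J l u)%:E | u in Nehari m l].

Definition attained (m : nat) (l : R) : Prop :=
  exists2 u, Nehari m l u & (J l u)%:E = ell m l.

End variational.

Definition sobolev_const (R : realType) (n : nat) : R :=
  let mu := lebesgue_rV R n in
  sup [set s : R | forall u : 'rV[R]_n -> R, H1 setT u ->
    (s%:E * (\int[mu]_x (`|u x| `^ crit_exp R n)%:E) `^ (2 / crit_exp R n) <=
     \int[mu]_x (\sum_(i < n) weak_partial setT i u x ^+ 2)%:E)%E].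

Section thresholds.
Context {R : realType} {n : nat}.
Variables (Theta : set 'rV[R]_n) (a b c : 'rV[R]_n -> R).
Variables (lam : nat -> R) (e : nat -> 'rV[R]_n -> R).

Definition kappa : R :=
  inf [set a x `^ (n%:R / 2) / c x `^ ((n%:R - 2) / 2) | x in closure Theta] *
  (n%:R^-1 * sobolev_const R n `^ (n%:R / 2)).

Definition lambda_star (m : nat) : \bar R :=
  ereal_inf [set l%:E | l in
    [set l | T lam m l /\ (ell Theta a b c e m l < kappa%:E)%E]].

End thresholds.

(* Main.v *)
Require Import Defs.
From mathcomp Require Import all_boot all_order all_algebra.
From mathcomp Require Import all_classical all_reals all_analysis.
From mathcomp Require Import measurable_realfun lebesgue_integral_under.
From mathcomp Require Import ring lra zify.

(** For [l] in [T m] the energy [J l] satisfies [J l w <= J l u] for every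
    Nehari point [u] and every [w] in [R u + Z m], and conversely [J l] attains
    its maximum on [R u + Z m], for [u] outside [Z m], at a Nehari point.  Hence
    [ell m l] is the infimum over [u] outside [Z m] of the maximum of [J l] on
    [R u + Z m], from which monotonicity, the Lipschitz estimate, the strict
    decrease after an attained level and the limit at the endpoint follow by
    comparing energies for two values of [l].  Positivity comes from the spectral
    gap on the orthogonal complement of [Z m] and the Sobolev inequality; the
    upper bound by [kappa] from rescaled almost optimal functions for the Sobolev
    inequality, concentrated near a minimum point of [a ^ (n/2) / c ^ ((n-2)/2)].
    Below [kappa], a minimizing sequence has a weak limit [u]; passing to the
    limit in [J l (s u_k + z) <= J l (u_k)] with the Brezis-Lieb splitting, and
    using that the part of the sequence lost in the limit carries at least the
    energy [kappa] by the Sobolev inequality for [sqrt a * phi], nothing is lost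
    and [u] is a minimizer.

    The argument is carried out for two quadratic forms [A], [B] and a functional
    [F] homogeneous of degree [2^*] on an abstract space; elements of [B]-norm
    zero play the role of functions vanishing almost everywhere.  The Sobolev
    inequality itself is obtained from a Nash inequality, proved by mollification,
    applied to smooth truncations at dyadic levels. *)

Set Implicit Arguments.
Unset Strict Implicit.
Unset Printing Implicit Defensive.

Import Order.TTheory GRing.Theory Num.Theory.
Import numFieldNormedType.Exports.

Local Open Scope classical_set_scope.
Local Open Scope ring_scope.

(** * Lebesgue measure on row vectors *)

(** The obstacle is the sign of the quadratic form [quadQ l]: once m is positive it is only
    nonpositive on [Z m], so points cannot be scaled onto the Nehari set along rays, and the affine
    spaces R u + Z m take the place of rays. That a Nehari point maximizes the energy there follows
    from one pointwise inequality for |t|^p, [apow_nehari]; hence neither uniqueness of the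
    maximizer nor a manifold structure nor Palais-Smale sequences are used, and any minimizing
    sequence of Nehari points will do. Below [kappa] the lost part of such a sequence is excluded by
    comparing two points of R u + Z m, where u is the weak limit. Functions are never identified
    almost everywhere. The forms are therefore semi-definite, spans and orthogonality are understood
    up to elements of B-norm zero, and [null_AB] says that such elements are also null for A.
    Coinciding successive eigenvalues make [T m] empty; the strict gap between l and [lam m] in
    [in_gap] is what positivity of the level rests on. *)

Section affine_line.
Local Open Scope ereal_scope.
Context {R : realType}.
Local Notation mu := (@lebesgue_measure R).

Lemma measurable_affine (s v : R) :
  measurable_fun setT (fun x : measurableTypeR R => (s * x + v)%R : measurableTypeR R).
Proof. by apply: measurable_funD => //; exact: measurable_funM. Qed.

(** The pushforward multiplied by s gives every half-open interval its length, so it is Lebesgue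
    measure by uniqueness. *)
Lemma lebesgue_measure_affine (s v : R) A : (0 < s)%R -> measurable A ->
  mu ((fun x => s * x + v)%R @^-1` A) = (s^-1)%:E * mu A.
Proof.
move=> s0 mA.
pose m : {measure set (measurableTypeR R) -> \bar R} :=
  mscale (NngNum (ltW s0))
    (measure_function_pushforward__canonical__measure_function_Measure mu (measurable_affine s v)).
have mE B : m B = s%:E * mu ((fun x => s * x + v)%R @^-1` B) by [].
rewrite (@lebesgue_measure_unique _ m _ A mA).
  by rewrite mE muleA -EFinM mulVf ?gt_eqF// mul1e.
move=> _ [[a b] _ <-]; rewrite mE/=.
have -> : (fun x => s * x + v)%R @^-1` `]a, b]%classic
   = `]((a - v) / s)%R, ((b - v) / s)%R]%classic.
  apply/seteqP; split => x /=; rewrite !in_itv/=.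
    by rewrite ltr_pdivrMr// ler_pdivlMr// ltrBlDr lerBrDr (mulrC x).
  by rewrite ltr_pdivrMr// ler_pdivlMr// ltrBlDr lerBrDr (mulrC x).
rewrite !lebesgue_measure_itv/= !lte_fin ltr_pM2r ?invr_gt0// ltrD2r.
case: ifPn => ab; last by rewrite mule0.
rewrite -!EFinB -EFinM; congr EFin; field; exact: lt0r_neq0.
Qed.

Lemma integral_affine_line (f : measurableTypeR R -> \bar R) (s v : R) :
  (0 < s)%R -> measurable_fun setT f -> (forall x, 0 <= f x) ->
  \int[mu]_x f (s * x + v)%R = (s^-1)%:E * \int[mu]_x f x.
Proof.
move=> s0 mf f0.
pose phi : {mfun measurableTypeR R >-> measurableTypeR R} :=
  mfun_Sub (mem_set (measurable_affine s v)).
have si0 : (0 <= s^-1)%R by rewrite invr_ge0 ltW.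
transitivity (\int[pushforward mu phi]_x f x).
  rewrite ge0_integral_pushforward//; exact: (measurable_affine s v).
rewrite (_ : (s^-1)%:E = ((NngNum si0)%:num)%:E)// -ge0_integral_mscale//.
apply: eq_measure_integral => A mA _.
exact: lebesgue_measure_affine.
Qed.

End affine_line.

Section integral_rV.
Local Open Scope ereal_scope.
Context {R : realType}.

Lemma measurable_rV_affine n (s : R) (v : 'rV[R]_n) :
  measurable_fun setT (fun x : 'rV[R]_n => (s *: x + v)%R).
Proof.
apply: measurable_fun_rV => i.
rewrite (_ : _ \o _ = fun x => (s * rV_coord i x + v ord0 i)%R).
  by apply: measurable_funD => //; apply: measurable_funM => //; exact: measurable_rV_coord.
by apply/funext => x; rewrite /= /rV_coord !mxE.
Qed.

Lemma integral_rV0 (f : 'rV[R]_0 -> \bar R) :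
  measurable_fun setT f -> (forall x, 0 <= f x) ->
  \int[lebesgue_rV R 0]_x f x = f 0%R.
Proof. by move=> mf f0; rewrite integral_dirac// diracT mul1e. Qed.

Lemma integral_rVS n (f : 'rV[R]_n.+1 -> \bar R) :
  measurable_fun setT f -> (forall x, 0 <= f x) ->
  \int[lebesgue_rV R n.+1]_x f x =
  \int[@lebesgue_measure R]_r \int[lebesgue_rV R n]_y f (rV_cons (r, y)).
Proof.
move=> mf f0.
transitivity (\int[@lebesgue_measure R \x lebesgue_rV R n]_z f (rV_cons z)).
  rewrite ge0_integral_pushforward//; exact: measurable_rV_cons.
rewrite fubini_tonelli1//; apply: measurableT_comp => //; exact: measurable_rV_cons.
Qed.

Lemma rV_cons_affine n (s r : R) (y : 'rV[R]_n) (v : 'rV[R]_n.+1) :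
  (s *: rV_cons (r, y) + v =
   rV_cons (s * r + (rV_uncons v).1, s *: y + (rV_uncons v).2))%R.
Proof.
apply/rowP => i; rewrite !mxE; have [j ->|->] := unliftP ord0 i.
  by rewrite !mxE.
by [].
Qed.

(** Induction on the dimension with Tonelli: splitting off the first coordinate, each coordinate
    contributes one factor 1/s. *)
Lemma integral_affine n (f : 'rV[R]_n -> \bar R) (s : R) (v : 'rV[R]_n) :
  (0 < s)%R -> measurable_fun setT f -> (forall x, 0 <= f x) ->
  \int[lebesgue_rV R n]_x f (s *: x + v)%R =
  (s^-1 ^+ n)%:E * \int[lebesgue_rV R n]_x f x.
Proof.
move=> s0; elim: n => [|n IH] in f v *.
  move=> mf f0; rewrite !integral_rV0//.
    by rewrite expr0 mul1e; congr f; apply/rowP; case.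
  by apply: measurableT_comp => //; exact: measurable_rV_affine.
move=> mf f0.
have mfc r : measurable_fun setT (fun y : 'rV[R]_n => f (rV_cons (r, y))).
  apply: (measurableT_comp (f := fun y : 'rV[R]_n.+1 => f y)) => //.
  apply: (measurableT_comp (f := rV_cons)); first exact: measurable_rV_cons.
  exact: measurable_fun_pair.
rewrite integral_rVS//; last first.
  by apply: measurableT_comp => //; exact: measurable_rV_affine.
pose G r := \int[lebesgue_rV R n]_y f (rV_cons (r, y)).
transitivity (\int[@lebesgue_measure R]_r
    ((s^-1 ^+ n)%:E * G (s * r + (rV_uncons v).1)%R)).
  apply: eq_integral => r _.
  under eq_integral do rewrite rV_cons_affine.
  by rewrite (IH (fun y => f (rV_cons ((s * r + (rV_uncons v).1)%R, y)))).
have mG : measurable_fun setT G.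
  apply: (measurable_fun_fubini_tonelli_F (fun z => f (rV_cons z))).
    apply: measurableT_comp => //; exact: measurable_rV_cons.
  by [].
have G0 r : 0 <= G r by exact: integral_ge0.
have si0 : (0 <= s^-1)%R by rewrite invr_ge0 ltW.
rewrite ge0_integralZl//; last first.
- by rewrite lee_fin exprn_ge0.
- by apply: measurableT_comp => //; exact: measurable_affine.
rewrite integral_affine_line// integral_rVS// muleA -EFinM; congr (_%:E * _).
by rewrite exprSr.
Qed.

Lemma integral_rV_prod n (g : 'I_n -> R -> R) :
  (forall i, measurable_fun setT (g i)) -> (forall i x, 0 <= g i x)%R ->
  \int[lebesgue_rV R n]_x (\prod_i g i (x ord0 i))%:E =
  \prod_i \int[@lebesgue_measure R]_t (g i t)%:E.
Proof.
elim: n => [|n IH] in g * => mg g0.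
  rewrite big_ord0 (_ : (fun x => _) = cst 1%:E); last first.
    by apply/funext => x; rewrite big_ord0.
  by rewrite integral_rV0// => x; rewrite lee_fin.
have mpr k (h : 'I_k -> R -> R) : (forall i, measurable_fun setT (h i)) ->
    measurable_fun setT (fun x : 'rV[R]_k => (\prod_i h i (x ord0 i))%:E).
  move=> mh; apply/measurable_EFinP; apply: measurable_prod => i _.
  apply: (measurableT_comp (f := h i)) => //; exact: (measurable_rV_coord i).
rewrite integral_rVS//; [|exact: mpr|by move=> x; rewrite lee_fin prodr_ge0].
transitivity (\int[@lebesgue_measure R]_r ((g ord0 r)%:E *
    \int[lebesgue_rV R n]_y (\prod_i g (lift ord0 i) (y ord0 i))%:E)).
  apply: eq_integral => r _; rewrite -ge0_integralZl//.
  - apply: eq_integral => y _; rewrite big_ord_recl EFinM mxE unlift_none.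
    by congr (_ * (_)%:E); apply: eq_bigr => i _; rewrite mxE liftK.
  - by apply: (mpr _ (fun i => g (lift ord0 i))).
  - by move=> y _; rewrite lee_fin prodr_ge0.
  - by rewrite lee_fin.
rewrite (IH (fun i => g (lift ord0 i)))// big_ord_recl ge0_integralZr//.
- by apply/measurable_EFinP; exact: mg.
- by move=> x _; rewrite lee_fin.
- by apply: prode_ge0 => i _; apply: integral_ge0 => t _; rewrite lee_fin.
Qed.

End integral_rV.

Section open_rV.
Context {R : realType} {n : nat}.
Implicit Types U : set 'rV[R]_n.

Lemma ler_coord_norm (x : 'rV[R]_n) i : `|x ord0 i| <= `|x|.
Proof.
rewrite [leRHS]/Num.norm/= mx_normrE.
exact: (le_bigmax _ (fun j => `|x j.1 j.2|) (ord0, i)).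
Qed.

Definition obox (a b : 'rV[R]_n) : set 'rV[R]_n :=
  [set x | forall i, a ord0 i < x ord0 i < b ord0 i].

Definition cbox (a b : 'rV[R]_n) : set 'rV[R]_n :=
  [set x | forall i, a ord0 i <= x ord0 i <= b ord0 i].

Lemma measurable_coord_itv (I : 'I_n -> interval R) :
  measurable [set x : 'rV[R]_n | forall i, x ord0 i \in I i].
Proof.
rewrite (_ : [set x | _] = \bigcap_(i in [set` finset.setT]) (@rV_coord R n i @^-1` [set` I i])).
  apply: fin_bigcap_measurable; first exact: finite_finset.
  move=> i _; rewrite -[X in measurable X]setTI; exact: measurable_rV_coord.
by apply/seteqP; split => x /= Ix i => [_|]; apply: Ix; rewrite /= ?inE.
Qed.

Lemma measurable_obox a b : measurable (obox a b).
Proof.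
rewrite (_ : obox a b = [set x | forall i, x ord0 i \in `]a ord0 i, b ord0 i[]).
  exact: measurable_coord_itv.
by apply/seteqP; split => x /= h i; move: (h i); rewrite in_itv.
Qed.

Lemma measurable_cbox a b : measurable (cbox a b).
Proof.
rewrite (_ : cbox a b = [set x | forall i, x ord0 i \in `[a ord0 i, b ord0 i]]).
  exact: measurable_coord_itv.
by apply/seteqP; split => x /= h i; move: (h i); rewrite in_itv.
Qed.

Lemma rV_ballP (x : 'rV[R]_n) (e : R) y : 0 < e ->
  ball x e y <-> forall i, `|x ord0 i - y ord0 i| < e.
Proof.
move=> e0; split => [[_ h] i|h]; first by have := h ord0 i.
by split => // i j; rewrite (ord1 i); exact: h.
Qed.

Lemma open_oboxP U : open U <-> forall x, U x ->
  exists2 e : R, 0 < e & obox (x - const_mx e) (x + const_mx e) `<=` U.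
Proof.
have boxE (x : 'rV[R]_n) (e : R) : 0 < e -> obox (x - const_mx e) (x + const_mx e) = ball x e.
  move=> e0; apply/seteqP; split => y.
    by move=> h; apply/rV_ballP => // i; move: (h i); rewrite !mxE ltr_distlC.
  by move/(rV_ballP _ _ e0) => h i; move: (h i); rewrite !mxE ltr_distlC.
rewrite openE; split => oU x Ux.
  have /nbhs_ballP[e /= e0 eU] := oU _ Ux.
  by exists e => //; rewrite boxE.
apply/nbhs_ballP; have [e e0 eU] := oU _ Ux.
by exists e => //=; rewrite -boxE.
Qed.

(** Boxes with rational corners are countably many. Only those whose closed box lies in [U] are
    kept, so that bumps on them are test functions on [U]. *)
Lemma open_bigcup_obox U : open U ->
  exists (D : set nat) (F : nat -> 'rV[R]_n * 'rV[R]_n),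
    U = \bigcup_(k in D) obox (F k).1 (F k).2 /\
    (forall k, D k -> cbox (F k).1 (F k).2 `<=` U).
Proof.
move=> /open_oboxP oU.
pose I := ('rV[rat]_n * 'rV[rat]_n)%type.
pose B (q : I) := (map_mx (ratr : rat -> R) q.1, map_mx (ratr : rat -> R) q.2).
pose F k : 'rV[R]_n * 'rV[R]_n := if @unpickle I k is Some q then B q else (0, 0).
pose D : set nat := [set k | cbox (F k).1 (F k).2 `<=` U].
exists D, F; split => //.
apply/seteqP; split => [x Ux|x [k Dk Fx]]; last first.
  by apply: Dk => i; have /andP[/ltW -> /ltW ->] := Fx i.
have [e e0 eU] := oU _ Ux.
have /choice[q hq] (i : 'I_n) : exists r : rat * rat,
    x ord0 i - e < ratr r.1 < x ord0 i /\ x ord0 i < ratr r.2 < x ord0 i + e.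
  have xe : x ord0 i - e < x ord0 i by rewrite ltrBlDr ltrDl.
  have xe' : x ord0 i < x ord0 i + e by rewrite ltrDl.
  have [r1 h1] := rat_in_itvoo xe; have [r2 h2] := rat_in_itvoo xe'.
  by exists (r1, r2); move: h1 h2; rewrite !in_itv.
pose p : I := (\row_i (q i).1, \row_i (q i).2).
have FE : F (pickle p) = B p by rewrite /F pickleK.
exists (pickle p).
  rewrite /D/= FE => y /= By; apply: eU => i; move: (By i); rewrite !mxE.
  have [/andP[h1 h2] /andP[h3 h4]] := hq i => /andP[h5 h6].
  by rewrite (lt_le_trans h1)//= (le_lt_trans h6).
rewrite FE => i; rewrite !mxE.
by have [/andP[h1 ->] /andP[-> h4]] := hq i.
Qed.

Lemma open_measurable_rV U : open U -> measurable U.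
Proof.
move=> /open_bigcup_obox[D [F [-> _]]].
by apply: bigcup_measurable => k _; exact: measurable_obox.
Qed.

Lemma closed_measurable_rV U : closed U -> measurable U.
Proof. by rewrite -openC => /open_measurable_rV/measurableC; rewrite setCK. Qed.

Lemma continuous_within_measurable_rV U (f : 'rV[R]_n -> R) :
  measurable U -> {within U, continuous f} -> measurable_fun U f.
Proof.
move=> mU /continuousP cf; apply: (measurability _ (RGenOpens.measurableE R)).
move=> _ [_ [a [b ->] <-]].
have := cf _ (@interval_open _ (BRight a) (BLeft b) isT isT).
move=> /open_subspaceP[V oV VU].
have -> : U `&` f @^-1` `]a, b[ = V `&` U by rewrite VU setIC.
by apply: measurableI => //; exact: open_measurable_rV.
Qed.

Lemma continuous_in_measurable_rV U (f : 'rV[R]_n -> R) :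
  open U -> (forall x, U x -> {for x, continuous f}) -> measurable_fun U f.
Proof.
move=> oU cf; apply: continuous_within_measurable_rV; first exact: open_measurable_rV.
by rewrite continuous_open_subspace// => x /set_mem; exact: cf.
Qed.

Lemma continuous_measurable_rV (f : 'rV[R]_n -> R) :
  continuous f -> measurable_fun setT f.
Proof. by move=> cf; apply: continuous_in_measurable_rV; [exact: openT|move=> x _; exact: cf]. Qed.

Lemma lebesgue_rV_box (I : 'I_n -> interval R) :
  lebesgue_rV R n [set x | forall i, x ord0 i \in I i] =
  (\prod_i @lebesgue_measure R [set` I i])%E.
Proof.
have mA := @measurable_coord_itv I.
pose A := [set x : 'rV[R]_n | forall i, x ord0 i \in I i].
pose h (x : 'rV[R]_n) := (\prod_i \1_[set` I i] (x ord0 i) : R)%:E.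
rewrite -[X in lebesgue_rV R n X]setIT -(integral_indic (lebesgue_rV R n) measurableT mA).
transitivity (\int[lebesgue_rV R n]_x h x)%E.
  apply: eq_integral => x _; congr EFin; rewrite indicE.
  have [xA|xA] := boolP (x \in A).
    rewrite big1// => i _; rewrite indicE mem_set//=; exact: (set_mem xA i).
  have [i xi] : exists i, x ord0 i \notin I i.
    apply: contrapT => /forallNP h'; move/negP: xA; apply; apply/mem_set => i.
    by apply/negPn/negP => ?; exact: (h' i).
  by rewrite (bigD1 i)//= indicE memNset ?mul0r//=; exact/negP.
rewrite (integral_rV_prod (g := fun i => \1_[set` I i]))//.
by apply: eq_bigr => i _; rewrite integral_indic ?setIT.
Qed.

Lemma lebesgue_rV_obox (a b : 'rV[R]_n) : (forall i, a ord0 i <= b ord0 i) ->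
  lebesgue_rV R n (obox a b) = (\prod_i (b ord0 i - a ord0 i))%:E.
Proof.
move=> ab; rewrite (_ : obox a b = [set x | forall i, x ord0 i \in `]a ord0 i, b ord0 i[]).
  rewrite lebesgue_rV_box -prodEFin; apply: eq_bigr => i _.
  rewrite lebesgue_measure_itv/= lte_fin lt_neqAle ab andbT.
  by case: eqVneq => [->|_]; rewrite ?subrr.
by apply/seteqP; split => x /= h i; move: (h i); rewrite in_itv.
Qed.

Lemma lebesgue_rV_bounded U : measurable U -> bounded_set U ->
  (lebesgue_rV R n U < +oo)%E.
Proof.
move=> mU /ex_strict_bound_gt0[M M0 UM].
apply: (@le_lt_trans _ _ (lebesgue_rV R n (obox (const_mx (- M)) (const_mx M)))).
  apply: le_measure; rewrite ?inE//; first exact: measurable_obox.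
  move=> x /UM xM i; rewrite !mxE -ltr_norml; apply: le_lt_trans xM.
  exact: ler_coord_norm.
rewrite lebesgue_rV_obox ?ltry// => i; rewrite !mxE; lra.
Qed.

End open_rV.

(** * Almost everywhere limits and square-integrable functions *)

Section ae_limits.
Local Open Scope ereal_scope.
Context d (T : measurableType d) (R : realType) (mu : {measure set T -> \bar R}).
Variables (D : set T) (mD : measurable D).
Implicit Types (f u v : T -> R).

Lemma limn_einf_le (u : (\bar R)^nat) (C : \bar R) :
  (forall n, u n <= C) -> limn_einf u <= C.
Proof.
move=> uC; rewrite limn_einf_lim; apply: lime_le; first exact: is_cvg_einfs.
by apply: nearW => n; apply: (le_trans _ (uC n)); apply: ereal_inf_lbound; exists n => /=.
Qed.

(** Fatou's lemma for the lower limit, which agrees with [f] almost everywhere. It carries every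
    later passage from smooth functions to Sobolev functions. *)
Lemma fatou_bound (f_ : nat -> T -> R) f (C : \bar R) :
  (forall n, measurable_fun D (f_ n)) -> measurable_fun D f ->
  (forall n x, D x -> 0 <= f_ n x)%R -> (forall x, D x -> 0 <= f x)%R ->
  {ae mu, forall x, D x -> f_ ^~ x @ \oo --> f x} ->
  (forall n, \int[mu]_(x in D) (f_ n x)%:E <= C) ->
  \int[mu]_(x in D) (f x)%:E <= C.
Proof.
move=> mf_ mf f_0 f0 cf fC.
have mF n : measurable_fun D (EFin \o f_ n) by exact/measurable_EFinP.
rewrite (@ge0_ae_eq_integral _ _ _ mu D _ (fun x => limn_einf (fun n => (f_ n x)%:E)))//.
- apply: le_trans (fatou mu mD mF _) _; first by move=> n x Dx; rewrite lee_fin f_0.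
  exact: limn_einf_le.
- exact/measurable_EFinP.
- rewrite (_ : (fun x => _) = (fun x => - limn_esup (fun n => (- f_ n x)%:E))).
    apply/measurableT_comp => //; apply: measurable_fun_limn_esup => n.
    by apply/measurable_EFinP; exact: measurableT_comp.
  by apply/funext => x; rewrite -limn_einfN; congr limn_einf; apply/funext => n /=; rewrite opprK.
- move=> x Dx; rewrite limn_einf_lim; apply: lime_ge; first exact: is_cvg_einfs.
  by apply: nearW => n; apply: le_ereal_inf_tmp => _ [k _ <-]; rewrite lee_fin f_0.
- apply: filterS cf => x /= + Dx => /(_ Dx) cfx.
  have : (EFin \o f_ ^~ x) @ \oo --> (f x)%:E by apply: cvg_EFin => //; exact: nearW.
  by move/cvg_limn_einf_sup => [->].
Qed.

(** The sum of the series has a finite integral, hence is finite almost everywhere, and the terms of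
    a convergent series tend to zero. *)
Lemma nnseries_cvg0_ae (f_ : nat -> T -> R) :
  (forall n, measurable_fun D (f_ n)) -> (forall n x, D x -> 0 <= f_ n x)%R ->
  \sum_(0 <= k <oo) \int[mu]_(x in D) (f_ k x)%:E < +oo ->
  {ae mu, forall x, D x -> f_ ^~ x @ \oo --> (0 : R)%R}.
Proof.
move=> mf f0 foo.
have mF n : measurable_fun D (EFin \o f_ n) by exact/measurable_EFinP.
have F0 n x : D x -> 0 <= (EFin \o f_ n) x by move=> Dx; rewrite lee_fin f0.
pose g x := \sum_(0 <= k <oo) (f_ k x)%:E.
have ig : mu.-integrable D g.
  apply/integrableP; split.
    by apply: ge0_emeasurable_sum => [k x Dx _|k _]; [exact: F0|exact: mF].
  rewrite (_ : \int[mu]_(x in D) _ = \int[mu]_(x in D) g x).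
    by rewrite /g (integral_nneseries _ mD mF F0).
  apply: eq_integral => x /set_mem Dx; rewrite gee0_abs//.
  by apply: nneseries_ge0 => k _ _; exact: F0.
apply: filterS (integrable_ae mD ig) => x + Dx => /(_ Dx).
move=> /fin_numP[_ /negP gx].
have : cvgn (series (fun k => f_ k x * (x \in D)%:R)%R).
  apply: nnseries_is_cvg; first by move=> k; rewrite mulr_ge0// f0.
  rewrite ltey; apply/negP => h; apply: gx; rewrite -(eqP h); apply/eqP.
  by apply: eq_eseriesr => k _; rewrite (mem_set Dx) mulr1.
by move=> /cvg_series_cvg_0; under eq_fun do rewrite (mem_set Dx) mulr1.
Qed.

End ae_limits.

Section square_integrable.
Local Open Scope ereal_scope.
Context d (T : measurableType d) (R : realType) (mu : {measure set T -> \bar R}).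
Variables (D : set T) (mD : measurable D).
Implicit Types (f u v : T -> R).

Definition sqn u := \int[mu]_(x in D) (u x ^+ 2)%:E.

Lemma sqn_ge0 u : 0 <= sqn u.
Proof. by apply: integral_ge0 => x _; rewrite lee_fin sqr_ge0. Qed.

Lemma measurable_sqr u : measurable_fun D u -> measurable_fun D (fun x => (u x ^+ 2)%:E).
Proof. by move=> mu_; apply/measurable_EFinP; exact: measurable_funX. Qed.

Lemma sqnD u v : measurable_fun D u -> measurable_fun D v ->
  sqn (fun x => u x + v x)%R <= 2%:E * sqn u + 2%:E * sqn v.
Proof.
move=> mfu mv; rewrite /sqn -!ge0_integralZl//; last 4 first.
- exact: measurable_sqr.
- by move=> x _; rewrite lee_fin sqr_ge0.
- exact: measurable_sqr.
- by move=> x _; rewrite lee_fin sqr_ge0.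
rewrite -ge0_integralD//; last 4 first.
- by move=> x _; rewrite lee_fin mulr_ge0// sqr_ge0.
- by apply: measurable_funeM; exact: measurable_sqr.
- by move=> x _; rewrite lee_fin mulr_ge0// sqr_ge0.
- by apply: measurable_funeM; exact: measurable_sqr.
apply: ge0_le_integral => //.
- by move=> x _; rewrite lee_fin sqr_ge0.
- by apply: measurable_sqr; exact: measurable_funD.
- by apply: emeasurable_funD; apply: measurable_funeM; exact: measurable_sqr.
- move=> x _; rewrite lee_fin; have := sqr_ge0 (u x - v x)%R; nra.
Qed.

Lemma sqnZ k u : measurable_fun D u -> sqn (fun x => k * u x)%R = (k ^+ 2)%:E * sqn u.
Proof.
move=> mfu; rewrite /sqn -ge0_integralZl//; last 3 first.
- exact: measurable_sqr.
- by move=> x _; rewrite lee_fin sqr_ge0.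
- by rewrite lee_fin sqr_ge0.
by apply: eq_integral => x _; rewrite exprMn.
Qed.

Lemma sqn_cvg0_ae (u_ : nat -> T -> R) : (forall k, measurable_fun D (u_ k)) ->
  \sum_(0 <= k <oo) sqn (u_ k) < +oo ->
  {ae mu, forall x, D x -> u_ ^~ x @ \oo --> (0 : R)%R}.
Proof.
move=> mu_ h.
have : {ae mu, forall x, D x -> (fun k => u_ k x ^+ 2)%R @ \oo --> (0 : R)%R}.
  apply: (nnseries_cvg0_ae mD) h => [n|n x _]; first exact: measurable_funX.
  exact: sqr_ge0.
apply: filterS => x + Dx => /(_ Dx) /cvgrPdist_lt h0.
apply/cvgrPdist_lt => e e0; have := h0 (e ^+ 2)%R (exprn_gt0 2 e0).
apply: filterS => k; rewrite !sub0r !normrN => h1.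
by rewrite -(@ltr_pXn2r _ 2)// ?nnegrE ?(ltW e0)// -normrX.
Qed.

Lemma exprn_series_lty : \sum_(0 <= k <oo) ((2^-1 : R) ^+ k)%:E < +oo.
Proof.
have := @cvg_geometric_eseries_half R 1 0.
rewrite /= => h; have -> : \sum_(0 <= k <oo) (2^-1 ^+ k)%:E = limn (fun n => \sum_(0 <= k < n) (2^-1 ^+ k)%:E :> \bar R) by [].
apply: (@le_lt_trans _ _ 2%:E); last exact: ltry.
apply: lime_le; first by apply: is_cvg_ereal_nneg_natsum => k _; rewrite lee_fin exprn_ge0.
apply: nearW => n; rewrite sumEFin lee_fin.
elim: n => [|n _]; first by rewrite big_geq.
suff -> : (\sum_(0 <= i < n.+1) 2^-1 ^+ i = 2 - 2^-1 ^+ n :> R)%R.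
  by rewrite lerBlDr lerDl exprn_ge0.
elim: n => [|n IH]; first by rewrite big_nat1 expr0; lra.
by rewrite big_nat_recr//= IH exprS; field.
Qed.

(** Increments multiplied by 2^k still have summable squared norms, since 4^k 8^-k = 2^-k. So they
    tend to zero almost everywhere, and the increments are eventually dominated by a geometric
    series. *)
Lemma sqn_fast_cvg_ae (u_ : nat -> T -> R) : (forall k, measurable_fun D (u_ k)) ->
  (forall k, sqn (fun x => u_ k.+1 x - u_ k x)%R <= ((8^-1 : R) ^+ k)%:E) ->
  {ae mu, forall x, D x -> cvgn (u_ ^~ x)}.
Proof.
move=> mfu h; pose d_ k x := (2 ^+ k * (u_ k.+1 x - u_ k x))%R.
have md k : measurable_fun D (d_ k).
  by apply: measurable_funM => //; exact: measurable_funB.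
have /(sqn_cvg0_ae md) : \sum_(0 <= k <oo) sqn (d_ k) < +oo.
  apply: le_lt_trans exprn_series_lty; apply: lee_nneseries => [k _|k _].
    by move=> _; exact: sqn_ge0.
  rewrite sqnZ; last exact: measurable_funB.
  apply: (@le_trans _ _ (((2 ^+ k) ^+ 2)%:E * ((8^-1 : R) ^+ k)%:E)).
    by apply: lee_wpmul2l => //; rewrite lee_fin sqr_ge0.
  rewrite -EFinM lee_fin exprAC -exprMn; apply/lerXn2r; rewrite ?nnegrE; lra.
apply: filterS => x + Dx => /(_ Dx) /cvgrPdist_lt /(_ 1%R ltr01)[N _ hN].
suff : cvgn (series (fun k => u_ (k + N).+1 x - u_ (k + N)%N x))%R.
  move=> /cvg_ex[l hl]; apply/cvg_ex; exists (u_ N x + l)%R.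
  rewrite -(cvg_shiftn N).
  have -> : [sequence u_ (n + N)%N x]_n =
     (fun n => u_ N x + series (fun k => u_ (k + N).+1 x - u_ (k + N)%N x) n)%R.
    apply/funext => n /=; rewrite /series/=.
    rewrite (telescope_sumr (fun k => u_ (k + N)%N x))//.
    by rewrite add0n addrC subrK.
  by apply: cvgD => //; exact: cvg_cst.
apply: normed_cvg.
apply: (@series_le_cvg _ _ (geometric (2^-1 ^+ N) 2^-1)%R) => //=.
- move=> k; have /= := hN (k + N)%N (leq_addl _ _).
  rewrite sub0r normrN /d_ normrM normrX (@ger0_norm _ 2)// => /ltW h1.
  rewrite -exprD addnC exprVn -[leRHS]mul1r ler_pdivlMr ?exprn_gt0//.
  by rewrite addnC mulrC.
- apply: is_cvg_geometric_series; rewrite ger0_norm; lra.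
Qed.

(** Riesz-Fischer: a subsequence with fast decreasing increments converges almost everywhere, and
    Fatou's lemma turns the Cauchy bound into convergence of the whole sequence. *)
Lemma sqn_complete (u_ : nat -> T -> R) : (forall k, measurable_fun D (u_ k)) ->
  (forall k, sqn (u_ k) < +oo) ->
  (forall e, (0 < e)%R -> exists N, forall j k, (N <= j)%N -> (N <= k)%N ->
     sqn (fun x => u_ j x - u_ k x)%R <= e%:E) ->
  exists u, [/\ measurable_fun D u, sqn u < +oo &
    forall e, (0 < e)%R -> exists N, forall k, (N <= k)%N ->
      sqn (fun x => u_ k x - u x)%R <= e%:E].
Proof.
move=> mfu u2 cu.
have /choice[N hN] k : exists N, forall i j, (N <= i)%N -> (N <= j)%N ->
    sqn (fun x => u_ i x - u_ j x)%R <= ((8^-1 : R) ^+ k)%:E.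
  by apply: cu; rewrite exprn_gt0// invr_gt0.
(* Summing all earlier thresholds makes [s] monotone and above [N k]; the added k makes it
   unbounded. *)
pose s k := (\sum_(i < k.+1) N i + k)%N.
have sN k : (N k <= s k)%N by rewrite /s big_ord_recr/= -addnA addnCA leq_addr.
have ss k : (s k <= s k.+1)%N.
  by rewrite /s [in leqRHS]big_ord_recr/=; lia.
have sk k : (k <= s k)%N by rewrite /s leq_addl.
have cvs : {ae mu, forall x, D x -> cvgn (fun k => u_ (s k) x)}.
  apply: (sqn_fast_cvg_ae (u_ := fun k => u_ (s k))) => // k.
  by apply: hN; [exact: leq_trans (sN k) (ss k)|exact: sN].
(* The upper limit is measurable without any convergence, and it is the limit wherever there is
   one. *)
pose u x := fine (limn_esup (fun k => (u_ (s k) x)%:E)).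
have mfU : measurable_fun D u.
  apply: measurableT_comp => //; apply: measurable_fun_limn_esup => k.
  exact/measurable_EFinP.
have cvu : {ae mu, forall x, D x -> (fun k => u_ (s k) x) @ \oo --> u x}.
  apply: filterS cvs => x + Dx => /(_ Dx) /cvg_ex[l ul].
  rewrite /u; have : (fun k => (u_ (s k) x)%:E) @ \oo --> l%:E.
    by apply: cvg_EFin => //; exact: nearW.
  by move=> /cvg_limn_einf_sup[_ ->].
have main e : (0 < e)%R -> exists N, forall k, (N <= k)%N ->
      sqn (fun x => u_ k x - u x)%R <= e%:E.
  move=> e0; have [M hM] := cu e e0; exists M => k Mk.
  apply: (fatou_bound mD (f_ := fun j x => (u_ k x - u_ (s (j + M)%N) x) ^+ 2)%R).
  - by move=> n; apply: measurable_funX; exact: measurable_funB.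
  - by apply: measurable_funX; exact: measurable_funB.
  - by move=> *; exact: sqr_ge0.
  - by move=> *; exact: sqr_ge0.
  - apply: filterS cvu => x + Dx => /(_ Dx) cvx.
    have cvx' : (fun j => u_ (s (j + M)%N) x) @ \oo --> u x.
      by rewrite (cvg_shiftn M (fun k => u_ (s k) x)).
    rewrite expr2; under eq_fun do rewrite expr2.
    by apply: cvgM; apply: cvgB => //; exact: cvg_cst.
  - by move=> n; apply: hM => //; exact: leq_trans (leq_addl _ _) (sk _).
exists u; split => //.
have [M hM] := main 1%R ltr01; have := hM _ (leqnn M).
have -> : sqn u = sqn (fun x => u_ M x + (-1) * (u_ M x - u x))%R.
  by apply: eq_integral => x _; congr (_ ^+ _)%:E; lra.
move=> h; apply: le_lt_trans (sqnD _ _) _ => //.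
  by apply: measurable_funM => //; exact: measurable_funB.
rewrite lte_add_pinfty// lte_mul_pinfty// ?lee_fin//.
rewrite sqnZ ?sqrrN ?expr1n ?mul1e; last exact: measurable_funB.
by apply: le_lt_trans h _; exact: ltry.
Qed.

Lemma sqn_cvg_subseq_ae (u_ : nat -> T -> R) u : (forall k, measurable_fun D (u_ k)) ->
  measurable_fun D u ->
  (forall e, (0 < e)%R -> exists N, forall k, (N <= k)%N ->
     sqn (fun x => u_ k x - u x)%R <= e%:E) ->
  exists s : nat -> nat, (forall k, (s k < s k.+1)%N) /\
    {ae mu, forall x, D x -> (fun k => u_ (s k) x) @ \oo --> u x}.
Proof.
move=> mfu_ mfu cu.
have /choice[N hN] k : exists N, forall i, (N <= i)%N ->
    sqn (fun x => u_ i x - u x)%R <= ((2^-1 : R) ^+ k)%:E.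
  by apply: cu; rewrite exprn_gt0// invr_gt0.
pose s k := (\sum_(i < k.+1) N i + k)%N.
have sN k : (N k <= s k)%N by rewrite /s big_ord_recr/= -addnA addnCA leq_addr.
exists s; split; first by move=> k; rewrite /s [in ltnRHS]big_ord_recr/=; lia.
have : {ae mu, forall x, D x -> (fun k => u_ (s k) x - u x)%R @ \oo --> (0 : R)%R}.
  apply: (sqn_cvg0_ae (u_ := fun k x => u_ (s k) x - u x)%R).
    by move=> k; exact: measurable_funB.
  apply: le_lt_trans exprn_series_lty; apply: lee_nneseries => [k _ _|k _].
    exact: sqn_ge0.
  exact: hN.
apply: filterS => x + Dx => /(_ Dx) h.
have -> : u x = (0 + u x)%R by rewrite add0r.
under eq_fun do rewrite -(subrK (u x) (u_ _ _)).
by apply: cvgD => //; exact: cvg_cst.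
Qed.

Lemma integrable_mul3 (w u v : T -> R) (C : R) : measurable_fun D w ->
  (forall x, D x -> `|w x| <= C)%R ->
  measurable_fun D u -> sqn u < +oo -> measurable_fun D v -> sqn v < +oo ->
  mu.-integrable D (fun x => (w x * u x * v x)%:E).
Proof.
move=> mw wC mfu u2 mv v2.
have mP : measurable_fun D (fun x => w x * u x * v x)%R.
  by do 2 (apply: measurable_funM => //).
have isq f : measurable_fun D f -> sqn f < +oo -> mu.-integrable D (fun x => (f x ^+ 2)%:E).
  move=> mf f2; apply/integrableP; split; first exact: measurable_sqr.
  by under eq_integral do rewrite gee0_abs ?lee_fin ?sqr_ge0//.
apply: (le_integrable mD _ _ (integrableZl mD C (integrableD mD (isq _ mfu u2) (isq _ mv v2)))).
  exact/measurable_EFinP.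
move=> x Dx; rewrite -EFinD -EFinM /= lee_fin.
have := wC x Dx; have := normr_ge0 (w x); rewrite !normrM => w0 wx.
rewrite (ger0_norm (addr_ge0 (sqr_ge0 _) (sqr_ge0 _))) (@ger0_norm _ C); last lra.
apply: (@le_trans _ _ (C * (`|u x| * `|v x|))%R).
  by rewrite -mulrA ler_wpM2r// mulr_ge0.
apply: ler_wpM2l; first lra.
rewrite -(real_normK (num_real (u x))) -(real_normK (num_real (v x))).
have := normr_ge0 (u x); have := normr_ge0 (v x).
by have := sqr_ge0 (`|u x| - `|v x|)%R; nra.
Qed.

End square_integrable.

Section bilinear_integral.
Context d (T : measurableType d) (R : realType) (mu : {measure set T -> \bar R}).
Variables (D : set T) (mD : measurable D) (w : T -> R) (C : R).
Hypothesis mw : measurable_fun D w.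
Hypothesis wC : forall x, D x -> `|w x| <= C.
Implicit Types (u v : T -> R).

Definition wip u v : R := \int[mu]_(x in D) (w x * u x * v x).

Definition sqint u := measurable_fun D u /\ (sqn mu D u < +oo)%E.

Lemma integrable_wip u v : sqint u -> sqint v ->
  mu.-integrable D (EFin \o (fun x => w x * u x * v x)).
Proof. by move=> [mfu u2] [mv v2]; exact: (integrable_mul3 mD mw wC). Qed.

Lemma wipC u v : wip u v = wip v u.
Proof. by apply: eq_Rintegral => x _; rewrite mulrAC. Qed.

Lemma sqintD u v : sqint u -> sqint v -> sqint (fun x => u x + v x).
Proof.
move=> [mfu u2] [mv v2]; split; first exact: measurable_funD.
apply: le_lt_trans (sqnD _ _ _ _) _ => //.
by rewrite lte_add_pinfty// lte_mul_pinfty// lee_fin.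
Qed.

Lemma sqintZ k u : sqint u -> sqint (fun x => k * u x).
Proof.
move=> [mfu u2]; split; first exact: measurable_funM.
by rewrite sqnZ// lte_mul_pinfty// lee_fin sqr_ge0.
Qed.

Lemma sqint0 : sqint (cst 0).
Proof.
split => //; rewrite /sqn; under eq_integral do rewrite /= expr0n/=.
by rewrite integral0 ltry.
Qed.

Lemma wipDl u v z : sqint u -> sqint v -> sqint z ->
  wip (fun x => u x + v x) z = wip u z + wip v z.
Proof.
move=> hu hv hz; rewrite /wip -RintegralD//; [|exact: integrable_wip..].
by apply: eq_Rintegral => x _; ring.
Qed.

Lemma wipZl k u v : sqint u -> sqint v -> wip (fun x => k * u x) v = k * wip u v.
Proof.
move=> hu hv; rewrite /wip -RintegralZl//; last exact: integrable_wip.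
by apply: eq_Rintegral => x _; ring.
Qed.

End bilinear_integral.

Section sqn_wip.
Context d (T : measurableType d) (R : realType) (mu : {measure set T -> \bar R}).
Variables (D : set T) (mD : measurable D).

Lemma sqnE (u : T -> R) : sqint mu D u -> sqn mu D u = (\int[mu]_(x in D) (u x ^+ 2))%:E.
Proof.
by move=> [mfu u2]; rewrite /Rintegral fineK// ge0_fin_numE// sqn_ge0.
Qed.

Lemma wip_ae_eq (w u v u' v' : T -> R) :
  measurable_fun D (fun x => w x * u x * v x) ->
  measurable_fun D (fun x => w x * u' x * v' x) ->
  {ae mu, forall x, D x -> u x = u' x} -> {ae mu, forall x, D x -> v x = v' x} ->
  wip mu D w u v = wip mu D w u' v'.
Proof.
move=> m1 m2 uu' vv'; congr fine; apply: ae_eq_integral => //.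
- exact/measurable_EFinP.
- exact/measurable_EFinP.
- apply: filterS2 uu' vv' => x h1 h2 Dx; by rewrite h1// h2.
Qed.

Lemma sqn_eq0_ae (u : T -> R) : measurable_fun D u -> sqn mu D u = 0%E ->
  {ae mu, forall x, D x -> u x = 0}.
Proof.
move=> mfu h.
have : (\int[mu]_(x in D) `|(u x ^+ 2)%:E| = 0)%E.
  by rewrite -h; apply: eq_integral => x _; rewrite gee0_abs// lee_fin sqr_ge0.
move=> /(ae_eq_integral_abs mu mD (measurable_sqr mfu)).
apply: filterS => x + Dx => /(_ Dx) /= -[] /eqP.
by rewrite sqrf_eq0 => /eqP.
Qed.

End sqn_wip.

(** * Smooth functions and test functions *)

Lemma continuous_at_comp (T1 T2 T3 : topologicalType) (f : T1 -> T2) (g : T2 -> T3) x :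
  {for x, continuous f} -> {for f x, continuous g} ->
  {for x, continuous (fun y => g (f y))}.
Proof. exact: continuous_comp. Qed.

Section smooth_line.
Context {R : realType}.
Implicit Types (g h : R -> R).

(** The derivative is an existential witness, so the rules for sums, products and compositions
    become inductions on k. *)
Fixpoint diffn (k : nat) g : Prop := if k is k'.+1 then
  exists2 g', (forall t : R, is_derive t 1 g (g' t)) & diffn k' g' else True.

Lemma diffnD k g h : diffn k g -> diffn k h -> diffn k (fun t => g t + h t).
Proof.
elim: k g h => //= k IH g h [g' dg hg] [h' dh hh].
by exists (fun t => g' t + h' t); [move=> t; exact: (is_deriveD (dg t) (dh t)) | exact: IH].
Qed.

Lemma diffnZ k c g : diffn k g -> diffn k (fun t => c * g t).
Proof.
elim: k g => //= k IH g [g' dg hg].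
exists (fun t => c * g' t); last exact: IH.
by move=> t; exact: (is_deriveZ c (dg t)).
Qed.

Lemma diffnS k g : diffn k.+1 g -> diffn k g.
Proof.
by elim: k g => //= k IH g [g' dg hg]; exists g' => //; exact: IH.
Qed.

Lemma diffnM k g h : diffn k g -> diffn k h -> diffn k (fun t => g t * h t).
Proof.
elim: k g h => //= k IH g h hg hh.
have hg0 : diffn k g by apply: diffnS.
have hh0 : diffn k h by apply: diffnS.
have [g' dg hg'] := hg; have [h' dh hh'] := hh.
exists (fun t => g t * h' t + h t * g' t); first by move=> t; exact: (is_deriveM (dg t) (dh t)).
by apply: diffnD; exact: IH.
Qed.

Lemma is_derive_affine g (s v t g' : R) : is_derive (s * t + v) 1 g g' ->
  is_derive t 1 (fun t => g (s * t + v)) (s * g').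
Proof.
move=> dg; have ds : is_derive t 1 (fun t : R => s * t + v) s.
  apply: (is_derive_eq (is_deriveD (is_deriveZ s (is_derive_id t 1)) (is_derive_cst v t 1))).
  by rewrite addr0 [LHS]mulr1.
by rewrite mulrC; exact: (@is_derive1_comp _ g (fun t => s * t + v)).
Qed.

Lemma diffn_affine k g (s v : R) : diffn k g -> diffn k (fun t => g (s * t + v)).
Proof.
elim: k g => //= k IH g [g' dg hg].
exists (fun t => s * g' (s * t + v)); last by apply: diffnZ; exact: IH.
by move=> t; exact: is_derive_affine.
Qed.

(** The case j = 0 is the classical flat function. The extra index closes the family under
    differentiation up to linear combinations, which yields smoothness by a single induction. *)
Definition flat_exp (j : nat) (t : R) : R :=
  if 0 < t then t ^- j * expR (- t^-1) else 0.

Lemma flat_exp_ge0 j t : 0 <= flat_exp j t.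
Proof.
rewrite /flat_exp; case: ifPn => // t0.
by rewrite mulr_ge0 ?expR_ge0// invr_ge0 exprn_ge0// ltW.
Qed.

Lemma flat_exp_gt0 j t : 0 < t -> 0 < flat_exp j t.
Proof. by move=> t0; rewrite /flat_exp t0 mulr_gt0 ?expR_gt0// invr_gt0 exprn_gt0. Qed.

Lemma flat_exp_eq0 j t : t <= 0 -> flat_exp j t = 0.
Proof. by rewrite /flat_exp ltNge => ->. Qed.

Lemma flat_exp_le1 t : flat_exp 0 t <= 1.
Proof.
rewrite /flat_exp; case: ifPn => // t0.
by rewrite expr0 invr1 mul1r -expR0 ler_expR oppr_le0 invr_ge0 ltW.
Qed.

(** A single term of the exponential series at 1/t beats t^-(j+2). The quadratic bound makes the
    difference quotients at 0 vanish. *)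
Lemma flat_exp_le_sqr j t : flat_exp j t <= (j.+2)`!%:R * t ^+ 2.
Proof.
have [t0|t0] := ltrP 0 t; last by rewrite flat_exp_eq0// mulr_ge0// sqr_ge0.
rewrite /flat_exp t0.
have ti0 : 0 <= t^-1 by rewrite invr_ge0 ltW.
have h : t^-1 ^+ j.+2 / (j.+2)`!%:R <= expR t^-1.
  by apply: le_trans (expR_ge1Dxn j.+1 ti0); rewrite lerDr.
have f0 : (0 : R) < (j.+2)`!%:R by rewrite ltr0n fact_gt0.
rewrite expRN ler_pdivrMr ?expR_gt0//.
rewrite ler_pdivrMr// in h.
have tj : 0 < t ^+ 2 by exact: exprn_gt0.
have -> : t ^- j = t ^+ 2 * t^-1 ^+ j.+2.
  have -> : t ^+ 2 * t^-1 ^+ j.+2 = (t * t^-1) ^+ 2 * t^-1 ^+ j.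
    by rewrite exprMn -[j.+2]/(2 + j)%N exprD mulrA.
  by rewrite mulfV ?gt_eqF// expr1n mul1r exprVn.
rewrite (_ : _ * _ * expR _ = t ^+ 2 * (expR t^-1 * (j.+2)`!%:R)); last by ring.
by rewrite ler_pM2l.
Qed.

Lemma is_derive_flat_exp j (t : R) :
  is_derive t 1 (flat_exp j) (flat_exp j.+2 t - j%:R * flat_exp j.+1 t).
Proof.
have [t0|t0|t0] := ltrgtP 0 t.
- have near_t : \near t, (fun t => t ^- j * expR (- t^-1)) t = flat_exp j t.
    near=> s; rewrite /flat_exp ifT//.
    by near: s; exact: lt_nbhsr.
  apply: (near_eq_is_derive near_t).
  have tn0 : t != 0 by rewrite gt_eqF.
  have dV : is_derive t 1 (fun t : R => - t^-1) (t ^- 2).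
    apply: (is_derive_eq (is_deriveN (@is_deriveV _ id t 1 1 tn0 (is_derive_id t 1)))).
    by rewrite scaleNr opprK [LHS]mulr1.
  have dE : is_derive t 1 (fun t : R => expR (- t^-1)) (expR (- t^-1) * t ^- 2).
    exact: (@is_derive1_comp _ expR (fun t => - t^-1)).
  have dX : is_derive t 1 (fun t : R => t ^- j) (- j%:R * t ^- j.+1).
    have tj : (fun t : R => t ^+ j) t != 0 by rewrite expf_neq0.
    have dXj : is_derive t 1 (fun t : R => t ^+ j) ((j%:R * t ^+ j.-1) *: 1).
      by have := @is_deriveX _ _ id j t 1 _ (is_derive_id t 1); rewrite exprfctE.
    apply: (is_derive_eq (@is_deriveV _ (fun t => t ^+ j) _ _ _ tj dXj)).
    rewrite (_ : (j%:R * id t ^+ j.-1) *: 1 = j%:R * t ^+ j.-1); last exact: mulr1.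
    case: j {near_t tj dXj} => [|j]; first by rewrite mul0r scaler0 oppr0 mul0r.
    rewrite [LHS]mulNr mulNr; congr (- _); rewrite mulrCA; congr (_ * _).
    rewrite -exprM /= -!exprVn; apply: (mulIf (expf_neq0 (j.+1 * 2) tn0)).
    rewrite mulrAC -exprMn mulVf// expr1n mul1r.
    rewrite (_ : j.+1 * 2 = j.+2 + j)%N; last lia.
    by rewrite exprD mulrA -exprMn mulVf// expr1n mul1r.
  apply: (is_derive_eq (is_deriveM dX dE)).
  rewrite /flat_exp t0 /GRing.scale/=.
  by rewrite !exprS; field; rewrite ?expf_neq0 tn0.
- have near_t : \near t, cst 0 t = flat_exp j t.
    near=> s; rewrite flat_exp_eq0//; apply: ltW.
    by near: s; exact: lt_nbhsl.
  rewrite !flat_exp_eq0 ?(ltW t0)// mulr0 subr0.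
  apply: (near_eq_is_derive near_t); exact: (is_derive_cst (0 : R) t 1).
- rewrite -t0 !flat_exp_eq0// mulr0 subr0.
  have h0 : h^-1 *: ((flat_exp j \o shift 0) (h *: 1) - flat_exp j 0) @[h --> (0:R)^'] --> (0 : R).
    apply/cvgrPdist_le => e e0.
    pose C : R := (j.+2)`!%:R.
    have C0 : 0 < C by rewrite ltr0n fact_gt0.
    near=> s; rewrite sub0r normrN /= addr0 (flat_exp_eq0 j (lexx _)) subr0 [X in flat_exp j X]mulr1.
    have s0 : s != 0 by near: s; exact: nbhs_dnbhs_neq.
    rewrite [X in `|X|]/GRing.scale/= normrM normfV ger0_norm ?flat_exp_ge0// mulrC ler_pdivrMr ?normr_gt0//.
    apply: le_trans (flat_exp_le_sqr _ _) _; rewrite -/C -real_normK ?num_real// expr2 mulrA.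
    rewrite ler_pM2r ?normr_gt0// mulrC -ler_pdivlMr//.
    near: s; apply: dnbhs0_le; exact: divr_gt0.
  apply: DeriveDef; first by apply/cvg_ex; exists 0.
  exact/cvg_lim.
Unshelve. all: by end_near. Qed.

Lemma diffn_flat_exp k j : diffn k (flat_exp j).
Proof.
elim: k j => //= k IH j.
exists (fun t => flat_exp j.+2 t - j%:R * flat_exp j.+1 t).
  by move=> t; exact: is_derive_flat_exp.
under [X in diffn _ X]eq_fun do rewrite -mulNr.
by apply: diffnD => //; exact: diffnZ.
Qed.

Lemma diffn_continuous g : (forall k, diffn k g) -> continuous g.
Proof.
move=> /(_ 1%N) [g' dg _] t.
by apply/differentiable_continuous/derivable1_diffP; have [] := dg t.
Qed.

End smooth_line.

Section smooth_rV.
Context {R : realType} {n : nat}.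
Implicit Types (f g : 'rV[R]_n -> R).
Local Notation delta i := (delta_mx ord0 i : 'rV[R]_n).

Lemma is_derive_line f x v df :
  is_derive (0 : R) 1 (fun h : R => f (h *: v + x)) df -> is_derive x v f df.
Proof.
move=> [h1 h2]; split; first by apply/derivable1P.
rewrite -h2 /derive.
rewrite (_ : (fun h : R => h^-1 *: ((f \o shift x) (h *: v) - f x)) =
  (fun h : R => h^-1 *: (((fun h0 : R => f (h0 *: v + x)) \o shift 0) (h *: 1) - f (0 *: v + x))))//.
by apply/funext => h /=; rewrite scale0r add0r addr0 [h *: 1]mulr1.
Qed.

Lemma is_derive_line_at f x v (t : R) : derivable f (t *: v + x) v ->
  is_derive t 1 (fun h : R => f (h *: v + x)) ('D_v f (t *: v + x)).
Proof.
have E : (fun h : R => h^-1 *: (((fun h0 : R => f (h0 *: v + x)) \o shift t) (h *: 1)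
    - f (t *: v + x))) = (fun h => h^-1 *: ((f \o shift (t *: v + x)) (h *: v) - f (t *: v + x))).
  apply/funext => h /=; congr (_ *: (f _ - _)).
  by rewrite [h *: 1]mulr1 scalerDl addrA.
move=> df; split; first by rewrite /derivable E.
by rewrite /derive E.
Qed.

Lemma partialE f i x df : is_derive x (delta i) f df -> partial i f x = df.
Proof. by case. Qed.

Lemma CkS k f : Ck k.+1 setT f -> Ck k setT f.
Proof.
elim: k f => [|k IH] f [cf hf]; split => // i.
by have [hd hc] := hf i; split => //; apply: IH.
Qed.

Lemma Ck_continuous k f : Ck k setT f -> continuous f.
Proof. by case: k => [|k] [cf _] x; exact: cf. Qed.

Lemma Ck_is_derive k f i x : Ck k.+1 setT f -> is_derive x (delta i) f (partial i f x).
Proof. by move=> [_ /(_ i)[h _]]; apply: DeriveDef => //; exact: h. Qed.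

Lemma Ck_partial k f i : Ck k.+1 setT f -> Ck k setT (partial i f).
Proof. by move=> [_ /(_ i)[_ h]]. Qed.

Lemma CkSI k f (df : 'I_n -> 'rV[R]_n -> R) : continuous f ->
  (forall i x, is_derive x (delta i) f (df i x)) ->
  (forall i, Ck k setT (df i)) -> Ck k.+1 setT f.
Proof.
move=> cf hd hc; split; first by move=> x _; exact: cf.
move=> i; split; first by move=> x _; have [] := hd i x.
by rewrite (_ : partial i f = df i)//; apply/funext => x; exact: partialE.
Qed.

Lemma Ck_cst k (c : R) : Ck k setT (fun _ : 'rV[R]_n => c).
Proof.
elim: k c => [|k IH] c; first by split => // x _; exact: cst_continuous.
apply: (@CkSI _ _ (fun _ _ => 0)) => //; first by move=> x; exact: cst_continuous.
Qed.

Lemma CkD k f g : Ck k setT f -> Ck k setT g -> Ck k setT (fun x => f x + g x).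
Proof.
elim: k f g => [|k IH] f g hf hg.
  split => // x _; apply: continuousD; by [apply: hf.1|apply: hg.1].
apply: (@CkSI _ _ (fun i x => partial i f x + partial i g x)).
- by move=> x; apply: continuousD; [exact: Ck_continuous hf x|exact: Ck_continuous hg x].
- by move=> i x; exact: (is_deriveD (Ck_is_derive i x hf) (Ck_is_derive i x hg)).
- by move=> i; apply: IH; exact: Ck_partial.
Qed.

Lemma CkM k f g : Ck k setT f -> Ck k setT g -> Ck k setT (fun x => f x * g x).
Proof.
elim: k f g => [|k IH] f g hf hg.
  split => // x _; apply: continuousM; by [apply: hf.1|apply: hg.1].
apply: (@CkSI _ _ (fun i x => f x * partial i g x + g x * partial i f x)).
- by move=> x; apply: continuousM; [exact: Ck_continuous hf x|exact: Ck_continuous hg x].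
- by move=> i x; exact: (is_deriveM (Ck_is_derive i x hf) (Ck_is_derive i x hg)).
- by move=> i; apply: CkD; apply: IH; try exact: Ck_partial; exact: CkS.
Qed.

Lemma CkZ k c f : Ck k setT f -> Ck k setT (fun x => c * f x).
Proof. by move=> hf; apply: (CkM (f := fun=> c)) => //; exact: Ck_cst. Qed.

Lemma rV_affine_continuous (s : R) (v : 'rV[R]_n) : continuous (fun x : 'rV[R]_n => s *: x + v).
Proof.
move=> x; apply: (@continuousD _ _ _ (fun x => s *: x) (cst v)); last exact: cst_continuous.
exact: scaler_continuous.
Qed.

Lemma is_derive_rV_affine f (s : R) (v x : 'rV[R]_n) i df :
  is_derive (s *: x + v) (delta i) f df ->
  is_derive x (delta i) (fun x => f (s *: x + v)) (s * df).
Proof.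
move=> [h1 h2]; apply: is_derive_line.
have hl : is_derive (0 : R) 1 (fun h : R => f (h *: delta i + (s *: x + v))) df.
  have := @is_derive_line_at f (s *: x + v) (delta i) 0.
  by rewrite scale0r add0r -h2; apply.
rewrite (_ : (fun h => _) = (fun h : R => (fun h => f (h *: delta i + (s *: x + v))) (s * h + 0))).
  apply: (is_derive_affine (g := fun h : R => f (h *: delta i + (s *: x + v)))).
  by rewrite mulr0 addr0.
by apply/funext => h; rewrite addr0 scalerDr scalerA addrA.
Qed.

Lemma Ck_affine k f (s : R) (v : 'rV[R]_n) :
  Ck k setT f -> Ck k setT (fun x => f (s *: x + v)).
Proof.
elim: k f => [|k IH] f hf.
  split => // x _.
  apply: (continuous_at_comp (f := fun x : 'rV[R]_n => s *: x + v)); first exact: rV_affine_continuous.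
  exact: (Ck_continuous hf).
apply: (@CkSI _ _ (fun i x => s * partial i f (s *: x + v))).
- move=> x.
  apply: (continuous_at_comp (f := fun x : 'rV[R]_n => s *: x + v)); first exact: rV_affine_continuous.
  exact: (Ck_continuous hf).
- by move=> i x; exact: (is_derive_rV_affine (Ck_is_derive i _ hf)).
- by move=> i; apply: CkZ; apply: IH; exact: Ck_partial.
Qed.

(** Differentiation in coordinate j replaces the j-th factor by its derivative, so the product form
    is kept and the induction on k runs over all families of factors. *)
Lemma Ck_prod_coord k (G : 'I_n -> R -> R) : (forall i k, diffn k (G i)) ->
  Ck k setT (fun x : 'rV[R]_n => \prod_i G i (x ord0 i)).
Proof.
have cG (H : 'I_n -> R -> R) : (forall i k, diffn k (H i)) ->
    continuous (fun x : 'rV[R]_n => \prod_i H i (x ord0 i)).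
  move=> hH; elim: (index_enum _) => [|i r IHr] x.
    by under eq_fun do rewrite big_nil; exact: cst_continuous.
  under eq_fun do rewrite big_cons.
  apply: continuousM; last exact: IHr.
  apply: (continuous_at_comp (f := fun x : 'rV[R]_n => x ord0 i)).
    exact: coord_continuous.
  exact: (diffn_continuous (hH i)).
elim: k G => [|k IH] G hG; first by split => // x _; exact: cG.
(* [diffn] gives a possibly different derivative at each order; uniqueness of derivatives identifies
   them. *)
have /choice[G' hG'] i : exists g' : R -> R, (forall t : R, is_derive t 1 (G i) (g' t)) /\ forall k, diffn k g'.
  have [g' dg _] := hG i 1%N; exists g'; split => // j.
  have [g2 dg2 hg2] := hG i j.+1; suff -> : g' = g2 by [].
  by apply/funext => t; have [_ <-] := dg t; have [_ <-] := dg2 t.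
pose H j i := if i == j then G' i else G i.
apply: (@CkSI _ _ (fun j x => \prod_i H j i (x ord0 i))).
- exact: cG.
- move=> j x; apply: is_derive_line.
  pose P : R := \prod_(i < n | i != j) G i (x ord0 i).
  rewrite (_ : (fun h => _) = (fun h : R => P * G j (1 * h + x ord0 j))).
    rewrite (bigD1 j)//= /H eqxx mulrC.
    under eq_bigr => i ij do rewrite (negbTE ij).
    apply: (is_deriveZ P (f := fun h : R => G j (1 * h + x ord0 j))).
    rewrite -[G' j _]mul1r; apply: is_derive_affine.
    by rewrite mulr0 add0r; exact: (hG' j).1.
  apply/funext => h; rewrite [LHS](bigD1 j)//= [LHS]mulrC !mxE !eqxx mulr1 mul1r; congr (_ * _).
  by apply: eq_bigr => i ij; rewrite !mxE eqxx (negbTE ij) mulr0 add0r.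
- move=> j; apply: IH => i k'; rewrite /H; case: ifP => _; last exact: hG.
  exact: (hG' i).2.
Qed.

End smooth_rV.

Section test_functions.
Context {R : realType} {n : nat}.
Implicit Types (U K : set 'rV[R]_n) (f g phi : 'rV[R]_n -> R).
Local Notation delta i := (delta_mx ord0 i : 'rV[R]_n).

Lemma compact_closed_rV K : compact K -> closed K.
Proof. by apply: compact_closed; exact: norm_hausdorff. Qed.

Lemma compact_cbox (a b : 'rV[R]_n) : compact (cbox a b).
Proof.
rewrite (_ : cbox a b = [set x | forall i, `[a ord0 i, b ord0 i]%classic (x ord0 i)]).
  by apply: (@rV_compact _ _ (fun i => `[a ord0 i, b ord0 i]%classic)) => i; exact: segment_compact.
by apply/seteqP; split => x /= h i; move: (h i); rewrite in_itv.
Qed.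

Lemma compact_ball_norm K : compact K -> exists2 r : R, 0 < r & forall x, K x -> `|x| < r.
Proof. by move=> /compact_bounded /ex_strict_bound_gt0[r r0 h]; exists r. Qed.

Lemma smooth_continuous f : smooth f -> continuous f.
Proof. by move=> h; exact: (Ck_continuous (h 0%N)). Qed.

Lemma smooth_is_derive f i x : smooth f -> is_derive x (delta i) f (partial i f x).
Proof. by move=> h; exact: Ck_is_derive (h 1%N). Qed.

Lemma smooth_partial f i : smooth f -> smooth (partial i f).
Proof. by move=> h k; exact: Ck_partial (h k.+1). Qed.

Lemma smoothD f g : smooth f -> smooth g -> smooth (fun x => f x + g x).
Proof. by move=> hf hg k; exact: CkD. Qed.

Lemma smoothM f g : smooth f -> smooth g -> smooth (fun x => f x * g x).
Proof. by move=> hf hg k; exact: CkM. Qed.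

Lemma smooth_affine f (s : R) (v : 'rV[R]_n) : smooth f -> smooth (fun x => f (s *: x + v)).
Proof. by move=> hf k; exact: Ck_affine. Qed.

Lemma partial_out K f i x : closed K -> (forall x, ~ K x -> f x = 0) ->
  ~ K x -> partial i f x = 0.
Proof.
move=> cK f0 Kx; rewrite /partial.
have nf : \near x, cst 0 x = f x.
  by have := closed_openC cK; rewrite openE => /(_ _ Kx); apply: filterS => y Ky; rewrite f0.
by rewrite -(near_eq_derive _ nf) derive_cst.
Qed.

Lemma test_funS U V phi : U `<=` V -> test_fun U phi -> test_fun V phi.
Proof. by move=> UV [s [K [cK KU] h]]; split => //; exists K => //; split => //; exact: subset_trans UV. Qed.

Lemma test_fun_partial U phi i : test_fun U phi -> test_fun U (partial i phi).
Proof.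
move=> [s [K [cK KU] h]]; split; first exact: smooth_partial.
by exists K => // x Kx; apply: (partial_out _ _ h Kx); exact: compact_closed_rV.
Qed.

Lemma test_funMr U f phi : smooth f -> test_fun U phi -> test_fun U (fun x => f x * phi x).
Proof.
move=> sf [s [K [cK KU] h]]; split; first exact: smoothM.
by exists K => // x Kx; rewrite h// mulr0.
Qed.

Lemma test_funZ U c phi : test_fun U phi -> test_fun U (fun x => c * phi x).
Proof. by move=> h; apply: (test_funMr (f := fun=> c)) => // k; exact: Ck_cst. Qed.

Lemma test_funD U f g : test_fun U f -> test_fun U g -> test_fun U (fun x => f x + g x).
Proof.
move=> [sf [K [cK KU] hf]] [sg [L [cL LU] hg]]; split; first exact: smoothD.
exists (K `|` L); first by split; [exact: compactU|rewrite subUset].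
by move=> x /not_orP[Kx Lx]; rewrite hf// hg// addr0.
Qed.

Lemma test_fun_bsupp U phi : test_fun U phi ->
  exists2 r : R, 0 < r & forall x, r <= `|x| -> phi x = 0.
Proof.
move=> [s [K [cK KU] h]]; have [r r0 hr] := compact_ball_norm cK.
by exists r => // x rx; apply: h => /hr; rewrite ltNge rx.
Qed.

Lemma continuous_bsupp_bounded f (K : set 'rV[R]_n) : continuous f -> compact K ->
  (forall x, ~ K x -> f x = 0) -> exists2 M, 0 < M & forall x, `|f x| <= M.
Proof.
move=> cf cK f0.
have /compact_bounded /ex_strict_bound_gt0[M M0 hM] : compact (f @` K).
  by apply: continuous_compact => //; apply: continuous_subspaceT.
exists M => // x; have [Kx|Kx] := pselect (K x); last by rewrite f0// normr0 ltW.
by apply/ltW/hM; exists x.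
Qed.

Lemma test_fun_bounded U phi : test_fun U phi -> exists2 M, 0 < M & forall x, `|phi x| <= M.
Proof.
by move=> [s [K [cK KU] h]]; apply: (continuous_bsupp_bounded _ cK h); exact: smooth_continuous.
Qed.

Lemma test_fun_partial_bounded U phi : test_fun U phi ->
  exists2 M, 0 < M & forall i x, `|partial i phi x| <= M.
Proof.
move=> tphi; have /choice[M hM] (i : 'I_n) : exists M, 0 < M /\ forall x, `|partial i phi x| <= M.
  by have [M M0 hM] := test_fun_bounded (test_fun_partial i tphi); exists M.
exists (1 + \sum_i M i).
  by rewrite ltr_pwDl// sumr_ge0// => i _; apply: ltW; case: (hM i).
move=> i x; apply: le_trans ((hM i).2 x) _; rewrite (bigD1 i)//= addrCA lerDl.
by rewrite addr_ge0// sumr_ge0// => j _; apply: ltW; case: (hM j).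
Qed.

(** For k > 0 this smooth function is positive exactly on the open box, and as k grows it tends to
    the indicator of the box. It serves as test function, as mollifying kernel and as cutoff. *)
Definition box_bump (k : R) (a b : 'rV[R]_n) (x : 'rV[R]_n) : R :=
  \prod_i (flat_exp 0 (k * (x ord0 i - a ord0 i)) * flat_exp 0 (k * (b ord0 i - x ord0 i))).

Lemma smooth_box_bump k a b : smooth (box_bump k a b).
Proof.
move=> j; apply: (@Ck_prod_coord R n j (fun i t => flat_exp 0 (k * (t - a ord0 i)) * flat_exp 0 (k * (b ord0 i - t)))).
move=> i j'; apply: diffnM.
  rewrite (_ : (fun t => _) = (fun t => flat_exp 0 (k * t + - (k * a ord0 i)))).
    by apply: diffn_affine; exact: diffn_flat_exp.
  by apply/funext => t; congr flat_exp; ring.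
rewrite (_ : (fun t => _) = (fun t => flat_exp 0 (- k * t + k * b ord0 i))).
  by apply: diffn_affine; exact: diffn_flat_exp.
by apply/funext => t; congr flat_exp; ring.
Qed.

Lemma box_bump_ge0 k a b x : 0 <= box_bump k a b x.
Proof. by apply: prodr_ge0 => i _; rewrite mulr_ge0// flat_exp_ge0. Qed.

Lemma box_bump_le1 k a b x : box_bump k a b x <= 1.
Proof.
apply: prodr_ile1 => i _; rewrite mulr_ge0 ?flat_exp_ge0//=.
by apply: mulr_ile1; rewrite ?flat_exp_ge0 ?flat_exp_le1.
Qed.

Lemma box_bump_out k a b x : 0 < k -> ~ obox a b x -> box_bump k a b x = 0.
Proof.
move=> k0 /existsNP[i /negP]; rewrite negb_and -!leNgt => h.
rewrite /box_bump (bigD1 i)//=; case/orP: h => h.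
  by rewrite (flat_exp_eq0 0 (t := k * _)) ?mul0r// pmulr_rle0// subr_le0.
by rewrite (flat_exp_eq0 0 (t := k * (b _ _ - _))) ?mulr0 ?mul0r// pmulr_rle0// subr_le0.
Qed.

Lemma box_bump_gt0 k a b x : 0 < k -> obox a b x -> 0 < box_bump k a b x.
Proof.
move=> k0 h; apply: prodr_gt0 => i _; have /andP[h1 h2] := h i.
by rewrite mulr_gt0// flat_exp_gt0// mulr_gt0// subr_gt0.
Qed.

Lemma test_fun_box_bump U k a b : 0 < k -> cbox a b `<=` U -> test_fun U (box_bump k a b).
Proof.
move=> k0 abU; split; first exact: smooth_box_bump.
exists (cbox a b); first by split => //; exact: compact_cbox.
move=> x nx; apply: box_bump_out => // ox; apply: nx => i.
by have /andP[/ltW -> /ltW ->] := ox i.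
Qed.

Lemma flat_exp_cvg1 (t : R) : 0 < t -> (fun k : nat => flat_exp 0 (k.+1%:R * t)) @ \oo --> (1 : R).
Proof.
move=> t0; rewrite /flat_exp.
have -> : (fun k : nat => if 0 < k.+1%:R * t then (k.+1%:R * t) ^- 0 * expR (- (k.+1%:R * t)^-1) else 0)
   = (fun k : nat => expR (- t^-1 * k.+1%:R^-1)).
  by apply/funext => k; rewrite mulr_gt0// expr0 invr1 mul1r invfM mulNr mulrC.
rewrite -[X in _ --> X]expR0 -(mulr0 (- t^-1)).
apply: (@continuous_cvg _ _ _ _ _ _ expR); first exact: continuous_expR.
apply: cvgM; first exact: cvg_cst.
exact: cvg_harmonic.
Qed.

Lemma box_bump_cvg a b x :
  (fun k : nat => box_bump k.+1%:R a b x) @ \oo --> (\1_(obox a b) x : R).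
Proof.
rewrite indicE; have [|nx] := boolP (x \in obox a b); last first.
  rewrite (_ : (fun k => _) = cst 0); first exact: cvg_cst.
  by apply/funext => k; rewrite box_bump_out//; apply: contraNnot nx; exact: mem_set.
move=> /set_mem ox; rewrite /box_bump.
elim: (index_enum _) => [|i r IH].
  by under eq_fun do rewrite big_nil; exact: cvg_cst.
under eq_fun do rewrite big_cons.
have /andP[h1 h2] := ox i.
rewrite (_ : true%:R = 1 * 1 * true%:R :> R); last by rewrite !mul1r.
by apply: cvgM => //; apply: cvgM; apply: flat_exp_cvg1; rewrite subr_gt0.
Qed.

End test_functions.

Section coordinate_path.
Context {R : realType} {n : nat}.
Implicit Types (f : 'rV[R]_n -> R) (x w : 'rV[R]_n).
Local Notation delta i := (delta_mx ord0 i : 'rV[R]_n).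

(** The corners of a path that changes one coordinate at a time; along it the mean value theorem on
    the line replaces a total derivative. *)
Definition trunc_rV (j : nat) w : 'rV[R]_n := \row_i (if (i < j)%N then w ord0 i else 0).

Lemma trunc_rVS (j : 'I_n) w : trunc_rV j.+1 w = w ord0 j *: delta j + trunc_rV j w.
Proof.
apply/rowP => i; rewrite !mxE eqxx ltnS leq_eqVlt -[(i == j :> nat)]/(i == j).
case: eqVneq => [->|_]; first by rewrite ltnn mulr1 addr0.
by rewrite mulr0 add0r.
Qed.

Lemma coord_path f x w : f (w + x) - f x =
  \sum_(j < n) (f (w ord0 j *: delta j + (trunc_rV j w + x)) - f (trunc_rV j w + x)).
Proof.
transitivity (\sum_(j < n) (f (trunc_rV j.+1 w + x) - f (trunc_rV j w + x))).
  rewrite -(big_mkord xpredT (fun j => f (trunc_rV j.+1 w + x) - f (trunc_rV j w + x))) telescope_sumr//.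
  by congr (f _ - f _); [congr (_ + _)|rewrite -[LHS]add0r; congr (_ + _)]; apply/rowP => i; rewrite !mxE// ltn_ord.
by apply: eq_bigr => j _; rewrite trunc_rVS addrA.
Qed.

End coordinate_path.

(** * Semi-definite forms *)

Section prehilbert.
Context {R : realType} {V : lmodType R}.
Variables (H : set V) (B : V -> V -> R).

Definition subspace_like (S : set V) :=
  [/\ S 0, forall u v, S u -> S v -> S (u + v) & forall (c : R) u, S u -> S (c *: u)].

(** Linearity is required only on [H], because integrals of functions that are not integrable do not
    add up; definiteness fails since functions are not identified almost everywhere. *)
Definition psd_form := [/\ forall u v, B u v = B v u,
  forall u v w, H u -> H v -> H w -> B (u + v) w = B u w + B v w,
  forall (c : R) u v, H u -> H v -> B (c *: u) v = c * B u v &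
  forall u, H u -> 0 <= B u u].

Definition cvg_form (u_ : nat -> V) (u : V) := forall e : R, 0 < e ->
  exists N, forall k, (N <= k)%N -> B (u_ k - u) (u_ k - u) <= e.

Definition cauchy_form (u_ : nat -> V) := forall e : R, 0 < e ->
  exists N, forall j k, (N <= j)%N -> (N <= k)%N -> B (u_ j - u_ k) (u_ j - u_ k) <= e.

Definition complete_form := forall u_ : nat -> V,
  (forall k, H (u_ k)) -> cauchy_form u_ -> exists2 u, H u & cvg_form u_ u.

Hypothesis HS : subspace_like H.
Hypothesis HB : psd_form.

Lemma subspaceN u : H u -> H (- u).
Proof. by have [_ _ hZ] := HS => hu; rewrite -scaleN1r; exact: hZ. Qed.

Lemma subspaceB u v : H u -> H v -> H (u - v).
Proof. by have [_ hD _] := HS => hu hv; apply: hD => //; exact: subspaceN. Qed.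

Lemma subspaceD u v : H u -> H v -> H (u + v).
Proof. by have [_ hD _] := HS; exact: hD. Qed.

Lemma subspaceZ c u : H u -> H (c *: u).
Proof. by have [_ _ hZ] := HS; exact: hZ. Qed.

Lemma subspace0 : H 0. Proof. by have [] := HS. Qed.

Lemma subspace_sum I (r : seq I) (P : pred I) (F : I -> V) :
  (forall i, P i -> H (F i)) -> H (\sum_(i <- r | P i) F i).
Proof.
by move=> h; elim/big_ind : _ => //; [exact: subspace0|exact: subspaceD].
Qed.

Lemma formC u v : B u v = B v u. Proof. by have [h] := HB. Qed.

Lemma formDl u v w : H u -> H v -> H w -> B (u + v) w = B u w + B v w.
Proof. by have [_ h _ _] := HB; exact: h. Qed.

Lemma formZl c u v : H u -> H v -> B (c *: u) v = c * B u v.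
Proof. by have [_ _ h _] := HB; exact: h. Qed.

Lemma form_ge0 u : H u -> 0 <= B u u.
Proof. by have [_ _ _ h] := HB; exact: h. Qed.

Lemma formDr u v w : H u -> H v -> H w -> B w (u + v) = B w u + B w v.
Proof. by move=> *; rewrite formC formDl// formC (formC v). Qed.

Lemma formZr c u v : H u -> H v -> B v (c *: u) = c * B v u.
Proof. by move=> *; rewrite formC formZl// formC. Qed.

Lemma formNl u v : H u -> H v -> B (- u) v = - B u v.
Proof. by move=> hu hv; rewrite -scaleN1r formZl// mulN1r. Qed.

Lemma formNr u v : H u -> H v -> B v (- u) = - B v u.
Proof. by move=> *; rewrite formC formNl// formC. Qed.

Lemma formBl u v w : H u -> H v -> H w -> B (u - v) w = B u w - B v w.
Proof. by move=> *; rewrite formDl ?formNl//; exact: subspaceN. Qed.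

Lemma formBr u v w : H u -> H v -> H w -> B w (u - v) = B w u - B w v.
Proof. by move=> *; rewrite formDr ?formNr//; exact: subspaceN. Qed.

Lemma form0l u : H u -> B 0 u = 0.
Proof. by move=> hu; rewrite -(scale0r (0 : V)) formZl ?mul0r//; exact: subspace0. Qed.

Lemma form_suml I (r : seq I) (P : pred I) (F : I -> V) u :
  (forall i, P i -> H (F i)) -> H u ->
  B (\sum_(i <- r | P i) F i) u = \sum_(i <- r | P i) B (F i) u.
Proof.
move=> hF hu.
suff [] : B (\sum_(i <- r | P i) F i) u = \sum_(i <- r | P i) B (F i) u /\
  H (\sum_(i <- r | P i) F i) by [].
elim: r => [|i r [IH1 IH2]].
  by rewrite !big_nil form0l//; split => //; exact: subspace0.
rewrite !big_cons; case: (boolP (P i)) => // Pi.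
by rewrite formDl ?IH1//; [split => //; apply: subspaceD => //|]; exact: hF.
Qed.

Lemma form_sqrD u v : H u -> H v -> B (u + v) (u + v) = B u u + 2 * B u v + B v v.
Proof.
move=> hu hv; have huv := subspaceD hu hv.
by rewrite formDl// !formDr// (formC v u); ring.
Qed.

Lemma form_sqrB u v : H u -> H v -> B (u - v) (u - v) = B u u - 2 * B u v + B v v.
Proof.
move=> hu hv; have hv' := subspaceN hv.
by rewrite form_sqrD// formNr// formNl// formNr//; ring.
Qed.

Lemma form_sqrZ c u : H u -> B (c *: u) (c *: u) = c ^+ 2 * B u u.
Proof. by move=> hu; rewrite formZl ?formZr//; [ring|exact: subspaceZ]. Qed.

Lemma form_sqrBC u v : H u -> H v -> B (u - v) (u - v) = B (v - u) (v - u).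
Proof. by move=> hu hv; rewrite !form_sqrB// (formC v u); ring. Qed.

Lemma form_CS u v : H u -> H v -> (B u v) ^+ 2 <= B u u * B v v.
Proof.
move=> hu hv.
have h (t : R) : 0 <= B u u + 2 * t * B u v + t ^+ 2 * B v v.
  have := form_ge0 (subspaceD hu (subspaceZ t hv)).
  by rewrite (form_sqrD hu (subspaceZ t hv)) (formZr t hv hu) (form_sqrZ t hv) mulrA.
have u0 := form_ge0 hu; have v0 := form_ge0 hv.
have [B0|B0] := eqVneq (B v v) 0.
  have [->|uv] := eqVneq (B u v) 0; first by rewrite expr0n/= B0 mulr0.
  (* With B v v = 0 the quadratic is affine in t; this t gives it the value -1. *)
  have := h (- (B u u + 1) / (2 * B u v)); rewrite B0 mulr0 addr0.
  rewrite (_ : 2 * _ * B u v = - (B u u + 1)); last by field.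
  by rewrite opprD addrA subrr add0r ler0N1.
have vp : 0 < B v v by rewrite lt_neqAle eq_sym B0.
have := h (- B u v / B v v).
rewrite (_ : _ + _ = B u u - B u v ^+ 2 / B v v); last by field.
by rewrite subr_ge0 ler_pdivrMr.
Qed.

Lemma form_CS_abs u v : H u -> H v -> `|B u v| <= Num.sqrt (B u u) * Num.sqrt (B v v).
Proof.
move=> hu hv; rewrite -sqrtrM ?form_ge0// -sqrtr_sqr.
by rewrite ler_wsqrtr// form_CS.
Qed.

Lemma form_null u v : H u -> H v -> B u u = 0 -> B u v = 0.
Proof.
move=> hu hv u0; have := form_CS hu hv; rewrite u0 mul0r => h.
by apply/eqP; rewrite -sqrf_eq0 eq_le h sqr_ge0.
Qed.

Lemma form_sqrD_le u v : H u -> H v -> B (u + v) (u + v) <= 2 * B u u + 2 * B v v.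
Proof.
move=> hu hv; have := form_ge0 (subspaceB hu hv).
by rewrite (form_sqrD hu hv) (form_sqrB hu hv); lra.
Qed.

Lemma form_parallelogram u v : H u -> H v ->
  B (u - v) (u - v) = 2 * B u u + 2 * B v v - 4 * B (2^-1 *: (u + v)) (2^-1 *: (u + v)).
Proof.
move=> hu hv; rewrite form_sqrZ; last exact: subspaceD.
by rewrite (form_sqrB hu hv) (form_sqrD hu hv); field.
Qed.

Lemma form_dist_le u v w : H u -> H v -> H w ->
  B (u - w) (u - w) <= 2 * B (u - v) (u - v) + 2 * B (v - w) (v - w).
Proof.
move=> hu hv hw; have -> : u - w = (u - v) + (v - w) by rewrite addrA subrK.
by apply: form_sqrD_le; exact: subspaceB.
Qed.

Lemma cvg_form_sqr (u_ : nat -> V) u : (forall k, H (u_ k)) -> H u -> cvg_form u_ u ->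
  (fun k => B (u_ k - u) (u_ k - u)) @ \oo --> (0 : R).
Proof.
move=> hu_ hu cu; apply/cvgrPdist_le => e e0; have [N hN] := cu _ e0.
exists N => // k /= Nk; rewrite sub0r normrN ger0_norm ?hN//.
by apply: form_ge0; exact: subspaceB.
Qed.

Lemma cvg_form_linear (u_ : nat -> V) u v : (forall k, H (u_ k)) -> H u -> H v ->
  cvg_form u_ u -> (fun k => B (u_ k) v) @ \oo --> B u v.
Proof.
move=> hu_ hu hv cu; have h := cvg_form_sqr hu_ hu cu.
have hB k : H (u_ k - u) by exact: subspaceB.
suff : (fun k => B (u_ k - u) v) @ \oo --> (0 : R).
  move=> h0; rewrite -[X in _ --> X]add0r.
  rewrite (_ : (fun k => B (u_ k) v) = (fun k => B (u_ k - u) v + B u v)).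
    by apply: cvgD => //; exact: cvg_cst.
  by apply/funext => k; rewrite formBl// subrK.
have h2 : (fun k => Num.sqrt (B (u_ k - u) (u_ k - u)) * Num.sqrt (B v v)) @ \oo --> (0 : R).
  rewrite -(mul0r (Num.sqrt (B v v))); apply: cvgM; last exact: cvg_cst.
  rewrite -sqrtr0; exact: (continuous_cvg _ (@sqrt_continuous R 0) h).
apply/norm_cvg0P.
apply: (squeeze_cvgr _ (cvg_cst 0) h2).
by apply: nearW => k; rewrite normr_ge0 form_CS_abs.
Qed.

Lemma cvg_form_self (u_ : nat -> V) u : (forall k, H (u_ k)) -> H u ->
  cvg_form u_ u -> (fun k => B (u_ k) (u_ k)) @ \oo --> B u u.
Proof.
move=> hu_ hu cu; have h1 := cvg_form_sqr hu_ hu cu.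
have h2 := cvg_form_linear hu_ hu hu cu.
rewrite (_ : (fun k => _) = (fun k => B (u_ k - u) (u_ k - u) + 2 * B (u_ k) u - B u u)).
  rewrite -[X in _ --> X](_ : 0 + 2 * B u u - B u u = _); last by ring.
  apply: cvgB; last exact: cvg_cst.
  by apply: cvgD => //; apply: cvgM => //; exact: cvg_cst.
by apply/funext => k; rewrite form_sqrB//; ring.
Qed.

(** Parallelogram identity: almost minimal points are close when their midpoint cannot go below the
    minimum. The lower bound varies with the index because it is also used for a decreasing sequence
    of hulls. *)
Lemma cauchy_form_minimizing (d : nat -> R) (d0 : R) (u_ : nat -> V) :
  (forall k j, (k <= j)%N -> d k <= B (2^-1 *: (u_ k + u_ j)) (2^-1 *: (u_ k + u_ j))) ->
  (forall k, H (u_ k)) -> d @ \oo --> d0 ->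
  (forall k, B (u_ k) (u_ k) <= d k + k.+1%:R^-1) ->
  cauchy_form u_.
Proof.
move=> hmid hu hd hle e e0.
have e8 : 0 < e / 16 by rewrite divr_gt0.
have /cvgrPdist_le /(_ _ e8)[N1 _ hN1] := hd.
have /cvgrPdist_le /(_ _ e8)[N2 _ hN2] := @cvg_harmonic R.
exists (maxn N1 N2).
suff main j k : (maxn N1 N2 <= j)%N -> (j <= k)%N -> B (u_ j - u_ k) (u_ j - u_ k) <= e.
  move=> j k hj hk; have [jk|kj] := leqP j k; first exact: main.
  by rewrite form_sqrBC//; apply: main => //; exact: ltnW.
rewrite geq_max => /andP[h1 h2] jk; rewrite form_parallelogram//.
have := hmid _ _ jk; have := hle j; have := hle k.
have := hN1 _ h1; have := hN1 _ (leq_trans h1 jk).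
have := hN2 _ h2; have := hN2 _ (leq_trans h2 jk).
rewrite /= /harmonic !ler_norml.
set a := j.+1%:R^-1; set b := k.+1%:R^-1.
move: (B _ _) (B _ _) (B _ _) (d j) (d k) a b => ? ? ? ? ? ? ? /andP[? ?] /andP[? ?] /andP[? ?] /andP[? ?].
lra.
Qed.

(** Projection without a closed subspace: the residuals of a minimizing sequence converge to an
    element orthogonal to [S]. That element has norm zero by hypothesis, so the distance to [S] is
    zero. *)
Lemma dense_of_orthogonal (S : set V) : complete_form -> S `<=` H -> subspace_like S ->
  (forall v, H v -> (forall s, S s -> B v s = 0) -> B v v = 0) ->
  forall u (e : R), H u -> 0 < e -> exists2 s, S s & B (u - s) (u - s) < e.
Proof.
move=> cB SH [S0 SD SZ] hS u e hu e0.
pose Q := [set B (u - s) (u - s) | s in S].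
have Qlb : has_lbound Q.
  by exists 0 => _ [s /SH hs <-]; apply: form_ge0; exact: subspaceB.
have Qinf : has_inf Q by split => //; exists (B (u - 0) (u - 0)); exists 0.
pose d := inf Q.
have dle s : S s -> d <= B (u - s) (u - s).
  by move=> hs; apply: (ge_inf Qlb); exists s.
have /choice[s_ hs_] k : exists s, S s /\ B (u - s) (u - s) <= d + k.+1%:R^-1.
  have k0 : (0 : R) < k.+1%:R^-1 by rewrite invr_gt0.
  by have [_ [s ss <-] /ltW h] := inf_adherent k0 Qinf; exists s.
have hSs k : S (s_ k) by case: (hs_ k).
have hus k : H (u - s_ k) by apply: subspaceB => //; exact: SH.
have mide s t : 2^-1 *: (u - s + (u - t)) = u - 2^-1 *: (s + t).
  rewrite addrACA -opprD scalerBr -[u + u]mulr2n -[u *+ 2]scaler_nat scalerA mulVf ?scale1r//.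
have : cauchy_form (fun k => u - s_ k).
  apply: (@cauchy_form_minimizing (fun=> d) d) => //.
  - by move=> k j _; rewrite mide; apply: dle; apply: SZ; exact: SD.
  - exact: cvg_cst.
  - by move=> k; case: (hs_ k).
move=> /(cB _ hus)[v hv cv].
have orth s : S s -> B v s = 0.
  move=> ss; have hs := SH _ ss.
  have key (t : R) : B v v <= B (v + t *: s) (v + t *: s).
    have hts := subspaceZ t hs.
    have cv' : cvg_form (fun k => u - s_ k + t *: s) (v + t *: s).
      by move=> f f0; have [N hN] := cv f f0; exists N => k Nk; rewrite opprD addrACA subrr addr0 hN.
    have h1 := cvg_form_self hus hv cv.
    have h2 := cvg_form_self (fun k => subspaceD (hus k) hts) (subspaceD hv hts) cv'.
    have h1' : (fun k => B (u - s_ k) (u - s_ k) - k.+1%:R^-1) @ \oo --> B v v.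
      by rewrite -[B v v]subr0; apply: cvgB => //; exact: cvg_harmonic.
    apply: (ler_cvg_to h1' h2); apply: nearW => k.
    have := (hs_ k).2; rewrite -lerBlDr => /le_trans; apply.
    by rewrite -addrA -[t *: s]opprK -opprD; apply: dle; apply: SD => //; rewrite -scaleNr; exact: SZ.
  have s0 := form_ge0 hs.
  have key' (t : R) : 0 <= 2 * t * B v s + t ^+ 2 * B s s.
    have := key t; rewrite (form_sqrD hv (subspaceZ t hs)) (formZr t hs hv) (form_sqrZ t hs).
    by lra.
  (* Nearly the minimizing t; the added 1 avoids a separate case for B s s = 0. *)
  have := key' (- B v s / (B s s + 1)).
  rewrite (_ : _ + _ = - (B v s ^+ 2) * ((B s s + 2) / (B s s + 1) ^+ 2)); last by field; lra.
  rewrite mulNr oppr_ge0 pmulr_lle0; last by rewrite divr_gt0 ?exprn_gt0//; lra.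
  by move=> h; apply/eqP; rewrite -sqrf_eq0 eq_le h sqr_ge0.
have v0 := hS _ hv orth.
have [N hN] := cv _ (divr_gt0 e0 (ltr0n R 4)).
exists (s_ N) => //.
have := form_sqrD_le (subspaceB (hus N) hv) hv; rewrite subrK v0.
by have := hN N (leqnn N); lra.
Qed.

End prehilbert.

Lemma psd_formD (R : realType) (V : lmodType R) (H : set V) (A B : V -> V -> R) : psd_form H A -> psd_form H B ->
  psd_form H (fun u v => A u v + B u v).
Proof.
move=> [a1 a2 a3 a4] [b1 b2 b3 b4]; split.
- by move=> u v; rewrite a1 b1.
- by move=> u v w hu hv hw; rewrite a2// b2//; ring.
- by move=> c u v hu hv; rewrite a3// b3//; ring.
- by move=> u hu; rewrite addr_ge0 ?a4 ?b4.
Qed.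

(** * Translations, integration by parts and square-integrable functions *)

Section translation.
Context {R : realType} {n : nat}.
Local Notation mu := (lebesgue_rV R n).
Local Notation delta i := (delta_mx ord0 i : 'rV[R]_n).
Implicit Types (f g u v : 'rV[R]_n -> R).

Lemma integral_translate (f : 'rV[R]_n -> \bar R) (v : 'rV[R]_n) :
  measurable_fun setT f -> (forall x, 0 <= f x)%E ->
  (\int[mu]_x f (v + x)%R = \int[mu]_x f x)%E.
Proof.
move=> mf f0; have := @integral_affine R n f 1 v ltr01 mf f0.
rewrite invr1 expr1n mul1e => <-.
by apply: eq_integral => x _; rewrite scale1r addrC.
Qed.

Lemma translate_continuous (v : 'rV[R]_n) : continuous (fun x : 'rV[R]_n => v + x).
Proof.
have := @rV_affine_continuous R n 1 v.
by under eq_fun do rewrite scale1r addrC.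
Qed.

Lemma measurable_translate (v : 'rV[R]_n) : measurable_fun setT (fun x : 'rV[R]_n => v + x).
Proof.
have := measurable_rV_affine 1 v.
by under eq_fun do rewrite scale1r addrC.
Qed.

Lemma Rintegral_affine f (s : R) (v : 'rV[R]_n) : 0 < s ->
  measurable_fun setT f -> mu.-integrable setT (EFin \o f) ->
  \int[mu]_x f (s *: x + v) = s^-1 ^+ n * \int[mu]_x f x.
Proof.
move=> s0 mf intf; have mF : measurable_fun setT (EFin \o f) by exact/measurable_EFinP.
have sn0 : 0 <= s^-1 ^+ n by rewrite exprn_ge0// invr_ge0 ltW.
rewrite /Rintegral integralE.
have pE : (\int[mu]_x (fun x => (f (s *: x + v))%:E)^\+ x = (s^-1 ^+ n)%:E * \int[mu]_x (EFin \o f)^\+ x)%E.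
  rewrite -(integral_affine v)//; last exact: measurable_funepos.
  by apply: eq_integral => x _; rewrite !funeposE.
have nE : (\int[mu]_x (fun x => (f (s *: x + v))%:E)^\- x = (s^-1 ^+ n)%:E * \int[mu]_x (EFin \o f)^\- x)%E.
  rewrite -(integral_affine v)//; last exact: measurable_funeneg.
  by apply: eq_integral => x _; rewrite !funenegE.
rewrite pE nE -muleBr//; last first.
  apply: fin_num_adde_defl; rewrite fin_numN.
  exact: integrable_neg_fin_num.
rewrite -integralE fineM//; exact: integrable_fin_num.
Qed.

Lemma Rintegral_translate f (v : 'rV[R]_n) :
  measurable_fun setT f -> mu.-integrable setT (EFin \o f) ->
  \int[mu]_x f (v + x) = \int[mu]_x f x.
Proof.
move=> mf intf; have := Rintegral_affine v ltr01 mf intf.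
rewrite invr1 expr1n mul1r => <-.
by apply: eq_Rintegral => x _; rewrite scale1r addrC.
Qed.

Lemma closed_norm_ball (r : R) : closed [set x : 'rV[R]_n | `|x| <= r].
Proof.
apply: (@preimage_closed _ _ (fun x : 'rV[R]_n => `|x|) [set t | t <= r]).
  by move=> x _; exact: norm_continuous.
exact: closed_le.
Qed.

Lemma measurable_norm_ball (r : R) : measurable [set x : 'rV[R]_n | `|x| <= r].
Proof. by apply: closed_measurable_rV; exact: closed_norm_ball. Qed.

Lemma lebesgue_rV_ball_lty (r : R) : (mu [set x : 'rV[R]_n | (`|x| <= r)%R] < +oo)%E.
Proof.
apply: lebesgue_rV_bounded; first exact: measurable_norm_ball.
exists r; split; [exact: num_real|move=> M rM x /= xr]; apply: le_trans xr (ltW rM).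
Qed.

Lemma integrable_indic_ball (M r : R) :
  mu.-integrable setT (EFin \o (fun x : 'rV[R]_n => M * \1_[set x : 'rV[R]_n | `|x| <= r] x)).
Proof.
under [X in mu.-integrable _ X]eq_fun do rewrite /= EFinM.
apply: integrableZl => //; apply/integrableP; split.
  by apply/measurable_EFinP; apply: measurable_indic; exact: measurable_norm_ball.
under eq_integral do rewrite gee0_abs ?lee_fin//.
by rewrite integral_indic ?setIT//; [exact: lebesgue_rV_ball_lty|exact: measurable_norm_ball].
Qed.

Lemma integrable_bsupp f (M r : R) : measurable_fun setT f ->
  (forall x, `|f x| <= M) -> (forall x, r < `|x| -> f x = 0) ->
  mu.-integrable setT (EFin \o f).
Proof.
move=> mf fM f0; apply: le_integrable (integrable_indic_ball M r) => //.
  exact/measurable_EFinP.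
move=> x _; rewrite /= lee_fin indicE; have [xr|xr] := boolP (x \in _).
  by rewrite mulr1; apply: le_trans (fM x) (ler_norm _).
rewrite f0 ?normr0//; rewrite ltNge; apply: contraNN xr => h; exact: mem_set.
Qed.

Lemma continuous_bsupp_integrable f (r : R) : continuous f ->
  (forall x, r < `|x| -> f x = 0) -> mu.-integrable setT (EFin \o f).
Proof.
move=> cf f0.
have cK : compact (cbox (const_mx (- r)) (const_mx r) : set 'rV[R]_n) by exact: compact_cbox.
have f0' x : ~ cbox (const_mx (- r)) (const_mx r) x -> f x = 0.
  move=> /existsNP[i]; rewrite !mxE -ler_norml => /negP; rewrite -ltNge => h.
  by apply: f0; apply: lt_le_trans h (ler_coord_norm _ _).
have [M _ fM] := continuous_bsupp_bounded cf cK f0'.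
by apply: (integrable_bsupp _ fM f0); exact: continuous_measurable_rV.
Qed.

Lemma delta_norm_le (i : 'I_n) (h : R) : `|h *: delta i| <= `|h|.
Proof.
rewrite normrZ -[leRHS]mulr1 ler_wpM2l// [leLHS]/Num.norm/= mx_normrE.
apply/bigmax_leP; split => //= -[j k] _ /=; rewrite mxE.
by case: (_ && _); rewrite ?normr1 ?normr0.
Qed.

(** The integral of f(t e_i + x) over x does not depend on t, and its derivative at t = 0 is the
    integral of the partial derivative. *)
Lemma integral_partial_eq0 f i (r : R) : Ck 1 setT f ->
  (forall x, r < `|x| -> f x = 0) -> \int[mu]_x partial i f x = 0.
Proof.
move=> hf f0; have cf := Ck_continuous hf.
have cdf : continuous (partial i f) by exact: Ck_continuous (Ck_partial i hf).
have df0 x : r < `|x| -> partial i f x = 0.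
  move=> rx; apply: (@partial_out _ _ [set x | `|x| <= r]).
  - exact: closed_norm_ball.
  - by move=> y /negP; rewrite -ltNge => /f0.
  - by apply/negP; rewrite -ltNge.
pose g (t : R) x := f (t *: delta i + x).
have dg (t : R) x : is_derive t 1 (g ^~ x) (partial i f (t *: delta i + x)).
  by apply: is_derive_line_at; have [] := Ck_is_derive i (t *: delta i + x) hf.
have cK : compact (cbox (const_mx (- r)) (const_mx r) : set 'rV[R]_n) by exact: compact_cbox.
have [M M0 dM] : exists2 M, 0 < M & forall x, `|partial i f x| <= M.
  apply: (continuous_bsupp_bounded cdf cK) => x.
  move=> /existsNP[j]; rewrite !mxE -ler_norml => /negP; rewrite -ltNge => h.
  by apply: df0; apply: lt_le_trans h (ler_coord_norm _ _).
have intf := continuous_bsupp_integrable cf f0.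
have mf := continuous_measurable_rV cf.
have gE t : \int[mu]_x g t x = \int[mu]_x f x by exact: Rintegral_translate.
have int_g t : mu.-integrable setT (EFin \o g t).
  apply: (@continuous_bsupp_integrable _ (r + `|t|)).
    move=> x; apply: (continuous_at_comp (f := fun x : 'rV[R]_n => t *: delta i + x)).
      exact: translate_continuous.
    exact: cf.
  move=> x rx; apply: f0; have h := ler_normD (- (t *: delta i)) (t *: delta i + x).
  rewrite addrA addNr add0r normrN in h.
  have h2 := delta_norm_le i t; lra.
have I0 : `](-1 : R), 1[%classic 0 by rewrite /= in_itv/= ltrN10 ltr01.
(* For |t| < 1 the translates are supported in the ball of radius r + 1, which provides the
   dominating function. *)
have := @differentiation_under_integral R _ _ mu g setT measurableT 0 (-1) 1 I0
  (fun t _ => int_g t) (fun t x _ _ => ex_derive (is_derive := dg t x))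
  (fun x => M * \1_[set x : 'rV[R]_n | `|x| <= r + 1] x) _ (integrable_indic_ball M (r + 1)).
have E x y : partial1of2 g x y = partial i f (x *: delta i + y).
  by rewrite partial1of2E; have [_ ->] := dg x y.
rewrite (_ : (fun t => \int[mu]_x g t x) = cst (\int[mu]_x f x)); last exact/funext.
rewrite derive1_cst => ->.
- by apply: eq_Rintegral => x _; rewrite E scale0r add0r.
- by move=> y; rewrite mulr_ge0// ltW.
- move=> t y /=; rewrite in_itv/= => t1 _; rewrite E indicE.
  have [_|xr] := boolP (y \in _); first by rewrite mulr1.
  rewrite mulr0 df0 ?normr0//.
  have h := ler_normD (- (t *: delta i)) (t *: delta i + y).
  rewrite addrA addNr add0r normrN in h.
  have h2 := delta_norm_le i t.
  have : r + 1 < `|y| by rewrite ltNge; apply: contraNN xr => h'; exact: mem_set.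
  have : `|t| < 1 by rewrite ltr_norml.
  lra.
Qed.

Lemma integral_by_parts f g i (r : R) : Ck 1 setT f -> Ck 1 setT g ->
  (forall x, r < `|x| -> g x = 0) ->
  \int[mu]_x (f x * partial i g x) = - \int[mu]_x (partial i f x * g x).
Proof.
move=> hf hg g0; have cf := Ck_continuous hf; have cg := Ck_continuous hg.
have cdf : continuous (partial i f) by exact: Ck_continuous (Ck_partial i hf).
have cdg : continuous (partial i g) by exact: Ck_continuous (Ck_partial i hg).
have dg0 x : r < `|x| -> partial i g x = 0.
  move=> rx; apply: (@partial_out _ _ [set x | `|x| <= r]).
  - exact: closed_norm_ball.
  - by move=> y /negP; rewrite -ltNge => /g0.
  - by apply/negP; rewrite -ltNge.
have := @integral_partial_eq0 (fun x => f x * g x) i r (CkM hf hg).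
have -> : partial i (fun x => f x * g x) = fun x => f x * partial i g x + partial i f x * g x.
  apply/funext => x; rewrite [in RHS](mulrC (partial i f x)).
  apply: partialE; exact: (is_deriveM (Ck_is_derive i x hf) (Ck_is_derive i x hg)).
rewrite RintegralD//.
- by move=> h; apply/eqP; rewrite -addr_eq0; apply/eqP; apply: h => x /g0 ->; rewrite mulr0.
- apply: (@continuous_bsupp_integrable _ r); last by move=> x /dg0 ->; rewrite mulr0.
  by move=> x; apply: continuousM; [exact: cf|exact: cdg].
- apply: (@continuous_bsupp_integrable _ r); last by move=> x /g0 ->; rewrite mulr0.
  by move=> x; apply: continuousM; [exact: cdf|exact: cg].
Qed.

End translation.

Section fundamental_lemma.
Context {R : realType} {n : nat}.
Local Notation mu := (lebesgue_rV R n).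
Implicit Types (U : set 'rV[R]_n) (f g h phi : 'rV[R]_n -> R).

Definition oboxes : set (set 'rV[R]_n) := [set A | exists a b, A = obox a b].

Lemma oboxI (a b a' b' : 'rV[R]_n) : obox a b `&` obox a' b' =
  obox (\row_i Num.max (a ord0 i) (a' ord0 i)) (\row_i Num.min (b ord0 i) (b' ord0 i)).
Proof.
apply/seteqP; split => x.
  move=> [h1 h2] i; have /andP[h3 h4] := h1 i; have /andP[h5 h6] := h2 i.
  by rewrite !mxE gt_max lt_min h3 h4 h5 h6.
move=> h; split => i; have := h i; rewrite !mxE gt_max lt_min => /andP[/andP[h1 h2] /andP[h3 h4]].
  by rewrite h1 h3.
by rewrite h2 h4.
Qed.

Lemma measurable_sub_oboxes : measurable `<=` <<s oboxes >>.
Proof.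
apply: smallest_sub; first exact: smallest_sigma_algebra.
rewrite -bigcup_seq; apply: bigcup_sub => i _ _ [B mB <-].
rewrite setTI.
have mf : measurable_fun (setT : set (g_sigma_algebraType oboxes)) (@rV_coord R n i).
  apply: (measurability _ (RGenOpens.measurableE R)) => _ [_ [a [b ->] <-]].
  rewrite setTI.
  have [|D [F [-> _]]] := @open_bigcup_obox R n (@rV_coord R n i @^-1` `]a, b[).
    apply: open_comp; last exact: interval_open.
    by move=> x _; exact: coord_continuous.
  apply: bigcup_measurable => k _; apply: sub_sigma_algebra.
  by exists (F k).1, (F k).2.
by rewrite -[X in <<s _ >> X]setTI; exact: mf.
Qed.

(** The measurable sets over which [h] integrates to zero form a Dynkin system. It contains the
    boxes, which are closed under intersection and generate the measurable sets. *)
Lemma integral_obox_eq0_ae h (a0 b0 : 'rV[R]_n) :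
  mu.-integrable setT (EFin \o h) -> (forall x, ~ obox a0 b0 x -> h x = 0) ->
  (forall a b, (\int[mu]_(x in obox a b) (h x)%:E = 0)%E) ->
  {ae mu, forall x, h x = 0}.
Proof.
move=> ih h0 hbox.
pose L := [set A : set 'rV[R]_n | measurable A /\ (\int[mu]_(x in A) (h x)%:E = 0)%E].
have mh : measurable_fun setT h by apply/measurable_EFinP; exact: measurable_int ih.
have hT : (\int[mu]_x (h x)%:E = 0)%E.
  rewrite -(hbox a0 b0) [RHS]integral_mkcond; apply: eq_integral => x _.
  by rewrite patchE; case: ifPn => // /negP xb; rewrite h0// => ?; apply: xb; exact: mem_set.
have iA A : measurable A -> mu.-integrable A (EFin \o h).
  by move=> mA; exact: integrableS ih.
have dL : dynkin L.
  split.
  - by split => //; exact: measurableT.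
  - move=> A [mA iA0]; split; first exact: measurableC.
    have := @integral_setU _ _ _ mu A (~` A) (EFin \o h) mA (measurableC mA).
    rewrite setUCr hT iA0 => /(_ _ _)/esym; rewrite add0e; apply.
      exact/measurable_EFinP.
    by apply/disj_setPS; rewrite setICr.
  - move=> F tF LF; have mF k : measurable (F k) by case: (LF k).
    split; first exact: bigcup_measurable.
    rewrite integral_bigcup//; last by apply: iA; exact: bigcup_measurable.
    by apply: eseries0 => k _ _; case: (LF k).
have sub : measurable `<=` L.
  apply: subset_trans measurable_sub_oboxes _.
  apply: (@lambda_system_subset _ oboxes _ setT L) => //.
  - by move=> A B [a [b ->]] [a' [b' ->]]; rewrite oboxI; eexists; eexists.
  - exact/dynkin_lambda_system.
  - move=> A [a [b ->]]; split; [exact: measurable_obox|exact: hbox].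
have := @integral_ae_eq _ _ _ mu setT measurableT (cst 0%E) (EFin \o h) ih (measurable_cst _).
move=> H; have {}H : ae_eq mu setT (EFin \o h) (cst 0%E).
  by apply: H => E _ mE; rewrite integral0; case: (sub _ mE).
by apply: filterS H => x /(_ I) [].
Qed.

Lemma bounded_cbox (a b : 'rV[R]_n) : (mu (cbox a b) < +oo)%E.
Proof.
apply: lebesgue_rV_bounded; first exact: measurable_cbox.
exact/compact_bounded/compact_cbox.
Qed.

Lemma sub_obox_cbox (a b : 'rV[R]_n) : obox a b `<=` cbox a b.
Proof. by move=> x h i; have /andP[/ltW -> /ltW ->] := h i. Qed.

Lemma L2_integrable_finite U g A : measurable U -> measurable A -> A `<=` U ->
  L2 U g -> (mu A < +oo)%E -> mu.-integrable A (EFin \o g).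
Proof.
move=> mU mA AU [mg g2] Aoo.
have mgA : measurable_fun A g by exact: measurable_funS mg.
have ig2 : mu.-integrable A (fun x => (g x ^+ 2)%:E).
  apply/integrableP; split; first exact: measurable_sqr.
  under eq_integral do rewrite gee0_abs ?lee_fin ?sqr_ge0//.
  apply: le_lt_trans g2; apply: ge0_subset_integral => //.
    exact: measurable_sqr.
  by move=> x _; rewrite lee_fin sqr_ge0.
have i1 : mu.-integrable A (cst 1%:E).
  apply/integrableP; split; first exact: measurable_cst.
  by under eq_integral do rewrite gee0_abs//; rewrite integral_cst// mul1e.
apply: (le_integrable mA _ _ (integrableD mA ig2 i1)); first exact/measurable_EFinP.
move=> x _; rewrite /= lee_fin [leRHS]ger0_norm ?addr_ge0 ?sqr_ge0//.
rewrite -(real_normK (num_real (g x))).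
by have := sqr_ge0 (`|g x| - 1); have := normr_ge0 (g x); nra.
Qed.

Lemma Rintegral_supp U A f : A `<=` U -> (forall x, U x -> ~ A x -> f x = 0) ->
  \int[mu]_(x in U) f x = \int[mu]_(x in A) f x.
Proof.
move=> AU f0; rewrite Rintegral_mkcond [RHS]Rintegral_mkcond; apply: eq_Rintegral => x _.
rewrite !patchE; case: ifPn => xU; case: ifPn => xA //.
  apply: f0; first exact: set_mem.
  by move=> Ax; move/negP: xA; apply; exact: mem_set.
by move/negP: xU; case; apply/mem_set/AU/set_mem.
Qed.

(** Bumps tend boundedly to indicators, so [g] integrates to zero over every box whose closure is in
    [U]. Applied to subboxes this makes [g] null on each box of a countable cover. *)
Lemma fundamental_lemma U g : open U -> L2 U g ->
  (forall phi, test_fun U phi -> \int[mu]_(x in U) (g x * phi x) = 0) ->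
  {ae mu, forall x, U x -> g x = 0}.
Proof.
move=> oU Lg gphi; have mU := open_measurable_rV oU.
have [D [F [UE FU]]] := open_bigcup_obox oU.
have key a b : cbox a b `<=` U -> \int[mu]_(x in obox a b) g x = 0.
  move=> abU; have mab := @measurable_obox R n a b.
  have abU' : obox a b `<=` U by apply: subset_trans abU; exact: sub_obox_cbox.
  have iab : mu.-integrable (obox a b) (EFin \o g).
    apply: (L2_integrable_finite mU) => //.
    apply: le_lt_trans (bounded_cbox a b); apply: le_measure; rewrite ?inE//.
      exact: measurable_cbox.
    exact: sub_obox_cbox.
  have [mg _] := Lg.
  have mga : measurable_fun (obox a b) g by exact: measurable_funS mg.
  have E0 k : (\int[mu]_(x in obox a b) (g x * box_bump k.+1%:R a b x)%:E = 0)%E.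
    have := gphi _ (@test_fun_box_bump R n U k.+1%:R a b (ltr0Sn _ _) abU).
    rewrite (Rintegral_supp abU'); last first.
      by move=> x _ nx; rewrite box_bump_out ?mulr0.
    rewrite /Rintegral => /eqP; rewrite fine_eq0 => [/eqP //|].
    apply: (integrable_fin_num mab).
    apply: (le_integrable mab _ _ iab).
      apply/measurable_EFinP; apply: measurable_funM => //.
      apply: measurable_funTS; apply: continuous_measurable_rV.
      exact/smooth_continuous/smooth_box_bump.
    move=> x _; rewrite /= lee_fin normrM -[leRHS]mulr1 ler_wpM2l//.
    by rewrite ger0_norm ?box_bump_ge0// box_bump_le1.
  have : (fun k => \int[mu]_(x in obox a b) (g x * box_bump k.+1%:R a b x)%:E)%E @ \oo
      --> (\int[mu]_(x in obox a b) (g x)%:E)%E.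
    apply: (dominated_cvg mab (g := fun x => `|g x|%:E)) => //.
    - move=> k; apply/measurable_EFinP; apply: measurable_funM => //.
      apply: measurable_funTS; apply: continuous_measurable_rV.
      exact/smooth_continuous/smooth_box_bump.
    - move=> x abx; apply: cvg_EFin; first exact: nearW.
      rewrite -[X in _ --> X](mulr1 (g x)); apply: cvgM; first exact: cvg_cst.
      by have := @box_bump_cvg R n a b x; rewrite indicE mem_set.
    - exact: integrable_norm.
    - move=> k x _; rewrite /= lee_fin normrM -[leRHS]mulr1 ler_wpM2l//.
      by rewrite ger0_norm ?box_bump_ge0// box_bump_le1.
  rewrite (_ : (fun k => _) = cst 0%E); last exact/funext.
  by move=> /(cvg_unique (@ereal_hausdorff R) (cvg_cst 0%E)) h; rewrite /Rintegral -h.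
have keyD k : D k -> {ae mu, forall x, obox (F k).1 (F k).2 x -> g x = 0}.
  move=> Dk; set a := (F k).1; set b := (F k).2.
  have mab := @measurable_obox R n a b.
  have abU : obox a b `<=` U.
    by apply: subset_trans (FU _ Dk); exact: sub_obox_cbox.
  have iab : mu.-integrable (obox a b) (EFin \o g).
    apply: (L2_integrable_finite mU) => //.
    apply: le_lt_trans (bounded_cbox a b); apply: le_measure; rewrite ?inE//.
      exact: measurable_cbox.
    exact: sub_obox_cbox.
  have ih : mu.-integrable setT (EFin \o (g \_ (obox a b))).
    by rewrite -restrict_EFin; apply/integrable_restrict => //; rewrite setTI.
  have : {ae mu, forall x, (g \_ (obox a b)) x = 0}.
    apply: (integral_obox_eq0_ae ih (a0 := a) (b0 := b)).
      by move=> x nx; rewrite patchE memNset.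
    move=> a' b'.
    transitivity (\int[mu]_(x in obox a' b' `&` obox a b) (g x)%:E)%E.
      by rewrite integral_mkcondr restrict_EFin.
    have mI : measurable (obox a' b' `&` obox a b) by apply: measurableI => //; exact: measurable_obox.
    have fI : (\int[mu]_(x in obox a' b' `&` obox a b) (g x)%:E)%E \is a fin_num.
      by apply: integrable_fin_num => //; exact: integrableS iab.
    have [xI|I0] := pselect (exists x, (obox a' b' `&` obox a b) x); last first.
      by rewrite (_ : _ `&` _ = set0) ?integral_set0// -subset0 => x Ix; apply: I0; exists x.
    apply/eqP; rewrite -fine_eq0//; apply/eqP.
    rewrite oboxI; apply: key.
    apply: subset_trans (FU _ Dk) => x cx i.
    by have := cx i; rewrite !mxE ge_max le_min => /andP[/andP[_ ->] /andP[_ ->]].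
  by apply: filterS => x + abx; rewrite patchE mem_set.
have : {ae mu, forall x, forall k, D k -> obox (F k).1 (F k).2 x -> g x = 0}.
  apply: ae_foralln => k; have [Dk|nDk] := pselect (D k).
    by apply: filterS (keyD _ Dk) => x hx _; exact: hx.
  by apply: filterE => x /nDk.
by apply: filterS => x hx; rewrite UE => -[k Dk]; exact: hx.
Qed.

End fundamental_lemma.

Section L2_space.
Context {R : realType} {n : nat}.
Local Notation mu := (lebesgue_rV R n).
Local Notation V := ('rV[R]_n -> R^o).
Variables (U : set 'rV[R]_n) (mU : measurable U).
Implicit Types u v : V.

Lemma L2_subspace : subspace_like (L2 U : set V).
Proof.
split; first exact: (sqint0 mu U).
  by move=> u v hu hv; exact: (sqintD mU hu hv).
by move=> c u hu; exact: (sqintZ mU c hu).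
Qed.

Lemma wip_psd (w : 'rV[R]_n -> R) (C : R) : measurable_fun U w ->
  (forall x, U x -> 0 <= w x <= C) -> psd_form (L2 U : set V) (wip mu U w : V -> V -> R).
Proof.
move=> mw wC; have wC' x : U x -> `|w x| <= C.
  by move=> /wC/andP[h1 h2]; rewrite ger0_norm.
split.
- by move=> u v; exact: wipC.
- by move=> u v z hu hv hz; exact: (wipDl mU mw wC').
- by move=> c u v hu hv; exact: (wipZl mU mw wC').
- move=> u hu; apply: Rintegral_ge0 => x Ux; rewrite -mulrA -expr2.
  by rewrite mulr_ge0 ?sqr_ge0//; case/andP: (wC x Ux).
Qed.

Definition ip2 : V -> V -> R := wip mu U (cst 1).

Lemma ip2E u v : ip2 u v = \int[mu]_(x in U) (u x * v x).
Proof. by apply: eq_Rintegral => x _; rewrite mul1r. Qed.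

Lemma ip2_psd : psd_form (L2 U : set V) ip2.
Proof. by apply: (@wip_psd _ 1); [exact: measurable_cst|move=> x _; rewrite ler01 lexx]. Qed.

Lemma ip2_sqn u : L2 U u -> sqn mu U u = (ip2 u u)%:E.
Proof.
by move=> hu; rewrite sqnE// ip2E; congr EFin; apply: eq_Rintegral => x _; rewrite expr2.
Qed.

Lemma L2B u v : L2 U u -> L2 U v -> L2 U (u - v).
Proof. exact: (subspaceB L2_subspace). Qed.

Lemma ip2_complete : complete_form (L2 U : set V) ip2.
Proof.
move=> u_ hu_ cu_.
have [|||u [mfu u2 cu]] := @sqn_complete _ _ R mu U mU u_.
- by move=> k; case: (hu_ k).
- by move=> k; case: (hu_ k).
- move=> e e0; have [N hN] := cu_ e e0; exists N => j k jN kN.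
  have := hN _ _ jN kN; rewrite -lee_fin -ip2_sqn//; exact: L2B.
exists u; first by split.
move=> e e0; have [N hN] := cu e e0; exists N => k kN.
have := hN _ kN; rewrite -lee_fin -ip2_sqn//; apply: L2B => //.
Qed.

End L2_space.

Section test_density.
Context {R : realType} {n : nat}.
Local Notation mu := (lebesgue_rV R n).
Local Notation V := ('rV[R]_n -> R^o).
Variables (U : set 'rV[R]_n) (oU : open U).
Let mU : measurable U := open_measurable_rV oU.

Lemma test_fun0 : test_fun U (cst 0 : 'rV[R]_n -> R).
Proof.
split; first by move=> k; exact: Ck_cst.
by exists set0 => //; split; [exact: compact0|exact: sub0set].
Qed.

Lemma test_fun_subspace : subspace_like (@test_fun R n U : set V).
Proof.
split; first exact: test_fun0.
  by move=> u v; exact: test_funD.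
by move=> c u; exact: test_funZ.
Qed.

Lemma bounded_bsupp_L2 (f : 'rV[R]_n -> R) (A : set 'rV[R]_n) (M r : R) :
  measurable A -> measurable_fun setT f -> (forall x, `|f x| <= M) ->
  (forall x, r < `|x| -> f x = 0) -> L2 A f.
Proof.
move=> mA mf fM f0.
have h : mu.-integrable setT (EFin \o (fun x => f x ^+ 2)).
  apply: (@integrable_bsupp _ _ _ (M ^+ 2) r).
  - exact: measurable_funX.
  - by move=> x; rewrite normrX lerXn2r// nnegrE// (le_trans _ (fM x)).
  - by move=> x /f0 ->; rewrite expr0n.
split; first exact: measurable_funTS.
have /integrableP[_] := integrableS measurableT mA (subsetT A) h.
by under eq_integral do rewrite /= ger0_norm ?sqr_ge0//.
Qed.

Lemma test_fun_L2 (A : set 'rV[R]_n) phi : measurable A -> test_fun U phi -> L2 A phi.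
Proof.
move=> mA tphi; have [M M0 hM] := test_fun_bounded tphi.
have [r r0 hr] := test_fun_bsupp tphi.
apply: (@bounded_bsupp_L2 _ _ M r) => //.
  by apply: continuous_measurable_rV; apply: smooth_continuous; case: tphi.
by move=> x /ltW; exact: hr.
Qed.

(** By the fundamental lemma a function orthogonal to all test functions is null, so the abstract
    density criterion applies. *)
Lemma test_fun_dense (u : V) (e : R) : L2 U u -> 0 < e ->
  exists2 phi, test_fun U phi & ip2 U (u - phi : V) (u - phi : V) < e.
Proof.
apply: (dense_of_orthogonal (L2_subspace mU) (ip2_psd mU) (ip2_complete mU)).
- by move=> phi; exact: test_fun_L2.
- exact: test_fun_subspace.
- move=> v hv h.
  have h0 : {ae mu, forall x, U x -> v x = 0}.
    by apply: fundamental_lemma => // phi /h; rewrite ip2E.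
  rewrite ip2E /Rintegral.
  rewrite (@ae_eq_integral _ _ _ mu U (cst 0%E)) ?integral0//.
    by apply/measurable_EFinP; apply: measurable_funM; case: hv.
  by apply: filterS h0 => x hx Ux; rewrite hx// mul0r.
Qed.

End test_density.

(** * Weak derivatives *)

Section integral_sums.
Context d (T : measurableType d) (R : realType) (mu : {measure set T -> \bar R}).
Variables (D : set T) (mD : measurable D).

Lemma Rintegral_sum I (r : seq I) (F : I -> T -> R) :
  (forall i, mu.-integrable D (EFin \o F i)) ->
  \int[mu]_(x in D) (\sum_(i <- r) F i x) = \sum_(i <- r) \int[mu]_(x in D) F i x.
Proof.
move=> hF; elim: r => [|i r IH].
  by rewrite big_nil; under eq_Rintegral do rewrite big_nil; rewrite /Rintegral integral0.
rewrite big_cons -IH -RintegralD//.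
  by apply: eq_Rintegral => x _; rewrite big_cons.
apply: eq_integrable (integrable_sum mD r (P := xpredT) (fun i _ => hF i)) => // x _.
by rewrite /= sumEFin.
Qed.

Lemma measurable_mul3 (w u v : T -> R) : measurable_fun D w -> measurable_fun D u ->
  measurable_fun D v -> measurable_fun D (fun x => w x * u x * v x).
Proof. by move=> *; do 2 apply: measurable_funM => //. Qed.

End integral_sums.

Section weak_derivatives.
Context {R : realType} {n : nat}.
Local Notation mu := (lebesgue_rV R n).
Local Notation V := ('rV[R]_n -> R^o).
Variables (U : set 'rV[R]_n) (oU : open U).
Let mU : measurable U := open_measurable_rV oU.
Implicit Types (u v g h phi : V).

Lemma ae_eq_on_sym u v : ae_eq_on U u v -> ae_eq_on U v u.
Proof. by apply: filterS => x h Ux; rewrite h. Qed.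

Lemma ae_eq_on_trans u v w : ae_eq_on U u v -> ae_eq_on U v w -> ae_eq_on U u w.
Proof. by apply: filterS2 => x h1 h2 Ux; rewrite h1// h2. Qed.

Lemma ae_eq_on_refl u : ae_eq_on U u u.
Proof. exact: filterE. Qed.

Lemma integrable_ip u v : L2 U u -> L2 U v -> mu.-integrable U (EFin \o (fun x => u x * v x)).
Proof.
move=> hu hv; have c1 x : U x -> `|(cst 1 : 'rV[R]_n -> R) x| <= 1 by rewrite normr1.
have := integrable_wip mU (measurable_cst (1 : R)) c1 hu hv.
by apply: eq_integrable => // x _; rewrite /= mul1r.
Qed.

Lemma ip2_ae_eq u u' v v' : measurable_fun U u -> measurable_fun U v ->
  measurable_fun U u' -> measurable_fun U v' ->
  ae_eq_on U u u' -> ae_eq_on U v v' -> ip2 U u v = ip2 U u' v'.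
Proof.
move=> m1 m2 m3 m4 e1 e2; apply: (wip_ae_eq mU) => //.
  exact: measurable_mul3.
exact: measurable_mul3.
Qed.

Lemma ip2_eq0_ae u : L2 U u -> ip2 U u u = 0 -> ae_eq_on U u (cst 0).
Proof.
move=> hu u0; apply: (sqn_eq0_ae mU); first by case: hu.
by have := ip2_sqn hu; rewrite u0.
Qed.

Lemma is_weak_partialE i u g : is_weak_partial U i u g <->
  L2 U g /\ forall phi, test_fun U phi -> ip2 U u (partial i phi) = - ip2 U g phi.
Proof.
by split => -[h1 h2]; split => // phi tphi; have := h2 phi tphi; rewrite !ip2E.
Qed.

Lemma weak_partial_unique i u g h :
  is_weak_partial U i u g -> is_weak_partial U i u h -> ae_eq_on U g h.
Proof.
move=> /is_weak_partialE[Lg hg] /is_weak_partialE[Lh hh].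
have : {ae mu, forall x, U x -> (g - h) x = 0}.
  apply: fundamental_lemma => //; first exact: L2B.
  move=> phi tphi; rewrite -ip2E (formBl (L2_subspace mU) (ip2_psd mU))//.
    by apply/eqP; rewrite subr_eq0 -[_ == _]eqr_opp -hg// -hh.
  exact: test_fun_L2 tphi.
by apply: filterS => x + Ux => /(_ Ux) /eqP; rewrite subr_eq0 => /eqP.
Qed.

Lemma weak_partialP i u : H1 U u -> is_weak_partial U i u (weak_partial U i u).
Proof. by move=> [_ /(_ i)[g hg]]; exact: (xgetPex (cst 0) (ex_intro _ g hg)). Qed.

Lemma weak_partial_L2 i u : H1 U u -> L2 U (weak_partial U i u).
Proof. by move=> /(weak_partialP i)[]. Qed.

Lemma weak_partial_ae i u g : is_weak_partial U i u g -> ae_eq_on U (weak_partial U i u) g.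
Proof.
move=> hg; apply: (@weak_partial_unique i u) => //.
exact: (xgetPex (cst 0) (ex_intro _ g hg)).
Qed.

Lemma is_weak_partialD i u v g h : L2 U u -> L2 U v ->
  is_weak_partial U i u g -> is_weak_partial U i v h -> is_weak_partial U i (u + v) (g + h).
Proof.
move=> hu hv /is_weak_partialE[Lg hg] /is_weak_partialE[Lh hh]; apply/is_weak_partialE.
have S := L2_subspace mU; have P := ip2_psd mU.
split; first exact: (subspaceD S).
move=> phi tphi; have h1 := test_fun_L2 mU tphi.
have h2 := test_fun_L2 mU (test_fun_partial i tphi).
by rewrite (formDl P hu hv h2) (formDl P Lg Lh h1) hg// hh// opprD.
Qed.

Lemma is_weak_partialZ i c u g : L2 U u ->
  is_weak_partial U i u g -> is_weak_partial U i (c *: u) (c *: g).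
Proof.
move=> hu /is_weak_partialE[Lg hg]; apply/is_weak_partialE.
have S := L2_subspace mU; have P := ip2_psd mU.
split; first exact: (subspaceZ S).
move=> phi tphi; have h1 := test_fun_L2 mU tphi.
have h2 := test_fun_L2 mU (test_fun_partial i tphi).
by rewrite (formZl P _ hu h2) (formZl P _ Lg h1) hg// mulrN.
Qed.

Lemma is_weak_partial_cvg i (u_ g_ : nat -> V) u g :
  (forall k, L2 U (u_ k)) -> L2 U u -> (forall k, is_weak_partial U i (u_ k) (g_ k)) -> L2 U g ->
  cvg_form (ip2 U) u_ u -> cvg_form (ip2 U) g_ g -> is_weak_partial U i u g.
Proof.
move=> hu_ hu hg_ hg cu cg; apply/is_weak_partialE; split => // phi tphi.
have S := L2_subspace mU; have P := ip2_psd mU.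
have h1 := test_fun_L2 mU tphi.
have h2 := test_fun_L2 mU (test_fun_partial i tphi).
have Lg_ k : L2 U (g_ k) by case: (hg_ k).
have c1 := cvg_form_linear S P hu_ hu h2 cu.
have c2 := cvg_form_linear S P Lg_ hg h1 cg.
have c3 : (fun k => ip2 U (u_ k) (partial i phi)) @ \oo --> - ip2 U g phi.
  rewrite (_ : (fun k => _) = (fun k => - ip2 U (g_ k) phi)); first exact: cvgN.
  by apply/funext => k; have /is_weak_partialE[_ ->] := hg_ k.
exact: (cvg_unique _ c1 c3).
Qed.

Lemma is_weak_partial_ae_eq i u u' g g' : measurable_fun U u -> measurable_fun U u' ->
  measurable_fun U g' -> ae_eq_on U u u' -> ae_eq_on U g g' ->
  is_weak_partial U i u g -> is_weak_partial U i u' g'.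
Proof.
move=> mfu mu' mg' uu' gg' /is_weak_partialE[[mg g2] hg]; apply/is_weak_partialE.
have mt phi : test_fun U phi -> measurable_fun U phi by move=> /(test_fun_L2 mU)[].
split.
  split => //; apply: le_lt_trans g2; rewrite le_eqVlt; apply/orP; left; apply/eqP.
  apply: ge0_ae_eq_integral => //.
  - exact: measurable_sqr.
  - exact: measurable_sqr.
  - by move=> x _; rewrite lee_fin sqr_ge0.
  - by move=> x _; rewrite lee_fin sqr_ge0.
  - by apply: filterS gg' => x h Ux; rewrite h.
move=> phi tphi; have m1 := mt _ tphi; have m2 := mt _ (test_fun_partial i tphi).
rewrite -(ip2_ae_eq mfu m2 mu' m2 uu' (@ae_eq_on_refl _)) hg//.
by rewrite (ip2_ae_eq mg m1 mg' m1 gg' (@ae_eq_on_refl _)).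
Qed.

Lemma Ck1_is_weak_partial i (f : 'rV[R]_n -> R) : Ck 1 setT f -> L2 U (partial i f) ->
  is_weak_partial U i f (partial i f).
Proof.
move=> hf Lf; split => // phi tphi.
have [s [K [cK KU] h0]] := tphi.
have [r r0 hr] := test_fun_bsupp tphi.
have hT g : (forall x, ~ K x -> g x = 0) -> \int[mu]_(x in U) g x = \int[mu]_x g x.
  move=> g0; rewrite (Rintegral_supp KU); last by move=> x _; exact: g0.
  by rewrite [RHS](Rintegral_supp (subsetT K))// => x _; exact: g0.
rewrite hT; last first.
  move=> x nK; rewrite (partial_out i (compact_closed_rV cK) h0 nK) ?mulr0//.
rewrite hT; last by move=> x /h0 ->; rewrite mulr0.
exact: (integral_by_parts i hf (s 1%N) (fun x xr => hr x (ltW xr))).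
Qed.

Lemma test_fun_is_weak_partial i phi : test_fun U phi -> is_weak_partial U i phi (partial i phi).
Proof.
move=> tphi; apply: Ck1_is_weak_partial; first by case: tphi => + _; exact.
exact: (test_fun_L2 mU (test_fun_partial i tphi)).
Qed.

Lemma test_fun_H1 phi : test_fun U phi -> H1 U phi.
Proof.
move=> tphi; split; first exact: (test_fun_L2 mU tphi).
by move=> i; exists (partial i phi); exact: test_fun_is_weak_partial.
Qed.

Lemma H1_subspace : subspace_like (H1 U : set V).
Proof.
have [S0 SD SZ] := L2_subspace mU; split.
- exact: (test_fun_H1 (test_fun0 U)).
- move=> u v [hu du] [hv dv]; split; first exact: SD.
  move=> i; have [g hg] := du i; have [h hh] := dv i.
  by exists (g + h); exact: is_weak_partialD.
- move=> c u [hu du]; split; first exact: SZ.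
  by move=> i; have [g hg] := du i; exists (c *: g); exact: is_weak_partialZ.
Qed.

Lemma weak_partialD i u v : H1 U u -> H1 U v ->
  ae_eq_on U (weak_partial U i (u + v)) (weak_partial U i u + weak_partial U i v).
Proof.
move=> hu hv; apply: weak_partial_ae.
apply: is_weak_partialD; [exact: hu.1|exact: hv.1|exact: weak_partialP..].
Qed.

Lemma weak_partialZ i c u : H1 U u ->
  ae_eq_on U (weak_partial U i (c *: u)) (c *: weak_partial U i u).
Proof.
move=> hu; apply: weak_partial_ae.
apply: is_weak_partialZ; [exact: hu.1|exact: weak_partialP].
Qed.

Section gradient_form.
Variables (a : 'rV[R]_n -> R) (C : R).
Hypothesis ma : measurable_fun U a.
Hypothesis aC : forall x, U x -> 0 <= a x <= C.

Let aC' x : U x -> `|a x| <= C.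
Proof. by move=> /aC/andP[h1 h2]; rewrite ger0_norm. Qed.

Lemma dot_aE u v : H1 U u -> H1 U v ->
  dot_a U a u v = \sum_(i < n) wip mu U a (weak_partial U i u) (weak_partial U i v).
Proof.
move=> hu hv; rewrite /dot_a /wip.
have hi (i : 'I_n) : mu.-integrable U (EFin \o (fun x => a x * weak_partial U i u x * weak_partial U i v x)).
  by apply: (integrable_wip mU ma aC'); exact: weak_partial_L2.
rewrite -(Rintegral_sum mU)//; apply: eq_Rintegral => x _.
rewrite mulr_sumr; apply: eq_bigr => i _; exact: mulrA.
Qed.

Lemma dot_a_psd : psd_form (H1 U : set V) (dot_a U a).
Proof.
have S := H1_subspace; have [wC wD wZ w0] := wip_psd mU ma aC.
have mW i u : H1 U u -> measurable_fun U (weak_partial U i u).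
  by move=> /(weak_partial_L2 i)[].
split.
- by move=> u v; apply: eq_Rintegral => x _; congr (_ * _); apply: eq_bigr => i _; rewrite mulrC.
- move=> u v w hu hv hw; rewrite !dot_aE//; last exact: (subspaceD S).
  rewrite -big_split/=; apply: eq_bigr => i _.
  rewrite -wD; [|exact: weak_partial_L2..].
  have huv := subspaceD S hu hv.
  apply: (wip_ae_eq mU).
  + by apply: measurable_mul3 => //; exact: mW.
  + apply: measurable_mul3 => //; last exact: mW.
    exact: measurable_funD (mW i u hu) (mW i v hv).
  + exact: weak_partialD.
  + exact: ae_eq_on_refl.
- move=> c u v hu hv; rewrite !dot_aE//; last exact: (subspaceZ S).
  rewrite mulr_sumr; apply: eq_bigr => i _.
  rewrite -wZ; [|exact: weak_partial_L2..].
  have hcu := subspaceZ S c hu.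
  apply: (wip_ae_eq mU).
  + by apply: measurable_mul3 => //; exact: mW.
  + apply: measurable_mul3 => //; last exact: mW.
    exact: measurable_funM (measurable_cst c) (mW i u hu).
  + exact: weak_partialZ.
  + exact: ae_eq_on_refl.
- move=> u hu; apply: Rintegral_ge0 => x Ux; apply: mulr_ge0; first by case/andP: (aC Ux).
  by apply: sumr_ge0 => i _; rewrite -expr2 sqr_ge0.
Qed.

End gradient_form.

End weak_derivatives.

Section H10_space.
Context {R : realType} {n : nat}.
Local Notation mu := (lebesgue_rV R n).
Local Notation V := ('rV[R]_n -> R^o).
Variables (U : set 'rV[R]_n) (oU : open U).
Let mU : measurable U := open_measurable_rV oU.
Implicit Types (u v g h phi : V).

Definition ipH1 u v : R := ip2 U u v + dot_a U (cst 1) u v.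

Let lt_sum4 (x a b e : R) : x <= 2 * a + 2 * b -> a < e / 4 -> b < e / 4 -> x < e.
Proof. lra. Qed.

Lemma one_bounds (x : 'rV[R]_n) : U x -> 0 <= (cst 1 : 'rV[R]_n -> R) x <= 1.
Proof. by rewrite ler01 lexx. Qed.

Lemma ip2_psd_H1 : psd_form (H1 U : set V) (ip2 U).
Proof.
have [a b c d] := ip2_psd mU; split => //.
- by move=> u v w [hu _] [hv _] [hw _]; exact: b.
- by move=> k u v [hu _] [hv _]; exact: c.
- by move=> u [hu _]; exact: d.
Qed.

Lemma dot1_psd : psd_form (H1 U : set V) (dot_a U (cst 1)).
Proof. exact: (dot_a_psd oU (measurable_cst _) one_bounds). Qed.

Lemma ipH1_psd : psd_form (H1 U : set V) ipH1.
Proof. exact: psd_formD ip2_psd_H1 dot1_psd. Qed.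

Lemma dot1E u v : H1 U u -> H1 U v ->
  dot_a U (cst 1) u v = \sum_(i < n) ip2 U (weak_partial U i u) (weak_partial U i v).
Proof. exact: (dot_aE oU (measurable_cst _) one_bounds). Qed.

Lemma weak_partialB i u v : H1 U u -> H1 U v ->
  ae_eq_on U (weak_partial U i (u - v)) (weak_partial U i u - weak_partial U i v).
Proof.
move=> hu hv; apply: weak_partial_ae => //.
have hv' := is_weak_partialZ oU (-1) hv.1 (weak_partialP i hv).
rewrite -(scaleN1r v) -(scaleN1r (weak_partial U i v)).
apply: is_weak_partialD => //; [exact: hu.1|exact: (subspaceZ (L2_subspace mU) _ hv.1)|exact: weak_partialP].
Qed.

Lemma H1_sqdistE u v : H1 U u -> H1 U v -> H1_sqdist U u v = ipH1 (u - v) (u - v).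
Proof.
move=> hu hv; have huv := subspaceB (H1_subspace oU) hu hv.
rewrite /H1_sqdist /ipH1 dot1E//; congr (_ + _).
  by rewrite ip2E; apply: eq_Rintegral => x _; rewrite expr2.
apply: eq_bigr => i _.
have w1 := weak_partial_L2 i hu; have w2 := weak_partial_L2 i hv.
have w12 := L2B mU w1 w2; have w := weak_partial_L2 i huv.
have e := weak_partialB i hu hv.
rewrite (ip2_ae_eq oU w.1 w.1 w12.1 w12.1 e e) ip2E.
by apply: eq_Rintegral => x _; rewrite expr2.
Qed.

Lemma H10P u : H10 U u <-> H1 U u /\ forall e : R, 0 < e ->
  exists2 phi, test_fun U phi & ipH1 (u - phi) (u - phi) < e.
Proof.
split => -[hu h]; split => // e e0; have [phi tphi d] := h e e0; exists phi => //.
  by rewrite -H1_sqdistE//; exact: test_fun_H1.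
by rewrite H1_sqdistE//; exact: test_fun_H1.
Qed.

Lemma test_fun_H10 phi : test_fun U phi -> H10 U phi.
Proof.
move=> tphi; apply/H10P; split; first exact: test_fun_H1.
move=> e e0; exists phi => //; rewrite subrr (form0l (H1_subspace oU) ipH1_psd)//.
exact: (subspace0 (H1_subspace oU)).
Qed.

Lemma H10_sub_H1 : H10 U `<=` H1 U. Proof. by move=> u []. Qed.

Lemma H10_subspace : subspace_like (H10 U : set V).
Proof.
have S := H1_subspace oU; have P := ipH1_psd.
split; first exact: test_fun_H10 (test_fun0 U).
- move=> u v /H10P[hu du] /H10P[hv dv]; apply/H10P; split; first exact: (subspaceD S).
  move=> e e0; have e4 : 0 < e / 4 by rewrite divr_gt0.
  have [f tf hf] := du _ e4; have [g tg hg] := dv _ e4.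
  exists (f + g); first exact: test_funD.
  have h1 := test_fun_H1 oU tf; have h2 := test_fun_H1 oU tg.
  rewrite opprD addrACA.
  exact: (lt_sum4 (form_sqrD_le S P (subspaceB S hu h1) (subspaceB S hv h2)) hf hg).
- move=> c u /H10P[hu du]; apply/H10P; split; first exact: (subspaceZ S).
  move=> e e0; have c0 : 0 < c ^+ 2 + 1 by rewrite ltr_wpDl ?sqr_ge0.
  have [f tf hf] := du _ (divr_gt0 e0 c0).
  exists (c *: f); first exact: test_funZ.
  have h1 := test_fun_H1 oU tf; have h2 := subspaceB S hu h1.
  rewrite -scalerBr (form_sqrZ S P)//; have := form_ge0 P h2.
  move: hf; rewrite ltr_pdivlMr//; move: (ipH1 _ _) => t.
  by move=> hf h0; have := sqr_ge0 c; nra.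
Qed.

(** The functions and each of their weak partial derivatives converge in L^2, and weak derivatives
    pass to such limits; the limit inherits approximation by test functions from a late member of
    the sequence. *)
Lemma H10_complete : complete_form (H10 U : set V) ipH1.
Proof.
have S1 := H1_subspace oU; have S := L2_subspace mU; have P2 := ip2_psd mU.
move=> u_ hu_ cu.
have hu1 k : H1 U (u_ k) by case: (hu_ k).
have huB j k : H1 U (u_ j - u_ k) by exact: (subspaceB S1).
have c2 : cauchy_form (ip2 U) u_.
  move=> e e0; have [N hN] := cu e e0; exists N => j k jN kN.
  apply: le_trans (hN _ _ jN kN); rewrite lerDl.
  exact: (form_ge0 dot1_psd).
have [u Lu cvu] := ip2_complete mU (fun k => (hu1 k).1) c2.
have /choice[g hg] i : exists g : V, L2 U g /\ cvg_form (ip2 U) (fun k => weak_partial U i (u_ k)) g.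
  have [||g Lg cg] := @ip2_complete _ _ U mU (fun k => weak_partial U i (u_ k)); last by exists g.
    by move=> k; exact: weak_partial_L2.
  move=> e e0; have [N hN] := cu e e0; exists N => j k jN kN.
  apply: le_trans (hN _ _ jN kN); rewrite /ipH1 dot1E//.
  have w1 := weak_partial_L2 i (hu1 j); have w2 := weak_partial_L2 i (hu1 k).
  have w12 := L2B mU w1 w2; have w := weak_partial_L2 i (huB j k).
  have ee := weak_partialB i (hu1 j) (hu1 k).
  rewrite -(ip2_ae_eq oU w.1 w.1 w12.1 w12.1 ee ee) (bigD1 i)//= addrCA lerDl.
  rewrite addr_ge0//; first exact: (form_ge0 P2 (huB j k).1).
  by apply: sumr_ge0 => l _; exact: (form_ge0 P2 (weak_partial_L2 l (huB j k))).
have wg i : is_weak_partial U i u (g i).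
  have [Lg cg] := hg i.
  exact: (is_weak_partial_cvg oU (fun k => (hu1 k).1) Lu (fun k => weak_partialP i (hu1 k)) Lg cvu cg).
have hu : H1 U u by split => // i; exists (g i).
have huk k : H1 U (u_ k - u) by exact: (subspaceB S1).
have cvH : cvg_form ipH1 u_ u.
  move=> e e0.
  (* One share for the function and one for each of the n partial derivatives. *)
  have en : 0 < e / (n.+1)%:R by rewrite divr_gt0.
  have [N0 hN0] := cvu _ en.
  have /choice[N hN] (i : 'I_n) := (hg i).2 _ en.
  exists (N0 + \sum_i N i)%N => k kN.
  have kN0 : (N0 <= k)%N by exact: leq_trans (leq_addr _ _) kN.
  have kNi i : (N i <= k)%N.
    apply: leq_trans kN; rewrite (bigD1 i)//= addnCA; exact: leq_addr.
  rewrite /ipH1 dot1E//.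
  have -> : e = e / n.+1%:R + \sum_(i < n) e / n.+1%:R.
    rewrite sumr_const card_ord -[in LHS](mulr1 e) -[X in X + _]mulr1n -mulrnDr add1n.
    by rewrite mulr1 -[RHS]mulr_natr divfK.
  apply: lerD; first exact: hN0.
  apply: ler_sum => i _.
  have w1 := weak_partial_L2 i (hu1 k); have w := weak_partial_L2 i (huk k).
  have Lg := (hg i).1; have w12 := L2B mU w1 Lg.
  have ee : ae_eq_on U (weak_partial U i (u_ k - u)) (weak_partial U i (u_ k) - g i).
    apply: ae_eq_on_trans (weak_partialB i (hu1 k) hu) _.
    have := weak_partial_ae oU (wg i); apply: filterS => x hx Ux.
    by rewrite /GRing.add/= /GRing.opp/= hx.
  by rewrite (ip2_ae_eq oU w.1 w.1 w12.1 w12.1 ee ee); exact: hN.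
exists u => //; apply/H10P; split => // e e0.
have [N hN] := cvH _ (divr_gt0 e0 (ltr0n R 5)).
have /H10P[_ /(_ _ (divr_gt0 e0 (ltr0n R 4)))[phi tphi hphi]] := hu_ N.
exists phi => //; have hp := test_fun_H1 oU tphi.
have h := form_dist_le S1 ipH1_psd hu (hu1 N) hp.
rewrite (form_sqrBC S1 ipH1_psd hu (hu1 N)) in h.
apply: (lt_sum4 h _ hphi); apply: le_lt_trans (hN _ (leqnn N)) _.
by rewrite ltr_pM2l// ltf_pV2 ?posrE// ltr_nat.
Qed.

End H10_space.

Section prehilbert_sums.
Context {R : realType} {V : lmodType R}.
Variables (H : set V) (B : V -> V -> R).
Hypotheses (HS : subspace_like H) (HB : psd_form H B).

Lemma form_young (t : R) u v : 0 < t -> H u -> H v -> 2 * B u v <= t * B u u + t^-1 * B v v.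
Proof.
move=> t0 hu hv; have htu := subspaceZ HS t hu.
have := form_ge0 HB (subspaceB HS htu hv).
rewrite (form_sqrB HS HB htu hv) (form_sqrZ HS HB)// (formZl HB)//.
move: (B u u) (B u v) (B v v) => p q r h.
have : 0 <= t^-1 * (t ^+ 2 * p - 2 * (t * q) + r) by rewrite mulr_ge0// invr_ge0 ltW.
rewrite (_ : t^-1 * _ = t * p + t^-1 * r - 2 * q) ?subr_ge0//.
by field; rewrite gt_eqF.
Qed.

Lemma form_sqr_sum_le k (u_ : 'I_k -> V) : (forall i, H (u_ i)) ->
  B (\sum_i u_ i) (\sum_i u_ i) <= k%:R * \sum_i B (u_ i) (u_ i).
Proof.
elim: k u_ => [|k IH] u_ hu; first by rewrite !big_ord0 (form0l HS HB) ?mul0r//; exact: (subspace0 HS).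
rewrite !big_ord_recr/=.
have hS : H (\sum_(i < k) u_ (widen_ord (leqnSn k) i)) by apply: (subspace_sum HS) => i _; exact: hu.
have := IH (fun i => u_ (widen_ord (leqnSn k) i)) (fun i => hu _).
rewrite (form_sqrD HS HB)//.
(* Young's inequality is used with the reciprocal of the number of earlier terms, so an empty
   initial sum is treated apart. *)
case: k IH u_ hu hS => [|k] IH u_ hu hS.
  by rewrite !big_ord0 !(form0l HS HB) ?mulr0 ?add0r ?mul1r//; exact: (subspace0 HS).
have k0 : (0 : R) < k.+1%:R by [].
have := form_young (t := k.+1%:R^-1) _ hS (hu ord_max).
rewrite invr_gt0 => /(_ k0); rewrite invrK.
set S := \sum_(i < k.+1) u_ _; set s := \sum_(i < k.+1) B _ _.
move: (B S S) (B S _) (B (u_ ord_max) _) s => p q r s h1 h2.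
have h3 : k.+1%:R^-1 * p <= s by rewrite ler_pdivrMl.
rewrite -[k.+2%:R]natr1; move: {hS S IH} k.+1%:R k0 h1 h2 h3 => /= t t0 h1 h2 h3.
by rewrite mulrDl mul1r !mulrDr; lra.
Qed.

End prehilbert_sums.

(** * Differences of translates *)

Section mollification.
Context {R : realType} {n : nat}.
Local Notation mu := (lebesgue_rV R n).
Local Notation V := ('rV[R]_n -> R^o).
Local Notation delta i := (delta_mx ord0 i : 'rV[R]_n).
Local Notation ip := (ip2 (n := n) setT).
Implicit Types (u v f g : V) (w x : 'rV[R]_n).

(** Mean value theorem on each leg of the coordinate path. The numbers [d] are free: the partial
    derivatives at [x] give a Taylor estimate, zero gives a Lipschitz estimate. *)
Lemma Ck1_taylor (f : 'rV[R]_n -> R) (M : R) x w (d : 'I_n -> R) : Ck 1 setT f ->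
  (forall i (y : 'rV[R]_n), (forall k, `|y ord0 k - x ord0 k| <= `|w ord0 k|) ->
     `|partial i f y - d i| <= M) ->
  `|f (w + x) - f x - \sum_i w ord0 i * d i| <= M * \sum_i `|w ord0 i|.
Proof.
move=> hf hM; rewrite coord_path -sumrB; apply: le_trans (ler_norm_sum _ _ _) _.
rewrite mulr_sumr; apply: ler_sum => j _.
set y := trunc_rV j w + x.
pose q (t : R) := f (t *: delta j + y) - t * d j.
have dq (t : R) : is_derive t 1 q (partial j f (t *: delta j + y) - d j).
  have h1 : is_derive t 1 (fun t : R => f (t *: delta j + y)) (partial j f (t *: delta j + y)).
    by apply: is_derive_line_at; have [] := Ck_is_derive j (t *: delta j + y) hf.
  have h2 : is_derive t 1 (fun t : R => t * d j) (d j).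
    have := is_deriveM (is_derive_id t (1 : R)) (is_derive_cst (d j) t 1).
    by rewrite scaler0 add0r /GRing.scale/= mulr1.
  exact: (is_deriveB h1 h2).
have cq : continuous q by move=> t; apply/differentiable_continuous/derivable1_diffP; have [] := dq t.
have key (s t : R) : s <= t -> (forall c, s <= c <= t -> `|c| <= `|w ord0 j|) ->
    `|q t - q s| <= M * `|t - s|.
  move=> st hc; have [c cst ->] := MVT_segment st (fun t _ => dq t) (continuous_subspaceT cq).
  rewrite normrM ler_wpM2r//; apply: hM => k; rewrite !mxE -addrA addrK.
  rewrite !eqxx/=; have [kj|kj] := eqVneq k j.
    by rewrite kj ltnn addr0 mulr1; apply: hc; move: cst; rewrite in_itv.
  by rewrite mulr0 add0r; case: ifP => // _; rewrite normr0.
have q0 : q 0 = f y by rewrite /q scale0r add0r mul0r subr0.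
have -> : f (w ord0 j *: delta j + y) - f y - w ord0 j * d j = q (w ord0 j) - q 0.
  by rewrite q0 /q addrAC.
have [h|/ltW h] := leP 0 (w ord0 j).
  have := key _ _ h; rewrite subr0 ger0_norm//; apply => c /andP[c0 c1].
  by rewrite ger0_norm.
rewrite distrC; have := key _ _ h; rewrite sub0r normrN; apply => c /andP[c0 c1].
by rewrite !ler0_norm// lerN2.
Qed.

Lemma Ck1_lipschitz (f : 'rV[R]_n -> R) (M : R) x w : Ck 1 setT f ->
  (forall i (y : 'rV[R]_n), `|partial i f y| <= M) -> `|f (w + x) - f x| <= M * \sum_i `|w ord0 i|.
Proof.
move=> hf hM; have := @Ck1_taylor f M x w (fun=> 0) hf.
rewrite big1 ?subr0 => [|i _]; last exact: mulr0.
by apply=> i y _; rewrite subr0.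
Qed.

Lemma sum_coord_le w : \sum_i `|w ord0 i| <= n%:R * `|w|.
Proof.
apply: (@le_trans _ _ (\sum_(i < n) `|w|)); last by rewrite sumr_const card_ord mulr_natl.
by apply: ler_sum => i _; exact: ler_coord_norm.
Qed.

Lemma test_fun_taylor U phi : test_fun U phi -> exists2 M : R, 0 < M &
  forall x w, `|phi (w + x) - phi x - \sum_i w ord0 i * partial i phi x| <= M * `|w| ^+ 2.
Proof.
move=> tphi.
have /choice[M hM] (i : 'I_n) : exists M : R, 0 < M /\ forall j x, `|partial j (partial i phi) x| <= M.
  by have [M] := test_fun_partial_bounded (test_fun_partial i tphi); exists M.
pose L := \sum_i M i.
have L0 : 0 <= L by apply: sumr_ge0 => i _; have [/ltW] := hM i.
have C0 : 0 < L * n%:R * n%:R + 1 by rewrite ltr_wpDl// !mulr_ge0.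
exists (L * n%:R * n%:R + 1) => // x w.
have h := @Ck1_taylor phi (L * n%:R * `|w|) x w (fun i => partial i phi x) (tphi.1 1%N) _.
apply: le_trans (h _) _.
  move=> i y hy; rewrite -[y](subrK x).
  apply: le_trans (Ck1_lipschitz (M := M i) x (y - x) (smooth_partial i tphi.1 1%N) (hM i).2) _.
  rewrite -mulrA ler_pM ?(ltW (hM i).1) ?sumr_ge0//.
    by rewrite /L (bigD1 i)//= lerDl sumr_ge0// => j _; have [/ltW] := hM j.
  apply: le_trans (sum_coord_le w); apply: ler_sum => k _; apply: le_trans (hy k).
  by rewrite !mxE.
have := ler_wpM2l (mulr_ge0 (mulr_ge0 L0 (ler0n R n)) (normr_ge0 w)) (sum_coord_le w).
by have := sqr_ge0 `|w|; rewrite !expr2; nra.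
Qed.

Definition translate (w : 'rV[R]_n) (f : 'rV[R]_n -> R) : 'rV[R]_n -> R := fun x => f (w + x).

Lemma measurable_translate_fun w (f : 'rV[R]_n -> R) : measurable_fun setT f -> measurable_fun setT (translate w f).
Proof. by move=> mf; apply: (measurableT_comp mf); exact: measurable_translate. Qed.

Lemma translate_L2 w u : L2 setT u -> L2 setT (translate w u).
Proof.
move=> [mf fin]; split; first exact: measurable_translate_fun.
rewrite (integral_translate (f := fun x => (u x ^+ 2)%:E) w)//; first exact: measurable_sqr.
by move=> x; rewrite lee_fin sqr_ge0.
Qed.

Lemma ip2_translate w u v : L2 setT u -> L2 setT v -> ip (translate w u) (translate w v) = ip u v.
Proof.
move=> hu hv; rewrite !ip2E.
apply: (Rintegral_translate (f := fun x => u x * v x) w).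
  exact: (measurable_funM hu.1 hv.1).
exact: (integrable_ip openT hu hv).
Qed.

Let ler_sqr_norm (x y : R) : `|x| <= y -> x ^+ 2 <= y ^+ 2.
Proof. by move=> xy; rewrite -(real_normK (num_real x)) ler_sqr ?nnegrE// (le_trans _ xy). Qed.

Lemma bsupp_L2_le (f : 'rV[R]_n -> R) (M r : R) : measurable_fun setT f ->
  (forall x, `|f x| <= M) -> (forall x, r < `|x| -> f x = 0) ->
  ip f f <= M ^+ 2 * fine (mu [set x : 'rV[R]_n | `|x| <= r]).
Proof.
move=> mf fM f0; have hf := bounded_bsupp_L2 measurableT mf fM f0.
have M0 : 0 <= M by apply: le_trans (fM 0).
have mB := @measurable_norm_ball R n r; have Boo := @lebesgue_rV_ball_lty R n r.
rewrite -lee_fin -(ip2_sqn hf) EFinM fineK ?ge0_fin_numE//.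
rewrite -[X in (X <= _)%E]/(\int[mu]_x (f x ^+ 2)%:E)%E.
rewrite -(setIT [set x : 'rV[R]_n | `|x| <= r]) -(integral_indic mu measurableT).
rewrite -ge0_integralZl//; last 2 first.
- by apply/measurable_EFinP; exact: measurable_indic.
- by rewrite lee_fin sqr_ge0.
apply: ge0_le_integral => //.
- by move=> x _; rewrite lee_fin sqr_ge0.
- exact: measurable_sqr.
- by apply: emeasurable_funM => //; apply/measurable_EFinP; exact: measurable_indic.
move=> x _; rewrite -EFinM lee_fin; have [xr|xr] := leP `|x| r.
    by rewrite indicE mem_set// mulr1 ler_sqr_norm.
  by rewrite f0// expr0n/= mulr_ge0 ?sqr_ge0.
exact: mB.
Qed.

Lemma translate_taylor_L2 U phi : test_fun U phi -> exists2 C : R, 0 < C &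
  forall w, `|w| <= 1 ->
  let r : V := fun x => phi (w + x) - phi x - \sum_i w ord0 i * partial i phi x in
  L2 setT r /\ ip r r <= C * `|w| ^+ 4.
Proof.
move=> tphi; have [M M0 hM] := test_fun_taylor tphi.
have [r r0 hr] := test_fun_bsupp tphi.
have tp i := test_fun_partial i tphi.
have /choice[s hs] (i : 'I_n) : exists s : R, 0 < s /\ forall x, s <= `|x| -> partial i phi x = 0.
  by have [s] := test_fun_bsupp (tp i); exists s.
(* This radius covers the supports of phi and of its partial derivatives, and a translation of
   length at most 1. *)
pose q := r + \sum_i s i + 1.
exists (M ^+ 2 * fine (mu [set x : 'rV[R]_n | `|x| <= q]) + 1).
  by rewrite ltr_wpDl// mulr_ge0 ?sqr_ge0 ?fine_ge0.
move=> w w1 f.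
have cphi : continuous phi := smooth_continuous tphi.1.
have mphi : measurable_fun setT phi by exact: continuous_measurable_rV.
have mf : measurable_fun setT f.
  apply: measurable_funB; first by apply: measurable_funB => //; exact: measurable_translate_fun.
  apply: (@measurable_sum _ _ R setT _ _ (fun i x => w ord0 i * partial i phi x)) => i.
  apply: measurable_funM => //.
  by apply: continuous_measurable_rV; apply: smooth_continuous; exact: (tp i).1.
have s0 : 0 <= \sum_i s i by apply: sumr_ge0 => i _; have [/ltW] := hs i.
have f0 x : q < `|x| -> f x = 0.
  move=> qx; rewrite /f (hr x); last by rewrite /q in qx; lra.
  have nwx : `|x| <= `|w + x| + `|w|.
    by rewrite -[X in `|X| <= _](addKr w) addrC; apply: le_trans (ler_normB _ _) _.
  rewrite (hr (w + x)); last by rewrite /q in qx; lra.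
  rewrite subrr sub0r big1 ?oppr0// => i _; rewrite ((hs i).2 x) ?mulr0//.
  apply: le_trans (ltW qx); rewrite /q (bigD1 i)//=.
  have : 0 <= \sum_(j | j != i) s j by apply: sumr_ge0 => j _; have [/ltW] := hs j.
  lra.
have fM x := hM x w.
split; first exact: (bounded_bsupp_L2 measurableT mf fM f0).
apply: le_trans (bsupp_L2_le mf fM f0) _.
rewrite exprMn -exprM mulrAC ler_wpM2r ?exprn_ge0// lerDl//.
Qed.

Definition grad_sqn (f : 'rV[R]_n -> R) : R := \sum_i ip (partial i f) (partial i f).

Lemma grad_sqn_ge0 U phi : test_fun U phi -> 0 <= grad_sqn phi.
Proof.
move=> tphi; apply: sumr_ge0 => i _; apply: (form_ge0 (ip2_psd measurableT)).
exact: (test_fun_L2 measurableT (test_fun_partial i tphi)).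
Qed.

Let ler_archi (x y z : R) : (forall k : nat, x <= y + z / k.+1%:R) -> x <= y.
Proof.
move=> h; apply: contrapT => /negP; rewrite -ltNge => yx.
have [z0|z0] := leP z 0.
  have := h 0%N; rewrite divr1; lra.
have [k hk] : exists k : nat, z / (x - y) < k.+1%:R.
  exists (Num.truncn (z / (x - y))); have := Num.Theory.truncnS_gt (z / (x - y)); exact.
have := h k; rewrite leNgt => /negP; apply.
by rewrite -ltrBrDl ltr_pdivrMr// mulrC -ltr_pdivrMr// subr_gt0.
Qed.

Let taylor_arith (t g q p c : R) : 0 < t -> t <= 1 -> 0 <= g -> 0 <= c -> p <= t ^+ 4 * c ->
  2 * q <= t * (t ^+ 2 * g) + t^-1 * p -> t ^+ 2 * g + 2 * q + p <= t ^+ 2 * (g + t * (g + 2 * c)).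
Proof.
move=> t0 t1 g0 c0 pc h.
have h1 : t^-1 * p <= t ^+ 3 * c by rewrite ler_pdivrMl// mulrA -exprS.
have h2 : t ^+ 4 * c <= t ^+ 3 * c by rewrite ler_wpM2r// ler_wiXn2l// ltW.
rewrite [X in _ <= X](_ : _ = t ^+ 2 * g + t * (t ^+ 2 * g) + 2 * (t ^+ 3 * c)); first lra.
by ring.
Qed.

(* A telescoping sum of k translates by w/k, each of which is w/k . grad phi up
   to O(1/k^2), bounds the difference by w . grad phi without integrating along
   segments. *)
Lemma translate_dist_le U phi w : test_fun U phi ->
  ip (translate w phi - phi : V) (translate w phi - phi : V) <= n%:R * `|w| ^+ 2 * grad_sqn phi.
Proof.
move=> tphi; have [C C0 hC] := translate_taylor_L2 tphi.
have S := @L2_subspace R n _ measurableT; have P := @ip2_psd R n _ measurableT.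
have Lphi : L2 setT phi := test_fun_L2 measurableT tphi.
have Ld i : L2 setT (partial i phi) := test_fun_L2 measurableT (test_fun_partial i tphi).
pose G : V := \sum_i w ord0 i *: (partial i phi : V).
have LG : L2 setT G by apply: (subspace_sum S) => i _; exact: (subspaceZ S).
have hG : ip G G <= n%:R * `|w| ^+ 2 * grad_sqn phi.
  apply: le_trans (form_sqr_sum_le S P (fun i => subspaceZ S (w ord0 i) (Ld i))) _.
  rewrite -mulrA ler_wpM2l//= /grad_sqn mulr_sumr; apply: ler_sum => i _.
  rewrite (form_sqrZ S P)// ler_wpM2r//; first exact: (form_ge0 P).
  by rewrite ler_sqr_norm// ler_coord_norm.
apply: le_trans hG; apply: (ler_archi (z := ip G G + 2 * (C * `|w| ^+ 4))) => k.
pose K := (k + (Num.truncn `|w|).+1)%N.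
have wK : `|w| < K%:R.
  by apply: lt_le_trans (Num.Theory.truncnS_gt _) _; rewrite ler_nat leq_addl.
have K0 : (0 : R) < K%:R by apply: le_lt_trans wK.
have kK : (k.+1%:R : R) <= K%:R by rewrite ler_nat /K addnS ltnS leq_addr.
have Ki0 : 0 < K%:R^-1 :> R by rewrite invr_gt0.
pose D : V := translate (K%:R^-1 *: w) phi - (phi : V).
have nKw : `|K%:R^-1 *: w| = K%:R^-1 * `|w| by rewrite normrZ gtr0_norm.
have nKw1 : `|K%:R^-1 *: w| <= 1 by rewrite nKw mulrC ler_pdivrMr// mul1r ltW.
have [Lr hr] := hC _ nKw1; set r := (r in ip r r) in Lr hr.
have LD : L2 setT D by apply: (subspaceB S) => //; exact: translate_L2.
have Gx x : G x = \sum_i w ord0 i * partial i phi x by rewrite /G fct_sumE.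
have DE : D = (K%:R^-1 *: G : V) + r.
  apply/funext => x; rewrite -[RHS]/(K%:R^-1 * G x + r x) -[LHS]/(phi (K%:R^-1 *: w + x) - phi x).
  rewrite Gx /r mulr_sumr (eq_bigr (fun i => (K%:R^-1 *: w) ord0 i * partial i phi x)).
    by rewrite [RHS]addrC subrK.
  by move=> i _; rewrite mxE mulrA.
have hD : ip D D <= K%:R^-1 ^+ 2 * (ip G G + K%:R^-1 * (ip G G + 2 * (C * `|w| ^+ 4))).
  have LKG := subspaceZ S K%:R^-1 LG.
  have := form_young S P Ki0 LKG Lr.
  rewrite DE (form_sqrD S P LKG Lr) (form_sqrZ S P K%:R^-1 LG) => h.
  apply: (taylor_arith _ _ (form_ge0 P LG) _ _ h) => //.
  - by rewrite invf_le1// ler1n /K addnS.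
  - by rewrite mulr_ge0 ?exprn_ge0// ltW.
  - by move: hr; rewrite nKw exprMn mulrCA.
have hG0 : 0 <= ip G G + 2 * (C * `|w| ^+ 4).
  by rewrite addr_ge0 ?(form_ge0 P LG)// !mulr_ge0 ?exprn_ge0// ltW.
have -> : translate w phi - (phi : V) = \sum_(j < K) (translate ((j%:R * K%:R^-1) *: w) D : V).
  apply/funext => x; rewrite fct_sumE -[LHS]/(phi (w + x) - phi x).
  pose F (j : nat) := phi ((j%:R * K%:R^-1) *: w + x).
  rewrite (eq_bigr (fun j : 'I_K => F j.+1 - F j)); last first.
    move=> j _; rewrite /F /D /translate -[LHS]/(phi _ - phi _); congr (phi _ - phi _).
    by rewrite addrA -scalerDl -natr1 mulrDl mul1r [_^-1 + _]addrC.
  rewrite -(big_mkord xpredT (fun j => F j.+1 - F j)) telescope_sumr// /F.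
  by rewrite mulfV ?gt_eqF// scale1r mul0r scale0r add0r.
apply: le_trans (form_sqr_sum_le S P (fun j => translate_L2 _ LD)) _.
rewrite (eq_bigr (fun=> ip D D)) => [|j _]; last by rewrite ip2_translate.
rewrite sumr_const card_ord -[ip D D *+ K]mulr_natl mulrA.
apply: (@le_trans _ _ (ip G G + K%:R^-1 * (ip G G + 2 * (C * `|w| ^+ 4)))).
  move: hD; rewrite exprVn mulrC ler_pdivlMr ?exprn_gt0// => hD.
  by rewrite -expr2 mulrC.
by rewrite lerD2l mulrC ler_wpM2l// lef_pV2 ?posrE.
Qed.

End mollification.

(** * Mollification *)

Section convolution.
Context {R : realType} {n : nat}.
Local Notation mu := (lebesgue_rV R n).
Local Notation V := ('rV[R]_n -> R^o).
Local Notation delta i := (delta_mx ord0 i : 'rV[R]_n).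
Local Notation ip := (ip2 (n := n) setT).
Implicit Types (u v f g : V) (w x : 'rV[R]_n).

Let L2S := @L2_subspace R n _ measurableT.
Let L2P := @ip2_psd R n _ measurableT.

(** A quadratic remainder divided by h is of order h. Used for convolutions and for |t|^p at the
    origin. *)
Lemma is_derive_remainder (W : normedModType R) (f : W -> R) (x v : W) (d C : R) :
  (forall h : R, `|h| <= 1 -> `|f (h *: v + x) - f x - h * d| <= C * h ^+ 2) ->
  is_derive x v f d.
Proof.
move=> hC; have C0 : 0 <= C.
  by have := hC 1; rewrite expr1n mulr1 normr1 => /(_ (lexx _)); apply: le_trans.
have cv : (fun h : R => h^-1 *: (f (h *: v + x) - f x)) @ 0^' --> (d : R^o).
  apply/cvgrPdist_le => e e0; near=> h.
  have h0 : h != 0 by near: h; exact: nbhs_dnbhs_neq.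
  have h1 : `|h| <= 1.
    near: h; apply: dnbhs0_le; exact: ltr01.
  rewrite -normrN opprB -[X in X <= _](mulVKf (x := `|h|)) ?normr_eq0//.
  rewrite mulrCA ler_pdivrMl ?normr_gt0// -normrM mulrBr.
  rewrite -[h^-1 *: _]/(h^-1 * _) mulVKf//.
  apply: le_trans (hC h h1) _; rewrite -(real_normK (num_real h)) expr2 mulrCA ler_wpM2l//.
  have he : `|h| <= e / (C + 1).
    by near: h; apply: dnbhs0_le; rewrite divr_gt0// ltr_wpDl.
  apply: le_trans (ler_wpM2l C0 he) _; rewrite mulrCA ler_piMr ?(ltW e0)//.
  by rewrite ler_pdivrMr ?ltr_wpDl// mul1r lerDl.
have dv : derivable f x v by apply/cvg_ex; exists d.
apply: DeriveDef => //; exact: cvg_lim cv.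
Unshelve. all: by end_near. Qed.

(** The integral of u(y) eta(y - x) over y, that is, convolution with the reflected kernel. As an
    inner product it is estimated by Cauchy-Schwarz; the reflection causes the minus sign when the
    derivative falls on the kernel. *)
Definition conv (eta u : 'rV[R]_n -> R) : 'rV[R]_n -> R := fun x => ip u (translate (- x) eta).

Lemma translateD w x f : translate (w + x) f = translate x (translate w f).
Proof. by apply/funext => y; rewrite /translate addrA. Qed.

Lemma translate_test_fun w eta : test_fun setT eta -> test_fun setT (translate w eta).
Proof.
move=> te; have [r r0 hr] := test_fun_bsupp te; split.
  move=> k; rewrite (_ : translate w eta = (fun x => eta (1 *: x + w))).
    exact: Ck_affine (te.1 k).
  by apply/funext => x; rewrite /translate scale1r addrC.
exists (cbox (const_mx (- (r + `|w|))) (const_mx (r + `|w|))).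
  by split => //; exact: compact_cbox.
move=> x xK; apply: hr; rewrite leNgt; apply/negP => xr; apply: xK => i.
rewrite !mxE -ler_norml; apply: le_trans (ler_coord_norm x i) _.
rewrite -[x](addKr w) addrC; apply: le_trans (ler_normB _ _) _.
by rewrite lerD2r ltW.
Qed.

Lemma partial_translate i w f x : partial i (translate w f) x = translate w (partial i f) x.
Proof.
rewrite /partial /translate /derive.
under eq_fun do rewrite /= addrCA.
by [].
Qed.

Lemma conv_lipschitz eta u w x : test_fun setT eta -> L2 setT u ->
  (conv eta u (w + x) - conv eta u x) ^+ 2 <= ip u u * (n%:R * `|w| ^+ 2 * grad_sqn eta).
Proof.
move=> te hu; have Le := test_fun_L2 measurableT te.
rewrite /conv -(formBr L2S L2P)//; [|exact: translate_L2..].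
rewrite opprD addrC translateD addrC.
have Ld := L2B measurableT (translate_L2 (- w) Le) Le.
have -> : translate (- x) (translate (- w) eta) - (translate (- x) eta : V) = translate (- x) (translate (- w) eta - (eta : V)) by [].
apply: le_trans (form_CS L2S L2P hu (translate_L2 _ Ld)) _.
rewrite ip2_translate// ler_wpM2l ?(form_ge0 L2P)//.
by have := translate_dist_le (- w) te; rewrite normrN.
Qed.

Lemma sqr_lipschitz_continuous (f : 'rV[R]_n -> R) (C : R) :
  (forall w x, (f (w + x) - f x) ^+ 2 <= C * `|w| ^+ 2) -> continuous f.
Proof.
move=> hC x A /nbhs_ballP[e /= e0 eA]; apply/nbhs_ballP.
have C0 : 0 < `|C| + 1 by rewrite ltr_wpDl.
have d0 : 0 < e / (`|C| + 1) by exact: divr_gt0.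
exists (e / (`|C| + 1)) => //= y; rewrite -ball_normE/= => xy; apply: eA.
rewrite -ball_normE/= distrC -ltr_sqr ?nnegrE ?(ltW e0)// real_normK ?num_real//.
have := hC (y - x) x; rewrite subrK => h; apply: le_lt_trans h _.
have h2 : `|y - x| ^+ 2 < (e / (`|C| + 1)) ^+ 2.
  by rewrite ltr_sqr ?nnegrE ?(ltW d0)// distrC.
have h3 : C * `|y - x| ^+ 2 <= (`|C| + 1) ^+ 2 * `|y - x| ^+ 2.
  rewrite ler_wpM2r ?sqr_ge0//; apply: le_trans (ler_norm C) _.
  by have := normr_ge0 C; move: (`|C|) => c; nra.
apply: le_lt_trans h3 _; rewrite -[ltRHS](mulVKf (x := (`|C| + 1) ^+ 2)) ?gt_eqF ?exprn_gt0//.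
by rewrite ltr_pM2l ?exprn_gt0// mulrC -exprVn -exprMn.
Qed.

Lemma conv_continuous eta u : test_fun setT eta -> L2 setT u -> continuous (conv eta u).
Proof.
move=> te hu; apply: (@sqr_lipschitz_continuous _ (ip u u * (n%:R * grad_sqn eta))) => w x.
by apply: le_trans (conv_lipschitz w x te hu) _; rewrite le_eqVlt; apply/orP; left; apply/eqP; ring.
Qed.

(** The first order Taylor remainder of the kernel is of order h^2 in L^2, and pairing it with [u]
    keeps this order. *)
Lemma is_derive_conv eta u i x : test_fun setT eta -> L2 setT u ->
  is_derive x (delta i) (conv eta u) (- conv (partial i eta) u x).
Proof.
move=> te hu; have [C C0 hC] := translate_taylor_L2 te.
have Le := test_fun_L2 measurableT te.
have Ld := test_fun_L2 measurableT (test_fun_partial i te).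
apply: (@is_derive_remainder _ _ _ _ _ (Num.sqrt (ip u u * C))) => h h1.
have hd : `|(- h) *: delta i| <= `|h| by apply: le_trans (delta_norm_le _ _) _; rewrite normrN.
have [Lr hr] := hC _ (le_trans hd h1); set r := (r in ip r r) in Lr hr.
have -> : conv eta u (h *: delta i + x) - conv eta u x - h * - conv (partial i eta) u x =
    ip u (translate (- x) r).
  have -> : translate (- x) r = (translate (- (h *: delta i + x)) eta - (translate (- x) eta : V)) +
     h *: (translate (- x) (partial i eta) : V).
    apply/funext => y; rewrite /r /translate.
    rewrite -[RHS]/(eta (- (h *: delta i + x) + y) - eta (- x + y) + h * partial i eta (- x + y)).
    congr (_ + _); first by rewrite opprD scaleNr addrA.
    rewrite (bigD1 i)//= big1 => [|j ji].
      by rewrite addr0 !mxE !eqxx mulr1 mulNr opprK.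
    by rewrite !mxE eqxx (negbTE ji) mulr0 mul0r.
  have L1 := translate_L2 (- (h *: delta i + x)) Le; have L2 := translate_L2 (- x) Le.
  have L3 := translate_L2 (- x) Ld.
  rewrite (formDr L2P (subspaceB L2S L1 L2) (subspaceZ L2S h L3) hu).
  by rewrite (formBr L2S L2P L1 L2 hu) (formZr L2P h L3 hu) mulrN opprK.
have -> : h ^+ 2 = Num.sqrt ((h ^+ 2) ^+ 2) by rewrite sqrtr_sqr ger0_norm ?sqr_ge0.
rewrite -sqrtrM; last first.
  by rewrite mulr_ge0 ?(form_ge0 L2P)// ltW.
rewrite -sqrtr_sqr ler_wsqrtr//.
apply: le_trans (form_CS L2S L2P hu (translate_L2 _ Lr)) _.
rewrite ip2_translate// -mulrA ler_wpM2l ?(form_ge0 L2P)//.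
apply: le_trans hr _; rewrite ler_wpM2l ?(ltW C0)//.
rewrite -(real_normK (num_real h)) -exprM.
by rewrite lerXn2r ?nnegrE.
Qed.

Lemma partial_conv eta u i x : test_fun setT eta -> L2 setT u ->
  partial i (conv eta u) x = - conv (partial i eta) u x.
Proof. by move=> te hu; apply: partialE; exact: is_derive_conv. Qed.

Lemma conv_smooth eta u : test_fun setT eta -> L2 setT u -> smooth (conv eta u).
Proof.
move=> te hu k; elim: k eta te => [|k IH] eta te.
  by split => // x _; exact: conv_continuous.
apply: (@CkSI _ _ _ _ (fun i x => - conv (partial i eta) u x)).
- exact: conv_continuous.
- by move=> i x; exact: is_derive_conv.
- move=> i; rewrite (_ : (fun x => _) = (fun x => -1 * conv (partial i eta) u x)).
    by apply: CkZ; apply: IH; exact: test_fun_partial.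
  by apply/funext => x; rewrite mulN1r.
Qed.

(** A translated kernel is a test function, so this is the definition of the weak derivative;
    mollification thus commutes with weak differentiation. *)
Lemma partial_conv_weak eta u g i x : test_fun setT eta -> L2 setT u ->
  is_weak_partial setT i u g -> partial i (conv eta u) x = conv eta g x.
Proof.
move=> te hu /(is_weak_partialE)[_ hg]; rewrite partial_conv// /conv.
have <- : partial i (translate (- x) eta) = translate (- x) (partial i eta).
  by apply/funext => y; rewrite partial_translate.
by rewrite hg ?opprK//; exact: translate_test_fun.
Qed.

Record mollifier := Mollifier {
  mker :> 'rV[R]_n -> R;
  mker_test : test_fun setT mker;
  mker_ge0 : forall w, 0 <= mker w;
  mker_out : forall w, 1 < `|w| -> mker w = 0;
  mker_int : \int[mu]_w mker w = 1 }.

(** A normalized bump. Its integral is positive, since otherwise the bump would vanish almost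
    everywhere although it is positive on a box of positive volume. *)
Lemma mollifier_exists : inhabited mollifier.
Proof.
pose b := box_bump 1 (const_mx (-1)) (const_mx 1) : 'rV[R]_n -> R.
have tb : test_fun setT b by apply: test_fun_box_bump.
have cb : continuous b := smooth_continuous tb.1.
have b0 w : 0 <= b w by exact: box_bump_ge0.
have bout w : 1 < `|w| -> b w = 0.
  move=> w1; apply: box_bump_out => // h; move: w1; apply/negP; rewrite -leNgt.
  apply/ltW; rewrite [ltLHS]/Num.norm/= mx_normrE.
  apply/bigmax_ltP; split => //= -[j k] _ /=; rewrite ord1 ltr_norml.
  by have := h k; rewrite !mxE.
have ib : mu.-integrable setT (EFin \o b) by exact: continuous_bsupp_integrable cb bout.
have mb : measurable_fun setT b by exact: continuous_measurable_rV.
have pb : 0 < \int[mu]_w b w.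
  rewrite lt_neqAle Rintegral_ge0 ?andbT//; apply/eqP => ib0.
  have /(ae_eq_integral_abs mu measurableT (measurable_int _ ib)) : (\int[mu]_w `|(b w)%:E| = 0)%E.
    rewrite (eq_integral (EFin \o b)) => [|w _]; last by rewrite /= ger0_norm.
    by rewrite -[LHS]fineK ?integrable_fin_num// -[fine _]/(\int[mu]_w b w) -ib0.
  move=> [N [mN N0 hN]].
  have sub : obox (const_mx (-1)) (const_mx 1) `<=` N.
    move=> w ow; apply: hN => /= /(_ Logic.I)[] bw.
    by have := @box_bump_gt0 R n 1 _ _ w ltr01 ow; rewrite -/(b w) bw ltxx.
  have : (mu (obox (const_mx (-1)%R) (const_mx 1%R)) <= 0)%E.
    apply: le_trans (le_measure mu (mem_set (measurable_obox _ _)) (mem_set mN) sub) _.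
    by rewrite le_eqVlt; apply/orP; left; apply/eqP; exact: N0.
  rewrite lebesgue_rV_obox; last by move=> i; rewrite !mxE; lra.
  rewrite lee_fin leNgt => /negP; apply; apply: prodr_gt0 => i _; rewrite !mxE; lra.
constructor.
exists (fun w => (\int[mu]_w b w)^-1 * b w).
- exact: test_funZ.
- by move=> w; rewrite mulr_ge0// invr_ge0 ltW.
- by move=> w /bout ->; rewrite mulr0.
- by rewrite RintegralZl// mulVf// gt_eqF.
Qed.

End convolution.
Arguments mollifier : clear implicits.

Section mollify.
Context {R : realType} {n : nat}.
Local Notation mu := (lebesgue_rV R n).
Local Notation V := ('rV[R]_n -> R^o).
Local Notation delta i := (delta_mx ord0 i : 'rV[R]_n).
Local Notation ip := (ip2 (n := n) setT).
Implicit Types (u v f g : V) (w x : 'rV[R]_n) (rho : mollifier R n).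

Let L2S := @L2_subspace R n _ measurableT.
Let L2P := @ip2_psd R n _ measurableT.

Definition scaled_ker rho (e : R) (y : 'rV[R]_n) := e^-1 ^+ n * rho (e^-1 *: y).

Definition mollify rho (e : R) u : 'rV[R]_n -> R := conv (scaled_ker rho e) u.

Let D : set 'rV[R]_n := [set w | `|w| <= 1].
Let mD : measurable D := measurable_norm_ball 1.

Lemma scaled_ker_test rho (e : R) : 0 < e -> test_fun setT (scaled_ker rho e).
Proof.
move=> e0; apply: test_funZ; split.
  move=> k; rewrite (_ : (fun y => _) = (fun y => rho (e^-1 *: y + 0))).
    exact: Ck_affine ((mker_test rho).1 k).
  by apply/funext => y; rewrite addr0.
exists (cbox (const_mx (- e)) (const_mx e)).
  by split => //; exact: compact_cbox.
move=> x xK; apply: mker_out; rewrite ltNge; apply/negP => xr; apply: xK => i.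
rewrite !mxE -ler_norml; apply: le_trans (ler_coord_norm x i) _.
by move: xr; rewrite normrZ gtr0_norm ?invr_gt0// ler_pdivrMl// mulr1.
Qed.

Lemma affine_L2 (e : R) x u : 0 < e -> L2 setT u -> L2 setT (fun w => u (e *: w + x)).
Proof.
move=> e0 [mf fin]; split; first by apply: (measurableT_comp mf); exact: measurable_rV_affine.
rewrite (integral_affine (f := fun x => (u x ^+ 2)%:E))//.
- by rewrite lte_mul_pinfty// lee_fin exprn_ge0// invr_ge0 ltW.
- exact: measurable_sqr.
- by move=> y; rewrite lee_fin sqr_ge0.
Qed.

Lemma mollifyE rho (e : R) u x : 0 < e -> L2 setT u ->
  mollify rho e u x = \int[mu]_(w in D) (rho w * u (e *: w + x)).
Proof.
move=> e0 hu.
have Lk := translate_L2 (- x) (test_fun_L2 measurableT (scaled_ker_test rho e0)).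
rewrite -(Rintegral_supp (subsetT D)); last first.
  by move=> w _ /negP; rewrite -ltNge => w1; rewrite mker_out ?mul0r.
pose F y : R := u y * translate (- x) (scaled_ker rho e) y.
have iF : mu.-integrable setT (EFin \o F) by exact: (integrable_ip openT hu Lk).
have mF : measurable_fun setT F := measurable_funM hu.1 Lk.1.
rewrite /mollify /conv ip2E -[LHS]/(\int[mu]_y F y).
have h := Rintegral_affine x e0 mF iF.
apply: (mulfI (x := e^-1 ^+ n)); first by rewrite expf_neq0// invr_neq0// gt_eqF.
rewrite -h -RintegralZl//; last first.
  exact: (integrable_ip openT (test_fun_L2 measurableT (mker_test rho)) (affine_L2 x e0 hu)).
apply: eq_Rintegral => w _; rewrite /F /translate /scaled_ker.
have -> : - x + (e *: w + x) = e *: w by rewrite addrC addrK.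
by rewrite scalerA mulVf ?gt_eqF// scale1r; ring.
Qed.

Let L2S_D := @L2_subspace R n _ mD.
Let mrho rho : measurable_fun setT rho.
Proof. by apply: continuous_measurable_rV; apply: smooth_continuous; case: (mker_test rho). Qed.

Lemma wip_mker_psd rho : psd_form (L2 D : set V) (wip mu D rho : V -> V -> R).
Proof.
have [M M0 hM] := test_fun_bounded (mker_test rho).
apply: (@wip_psd R n D mD rho M); first by apply: measurable_funTS; exact: mrho.
by move=> w _; rewrite mker_ge0/=; apply: le_trans (ler_norm _) (hM w).
Qed.

Lemma L2_sub (A : set 'rV[R]_n) u : measurable A -> L2 setT u -> L2 A u.
Proof.
move=> mA [mf fin]; split; first exact: measurable_funTS.
apply: le_lt_trans fin; apply: ge0_subset_integral => //.
- exact: measurable_sqr.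
- by move=> x _; rewrite lee_fin sqr_ge0.
Qed.

Lemma L2_cst (c : R) : L2 D (cst c).
Proof.
split; first exact: measurable_cst.
rewrite -[X in (X < _)%E]/(\int[mu]_(x in D) cst (c ^+ 2)%:E x)%E.
by rewrite (integral_cst mu mD) lte_mul_pinfty// ?lebesgue_rV_ball_lty// lee_fin sqr_ge0.
Qed.

Lemma wip_mker1 rho : wip mu D rho (cst 1) (cst 1) = 1.
Proof.
transitivity (\int[mu]_w rho w); last exact: mker_int.
rewrite /wip [RHS](Rintegral_supp (subsetT D)).
  by apply: eq_Rintegral => w _; rewrite !mulr1.
by move=> w _ /negP; rewrite -ltNge => /(mker_out rho).
Qed.

(** Jensen's inequality for the square, obtained from Cauchy-Schwarz against the constant 1 for the
    probability weight [rho]. *)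
Lemma mollify_jensen rho (e : R) u x (c : R) : 0 < e -> L2 setT u ->
  (((mollify rho e u x - c) ^+ 2)%:E <=
   \int[mu]_w (rho w * (u (e *: w + x) - c) ^+ 2)%:E)%E.
Proof.
move=> e0 hu; pose g : V := fun w => u (e *: w + x).
have Lg : L2 D g by apply: L2_sub => //; exact: affine_L2.
have P := wip_mker_psd rho.
have Lgc := subspaceB L2S_D Lg (L2_cst c).
have -> : mollify rho e u x - c = wip mu D rho (g - cst c) (cst 1).
  rewrite (formBl L2S_D P Lg (L2_cst c) (L2_cst 1)); congr (_ - _).
    by rewrite mollifyE// /wip; apply: eq_Rintegral => w _; rewrite mulr1.
  have -> : (cst c : V) = c *: (cst 1 : V) by apply/funext => w; rewrite -[RHS]/(c * 1) mulr1.
  by rewrite (formZl P c (L2_cst 1) (L2_cst 1)) wip_mker1 mulr1.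
apply: (@le_trans _ _ (wip mu D rho (g - cst c) (g - cst c))%:E).
  rewrite lee_fin; apply: le_trans (form_CS L2S_D P Lgc (L2_cst 1)) _.
  by rewrite wip_mker1 mulr1.
have [M M0 hM] := test_fun_bounded (mker_test rho).
have I := integrable_wip mD (measurable_funTS (@mrho rho)) (fun w _ => hM w) Lgc Lgc.
rewrite /wip /Rintegral fineK ?integrable_fin_num//.
rewrite (eq_integral (fun w => (rho w * (u (e *: w + x) - c) ^+ 2)%:E)); last first.
  by move=> w _; rewrite expr2 mulrA.
apply: ge0_subset_integral => //.
- apply/measurable_EFinP; apply: measurable_funM; first exact: mrho.
  apply: measurable_funX; apply: measurable_funB => //.
  by apply: (measurableT_comp hu.1); exact: measurable_rV_affine.
- by move=> w _; rewrite lee_fin mulr_ge0 ?mker_ge0// sqr_ge0.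
Qed.

(** A mollified function is an average of translates, so by Jensen and Tonelli it is no farther from
    [v] than they are. With v = 0 this is contraction, with v = u an approximation rate. *)
Lemma mollify_dist rho (e K : R) u v : 0 < e -> L2 setT u -> L2 setT v ->
  (forall w, `|w| <= 1 -> ip (translate (e *: w) u - v : V) (translate (e *: w) u - v : V) <= K) ->
  L2 setT (mollify rho e u - v : V) /\
  ip (mollify rho e u - v : V) (mollify rho e u - v : V) <= K.
Proof.
move=> e0 hu hv hK.
have mm : measurable_fun setT (mollify rho e u - v : V).
  apply: measurable_funB hv.1.
  by apply: continuous_measurable_rV; apply: conv_continuous => //; exact: scaled_ker_test.
have mF : measurable_fun setT (fun p : 'rV[R]_n * 'rV[R]_n =>
    (rho p.2 * (u (e *: p.2 + p.1) - v p.1) ^+ 2)%:E).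
  apply/measurable_EFinP; apply: measurable_funM.
    by apply: (measurableT_comp (@mrho rho)); exact: measurable_snd.
  apply: measurable_funX; apply: measurable_funB; last first.
    by apply: (measurableT_comp hv.1); exact: measurable_fst.
  apply: (measurableT_comp hu.1); apply: measurable_fun_rV => i.
  rewrite (_ : _ \o _ = (fun p => e * rV_coord i p.2 + rV_coord i p.1)); last first.
    by apply/funext => p; rewrite /rV_coord /= !mxE.
  apply: measurable_funD; last first.
    by apply: (measurableT_comp (@measurable_rV_coord R n i)); exact: measurable_fst.
  apply: measurable_funM => //.
  by apply: (measurableT_comp (@measurable_rV_coord R n i)); exact: measurable_snd.
have F0 (p : 'rV[R]_n * 'rV[R]_n) : (0 <= (rho p.2 * (u (e *: p.2 + p.1) - v p.1) ^+ 2)%:E)%E.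
  by rewrite lee_fin mulr_ge0 ?mker_ge0// sqr_ge0.
have K0 : 0 <= K.
  have := hK 0; rewrite normr0 ler01 => /(_ isT); apply: le_trans.
  by apply: (form_ge0 L2P); exact: (L2B measurableT (translate_L2 _ hu) hv).
have key : (\int[mu]_x (((mollify rho e u - v : V) x) ^+ 2)%:E <= K%:E)%E.
  apply: (@le_trans _ _ (\int[mu]_x \int[mu]_w (rho w * (u (e *: w + x) - v x) ^+ 2)%:E)%E).
    apply: ge0_le_integral => //.
    - by move=> x _; rewrite lee_fin sqr_ge0.
    - exact: measurable_sqr.
    - exact: (measurable_fun_fubini_tonelli_F _ mF F0).
    by move=> x _; exact: mollify_jensen.
  rewrite (fubini_tonelli _ mF F0)/=.
  apply: (@le_trans _ _ (\int[mu]_w ((K * rho w)%:E))%E).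
    apply: ge0_le_integral => //.
    - by move=> w _; apply: integral_ge0 => x _; rewrite lee_fin mulr_ge0 ?mker_ge0// sqr_ge0.
    - exact: (measurable_fun_fubini_tonelli_G _ mF F0).
    - by apply/measurable_EFinP; apply: measurable_funM => //; exact: mrho.
    move=> w _ /=; have [w1|w1] := leP `|w| 1; last first.
      by rewrite mker_out// mulr0 integral0_eq// => x _; rewrite mul0r.
    have Lt := L2B measurableT (translate_L2 (e *: w) hu) hv.
    under eq_integral do rewrite EFinM.
    rewrite ge0_integralZl//; last 3 first.
    - by apply: measurable_sqr; exact: Lt.1.
    - by move=> x _; rewrite lee_fin sqr_ge0.
    - by rewrite lee_fin mker_ge0.
    rewrite -[X in (_ * X <= _)%E]/(sqn mu setT (translate (e *: w) u - v : V)).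
    rewrite (ip2_sqn Lt) -EFinM lee_fin mulrC ler_wpM2r ?mker_ge0//; exact: hK.
  under eq_integral do rewrite EFinM.
  rewrite ge0_integralZl//; last 2 first.
  - by apply/measurable_EFinP; exact: mrho.
  - by move=> w _; rewrite lee_fin mker_ge0.
  have irho : mu.-integrable setT (EFin \o rho).
    exact: (continuous_bsupp_integrable (smooth_continuous (mker_test rho).1) (@mker_out _ _ rho)).
  have -> : (\int[mu]_w (rho w)%:E = 1)%E.
    by rewrite -[LHS]fineK ?integrable_fin_num// -[fine _]/(\int[mu]_w rho w) mker_int.
  by rewrite mule1.
have L : L2 setT (mollify rho e u - v : V) by split => //; apply: le_lt_trans key _; rewrite ltry.
by split => //; rewrite -lee_fin -(ip2_sqn L).
Qed.

Lemma mollify_L2 rho (e : R) u : 0 < e -> L2 setT u ->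
  L2 setT (mollify rho e u) /\ ip (mollify rho e u) (mollify rho e u) <= ip u u.
Proof.
move=> e0 hu; have L0 := subspace0 L2S.
have := @mollify_dist rho e (ip u u) u 0 e0 hu L0; rewrite !subr0; apply => w _.
by rewrite subr0 ip2_translate.
Qed.

Lemma mollify_test_dist rho (e : R) U phi : 0 < e -> test_fun U phi ->
  ip (mollify rho e phi - (phi : V)) (mollify rho e phi - (phi : V)) <=
  n%:R * e ^+ 2 * grad_sqn phi.
Proof.
move=> e0 tphi; have Lp := test_fun_L2 measurableT tphi.
apply: (mollify_dist rho e0 Lp Lp _).2 => w w1.
apply: le_trans (translate_dist_le _ tphi) _.
rewrite ler_wpM2r ?(grad_sqn_ge0 tphi)// ler_wpM2l// lerXn2r ?nnegrE ?(ltW e0)//.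
by rewrite normrZ gtr0_norm// ger_pMr.
Qed.

Lemma mollifyB rho (e : R) u v : 0 < e -> L2 setT u -> L2 setT v ->
  mollify rho e (u - v) = mollify rho e u - mollify rho e v :> V.
Proof.
move=> e0 hu hv; apply/funext => x; rewrite /mollify /conv.
have Lk := translate_L2 (- x) (test_fun_L2 measurableT (scaled_ker_test rho e0)).
exact: (formBl L2S L2P hu hv Lk).
Qed.

Let arith (e d G : R) : 0 < e -> e <= 1 -> 0 <= G -> e * (16 * G + 1) <= d -> e ^+ 2 * G <= d / 16.
Proof.
move=> e0 e1 G0 ed; have h : e ^+ 2 * G <= e * G by rewrite ler_wpM2r// expr2 ger_pMr.
lra.
Qed.

Let arith5 (x a b c e f d : R) : 0 < d -> x <= 2 * a + 2 * b -> b <= 2 * c + 2 * e ->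
  a <= f -> c <= d / 16 -> e < d / 16 -> f < d / 16 -> x <= d.
Proof. lra. Qed.

(** For test functions the rate is explicit; density and the contraction property carry convergence
    over to L^2. *)
Lemma mollify_cvg rho u (d : R) : L2 setT u -> 0 < d -> exists2 e0 : R, 0 < e0 &
  forall e, 0 < e -> e <= e0 -> ip (mollify rho e u - u : V) (mollify rho e u - u : V) <= d.
Proof.
move=> hu d0.
have d16 : 0 < d / 16 by rewrite divr_gt0.
have [phi tphi hphi] := test_fun_dense openT hu d16.
have Lp := test_fun_L2 measurableT tphi.
have g0 : 0 < 16 * n%:R * grad_sqn phi + 1.
  by rewrite ltr_wpDl// mulr_ge0 ?(grad_sqn_ge0 tphi)// mulr_ge0.
pose e1 := Num.min 1 (d / (16 * n%:R * grad_sqn phi + 1)).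
have e10 : 0 < e1 by rewrite lt_min ltr01 divr_gt0.
exists e1 => // e e0 ee1.
have h1 := mollify_test_dist rho e0 tphi.
have hup := L2B measurableT hu Lp.
have [Lm h2] := mollify_L2 rho e0 hup.
rewrite (mollifyB rho e0 hu Lp) in h2 Lm.
have [L3 _] := mollify_L2 rho e0 hu; have [L4 _] := mollify_L2 rho e0 Lp.
have h3 := form_dist_le L2S L2P L3 L4 hu.
have h4 := form_dist_le L2S L2P L4 Lp hu.
rewrite (form_sqrBC L2S L2P Lp hu) in h4.
have h5 : n%:R * e ^+ 2 * grad_sqn phi <= d / 16.
  rewrite [_ * e ^+ 2]mulrC -mulrA.
  have e1' : e <= 1 by apply: le_trans ee1 _; rewrite ge_min lexx.
  have ed : e * (16 * n%:R * grad_sqn phi + 1) <= d.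
    by rewrite -ler_pdivlMr//; apply: le_trans ee1 _; rewrite ge_min lexx orbT.
  apply: arith => //; first by rewrite mulr_ge0 ?(grad_sqn_ge0 tphi).
  by rewrite mulrA.
exact: (arith5 d0 h3 h4 h2 (le_trans h1 h5) hphi hphi).
Qed.

End mollify.

(** * Density of test functions in H^1 of the whole space *)

Section H1_density.
Context {R : realType} {n : nat}.
Local Notation mu := (lebesgue_rV R n).
Local Notation V := ('rV[R]_n -> R^o).
Local Notation delta i := (delta_mx ord0 i : 'rV[R]_n).
Local Notation ip := (ip2 (n := n) setT).
Implicit Types (u v f g : V) (w x : 'rV[R]_n).

Let L2S := @L2_subspace R n _ measurableT.
Let L2P := @ip2_psd R n _ measurableT.

Lemma ip2_bmul_le (f g : 'rV[R]_n -> R) (M : R) : measurable_fun setT f ->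
  (forall x, `|f x| <= M) -> L2 setT g ->
  L2 setT (fun x => f x * g x) /\
  ip (fun x => f x * g x) (fun x => f x * g x) <= M ^+ 2 * ip g g.
Proof.
move=> mf fM Lg; have mfg : measurable_fun setT (fun x => f x * g x) by apply: measurable_funM => //; exact: Lg.1.
have le : (\int[mu]_x ((f x * g x) ^+ 2)%:E <= (M ^+ 2 * ip g g)%:E)%E.
  rewrite EFinM -(ip2_sqn Lg) -ge0_integralZl//; last 3 first.
  - by apply: measurable_sqr; exact: Lg.1.
  - by move=> x _; rewrite lee_fin sqr_ge0.
  - by rewrite lee_fin sqr_ge0.
  apply: ge0_le_integral => //.
  - by move=> x _; rewrite lee_fin sqr_ge0.
  - exact: measurable_sqr.
  - by apply: emeasurable_funM => //; apply: measurable_sqr; exact: Lg.1.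
  move=> x _; rewrite -EFinM lee_fin exprMn ler_wpM2r ?sqr_ge0//.
  by rewrite -(real_normK (num_real (f x))) lerXn2r ?nnegrE// (le_trans _ (fM x)).
have L : L2 setT (fun x => f x * g x) by split => //; apply: le_lt_trans le _; rewrite ltry.
by split => //; rewrite -lee_fin -(ip2_sqn L).
Qed.

Lemma ip2_bmul_cvg (f_ : nat -> 'rV[R]_n -> R) (g : 'rV[R]_n -> R) (M : R) :
  (forall k, measurable_fun setT (f_ k)) -> (forall k x, `|f_ k x| <= M) -> L2 setT g ->
  (forall x, (fun k => f_ k x) @ \oo --> (1 : R)) ->
  cvg_form ip (fun k => (fun x => f_ k x * g x) : V) (g : V).
Proof.
move=> mf fM Lg f1.
have Lfg k : L2 setT (fun x => f_ k x * g x) := (ip2_bmul_le (mf k) (fM k) Lg).1.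
have Ld k : L2 setT ((fun x => f_ k x * g x) - g : V) by exact: (subspaceB L2S).
have c0 : (fun k => ip ((fun x => f_ k x * g x) - g : V) ((fun x => f_ k x * g x) - g : V)) @ \oo --> (0 : R).
  have := @dominated_cvg _ _ _ mu setT measurableT
    (fun k x => ((f_ k x * g x - g x) ^+ 2)%:E) (cst 0%E) (fun x => ((M + 1) ^+ 2 * (g x * g x))%:E).
  rewrite integral0 => h.
  have : (\int[mu]_x ((f_ k x * g x - g x) ^+ 2)%:E @[k --> \oo] --> 0)%E.
    apply: h.
    - by move=> k; apply: measurable_sqr; exact: (Ld k).1.
    - move=> x _; apply/fine_cvgP; split; first by apply: nearW.
      have -> : (0 : R) = ((1 - 1) * g x) ^+ 2 by rewrite subrr mul0r expr0n.
      rewrite (_ : _ \o _ = (fun k => ((f_ k x - 1) * g x) ^+ 2)); last first.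
        by apply/funext => k; rewrite /= mulrBl mul1r.
      rewrite expr2; under eq_fun do rewrite expr2.
      by apply: cvgM; apply: cvgMl; apply: cvgB => //; exact: cvg_cst.
    - by move=> x _.
    - rewrite (_ : (fun x => _) = (fun x => ((M + 1) ^+ 2)%:E * (g x * g x)%:E)%E).
        by apply: integrableZl => //; exact: (integrable_ip openT Lg Lg).
      by apply/funext => x; rewrite EFinM.
    - move=> k x _; rewrite gee0_abs ?lee_fin ?sqr_ge0//.
      have -> : f_ k x * g x - g x = (f_ k x - 1) * g x by rewrite mulrBl mul1r.
      rewrite exprMn -expr2 ler_wpM2r ?sqr_ge0//.
      rewrite -(real_normK (num_real (_ - 1))) lerXn2r ?nnegrE//.
        by rewrite addr_ge0// (le_trans _ (fM 0%N 0)).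
      by apply: le_trans (ler_normB _ _) _; rewrite normr1 lerD2r.
  move=> /fine_cvgP[_]; apply: cvg_trans.
  apply: near_eq_cvg; apply: nearW => k /=.
  by rewrite -[RHS]/(fine (ip _ _)%:E) -(ip2_sqn (Ld k)).
by move=> e e0; have /cvgrPdist_le/(_ e e0)[N _ hN] := c0; exists N => k /hN; rewrite sub0r normrN; exact: le_trans (ler_norm _).
Qed.

(** Mollify, which commutes with weak derivatives, then cut off with dilations of a fixed test
    function; the derivative of the cutoff contributes a term of order 1/(k+1). *)
Lemma H1_test_fun_dense (u : V) (d : R) : H1 setT u -> 0 < d -> exists2 phi, test_fun setT phi &
  ip (u - (phi : V)) (u - (phi : V)) <= d /\
  forall i, ip (weak_partial setT i u - (partial i phi : V)) (weak_partial setT i u - (partial i phi : V)) <= d.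
Proof.
move=> hu d0.
have [rho] := @mollifier_exists R n.
have Lu := hu.1; have Lg i := weak_partial_L2 i hu.
have d16 : 0 < d / 16 by rewrite divr_gt0.
have [e1 e10 he1] := mollify_cvg rho Lu d16.
have /choice[e2 he2] (i : 'I_n) : exists e2, 0 < e2 /\ forall e, 0 < e -> e <= e2 ->
    ip (mollify rho e (weak_partial setT i u) - weak_partial setT i u)
       (mollify rho e (weak_partial setT i u) - weak_partial setT i u) <= d / 16.
  by have [e2] := mollify_cvg rho (Lg i) d16; exists e2.
pose e := \big[Order.min/e1]_i e2 i.
have e0 : 0 < e.
  rewrite /e; elim/big_ind : _ => // [x y x0 y0|i _]; first by rewrite lt_min x0.
  by case: (he2 i).
have ee1 : e <= e1 by rewrite /e; exact: bigmin_le_id.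
have ee2 i : e <= e2 i by rewrite /e; exact: bigmin_le_cond.
pose f := mollify rho e u.
have Lf : L2 setT f := (mollify_L2 rho e0 Lu).1.
have sf : smooth f by apply: conv_smooth => //; exact: scaled_ker_test.
have pf i : partial i f = mollify rho e (weak_partial setT i u).
  apply/funext => x; apply: partial_conv_weak => //; first exact: scaled_ker_test.
  exact: weak_partialP.
have Lpf i : L2 setT (partial i f) by rewrite pf; exact: (mollify_L2 rho e0 (Lg i)).1.
pose b := box_bump 1 (const_mx (-1)) (const_mx 1) : 'rV[R]_n -> R.
have tb : test_fun setT b by apply: test_fun_box_bump.
have b0 : 0 < b 0 by apply: box_bump_gt0 => // i; rewrite !mxE; lra.
(* The value 1 is arranged at the origin only: the dilates still tend to 1 pointwise and boundedly,
   which dominated convergence needs. *)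
pose chi x := (b 0)^-1 * b x.
have tchi : test_fun setT chi by exact: test_funZ.
have [M M0 hM] := test_fun_bounded tchi; have [M' M'0 hM'] := test_fun_partial_bounded tchi.
pose ck (k : nat) x := chi (k.+1%:R^-1 *: x + 0).
have tck k : test_fun setT (ck k).
  split; first by move=> j; exact: Ck_affine (tchi.1 j).
  have [r r0 hr] := test_fun_bsupp tchi.
  exists (cbox (const_mx (- (k.+1%:R * r))) (const_mx (k.+1%:R * r))).
    by split => //; exact: compact_cbox.
  move=> x xK; apply: hr; rewrite leNgt; apply/negP => xr; apply: xK => i.
  rewrite !mxE -ler_norml; apply: le_trans (ler_coord_norm x i) _.
  move: xr; rewrite addr0 normrZ gtr0_norm ?invr_gt0// => /ltW.
  by rewrite ler_pdivrMl.
have mck k : measurable_fun setT (ck k).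
  by apply: continuous_measurable_rV; apply: smooth_continuous; case: (tck k).
have pck k i x : partial i (ck k) x = k.+1%:R^-1 * partial i chi (k.+1%:R^-1 *: x + 0).
  apply: partialE; apply: is_derive_rV_affine; exact: smooth_is_derive tchi.1.
have mpck k i : measurable_fun setT (partial i (ck k)).
  by apply: continuous_measurable_rV; apply: smooth_continuous; exact: smooth_partial (tck k).1.
have pckM k i x : `|partial i (ck k) x| <= k.+1%:R^-1 * M'.
  by rewrite pck normrM gtr0_norm ?invr_gt0// ler_pM2l ?invr_gt0.
have ck1 x : (fun k => ck k x) @ \oo --> (1 : R).
  have -> : (1 : R) = chi (0 *: x + 0) by rewrite scale0r addr0 /chi mulVf// gt_eqF.
  have cchi := smooth_continuous tchi.1;
  have hc : (fun k : nat => (k.+1%:R^-1 : R) *: x + 0) @ \oo --> (0 *: x + 0 : 'rV[R]_n).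
    by apply: cvgD; [apply: cvgZl; exact: cvg_harmonic|exact: cvg_cst].
  exact: (cvg_comp _ _ hc (cchi _)).
have [N0 hN0] := ip2_bmul_cvg mck (fun k x => hM _) Lf ck1 d16.
have /choice[N hN] (i : 'I_n) := ip2_bmul_cvg mck (fun k x => hM _) (Lpf i) ck1 d16.
have hd : (fun k : nat => M' ^+ 2 * ip f f * (k.+1%:R^-1 * k.+1%:R^-1)) @ \oo --> (0 : R).
  rewrite -(mulr0 (M' ^+ 2 * ip f f)); apply: cvgM; first exact: cvg_cst.
  by rewrite -(mulr0 0); apply: cvgM; exact: cvg_harmonic.
have /cvgrPdist_le/(_ _ d16)[N1 _ hN1] := hd.
pose k := (N0 + (\sum_i N i + N1))%N.
have kN0 : (N0 <= k)%N by exact: leq_addr.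
have kN1 : (N1 <= k)%N by rewrite /k addnA leq_addl.
have kN i : (N i <= k)%N.
  by apply: leq_trans (leq_addl _ _); rewrite (bigD1 i)//= -addnA leq_addr.
have Lcf : L2 setT (fun x => ck k x * f x) := (ip2_bmul_le (mck k) (fun x => hM _) Lf).1.
exists (fun x => ck k x * f x).
  rewrite (_ : (fun x => _) = (fun x => f x * ck k x)); first exact: test_funMr.
  by apply/funext => x; rewrite mulrC.
split.
  have h1 := form_dist_le L2S L2P Lu Lf Lcf.
  have h2 := he1 _ e0 ee1; have h3 := hN0 _ kN0.
  rewrite (form_sqrBC L2S L2P Lu Lf) (form_sqrBC L2S L2P Lf Lcf) in h1.
  apply: le_trans h1 _; rewrite -/f in h2.
  apply: (@le_trans _ _ (2 * (d / 16) + 2 * (d / 16))); last by lra.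
  by apply: lerD; rewrite ler_pM2l.
move=> i.
have [La ha] := ip2_bmul_le (mpck k i) (pckM k i) Lf.
pose cpf : V := fun x => ck k x * partial i f x.
have Lcpf : L2 setT cpf := (ip2_bmul_le (mck k) (fun x => hM _) (Lpf i)).1.
have -> : (partial i (fun x => ck k x * f x) : V) = cpf + (fun x => partial i (ck k) x * f x : R^o).
  apply/funext => x; apply: partialE.
  have := is_deriveM (smooth_is_derive i x (tck k).1) (smooth_is_derive i x sf).
  by rewrite /cpf; move=> h; apply: is_derive_eq h _; rewrite /= /GRing.scale/= [f x * _]mulrC.
have h1 := form_dist_le L2S L2P (Lg i) (Lpf i) (subspaceD L2S Lcpf La).
have h2 := (he2 i).2 _ e0 (ee2 i); rewrite -pf in h2.
have h3 := hN i _ (kN i).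
rewrite (form_sqrBC L2S L2P (Lg i) (Lpf i)) in h1.
have eqv : (partial i f : V) - (cpf + (fun x => partial i (ck k) x * f x : R^o)) =
    ((partial i f : V) - cpf) - (fun x => partial i (ck k) x * f x : R^o).
  by rewrite opprD addrA.
rewrite eqv in h1.
have h4 := form_sqrD_le L2S L2P (L2B measurableT (Lpf i) Lcpf) (subspaceN L2S La).
rewrite (form_sqrBC L2S L2P (Lpf i) Lcpf) (formNl L2P La (subspaceN L2S La)) (formNr L2P La La) opprK in h4.
have h5 := hN1 _ kN1; rewrite sub0r normrN in h5.
have h6 := le_trans (ler_norm _) h5.
have h7 : ip (fun x => partial i (ck k) x * f x) (fun x => partial i (ck k) x * f x) <= d / 16.
  apply: le_trans ha _; apply: le_trans h6; rewrite exprMn -expr2.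
  by rewrite le_eqVlt; apply/orP; left; apply/eqP; ring.
apply: le_trans h1 _.
apply: (@le_trans _ _ (2 * (d / 16) + 2 * (2 * (d / 16) + 2 * (d / 16)))); last by lra.
apply: lerD; first by rewrite ler_pM2l.
rewrite ler_pM2l//; apply: le_trans h4 _.
by apply: lerD; rewrite ler_pM2l.
Qed.

End H1_density.

(** * Smooth truncation and the Nash inequality *)

Section smooth_composition.
Context {R : realType}.

Lemma diffn_comp k (f g : R -> R) : diffn k f -> diffn k g -> diffn k (fun t => f (g t)).
Proof.
elim: k f g => // k IH f g [f' df f'k] hg; have [g' dg g'k] := hg.
exists (fun t => f' (g t) * g' t).
  move=> t; have := is_derive1_comp (df (g t)) (dg t).
  by rewrite mulrC.
by apply: diffnM => //; apply: IH => //; exact: diffnS.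
Qed.

Lemma diffn_cst k (c : R) : diffn k (fun=> c).
Proof.
elim: k c => // k IH c; exists (fun=> 0); last exact: IH.
by move=> t; exact: is_derive_cst.
Qed.

Lemma diffn_derive (g g' : R -> R) : (forall j, diffn j g) ->
  (forall t : R, is_derive t 1 g (g' t)) -> forall j, diffn j g'.
Proof.
move=> hg dg j; have [h dh hj] := hg j.+1.
suff <- : h = g' by [].
by apply/funext => t; have [_ <-] := dh t; have [_ <-] := dg t.
Qed.

Lemma is_derive_comp_line n (g : R -> R) (f : 'rV[R]_n -> R) x v (dg df : R) :
  is_derive (f x) 1 g dg -> is_derive x v f df -> is_derive x v (fun y => g (f y)) (dg * df).
Proof.
move=> hg hf; apply: is_derive_line.
have hl : is_derive (0 : R) 1 (fun h : R => f (h *: v + x)) df.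
  have [hd <-] := hf; have := @is_derive_line_at _ _ f x v 0.
  by rewrite scale0r add0r; apply.
have hg' : is_derive (f (0 *: v + x)) 1 g dg by rewrite scale0r add0r.
by have := @is_derive1_comp _ g (fun h : R => f (h *: v + x)) 0 dg df hg' hl; rewrite mulrC.
Qed.

Lemma Ck_comp n k (g : R -> R) (f : 'rV[R]_n -> R) : (forall j, diffn j g) ->
  Ck k setT f -> Ck k setT (fun x => g (f x)).
Proof.
elim: k g f => [|k IH] g f hg hf.
  split => // x _; apply: (continuous_at_comp (f := f) (g := g)); first exact: hf.1.
  exact: diffn_continuous.
have [g' dg _] := hg 1%N.
apply: (@CkSI _ _ _ _ (fun i x => g' (f x) * partial i f x)).
- move=> x; apply: (continuous_at_comp (f := f) (g := g)); first exact: Ck_continuous hf x.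
  exact: diffn_continuous.
- by move=> i x; apply: is_derive_comp_line => //; exact: Ck_is_derive hf.
- move=> i; apply: CkM; last exact: Ck_partial.
  by apply: IH; [exact: diffn_derive hg dg|exact: CkS].
Qed.

(** A smooth step, 0 for t <= 1 and 1 for t >= 4, made by two nested uses of the flat function. Its
    argument will be v^2 / s^2, so the thresholds are |v| = s and |v| = 2 s. *)
Definition plateau (t : R) : R :=
  1 - flat_exp 0 (1 - flat_exp 0 (t - 1) / flat_exp 0 3) / flat_exp 0 1.

Lemma diffn_plateau k : diffn k plateau.
Proof.
have h1 : diffn k (fun t : R => 1 + (- (flat_exp 0 1)^-1) * flat_exp 0 (1 + (- (flat_exp 0 3)^-1) * flat_exp 0 (1 * t + -1))).
  apply: diffnD; first exact: diffn_cst.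
  apply: diffnZ; apply: diffn_comp; first exact: diffn_flat_exp.
  apply: diffnD; first exact: diffn_cst.
  by apply: diffnZ; apply: diffn_affine; exact: diffn_flat_exp.
congr (diffn k _) : h1; apply/funext => t; rewrite /plateau mul1r !mulNr.
by rewrite ![_^-1 * _]mulrC.
Qed.

Lemma flat_exp0_le (s t : R) : s <= t -> flat_exp 0 s <= flat_exp 0 t.
Proof.
move=> st; have [s0|s0] := leP s 0; first by rewrite (flat_exp_eq0 _ s0) flat_exp_ge0.
rewrite /flat_exp s0 (lt_le_trans s0 st) expr0 invr1 !mul1r ler_expR lerN2.
by rewrite lef_pV2 ?posrE// (lt_le_trans s0 st).
Qed.

Lemma plateau_ge0 (t : R) : 0 <= plateau t.
Proof.
have g1 : 0 < flat_exp 0 1 :> R by exact: flat_exp_gt0.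
have g3 : 0 < flat_exp 0 3 :> R by exact: flat_exp_gt0.
rewrite subr_ge0 ler_pdivrMr// mul1r; apply: flat_exp0_le.
by rewrite gerBl divr_ge0 ?flat_exp_ge0.
Qed.

Lemma plateau_le1 (t : R) : plateau t <= 1.
Proof. by rewrite gerBl divr_ge0 ?flat_exp_ge0. Qed.

Lemma plateau_eq0 (t : R) : t <= 1 -> plateau t = 0.
Proof.
move=> t1; rewrite /plateau (@flat_exp_eq0 _ 0 (t - 1)) ?subr_le0// mul0r subr0.
by rewrite divff ?subrr// gt_eqF// flat_exp_gt0.
Qed.

Lemma plateau_eq1 (t : R) : 4 <= t -> plateau t = 1.
Proof.
move=> t4; have g3 : 0 < flat_exp 0 3 :> R by exact: flat_exp_gt0.
rewrite /plateau (@flat_exp_eq0 _ 0 (1 - _)) ?mul0r ?subr0// subr_le0.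
rewrite ler_pdivlMr// mul1r; apply: flat_exp0_le; lra.
Qed.

Lemma plateau_derive : exists (dp : R -> R) (M : R), [/\ forall t : R, is_derive t 1 plateau (dp t),
  0 <= M, forall t, `|dp t| <= M & forall t, t <= 1 \/ 4 <= t -> dp t = 0].
Proof.
have g1 : 0 < flat_exp 0 1 :> R by exact: flat_exp_gt0.
have g3 : 0 < flat_exp 0 3 :> R by exact: flat_exp_gt0.
pose q (t : R) : R := 1 - flat_exp 0 (t - 1) / flat_exp 0 3.
have dq (t : R) : is_derive t 1 q (- (flat_exp 2 (t - 1) / flat_exp 0 3)).
  have h : is_derive (1 * t + -1) 1 (flat_exp 0) (flat_exp 2 (t - 1)).
    by have := is_derive_flat_exp 0 (1 * t + -1); rewrite mul0r subr0 mul1r.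
  have h1 := is_deriveZ (flat_exp 0 3)^-1 (is_derive_affine h).
  have h2 := is_deriveB (is_derive_cst (1 : R) t 1) h1.
  rewrite mul1r sub0r /GRing.scale/= mulrC in h2.
  congr (is_derive _ _ _ _) : h2; apply/funext => s; rewrite /q /=.
  by rewrite -[LHS]/(1 - (flat_exp 0 3)^-1 * flat_exp 0 (1 * s - 1)) mul1r [_^-1 * _]mulrC.
pose dp t := (flat_exp 0 1 * flat_exp 0 3)^-1 * flat_exp 2 (q t) * flat_exp 2 (t - 1).
have hdp (t : R) : is_derive t 1 plateau (dp t).
  have h : is_derive (q t) 1 (flat_exp 0) (flat_exp 2 (q t)).
    by have := is_derive_flat_exp 0 (q t); rewrite mul0r subr0.
  have h1 := is_deriveZ (flat_exp 0 1)^-1 (is_derive1_comp h (dq t)).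
  have h2 := is_deriveB (is_derive_cst (1 : R) t 1) h1.
  have e : plateau = cst 1 - (flat_exp 0 1)^-1 *: (flat_exp 0 \o q : R -> R^o).
    apply/funext => s; rewrite -[RHS]/(1 - (flat_exp 0 1)^-1 * flat_exp 0 (q s)).
    by rewrite /plateau [_^-1 * _]mulrC.
  rewrite e; apply: is_derive_eq h2 _.
  by rewrite /dp sub0r /GRing.scale/= invfM; ring.
have zero t : t <= 1 \/ 4 <= t -> dp t = 0.
  move=> [t1|t4]; first by rewrite /dp (@flat_exp_eq0 _ 2 (t - 1)) ?mulr0// subr_le0.
  rewrite /dp (@flat_exp_eq0 _ 2 (q t)) ?mulr0 ?mul0r// subr_le0.
  rewrite ler_pdivlMr// mul1r; apply: flat_exp0_le; lra.
exists dp, ((flat_exp 0 1 * flat_exp 0 3)^-1 * (4`!%:R) * ((4`!%:R) * 3 ^+ 2)); split => //.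
  by rewrite !mulr_ge0// ?invr_ge0 ?mulr_ge0// ltW.
move=> t; have [/orP h|/norP[]] := boolP ((t <= 1) || (4 <= t)).
  by rewrite zero// normr0 !mulr_ge0// ?invr_ge0 ?mulr_ge0// ltW.
rewrite -!ltNge => t1 t4.
rewrite ger0_norm; last by rewrite !mulr_ge0 ?flat_exp_ge0// ?invr_ge0 ?mulr_ge0// ltW.
have q1 : q t <= 1 by rewrite gerBl divr_ge0 ?flat_exp_ge0.
apply: ler_pM; rewrite ?flat_exp_ge0 ?mulr_ge0 ?flat_exp_ge0 ?invr_ge0 ?mulr_ge0 ?(ltW g1) ?(ltW g3)//.
- rewrite ler_pM2l ?invr_gt0 ?mulr_gt0//.
  have [q0|q0] := leP (q t) 0; first by rewrite flat_exp_eq0.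
  apply: le_trans (flat_exp_le_sqr _ _) _; rewrite ler_piMr//.
  by rewrite expr_le1// ltW.
- apply: le_trans (flat_exp_le_sqr _ _) _; rewrite ler_pM2l ?ltr0n//.
  by rewrite lerXn2r ?nnegrE//; lra.
Qed.

End smooth_composition.

Section nash.
Context {R : realType} {n : nat}.
Local Notation mu := (lebesgue_rV R n).
Local Notation V := ('rV[R]_n -> R^o).
Local Notation ip := (ip2 (n := n) setT).
Implicit Types (u v f g : V) (w x : 'rV[R]_n).

Let L2S := @L2_subspace R n _ measurableT.
Let L2P := @ip2_psd R n _ measurableT.

Lemma test_fun_integrable U phi : test_fun U phi -> mu.-integrable setT (EFin \o phi).
Proof.
move=> tphi; have [r r0 hr] := test_fun_bsupp tphi.
by apply: (continuous_bsupp_integrable (smooth_continuous tphi.1)) => x /ltW; exact: hr.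
Qed.

Lemma ip2_sup_le (phi g : 'rV[R]_n -> R) (K : R) U : test_fun U phi -> L2 setT g ->
  (forall x, `|g x| <= K) -> `|ip phi g| <= K * \int[mu]_x `|phi x|.
Proof.
move=> tphi Lg gK; have iphi := test_fun_integrable tphi.
have Lp := test_fun_L2 measurableT tphi.
have ii := integrable_ip openT Lp Lg.
rewrite ip2E; apply: le_trans (le_normr_Rintegral measurableT ii) _.
rewrite -RintegralZl//; last exact: integrable_norm iphi.
apply: le_Rintegral => //.
- exact: integrable_norm ii.
- rewrite (_ : _ \o _ = (fun x => K%:E * (EFin \o (fun x => `|phi x|%R)) x)%E).
    by apply: integrableZl => //; exact: integrable_norm iphi.
  by apply/funext => x; rewrite /= EFinM.
- by move=> x _; rewrite normrM mulrC ler_wpM2r.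
Qed.

(** Compare phi with its mollification f at scale d: they differ by d times the gradient, and f is
    bounded by d^-n times the L^1 norm. The square of f - phi is expanded and that of f dropped. The
    scale stays free. *)
Lemma nash_le : exists2 C : R, 0 < C & forall U phi (d : R), test_fun U phi -> 0 < d ->
  ip phi phi <= C * d ^+ 2 * grad_sqn phi + C * d^-1 ^+ n * (\int[mu]_x `|phi x|) ^+ 2.
Proof.
have [rho] := @mollifier_exists R n.
have [M M0 hM] := test_fun_bounded (mker_test rho).
exists (n%:R + 2 * M); first by rewrite ltr_wpDl// mulr_gt0.
move=> U phi d tphi d0; pose f := mollify rho d phi.
have Lp := test_fun_L2 measurableT tphi.
have Lf : L2 setT f := (mollify_L2 rho d0 Lp).1.
have dn0 : 0 < d^-1 ^+ n by rewrite exprn_gt0// invr_gt0.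
have hk x : `|scaled_ker rho d x| <= d^-1 ^+ n * M.
  by rewrite normrM gtr0_norm// ler_pM2l.
pose I := \int[mu]_x `|phi x|.
have I0 : 0 <= I by exact: Rintegral_ge0.
have hf x : `|f x| <= d^-1 ^+ n * M * I.
  apply: (ip2_sup_le tphi); last by move=> y; exact: hk.
  exact: translate_L2 (test_fun_L2 measurableT (scaled_ker_test rho d0)).
have h1 := mollify_test_dist rho d0 tphi; rewrite -/f in h1.
have h2 := ip2_sup_le tphi Lf hf; rewrite -/I in h2.
have h3 := form_sqrB L2S L2P Lf Lp; rewrite h3 (formC L2P) in h1.
have f0 := form_ge0 L2P Lf; have G0 := grad_sqn_ge0 tphi.
have h4 := le_trans (ler_norm _) h2.
have h5 : ip phi phi <= n%:R * d ^+ 2 * grad_sqn phi + 2 * (d^-1 ^+ n * M * I * I).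
  by move: f0 h1 h4; move: (ip f f) (ip phi f) (ip phi phi) => a b c; lra.
apply: le_trans h5 _.
rewrite -/I; apply: lerD; first by rewrite ler_wpM2r// ler_wpM2r ?sqr_ge0// lerDl mulr_ge0// ltW.
have -> (t : R) : 2 * (t * M * I * I) = 2 * M * (t * I ^+ 2) by ring.
by rewrite -[leRHS]mulrA ler_wpM2r ?lerDr// mulr_ge0 ?sqr_ge0// ltW.
Qed.

End nash.

(** * The Sobolev inequality *)

Section levels.
Context {R : realType} {n : nat}.
Local Notation mu := (lebesgue_rV R n).
Local Notation V := ('rV[R]_n -> R^o).
Local Notation ip := (ip2 (n := n) setT).
Variables (v : 'rV[R]_n -> R).
Hypothesis tv : test_fun setT v.

Let L2S := @L2_subspace R n _ measurableT.
Let L2P := @ip2_psd R n _ measurableT.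

Definition level (s : R) : set 'rV[R]_n := [set x | s <= `|v x|].
Definition level_band (s : R) : set 'rV[R]_n := level s `\` level (2 * s).
Definition level_vol (s : R) : R := \int[mu]_x \1_(level s) x.
Definition band_grad (s : R) : R :=
  \sum_i \int[mu]_x (\1_(level_band s) x * partial i v x ^+ 2).

Let mv : measurable_fun setT v.
Proof. by apply: continuous_measurable_rV; apply: smooth_continuous; case: tv. Qed.

Lemma measurable_level s : measurable (level s).
Proof.
rewrite -[X in measurable X]setTI (_ : level s = (fun x => `|v x|) @^-1` `[s, +oo[%classic).
  by apply: (measurableT_comp (@normr_measurable R setT) mv) => //; exact: measurable_itv.
by apply/seteqP; split => x /=; rewrite in_itv/= andbT.
Qed.

Lemma measurable_level_band s : measurable (level_band s).
Proof. by apply: measurableD; exact: measurable_level. Qed.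

Lemma integrable_level s : 0 < s -> mu.-integrable setT (EFin \o (\1_(level s) : 'rV[R]_n -> R)).
Proof.
move=> s0; have [r r0 hr] := test_fun_bsupp tv.
apply: (@integrable_bsupp _ _ _ 1 r).
- by apply: measurable_indic; exact: measurable_level.
- by move=> x; rewrite indicE; case: (_ \in _); rewrite ?normr1 ?normr0.
- move=> x xr; have v0 : v x = 0 by rewrite hr// ltW.
  rewrite indicE memNset//; move=> /=; rewrite /level/= v0 normr0; apply/negP.
  by rewrite -ltNge.
Qed.

Lemma level_vol_ge0 s : 0 <= level_vol s.
Proof. by apply: Rintegral_ge0 => x _; rewrite indicE. Qed.

Lemma integrable_band s i :
  mu.-integrable setT (EFin \o (fun x => \1_(level_band s) x * partial i v x ^+ 2 : R)).
Proof.
have tp := test_fun_partial i tv; have [r r0 hr] := test_fun_bsupp tp.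
have [M M0 hM] := test_fun_bounded tp.
apply: (@integrable_bsupp _ _ _ (M ^+ 2) r).
- apply: measurable_funM; first by apply: measurable_indic; exact: measurable_level_band.
  apply: measurable_funX; apply: continuous_measurable_rV; apply: smooth_continuous; exact: tp.1.
- move=> x; rewrite normrM normrX; rewrite indicE; case: (_ \in _) => /=.
    by rewrite normr1 mul1r lerXn2r ?nnegrE// ltW.
  by rewrite normr0 mul0r sqr_ge0.
- by move=> x xr; rewrite hr ?ltW// expr0n mulr0.
Qed.

End levels.

Section truncation.
Context {R : realType} {n : nat}.
Local Notation mu := (lebesgue_rV R n).
Local Notation ip := (ip2 (n := n) setT).

(** The Nash inequality for s * plateau(v^2 / s^2): this function equals s where |v| >= 2 s,
    vanishes where |v| < s, and its gradient lives on the band between. *)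
Lemma truncation_level : exists2 C : R, 0 < C & forall (v : 'rV[R]_n -> R) (s d : R),
  test_fun setT v -> 0 < s -> 0 < d ->
  s ^+ 2 * level_vol v (2 * s) <= C * d ^+ 2 * band_grad v s + C * d^-1 ^+ n * (s * level_vol v s) ^+ 2.
Proof.
have [C C0 hC] := @nash_le R n.
have [dp [T [hdp T0 dpT dp0]]] := @plateau_derive R.
exists (C * (1 + 16 * T ^+ 2)) => [|v s d tv s0 d0].
  by rewrite mulr_gt0// ltr_pwDl// mulr_ge0// sqr_ge0.
pose q x := s ^- 2 * (v x * v x).
pose f x := s * plateau (q x).
have cvv k : Ck k setT (fun x => v x * v x) by apply: CkM; exact: tv.1.
have sq k : Ck k setT q by exact: CkZ.
have v0q x : v x = 0 -> q x = 0 by move=> v0; rewrite /q v0 mul0r mulr0.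
have s20 : 0 < s ^+ 2 by exact: exprn_gt0.
have qlev x : level v s x -> 1 <= q x.
  by move=> hx; rewrite /q ler_pdivlMl// mulr1 -expr2 -(real_normK (num_real (v x))) lerXn2r ?nnegrE// ltW.
have nlev x : ~ level v s x -> q x <= 1.
  move=> /negP; rewrite -ltNge => /ltW hx.
  by rewrite /q ler_pdivrMl// mulr1 -expr2 -(real_normK (num_real (v x))) lerXn2r ?nnegrE// ltW.
have lev2 x : level v (2 * s) x -> 4 <= q x.
  move=> hx; rewrite /q ler_pdivlMl// -expr2 -(real_normK (num_real (v x))).
  rewrite (_ : s ^+ 2 * 4 = (2 * s) ^+ 2); last by ring.
  by rewrite lerXn2r ?nnegrE// mulr_ge0// ltW.
have tf : test_fun setT f.
  have [_ [K [cK KT] hK]] := tv; split.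
    by move=> k; apply: CkZ; apply: Ck_comp => //; exact: diffn_plateau.
  by exists K => // x /hK v0; rewrite /f v0q// plateau_eq0// mulr0.
have mf : measurable_fun setT f.
  by apply: continuous_measurable_rV; apply: smooth_continuous; case: tf.
have f0 x : 0 <= f x by rewrite mulr_ge0 ?plateau_ge0// ltW.
have pf i x : partial i f x = (s * (s ^- 2 * (2 * v x)) * dp (q x)) * partial i v x.
  apply: partialE.
  have hv := smooth_is_derive i x tv.1.
  have h1 := is_deriveZ (s ^- 2) (is_deriveM hv hv).
  have h2 := is_deriveZ s (is_derive_comp_line (hdp (q x)) h1).
  by apply: is_derive_eq h2 _; rewrite /GRing.scale/=; ring.
have iL2 := integrable_level tv (mulr_gt0 (ltr0n R 2) s0).
have iL := integrable_level tv s0.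
have h1 : s ^+ 2 * level_vol v (2 * s) <= ip f f.
  rewrite ip2E -RintegralZl//; apply: le_Rintegral => //.
  - rewrite (_ : _ \o _ = (fun x => (s ^+ 2)%:E * (EFin \o (\1_(level v (2 * s)) : _ -> R)) x)%E).
      exact: integrableZl.
    by apply/funext => x; rewrite /= EFinM.
  - by apply: (integrable_ip openT); exact: (test_fun_L2 measurableT tf).
  move=> x _; rewrite indicE; have [xl|xl] := pselect (level v (2 * s) x).
    by rewrite mem_set// mulr1 /f plateau_eq1 ?mulr1 ?expr2//; exact: lev2.
  by rewrite memNset// mulr0 mulr_ge0.
have h2 : \int[mu]_x `|f x| <= s * level_vol v s.
  rewrite -RintegralZl//; apply: le_Rintegral => //.
  - exact: integrable_norm (test_fun_integrable tf).
  - rewrite (_ : _ \o _ = (fun x => s%:E * (EFin \o (\1_(level v s) : _ -> R)) x)%E).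
      exact: integrableZl.
    by apply/funext => x; rewrite /= EFinM.
  move=> x _; rewrite ger0_norm// indicE; have [xl|xl] := pselect (level v s x).
    by rewrite mem_set// ler_pM2l// plateau_le1.
  by rewrite memNset// /f plateau_eq0 ?mulr0//; exact: nlev.
(* On the band |v| < 2 s, so the chain rule factor 2 |v| / s is at most 4. *)
have h3 : grad_sqn f <= 16 * T ^+ 2 * band_grad v s.
  rewrite /grad_sqn /band_grad mulr_sumr; apply: ler_sum => i _.
  have iB := integrable_band tv s i.
  rewrite ip2E -RintegralZl//; apply: le_Rintegral => //.
  - by apply: (integrable_ip openT); exact: (test_fun_L2 measurableT (test_fun_partial i tf)).
  - rewrite (_ : _ \o _ = (fun x => (16 * T ^+ 2)%:E * (EFin \o (fun x => \1_(level_band v s) x * partial i v x ^+ 2)%R) x)%E).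
      exact: integrableZl.
    by apply/funext => x; rewrite /= EFinM.
  move=> x _; rewrite pf -expr2 exprMn.
  have [[xl xl2]|xl] := pselect (level_band v s x).
    rewrite indicE mem_set// mul1r ler_wpM2r ?sqr_ge0//.
    rewrite (_ : 16 * T ^+ 2 = (4 * T) ^+ 2); last by ring.
    rewrite -(real_normK (num_real (_ * dp _))) lerXn2r ?nnegrE ?mulr_ge0//.
    rewrite normrM ler_pM//.
    rewrite (_ : s * _ = 2 * v x / s); last by field; rewrite gt_eqF.
    rewrite normrM normfV (gtr0_norm s0) ler_pdivrMr// normrM ger0_norm//.
    move/negP : xl2; rewrite -ltNge => /ltW xl2.
    by rewrite (_ : 4 * s = 2 * (2 * s)) ?ler_pM2l//; ring.
  rewrite indicE memNset// mul0r mulr0 dp0 ?mulr0 ?expr0n ?mul0r//.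
  have [xs|/nlev] := pselect (level v s x); last by left.
  by right; apply: lev2; apply: contrapT => x2; apply: xl.
have B0 : 0 <= band_grad v s.
  by apply: sumr_ge0 => i _; apply: Rintegral_ge0 => x _; rewrite mulr_ge0 ?sqr_ge0// indicE.
have h4 := hC setT f d tf d0; have dn0 : 0 < d^-1 ^+ n by rewrite exprn_gt0// invr_gt0.
apply: le_trans h1 _; apply: le_trans h4 _.
have Cd0 : 0 <= C * d ^+ 2 by rewrite mulr_ge0 ?sqr_ge0// ltW.
apply: lerD.
  apply: le_trans (ler_wpM2l Cd0 h3) _.
  rewrite (_ : C * (1 + 16 * T ^+ 2) * d ^+ 2 * band_grad v s = C * d ^+ 2 * (16 * T ^+ 2 * band_grad v s) + C * d ^+ 2 * band_grad v s); last by ring.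
  by rewrite lerDl mulr_ge0.
have I0 : 0 <= \int[mu]_x `|f x| by exact: Rintegral_ge0.
apply: ler_pM => //; rewrite ?sqr_ge0 ?mulr_ge0 ?(ltW C0) ?(ltW dn0)//.
  by rewrite ler_wpM2r ?(ltW dn0)// ler_peMr ?(ltW C0)// lerDl mulr_ge0 ?sqr_ge0.
by rewrite lerXn2r ?nnegrE// mulr_ge0 ?level_vol_ge0// ltW.
Qed.

End truncation.

Section crit_exp.
Context {R : realType}.

Lemma powRK (x r : R) : 0 <= x -> r != 0 -> (x `^ r) `^ r^-1 = x.
Proof. by move=> x0 r0; rewrite -powRrM mulfV// powRr1. Qed.

Lemma powRVK (x r : R) : 0 <= x -> r != 0 -> (x `^ r^-1) `^ r = x.
Proof. by move=> x0 r0; rewrite -powRrM mulVf// powRr1. Qed.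

Lemma le_powR (x y r : R) : 0 <= r -> 0 <= x -> x <= y -> x `^ r <= y `^ r.
Proof. by move=> r0 x0 xy; apply: ge0_ler_powR; rewrite ?nnegrE// (le_trans x0). Qed.

Variables (n : nat) (hn : (3 <= n)%N).
Local Notation p := (crit_exp R n).

Lemma natn_gt2 : 2 < n%:R :> R. Proof. by rewrite ltr_nat. Qed.

Lemma crit_exp_gt2 : 2 < p.
Proof.
have h := natn_gt2; rewrite /crit_exp ltr_pdivlMr ?subr_gt0// ltr_pM2l//.
by rewrite gtrBl.
Qed.

Lemma crit_exp_gt0 : 0 < p. Proof. by have := crit_exp_gt2; lra. Qed.
Lemma crit_exp_neq0 : p != 0. Proof. by rewrite gt_eqF// crit_exp_gt0. Qed.

Lemma crit_exp_half_sub : n%:R * ((p - 2) / 2) = p.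
Proof. by have h := natn_gt2; rewrite /crit_exp; field; lra. Qed.

Lemma crit_exp_two_div : 1 - 2 / n%:R = 2 / p.
Proof. by have h := natn_gt2; rewrite /crit_exp; field; apply/andP; split; lra. Qed.

End crit_exp.

Section sobolev_test.
Context {R : realType} {n : nat}.
Hypothesis hn : (3 <= n)%N.
Local Notation mu := (lebesgue_rV R n).
Local Notation V := ('rV[R]_n -> R^o).
Local Notation ip := (ip2 (n := n) setT).
Local Notation p := (crit_exp R n).

Let p0 : 0 < p := crit_exp_gt0 hn.
Let pn0 : p != 0 := crit_exp_neq0 hn.
Let p2 : 2 < p := crit_exp_gt2 hn.

Let level_arith (s t a a2 D C : R) (q : R) : 0 < s -> 0 < t -> 0 < C -> 0 < q ->
  q ^+ 2 * s ^+ 2 = q ^+ n ->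
  (s ^+ 2 * a2 <= C * (t / q) ^+ 2 * D + C * (t / q)^-1 ^+ n * (s * a) ^+ 2) ->
  q ^+ n * a2 <= C * (t ^+ 2 * D + t^-1 ^+ n * (q ^+ n * a) ^+ 2).
Proof.
move=> s0 t0 C0 q0 qn; have q20 : 0 < q ^+ 2 by exact: exprn_gt0.
rewrite -(ler_pM2l q20) mulrA qn => h; apply: le_trans h _.
rewrite le_eqVlt; apply/orP; left; apply/eqP.
rewrite invfM invrK !exprMn mulrDr mulrDr; congr (_ + _).
  by rewrite exprVn; field; rewrite gt_eqF.
move: qn; move: (t^-1 ^+ n) (q ^+ n) (q ^+ 2) (s ^+ 2) => x y z w h.
by rewrite -h; ring.
Qed.

(** The scale is d = t / q with q = s^((p-2)/2). Since n (p-2)/2 = p, all powers of s are absorbed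
    into s^p times the volume of the level, and t can be the same for all levels. *)
Lemma level_step : exists2 C : R, 0 < C & forall (v : 'rV[R]_n -> R) (s t : R), test_fun setT v ->
  0 < s -> 0 < t ->
  (2 * s) `^ p * level_vol v (2 * s) <=
  C * (t ^+ 2 * band_grad v s + t^-1 ^+ n * (s `^ p * level_vol v s) ^+ 2).
Proof.
suff [C C0 hC] : exists2 C : R, 0 < C & forall (v : 'rV[R]_n -> R) (s d : R), test_fun setT v ->
    0 < s -> 0 < d ->
    s ^+ 2 * level_vol v (2 * s) <= C * d ^+ 2 * band_grad v s + C * d^-1 ^+ n * (s * level_vol v s) ^+ 2.
  exists (2 `^ p * C); first by rewrite mulr_gt0// powR_gt0.
  move=> v s t tv s0 t0; pose q := s `^ ((p - 2) / 2).
  have q0 : 0 < q by exact: powR_gt0.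
  have qn : q ^+ n = s `^ p.
    by rewrite -powR_mulrn ?powR_ge0// -powRrM mulrC (crit_exp_half_sub hn).
  have q2 : q ^+ 2 * s ^+ 2 = q ^+ n.
    rewrite qn -!powR_mulrn ?powR_ge0 ?(ltW s0)// -powRrM -powRD; last by rewrite (gt_eqF s0) implybT.
    by congr (_ `^ _); field.
  have h := hC v s (t / q) tv s0 (divr_gt0 t0 q0).
  have := level_arith s0 t0 C0 q0 q2 h; rewrite qn => h1.
  by rewrite powRM ?(ltW s0)// -[leLHS]mulrA -[leRHS]mulrA ler_pM2l// powR_gt0.
exact: truncation_level.
Qed.

(** Dyadic bands are disjoint: the sum of their indicators telescopes to a difference of two level
    indicators. *)
Lemma sum_band_grad (v : 'rV[R]_n -> R) (s : R) K : test_fun setT v -> 0 < s ->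
  \sum_(j < K) band_grad v (s * 2 ^+ j) <= grad_sqn v.
Proof.
move=> tv s0; rewrite /band_grad /grad_sqn exchange_big/=; apply: ler_sum => i _.
rewrite -(Rintegral_sum measurableT) => [|j]; last exact: integrable_band.
rewrite ip2E; apply: le_Rintegral => //.
- apply: eq_integrable (integrable_sum measurableT (index_enum 'I_K) (P := xpredT) (fun j _ => integrable_band tv (s * 2 ^+ j) i)) => // x _.
  by rewrite /= sumEFin.
- by apply: (integrable_ip openT); exact: (test_fun_L2 measurableT (test_fun_partial i tv)).
move=> x _; rewrite -mulr_suml -expr2 ler_piMl ?sqr_ge0//.
pose F (j : nat) : R := \1_(level v (s * 2 ^+ j)) x.
rewrite (eq_bigr (fun j : 'I_K => - (F j.+1 - F j))); last first.
  move=> j _; rewrite /F opprB /level_band exprS mulrCA !indicE in_setD.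
  have [h|h] := pselect (level v (s * 2 ^+ j) x); last first.
    rewrite (memNset h) memNset ?subrr//= => h2; apply: h; apply: le_trans h2.
    by rewrite ler_pM2l// ler_peMl ?ler1n// exprn_ge0.
  by rewrite (mem_set h)/=; case: (_ \in _); rewrite ?subrr ?subr0.
rewrite sumrN -(big_mkord xpredT (fun j : nat => F j.+1 - F j)) telescope_sumr// opprB.
rewrite /F !indicE; case: (_ \in _); case: (_ \in _) => /=; lra.
Qed.

(** The choice t^n = 4 C B turns the quadratic term into B / 4. Unless B <= 4 b0, also b0 is below B
    / 4, so half of B is left; as 1 - 2/n = 2/p, this bounds B^(2/p) by a multiple of G. *)
Let sobolev_arith (B b0 G C : R) : 0 <= B -> 0 <= b0 -> 0 <= G -> 0 < C ->
  (forall t, 0 < t -> B <= b0 + C * (t ^+ 2 * G + t^-1 ^+ n * B ^+ 2)) ->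
  B <= 4 * b0 + (2 * C * (4 * C) `^ (2 / n%:R) * G) `^ (p / 2).
Proof.
move=> B0 b00 G0 C0 h.
have [B4|B4] := leP B (4 * b0); first by rewrite (le_trans B4)// lerDl powR_ge0.
have Bp : 0 < B by apply: le_lt_trans B4; rewrite mulr_ge0.
pose t := (4 * C * B) `^ n%:R^-1.
have n0 : n%:R != 0 :> R by rewrite pnatr_eq0; case: n hn.
have CB : 0 < 4 * C * B by rewrite !mulr_gt0.
have tn : t ^+ n = 4 * C * B by rewrite -powR_mulrn ?powR_ge0// powRVK// ltW.
have t2 : t ^+ 2 = (4 * C) `^ (2 / n%:R) * B `^ (2 / n%:R).
  rewrite -powR_mulrn ?powR_ge0// -powRrM [_^-1 * _]mulrC powRM ?(ltW Bp)//.
  by rewrite mulr_ge0// ltW.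
have t0 : 0 < t by exact: powR_gt0.
have := h _ t0; rewrite exprVn tn t2.
have -> : (4 * C * B)^-1 * B ^+ 2 = B / (4 * C) by field; rewrite !gt_eqF.
rewrite mulrDr (_ : C * (B / (4 * C)) = B / 4); last by field; rewrite gt_eqF.
set Y := (4 * C) `^ _; set X := B `^ _ => h1.
have X0 : 0 < X by exact: powR_gt0.
have h2 : B <= X * (2 * C * Y * G).
  rewrite (_ : X * _ = 2 * (C * (Y * X * G))); last by ring.
  by move: h1; move: (C * _) => c; lra.
have h3 : B `^ (2 / p) <= 2 * C * Y * G.
  rewrite -(ler_pM2l X0) -/X; apply: le_trans h2.
  rewrite -powRD; last by rewrite (gt_eqF Bp) implybT.
  by rewrite -(crit_exp_two_div hn) addrC subrK powRr1.
apply: (@le_trans _ _ ((2 * C * Y * G) `^ (p / 2))); last by rewrite lerDr mulr_ge0.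
have e : (2 / p)^-1 = p / 2 by rewrite invfM invrK mulrC.
rewrite -[leLHS](powRK (r := 2 / p)) ?mulf_neq0 ?invr_eq0// e.
have p20 : 0 <= p / 2 by rewrite divr_ge0// ltW.
by apply: le_powR => //; exact: powR_ge0.
Qed.

Lemma powR_le_levels (v : 'rV[R]_n -> R) (s : R) K x : 0 < s -> `|v x| < s * 2 ^+ K ->
  `|v x| `^ p <= s `^ p + \sum_(j < K) 2 `^ p * ((s * 2 ^+ j) `^ p * \1_(level v (s * 2 ^+ j)) x).
Proof.
move=> s0; elim: K => [|K IH].
  by rewrite expr0 mulr1 big_ord0 addr0 => /ltW; apply: le_powR => //; exact: ltW.
rewrite big_ord_recr/= addrA => h; have [hK|hK] := ltP `|v x| (s * 2 ^+ K).
  by apply: le_trans (IH hK) _; rewrite lerDl !mulr_ge0 ?powR_ge0.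
rewrite indicE mem_set// mulr1 -powRM//; last by rewrite mulr_ge0 ?exprn_ge0 ?(ltW s0).
apply: (@le_trans _ _ ((2 * (s * 2 ^+ K)) `^ p)); last first.
  by rewrite lerDr addr_ge0 ?powR_ge0// sumr_ge0// => j _; rewrite !mulr_ge0 ?powR_ge0.
by apply: le_powR; rewrite ?(ltW p0)// mulrCA -exprS ltW.
Qed.

Lemma test_fun_powR_integrable U v : test_fun U v -> mu.-integrable setT (EFin \o (fun x => `|v x| `^ p)).
Proof.
move=> tv; have [r r0 hr] := test_fun_bsupp tv; have [M M0 hM] := test_fun_bounded tv.
apply: (@integrable_bsupp _ _ _ (M `^ p) r).
- apply: (measurableT_comp (measurable_powR p)); apply: (measurableT_comp (@normr_measurable R setT)).
  by apply: continuous_measurable_rV; apply: smooth_continuous; case: tv.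
- by move=> x; rewrite ger0_norm ?powR_ge0//; apply: le_powR => //; exact: ltW.
- by move=> x xr; rewrite hr ?ltW// normr0 powR0.
Qed.

(** Sum [level_step] over the levels s 2^j. The squares on the right add up to at most B^2, where B
    is the full sum, so B is controlled by the gradient up to a multiple of s^p; finally s tends to
    0. *)
Lemma sobolev_test_fun : exists2 C : R, 0 < C & forall v : 'rV[R]_n -> R, test_fun setT v ->
  \int[mu]_x (`|v x| `^ p) <= (C * grad_sqn v) `^ (p / 2).
Proof.
have [C C0 hC] := level_step.
pose C2 := 2 * C * (4 * C) `^ (2 / n%:R).
have C20 : 0 < C2 by rewrite !mulr_gt0// powR_gt0// mulr_gt0.
exists (4 * C2) => [|v tv]; first by rewrite mulr_gt0.
have [r r0 hr] := test_fun_bsupp tv; have [M M0 hM] := test_fun_bounded tv.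
pose m0 := \int[mu]_x (1 * \1_[set x : 'rV[R]_n | `|x| <= r] x).
have m00 : 0 <= m0 by apply: Rintegral_ge0 => x _; rewrite indicE.
have G0 := grad_sqn_ge0 tv.
set X := (C2 * grad_sqn v) `^ (p / 2).
have iv := test_fun_powR_integrable tv.
have key (s : R) : 0 < s -> \int[mu]_x (`|v x| `^ p) <= s `^ p * (m0 + 2 `^ p * (4 * m0)) + 2 `^ p * X.
  move=> s0.
  (* Enough dyadic levels to exceed the maximum of |v|. *)
  pose K := (Num.truncn (M / s)).+1.
  have hK x : `|v x| < s * 2 ^+ K.
    apply: le_lt_trans (hM x) _; rewrite mulrC -ltr_pdivrMr//.
    apply: lt_le_trans (Num.Theory.truncnS_gt _) _.
    by rewrite -natrX ler_nat ltnW// ltn_expl.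
  pose b (j : nat) := (s * 2 ^+ j) `^ p * level_vol v (s * 2 ^+ j).
  have sj (j : nat) : 0 < s * 2 ^+ j by rewrite mulr_gt0// exprn_gt0.
  have b0 j : 0 <= b j by rewrite mulr_ge0 ?powR_ge0 ?level_vol_ge0.
  pose B := \sum_(j < K) b j.
  have B0 : 0 <= B by apply: sumr_ge0.
  have iball := @integrable_indic_ball R n 1 r.
  have hb0 : b 0%N <= s `^ p * m0.
    rewrite /b expr0 mulr1 ler_pM2l ?powR_gt0//; apply: le_Rintegral => //.
      exact: integrable_level.
    move=> x _; rewrite mul1r !indicE; have [xs|xs] := pselect (level v s x); last by rewrite (memNset xs).
    rewrite (mem_set xs) mem_set//= leNgt; apply/negP => /ltW/hr vx.
    by move: xs; rewrite /level/= vx normr0 leNgt s0.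
  have hB t : 0 < t -> B <= s `^ p * m0 + C * (t ^+ 2 * grad_sqn v + t^-1 ^+ n * B ^+ 2).
    move=> t0; have tn0 : 0 <= t^-1 ^+ n by rewrite exprn_ge0// invr_ge0 ltW.
    have BE : B = b 0%N + \sum_(j < K.-1) b j.+1 by rewrite /B /K big_ord_recl.
    rewrite [leLHS]BE; apply: lerD => //.
    apply: (@le_trans _ _ (\sum_(j < K.-1) C * (t ^+ 2 * band_grad v (s * 2 ^+ j) + t^-1 ^+ n * (b j) ^+ 2))).
      apply: ler_sum => j _; rewrite /b exprS (mulrCA s 2); exact: hC.
    rewrite -mulr_sumr ler_pM2l// big_split/=; apply: lerD.
      by rewrite -mulr_sumr ler_pM2l ?exprn_gt0//; exact: sum_band_grad.
    rewrite -mulr_sumr ler_wpM2l//.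
    apply: (@le_trans _ _ (\sum_(j < K.-1) b j * B)).
      apply: ler_sum => j _; rewrite expr2 ler_wpM2l// /B.
      by rewrite (bigD1 (widen_ord (leqnSn _) j))//= lerDl sumr_ge0.
    rewrite -mulr_suml expr2 ler_wpM2r// /B big_ord_recr/= lerDl; exact: b0.
  have hB2 := sobolev_arith B0 (mulr_ge0 (powR_ge0 s p) m00) G0 C0 hB.
  rewrite -/C2 -/X in hB2.
  have ib j : mu.-integrable setT (EFin \o (fun x => 2 `^ p * ((s * 2 ^+ j) `^ p * \1_(level v (s * 2 ^+ j)) x))).
    rewrite (_ : _ \o _ = (fun x => (2 `^ p * (s * 2 ^+ j) `^ p)%:E * (EFin \o (\1_(level v (s * 2 ^+ j)) : _ -> R)) x)%E).
      by apply: integrableZl => //; exact: integrable_level.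
    by apply/funext => x; rewrite /= -EFinM mulrA.
  have ibs : mu.-integrable setT (EFin \o (fun x => \sum_(j < K) 2 `^ p * ((s * 2 ^+ j) `^ p * \1_(level v (s * 2 ^+ j)) x))).
    apply: eq_integrable (integrable_sum measurableT (index_enum 'I_K) (P := xpredT) (fun j _ => ib j)) => // x _.
    by rewrite /= sumEFin.
  have is0 : mu.-integrable setT (EFin \o (fun x => s `^ p * \1_[set x : 'rV[R]_n | `|x| <= r] x)) by exact: integrable_indic_ball.
  apply: (@le_trans _ _ (\int[mu]_x (s `^ p * \1_[set x : 'rV[R]_n | `|x| <= r] x +
      \sum_(j < K) 2 `^ p * ((s * 2 ^+ j) `^ p * \1_(level v (s * 2 ^+ j)) x)))).
    apply: le_Rintegral => //.
      rewrite (_ : _ \o _ = ((EFin \o (fun x => (s `^ p * \1_[set x : 'rV[R]_n | `|x| <= r] x)%R)) \+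
       (EFin \o (fun x => (\sum_(j < K) 2 `^ p * ((s * 2 ^+ j) `^ p * \1_(level v (s * 2 ^+ j)) x))%R)))%E).
        exact: integrableD.
      by apply/funext => x; rewrite /= EFinD.
    move=> x _; have [xr|xr] := leP `|x| r.
      by rewrite indicE mem_set// mulr1; exact: powR_le_levels.
    have v0 : v x = 0 by rewrite hr// ltW.
    rewrite v0 normr0 powR0// addr_ge0 ?mulr_ge0 ?powR_ge0//.
    by apply: sumr_ge0 => j _; rewrite !mulr_ge0 ?powR_ge0.
  rewrite RintegralD// (Rintegral_sum measurableT)//.
  rewrite mulrDr -addrA; apply: lerD.
    rewrite -RintegralZl//; apply: le_Rintegral => //.
      rewrite (_ : _ \o _ = (fun x => (s `^ p)%:E * (EFin \o (fun x => 1 * \1_[set x : 'rV[R]_n | `|x| <= r] x)%R) x)%E).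
        exact: integrableZl.
      by apply/funext => x; rewrite /= EFinM.
    by move=> x _; rewrite mul1r.
  rewrite (_ : s `^ p * _ + _ = 2 `^ p * (4 * (s `^ p * m0) + X)); last by ring.
  apply: (@le_trans _ _ (2 `^ p * B)); last by rewrite ler_pM2l// powR_gt0.
  rewrite /B mulr_sumr; apply: ler_sum => j _; rewrite RintegralZl//; last first.
    rewrite (_ : _ \o _ = (fun x => ((s * 2 ^+ j) `^ p)%:E * (EFin \o (\1_(level v (s * 2 ^+ j)) : _ -> R)) x)%E).
      by apply: integrableZl => //; exact: integrable_level.
    by apply/funext => x; rewrite /= -EFinM.
  by rewrite RintegralZl//; exact: integrable_level.
have -> : (4 * C2 * grad_sqn v) `^ (p / 2) = 2 `^ p * X.
  have CG0 : 0 <= C2 * grad_sqn v by rewrite mulr_ge0// ltW.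
  rewrite -(mulrA 4 C2) (powRM _ _ CG0)// -/X; congr (_ * _).
  rewrite (_ : 4 = 2 ^+ 2 :> R); last by ring.
  by rewrite -powR_mulrn// -powRrM mulrC divfK.
apply/ler_addgt0Pr => e e0.
set A := m0 + _ in key.
have A0 : 0 <= A by rewrite addr_ge0// !mulr_ge0 ?powR_ge0.
have s0 : 0 < (e / (A + 1)) `^ p^-1 by rewrite powR_gt0// divr_gt0// ltr_wpDl.
have := key _ s0; rewrite powRVK//; last by rewrite divr_ge0 ?(ltW e0)// addr_ge0.
move=> h; apply: le_trans h _; rewrite addrC lerD2l mulrAC ler_pdivrMr ?ltr_wpDl//.
by rewrite ler_pM2l// lerDl.
Qed.

End sobolev_test.

(** * The power function *)

Section abs_power.
Context {R : realType}.
Variable p : R.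
Hypothesis p2 : 2 < p.
Implicit Types (s t a b : R).

Let p0 : 0 < p. Proof. by move: p2; lra. Qed.
Let pn0 : p != 0. Proof. by rewrite gt_eqF. Qed.
Let pm2 : 0 < p - 2. Proof. by rewrite subr_gt0. Qed.

Definition apow t : R := `|t| `^ p.
Definition dapow t : R := `|t| `^ (p - 2) * t.

Lemma apow_ge0 t : 0 <= apow t. Proof. exact: powR_ge0. Qed.
Lemma apow0 : apow 0 = 0. Proof. by rewrite /apow normr0 powR0. Qed.
Lemma apowN t : apow (- t) = apow t. Proof. by rewrite /apow normrN. Qed.
Lemma apowM s t : apow (s * t) = `|s| `^ p * apow t.
Proof. by rewrite /apow normrM powRM. Qed.

Lemma apow_le s t : `|s| <= `|t| -> apow s <= apow t.
Proof. by move=> st; apply: le_powR => //; exact: ltW. Qed.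

Lemma apowD_le s t : apow (s + t) <= 2 `^ p * (apow s + apow t).
Proof.
have key a b : `|a| <= `|b| -> apow (a + b) <= 2 `^ p * (apow a + apow b).
  move=> ab; apply: (@le_trans _ _ (apow (2 * b))).
    apply: apow_le; rewrite normrM ger0_norm//; apply: le_trans (ler_normD _ _) _.
    by rewrite mulr_natl mulr2n lerD2r.
  by rewrite apowM ger0_norm// ler_pM2l ?powR_gt0// lerDr apow_ge0.
have [st|/ltW ts] := leP `|s| `|t|; first exact: key.
by rewrite addrC [apow s + _]addrC; exact: key.
Qed.

Lemma dapow_mul t : dapow t * t = apow t.
Proof.
rewrite /dapow -mulrA -expr2 -(real_normK (num_real t)) -powR_mulrn// -powRD ?subrK//.
by rewrite (gt_eqF p0).
Qed.

Lemma dapowN t : dapow (- t) = - dapow t.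
Proof. by rewrite /dapow normrN mulrN. Qed.

Lemma norm_dapow t : `|dapow t| = `|t| `^ (p - 1).
Proof.
have [->|t0] := eqVneq t 0.
  by rewrite /dapow mulr0 !normr0 powR0//; move: p2; lra.
rewrite /dapow normrM ger0_norm ?powR_ge0// -[X in _ * X](powRr1 (normr_ge0 t)) -powRD.
  by congr (_ `^ _); ring.
by rewrite normr_eq0 t0 implybT.
Qed.

Lemma is_derive_apow t : is_derive t 1 apow (p * dapow t).
Proof.
have pos s : 0 < s -> is_derive s 1 apow (p * dapow s).
  move=> s0; rewrite /dapow.
  have -> : `|s| `^ (p - 2) * s = s `^ (p - 1).
    rewrite gtr0_norm// -[X in _ * X](powRr1 (ltW s0)) -powRD ?(gt_eqF s0) ?implybT//.
    by congr (_ `^ _); ring.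
  apply: (@near_eq_is_derive _ _ _ (fun x => x `^ p)) => //.
  - near=> x; rewrite /apow gtr0_norm//; near: x.
    exact: lt_nbhsr.
  - exact: is_derive1_powR.
have [t0|t0|->] := ltgtP t 0; [|exact: pos|].
- have h : is_derive (-1 * t + 0) 1 apow (p * dapow (- t)).
    by rewrite mulN1r addr0; apply: pos; rewrite oppr_gt0.
  have := is_derive_affine h; rewrite dapowN mulrN mulN1r opprK.
  by congr (is_derive _ _ _ _); apply/funext => s; rewrite mulN1r addr0 apowN.
(* For |h| <= 1 and p > 2 the value |h|^p is below h^2. *)
- apply: (@is_derive_remainder _ _ apow 0 1 _ 1) => h h1.
  rewrite apow0 subr0 /dapow !mulr0 subr0 addr0 mul1r ger0_norm ?apow_ge0//.
  rewrite /apow -[h *: _]/(h * 1) mulr1 -(real_normK (num_real h)) -powR_mulrn//.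
  have [->|h0] := eqVneq h 0; first by rewrite normr0 !powR0// pnatr_eq0.
  by apply: ger_powR; [rewrite normr_gt0 h0|exact: ltW].
Unshelve. all: by end_near. Qed.

Lemma continuous_apow : continuous apow.
Proof. by move=> t; apply/differentiable_continuous/derivable1_diffP; have [] := is_derive_apow t. Qed.

Lemma measurable_apow : measurable_fun setT apow.
Proof.
by apply: (measurableT_comp (measurable_powR p)); exact: (@normr_measurable R setT).
Qed.

Lemma apow_mvt a b : exists2 c, `|c| <= `|a| + `|b| & apow (a + b) - apow a = p * dapow c * b.
Proof.
pose f (h : R) := apow (h * b + a).
have df (h : R) : is_derive h 1 f (b * (p * dapow (h * b + a))).
  have -> : f = (fun h : R => apow (b * h + a)) by apply/funext => x; rewrite /f mulrC.
  by rewrite [h * b]mulrC; exact: is_derive_affine (is_derive_apow _).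
have cf : continuous f by move=> t; apply/differentiable_continuous/derivable1_diffP; have [] := df t.
have [c c01] := MVT_segment (@ler01 R) (fun t _ => df t) (continuous_subspaceT cf).
rewrite /f mul1r mul0r add0r subr0 mulr1 [b + a]addrC => ->.
exists (c * b + a); last by rewrite mulrC.
rewrite addrC; apply: le_trans (ler_normD _ _) _; rewrite lerD2l normrM.
move: c01; rewrite in_itv/= => /andP[c0 c1]; rewrite ger0_norm// ler_piMl//.
Qed.

(* The auxiliary inequality r s <= (r^2 + s^2) / 2 followed by Young's
   inequality r^2 / 2 <= |r|^p / p + 1/2 - 1/p, where w = r t. *)
Lemma apow_nehari s t w :
  (s ^+ 2 - 1) / 2 * apow t + s * (dapow t * (w - s * t)) + p^-1 * apow t - p^-1 * apow w <= 0.
Proof.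
have [->|t0] := eqVneq t 0.
  rewrite apow0 /dapow !(mulr0, mul0r) !add0r oppr_le0 mulr_ge0 ?apow_ge0//.
  by rewrite invr_ge0 ltW.
pose r := w / t; have -> : w = r * t by rewrite /r divfK.
rewrite apowM -mulrBl [dapow t * _]mulrCA dapow_mul.
have young : r ^+ 2 / 2 <= p^-1 * `|r| `^ p + 2^-1 - p^-1.
  have q0 : 0 < p / (p - 2) by rewrite divr_gt0.
  have p20 : 0 < p / 2 by rewrite divr_gt0.
  have := conjugate_powR (sqr_ge0 r) ler01 p20 q0.
  have -> : (r ^+ 2) `^ (p / 2) = `|r| `^ p.
    by rewrite -(real_normK (num_real r)) -powR_mulrn// -powRrM mulrC divfK.
  rewrite mulr1 powR1.
  rewrite mul1r !invf_div (_ : 2 / p + _ = 1); last by field.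
  move=> /(_ erefl); rewrite (_ : _ * (2 / p) = 2 * (p^-1 * `|r| `^ p)); last by field.
  rewrite (_ : (p - 2) / p = 1 - 2 * p^-1); last by field.
  by set X := p^-1 * _; set y := p^-1; move: X y (r ^+ 2) => X y z; lra.
have A0 := apow_ge0 t; have sr := sqr_ge0 (r - s); rewrite sqrrB in sr.
rewrite (_ : _ - _ = apow t * ((s ^+ 2 - 1) / 2 + s * (r - s) + p^-1 - p^-1 * `|r| `^ p)); last by ring.
apply: mulr_ge0_le0 => //.
move: sr young; rewrite mulrBr -expr2 -mulr_natr [r * s]mulrC.
set X := p^-1 * _; set y := p^-1.
by move: X y (r ^+ 2) (s ^+ 2) (s * r) => X y z a b; lra.
Qed.

(** Comparing Y with e X replaces the optimal constant of Young's inequality: in each case one term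
    on the right suffices. *)
Lemma powR_young (e X Y : R) : 0 < e -> 0 <= X -> 0 <= Y ->
  X `^ (p - 1) * Y <= e * X `^ p + e `^ (1 - p) * Y `^ p.
Proof.
move=> e0 X0 Y0; have p1 : 0 <= p - 1 by move: p2; lra.
have h Z : 0 <= Z -> Z `^ (p - 1) * Z = Z `^ p.
  by move=> Z0; rewrite mulrC mulr_powRB1.
have [YX|XY] := leP Y (e * X).
  apply: (@le_trans _ _ (e * X `^ p)); last by rewrite lerDl mulr_ge0 ?powR_ge0.
  by rewrite -h// mulrCA ler_wpM2l ?powR_ge0.
apply: (@le_trans _ _ (e `^ (1 - p) * Y `^ p)); last by rewrite lerDr mulr_ge0 ?powR_ge0 ?ltW.
rewrite -h// mulrA ler_wpM2r//.
have -> : e `^ (1 - p) * Y `^ (p - 1) = (Y / e) `^ (p - 1).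
  rewrite powRM ?invr_ge0 ?(ltW e0)// mulrC; congr (_ * _).
  rewrite -powR_inv1 ?(ltW e0)// -powRrM; congr (_ `^ _); ring.
by apply: le_powR => //; rewrite ler_pdivlMr// mulrC ltW.
Qed.

(** The elementary inequality behind Brezis-Lieb: mean value theorem, then [powR_young] with a
    parameter h for which p 2^p h = e. *)
Lemma apow_BL (e : R) : 0 < e -> exists2 C, 0 < C & forall a b,
  `|apow (a + b) - apow a| <= e * apow a + C * apow b.
Proof.
move=> e0; pose h := e / (p * 2 `^ p).
have P0 : 0 < p * 2 `^ p by rewrite mulr_gt0// powR_gt0.
have h0 : 0 < h by rewrite divr_gt0.
exists (e + p * h `^ (1 - p)).
  by rewrite ltr_pwDl// mulr_ge0 ?powR_ge0 ?(ltW p0).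
move=> a b; have [c cab ->] := apow_mvt a b.
rewrite normrM normrM gtr0_norm// norm_dapow.
have X0 : 0 <= `|a| + `|b| by exact: addr_ge0.
have p1 : 0 <= p - 1 by move: p2; lra.
apply: (@le_trans _ _ (p * ((`|a| + `|b|) `^ (p - 1) * `|b|))).
  by rewrite -mulrA ler_pM2l// ler_wpM2r//; exact: le_powR.
apply: (@le_trans _ _ (p * (h * (`|a| + `|b|) `^ p + h `^ (1 - p) * `|b| `^ p))).
  by rewrite ler_pM2l//; exact: powR_young.
have := apowD_le `|a| `|b|; rewrite {1}/apow ger0_norm// {1 2}/apow !normr_id.
rewrite -/(apow a) -/(apow b) => hab.
rewrite (_ : e * apow a + _ = p * (h * (2 `^ p * (apow a + apow b)) + h `^ (1 - p) * apow b)).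
  by rewrite ler_pM2l// lerD2r ler_pM2l.
rewrite /h; field; by rewrite gt_eqF ?powR_gt0.
Qed.

Lemma dapow_bound s t b : `|s| <= 1 -> `|dapow (t + s * b) * b| <= 2 `^ p * (apow t + apow b) + apow b.
Proof.
move=> s1; have X0 : 0 <= `|t| + `|b| by exact: addr_ge0.
have p1 : 0 <= p - 1 by move: p2; lra.
rewrite normrM norm_dapow.
apply: (@le_trans _ _ ((`|t| + `|b|) `^ (p - 1) * `|b|)).
  rewrite ler_wpM2r//; apply: le_powR => //; apply: le_trans (ler_normD _ _) _.
  by rewrite lerD2l normrM ler_piMl.
apply: le_trans (powR_young ltr01 X0 (normr_ge0 b)) _.
rewrite powR1 !mul1r lerD2r.
by have := apowD_le `|t| `|b|; rewrite /apow ger0_norm// !normr_id.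
Qed.

End abs_power.

Lemma leq_incr (s : nat -> nat) k : (forall k, (s k < s k.+1)%N) -> (k <= s k)%N.
Proof. by move=> hs; elim: k => // k IH; exact: leq_ltn_trans IH (hs k). Qed.

Lemma incr_cvg_oo (s : nat -> nat) : (forall k, (s k < s k.+1)%N) -> s @ \oo --> \oo.
Proof.
move=> hs A [N _ hN]; exists N => // k /= Nk; apply: hN => /=; apply: leq_trans Nk _.
exact: leq_incr.
Qed.

Lemma cvg_sumR (R : realType) I (r : seq I) (P : pred I) (f : I -> nat -> R) (l : I -> R) :
  (forall i, P i -> f i @ \oo --> l i) ->
  (fun k => \sum_(i <- r | P i) f i k) @ \oo --> \sum_(i <- r | P i) l i.
Proof.
move=> h; elim: r => [|i r IH].
  by rewrite big_nil; under eq_fun do rewrite big_nil; exact: cvg_cst.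
rewrite big_cons; under eq_fun do rewrite big_cons.
by case: ifP => Pi //; apply: cvgD => //; exact: h.
Qed.

(** * The best Sobolev constant *)

Section sobolev_constant.
Context {R : realType} {n : nat}.
Hypothesis hn : (3 <= n)%N.
Local Notation mu := (lebesgue_rV R n).
Local Notation V := ('rV[R]_n -> R^o).
Local Notation ip := (ip2 (n := n) setT).
Local Notation p := (crit_exp R n).
Local Notation wp i u := (weak_partial setT i u).
Implicit Types u : V.

Let p0 : 0 < p := crit_exp_gt0 hn.
Let pn0 : p != 0 := crit_exp_neq0 hn.
Let p2 : 2 < p := crit_exp_gt2 hn.
Let L2S := @L2_subspace R n _ measurableT.
Let L2P := @ip2_psd R n _ measurableT.

Definition wgrad_sqn u : R := \sum_i ip (wp i u) (wp i u).

Lemma wgrad_sqn_ge0 u : H1 setT u -> 0 <= wgrad_sqn u.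
Proof. by move=> hu; apply: sumr_ge0 => i _; exact: (form_ge0 L2P (weak_partial_L2 i hu)). Qed.

Lemma wgrad_sqnE u (g : 'I_n -> V) : (forall i, is_weak_partial setT i u (g i)) ->
  wgrad_sqn u = \sum_i ip (g i) (g i).
Proof.
move=> hg; apply: eq_bigr => i _.
have h1 := weak_partial_ae openT (hg i).
have hw : H1 setT u -> L2 setT (wp i u) by move=> /(weak_partial_L2 i).
have Lw : L2 setT (wp i u).
  rewrite /weak_partial; case: xgetP => [h -> [Lh _]//|/(_ (g i))]; by have := hg i.
have Lg : L2 setT (g i) by case: (hg i).
exact: (ip2_ae_eq openT Lw.1 Lw.1 Lg.1 Lg.1 h1 h1).
Qed.

Lemma measurable_powR_norm (D : set 'rV[R]_n) (u : 'rV[R]_n -> R) : measurable D -> measurable_fun D u ->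
  measurable_fun D (fun x => `|u x| `^ p).
Proof. by move=> mD mfu; exact: (measurableT_comp (measurable_apow p) mfu). Qed.

Lemma H1_approx u : H1 setT u -> exists phi : nat -> 'rV[R]_n -> R,
  [/\ forall k, test_fun setT (phi k), {ae mu, forall x, (fun k => phi k x) @ \oo --> u x} &
      (fun k => grad_sqn (phi k)) @ \oo --> wgrad_sqn u].
Proof.
move=> hu.
have /choice[f hf] (k : nat) : exists phi, test_fun setT phi /\
    (ip (u - (phi : V)) (u - (phi : V)) <= k.+1%:R^-1 /\
    forall i, ip (wp i u - (partial i phi : V)) (wp i u - (partial i phi : V)) <= k.+1%:R^-1).
  have [|phi tphi h] := H1_test_fun_dense hu (d := k.+1%:R^-1); first by rewrite invr_gt0.
  by exists phi.
have Lf k : L2 setT (f k) := test_fun_L2 measurableT (hf k).1.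
have inv_small (e : R) : 0 < e -> exists N, forall k, (N <= k)%N -> k.+1%:R^-1 <= e.
  move=> e0; have /cvgrPdist_le/(_ e e0)[N _ hN] := @cvg_harmonic R.
  by exists N => k /hN; rewrite sub0r normrN; exact: le_trans (ler_norm _).
have cf : cvg_form ip (f : nat -> V) u.
  move=> e e0; have [N hN] := inv_small e e0; exists N => k /hN; apply: le_trans.
  by rewrite (form_sqrBC L2S L2P (Lf k) hu.1); case: (hf k) => _ [].
have Lp k i : L2 setT (partial i (f k)) := test_fun_L2 measurableT (test_fun_partial i (hf k).1).
have cp i : cvg_form ip (fun k => partial i (f k) : V) (wp i u).
  move=> e e0; have [N hN] := inv_small e e0; exists N => k /hN; apply: le_trans.
  by rewrite (form_sqrBC L2S L2P (Lp k i) (weak_partial_L2 i hu)); case: (hf k) => _ [].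
have [|s [hs ae]] := @sqn_cvg_subseq_ae _ _ _ mu setT measurableT (fun k => f k) u (fun k => (Lf k).1) hu.1.1.
  move=> e e0; have [N hN] := cf e e0; exists N => k /hN.
  by rewrite -lee_fin -(ip2_sqn (L2B measurableT (Lf k) hu.1)).
exists (fun k => f (s k)); split; first by move=> k; case: (hf (s k)).
  by apply: filterS ae => x; apply.
apply: (@cvg_comp _ _ _ s (fun k => grad_sqn (f k)) _ _ _ (incr_cvg_oo hs)).
apply: (cvg_sumR (f := fun i k => ip (partial i (f k)) (partial i (f k)))) => i _.
exact: (cvg_form_self L2S L2P (Lp^~ i) (weak_partial_L2 i hu) (cp i)).
Qed.

(** Fatou's lemma along approximating test functions, with a slack e in the gradient. Raising to the
    power 2/p makes the bound affine in e before e tends to 0. *)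
Lemma sobolev_transfer (K : R) : 0 <= K -> (forall phi, test_fun setT phi ->
  \int[mu]_x (`|phi x| `^ p) <= (K * grad_sqn phi) `^ (p / 2)) ->
  forall u, H1 setT u -> (\int[mu]_x (`|u x| `^ p)%:E <= ((K * wgrad_sqn u) `^ (p / 2))%:E)%E.
Proof.
move=> K0 hK u hu; have [f [tf ae cf]] := H1_approx hu.
have p20 : 0 < p / 2 by rewrite divr_gt0.
have mfu : measurable_fun setT (fun x => `|u x| `^ p) := measurable_powR_norm measurableT hu.1.1.
have G0 := wgrad_sqn_ge0 hu.
have key (e : R) : 0 < e -> (\int[mu]_x (`|u x| `^ p)%:E <= ((K * (wgrad_sqn u + e)) `^ (p / 2))%:E)%E.
  move=> e0; have /cvgrPdist_le/(_ e e0)[N _ hN] := cf.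
  apply: (@fatou_bound _ _ _ mu setT measurableT (fun k x => `|f (k + N)%N x| `^ p)) => //.
  - move=> k; apply: measurable_powR_norm => //; apply: continuous_measurable_rV.
    by apply: smooth_continuous; case: (tf (k + N)%N).
  - apply: filterS ae => x hx _.
    have hx' : (fun k => f (k + N)%N x) @ \oo --> u x by exact: (cvg_comp _ _ (cvg_addnr N) hx).
    have hc : {for u x, continuous (apow p)} by exact: continuous_apow.
    have h2 : apow p (f (k + N)%N x) @[k --> \oo] --> apow p (u x) by exact: (cvg_comp _ _ hx' hc).
    exact: h2.
  move=> k; have ip' := test_fun_powR_integrable hn (tf (k + N)%N).
  rewrite -[X in (X <= _)%E]fineK ?integrable_fin_num// lee_fin.
  apply: le_trans (hK _ (tf _)) _.
  have g0 := grad_sqn_ge0 (tf (k + N)%N).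
  apply: le_powR; [exact: ltW|by rewrite mulr_ge0|rewrite ler_wpM2l//].
  have := hN (k + N)%N (leq_addl _ _); rewrite distrC => h.
  by rewrite -lerBlDl; apply: le_trans h; exact: ler_norm.
have fin : (\int[mu]_x (`|u x| `^ p)%:E < +oo)%E by apply: le_lt_trans (key 1 ltr01) _; rewrite ltry.
have I0 : (0 <= \int[mu]_x (`|u x| `^ p)%:E)%E.
  by apply: integral_ge0 => x _; rewrite lee_fin powR_ge0.
rewrite -[X in (X <= _)%E]fineK ?ge0_fin_numE// lee_fin.
have {}key (e : R) : 0 < e -> fine (\int[mu]_x (`|u x| `^ p)%:E) <= (K * (wgrad_sqn u + e)) `^ (p / 2).
  by move=> /key; rewrite -[X in (X <= _)%E]fineK ?ge0_fin_numE.
move: I0 => /fine_ge0; move: (fine _) key => I key I0.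
have h : I `^ (2 / p) <= K * wgrad_sqn u.
  apply/ler_addgt0Pr => e e0.
  have e1 : 0 < e / (K + 1) by rewrite divr_gt0// ltr_wpDl.
  have Ke0 : 0 <= K * (wgrad_sqn u + e / (K + 1)) by rewrite mulr_ge0// addr_ge0// ltW.
  have := le_powR (r := 2 / p) _ I0 (key _ e1); rewrite divr_ge0 ?(ltW p0)// => /(_ isT).
  rewrite -powRrM (_ : p / 2 * (2 / p) = 1); last by field.
  rewrite powRr1// => h; apply: le_trans h _; rewrite mulrDr lerD2l.
  by rewrite mulrCA ler_piMr ?(ltW e0)// ler_pdivrMr ?ltr_wpDl// mul1r lerDl.
have := le_powR (r := p / 2) (ltW p20) (powR_ge0 _ _) h.
by rewrite -powRrM (_ : 2 / p * (p / 2) = 1) ?powRr1//; field.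
Qed.

Let SE : set R := [set s | forall u : 'rV[R]_n -> R, H1 setT u ->
    (s%:E * (\int[mu]_x (`|u x| `^ p)%:E) `^ (2 / p) <=
     \int[mu]_x (\sum_(i < n) wp i u x ^+ 2)%:E)%E].
Local Notation S := (sobolev_const R n).

Lemma integral_wgrad u : H1 setT u ->
  (\int[mu]_x (\sum_(i < n) wp i u x ^+ 2)%:E)%E = (wgrad_sqn u)%:E.
Proof.
move=> hu; under eq_integral do rewrite -sumEFin.
rewrite ge0_integral_sum//.
- by rewrite -sumEFin; apply: eq_bigr => i _; exact: (ip2_sqn (weak_partial_L2 i hu)).
- by move=> i; apply: measurable_sqr; case: (weak_partial_L2 i hu).
- by move=> i x _; rewrite lee_fin sqr_ge0.
Qed.

Let SE_of_bound (K : R) : 0 < K -> (forall u, H1 setT u ->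
  (\int[mu]_x (`|u x| `^ p)%:E <= ((K * wgrad_sqn u) `^ (p / 2))%:E)%E) -> SE K^-1.
Proof.
move=> K0 hK u hu; rewrite integral_wgrad//; have := hK u hu.
have I0 : (0 <= \int[mu]_x (`|u x| `^ p)%:E)%E.
  by apply: integral_ge0 => x _; rewrite lee_fin powR_ge0.
have G0 := wgrad_sqn_ge0 hu.
move: I0; case: (\int[mu]_x _)%E => [I I0|_|]//.
rewrite poweR_EFin -EFinM !lee_fin => h; rewrite ler_pdivrMl//.
have KG0 : 0 <= K * wgrad_sqn u by rewrite mulr_ge0// ltW.
have := le_powR (r := 2 / p) _ I0 h; rewrite divr_ge0 ?(ltW p0)// => /(_ isT).
by rewrite -powRrM (_ : p / 2 * (2 / p) = 1) ?powRr1//; field.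
Qed.

Let SE_gt0 : exists2 s, 0 < s & SE s.
Proof.
have [C C0 hC] := @sobolev_test_fun R n hn.
exists C^-1; first by rewrite invr_gt0.
by apply: SE_of_bound => // u hu; exact: (sobolev_transfer (ltW C0) hC).
Qed.

Lemma H1_powR_lty u : H1 setT u -> (\int[mu]_x (`|u x| `^ p)%:E < +oo)%E.
Proof.
move=> hu; have [C C0 hC] := @sobolev_test_fun R n hn.
by apply: le_lt_trans (sobolev_transfer (ltW C0) hC hu) _; rewrite ltry.
Qed.

Let SE_le s u : SE s -> H1 setT u -> s * (\int[mu]_x (`|u x| `^ p)) `^ (2 / p) <= wgrad_sqn u.
Proof.
move=> hs hu; have := hs u hu; rewrite integral_wgrad//.
have I0 : (0 <= \int[mu]_x (`|u x| `^ p)%:E)%E.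
  by apply: integral_ge0 => x _; rewrite lee_fin powR_ge0.
rewrite -[X in (_ * X `^ _)%E]fineK ?ge0_fin_numE ?H1_powR_lty//.
Qed.

Lemma test_fun_powR_gt0 : exists2 phi, test_fun setT phi & 0 < \int[mu]_x (`|phi x| `^ p).
Proof.
have [rho] := @mollifier_exists R n; exists rho; first exact: mker_test.
rewrite lt_neqAle Rintegral_ge0 ?andbT; last by move=> x _; exact: powR_ge0.
apply/eqP => I0; have irho := test_fun_powR_integrable hn (mker_test rho).
have /(ae_eq_integral_abs mu measurableT (measurable_int _ irho)) ae0 :
    (\int[mu]_w `|(EFin \o (fun x => `|rho x|%R `^ p)%R) w| = 0)%E.
  rewrite (eq_integral (EFin \o (fun x => `|rho x|%R `^ p)%R)) => [|w _]; last first.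
    by rewrite /= ger0_norm ?powR_ge0.
  by rewrite -[LHS]fineK ?integrable_fin_num// -[fine _]/(\int[mu]_w (`|rho w| `^ p)) -I0.
have := mker_int rho; rewrite /Rintegral (ae_eq_integral (cst 0%E)) ?integral0//=.
- by move=> h; have := @ltr01 R; rewrite -h ltxx.
- exact: measurable_int (test_fun_integrable (mker_test rho)).
apply: filterS ae0 => x h _; have [h'] := h Logic.I.
by congr EFin; apply/eqP; rewrite -normr_eq0 -(powRK (normr_ge0 (rho x)) pn0) h' powR0// invr_eq0.
Qed.

(** This gives the supremum defining the constant its meaning: the inequality just proved makes the
    set nonempty, and the quotient of one nonzero test function bounds it. *)
Let SE_has_sup : has_sup SE.
Proof.
split; first by have [s _ hs] := SE_gt0; exists s.
have [phi tphi I0] := test_fun_powR_gt0.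
exists (wgrad_sqn phi / (\int[mu]_x (`|phi x| `^ p)) `^ (2 / p)) => s hs.
by rewrite ler_pdivlMr ?powR_gt0//; apply: SE_le => //; exact: (test_fun_H1 openT tphi).
Qed.

Lemma sobolev_const_gt0 : 0 < S.
Proof.
have [s s0 hs] := SE_gt0; apply: lt_le_trans s0 _.
exact: (sup_upper_bound SE_has_sup hs).
Qed.

Lemma sobolev_ineq u : H1 setT u -> S * (\int[mu]_x (`|u x| `^ p)) `^ (2 / p) <= wgrad_sqn u.
Proof.
move=> hu; set I := _ `^ _.
have I0 : 0 <= I by exact: powR_ge0.
apply/ler_addgt0Pr => e e0.
have e1 : 0 < e / (I + 1) by rewrite divr_gt0// ltr_wpDl.
have [s hs sS] := sup_adherent e1 SE_has_sup.
have h := SE_le hs hu; rewrite -/I in h.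
rewrite -/SE -[sup _]/S in sS.
have : S * I <= (s + e / (I + 1)) * I by rewrite ler_wpM2r// -lerBlDr ltW.
move=> h2; apply: le_trans h2 _; rewrite mulrDl; apply: lerD => //.
by rewrite mulrAC ler_pdivrMr ?ltr_wpDl// ler_pM2l// lerDl.
Qed.

(** Without such a test function the inequality with constant S + e would hold for all test
    functions, hence on H^1, against the maximality of S. *)
Lemma sobolev_const_approx (e : R) : 0 < e -> exists2 phi, test_fun setT phi &
  0 < \int[mu]_x (`|phi x| `^ p) /\
  grad_sqn phi <= (S + e) * (\int[mu]_x (`|phi x| `^ p)) `^ (2 / p).
Proof.
move=> e0; apply: contrapT => hno.
have Se0 : 0 < S + e by rewrite addr_gt0// sobolev_const_gt0.
suff : SE (S + e).
  move=> /(@sup_upper_bound _ _ SE_has_sup); rewrite -[sup _]/S leNgt => /negP; apply.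
  by rewrite ltrDl.
rewrite -[S + e]invrK; apply: SE_of_bound; first by rewrite invr_gt0.
move=> u hu; apply: sobolev_transfer => //; first by rewrite invr_ge0 ltW.
move=> phi tphi; set I := \int[mu]_x _.
have [I0|I0] := ltP 0 I; last by apply: le_trans I0 _; exact: powR_ge0.
have h : (S + e) * I `^ (2 / p) <= grad_sqn phi.
  rewrite leNgt; apply/negP => h; apply: hno; exists phi => //; split => //; exact: ltW.
have h2 : I `^ (2 / p) <= (S + e)^-1 * grad_sqn phi by rewrite ler_pdivlMl.
have := le_powR (r := p / 2) _ (powR_ge0 _ _) h2; rewrite divr_ge0 ?(ltW p0)// => /(_ isT).
by rewrite -powRrM (_ : 2 / p * (p / 2) = 1) ?powRr1 ?(ltW I0)//; field.
Qed.

End sobolev_constant.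

(** * Compactness *)

Section ultrafilter_cauchy.
Context {R : realType} (G : set_system nat) (UG : UltraFilter G).

(** Bounded sequences converge along an ultrafilter. One ultrafilter serves all points of space at
    once, so no successive extraction of subsequences is needed. *)
Lemma ultra_bounded_cauchy (u : nat -> R) (B e : R) : (forall k, `|u k| <= B) -> 0 < e ->
  exists2 A, G A & forall j k, A j -> A k -> `|u j - u k| <= e.
Proof.
move=> uB e0; have hc := @segment_compact R (- B) B.
have [|l [_ cl]] := hc (u @ G) _.
  apply: (@filterS _ G _ setT _ _ filterT) => k _ /=.
  by rewrite in_itv/= -ler_norml.
pose A := [set k | `|l - u k| < e / 2].
have e2 : 0 < e / 2 by rewrite divr_gt0.
exists A.
  have [//|GA] := in_ultra_setVsetC A UG.
  have GA' : (u @ G) [set x | e / 2 <= `|l - x|].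
    by apply: (filterS (F := G) _ GA) => k /negP; rewrite -leNgt.
  have [x []] := cl _ _ GA' (nbhsx_ballx l (e / 2) e2).
  by rewrite -ball_normE/= => h1 h2; move: (le_lt_trans h1 h2); rewrite ltxx.
move=> j k; rewrite /A/= => hj hk.
rewrite (_ : u j - u k = (l - u k) - (l - u j)); last by ring.
apply: le_trans (ler_normB _ _) _; lra.
Qed.

Hypothesis Goo : \oo `<=` G.

(** Back from the ultrafilter to a subsequence: s k is taken in the first k + 1 sets, whose
    intersection is large, and beyond its predecessor. *)
Lemma ultra_subsequence (T : nat -> nat -> nat -> Prop) :
  (forall m, exists2 A, G A & forall j k, A j -> A k -> T m j k) ->
  exists s : nat -> nat, (forall k, (s k < s k.+1)%N) /\
    forall m j k, (m <= j)%N -> (m <= k)%N -> T m (s j) (s k).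
Proof.
move=> hT; have /choice[A hA] (m : nat) : exists A, G A /\ forall j k, A j -> A k -> T m j k.
  by have [A GA hA] := hT m; exists A.
have GI m : G [set k | forall i, (i <= m)%N -> A i k].
  elim: m => [|m IH].
    by apply: filterS (hA 0%N).1 => k Ak i; rewrite leqn0 => /eqP ->.
  apply: filterS (filterI IH (hA m.+1).1) => k [h1 h2] i.
  by rewrite leq_eqVlt => /orP[/eqP ->//|]; rewrite ltnS; exact: h1.
have /choice[f hf] (q : nat * nat) : exists k, (q.2 <= k)%N /\ forall i, (i <= q.1)%N -> A i k.
  have Gq : G [set k | (q.2 <= k)%N] by apply: Goo; exact: nbhs_infty_ge.
  by have [k [h1 h2]] := filter_ex (filterI Gq (GI q.1)); exists k.
pose s := fix s k := if k is k'.+1 then f (k'.+1, (s k').+1) else f (0, 0)%N.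
have hs k : (s k < s k.+1)%N by have [] := hf (k.+1, (s k).+1).
have hsA k i : (i <= k)%N -> A i (s k).
  by case: k => [|k] ik; [have [_] := hf (0, 0)%N|have [_] := hf (k.+1, (s k).+1)]; apply.
exists s; split => // m j k mj mk; apply: (hA m).2; exact: hsA.
Qed.

End ultrafilter_cauchy.

Section rellich.
Context {R : realType} {n : nat}.
Local Notation mu := (lebesgue_rV R n).
Local Notation V := ('rV[R]_n -> R^o).
Local Notation ip := (ip2 (n := n) setT).
Implicit Types u v : V.

Let L2S := @L2_subspace R n _ measurableT.
Let L2P := @ip2_psd R n _ measurableT.

Let norm4 (y1 x1 x2 y2 e : R) : 0 < e -> `|y1 - x1| <= e -> `|x1 - x2| <= e ->
  `|y2 - x2| <= e -> `|y1 - y2| <= 4 * e.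
Proof.
move=> e0 h1 h2 h3.
rewrite (_ : y1 - y2 = (y1 - x1) + (x1 - x2) - (y2 - x2)); last by ring.
apply: le_trans (ler_normB _ _) _; apply: le_trans (lerD (ler_normD _ _) (lexx _)) _; lra.
Qed.

Let rellich_arith (q1 q2 q3 q4 a b c e : R) : 2 * (q1 - q2) <= 2^-1 * q1 + 2 * q4 ->
  2 * q2 <= 2^-1 * q1 + 2 * q3 -> q4 <= c -> c <= 4 * a -> q3 <= b -> 16 * b <= e ->
  16 * a <= e -> 0 < e -> q1 <= e.
Proof. lra. Qed.

Lemma grad_sqnB U phi psi : test_fun U phi -> test_fun U psi ->
  grad_sqn (phi - (psi : V) : V) <= 2 * grad_sqn phi + 2 * grad_sqn psi.
Proof.
move=> t1 t2; rewrite /grad_sqn.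
have La i : L2 setT (partial i phi) := test_fun_L2 measurableT (test_fun_partial i t1).
have Lb i : L2 setT (partial i psi) := test_fun_L2 measurableT (test_fun_partial i t2).
have -> : 2 * (\sum_i ip (partial i phi) (partial i phi)) + 2 * (\sum_i ip (partial i psi) (partial i psi)) =
    \sum_i (2 * ip (partial i phi) (partial i phi) + 2 * ip (partial i psi) (partial i psi)).
  by rewrite big_split; congr (_ + _); exact: mulr_sumr.
apply: ler_sum => i _.
have -> : (partial i (phi - (psi : V) : V) : V) = (partial i phi : V) - (partial i psi : V).
  apply/funext => x; apply: partialE.
  exact: (is_deriveB (smooth_is_derive i x t1.1) (smooth_is_derive i x t2.1)).
have := form_sqrD_le L2S L2P (La i) (subspaceN L2S (Lb i)).
by rewrite (formNl L2P (Lb i) (subspaceN L2S (Lb i))) (formNr L2P (Lb i) (Lb i)) opprK.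
Qed.

(** Mollified at a fixed small scale the functions are bounded and equi-Lipschitz, hence Cauchy
    along an ultrafilter uniformly on a box, while the mollification error is uniformly small by the
    gradient bound. *)
Lemma rellich_test (r M : R) (phi : nat -> 'rV[R]_n -> R) : 
  (forall k, test_fun setT (phi k)) -> (forall k x, r < `|x| -> phi k x = 0) ->
  (forall k, ip (phi k) (phi k) <= M) -> (forall k, grad_sqn (phi k) <= M) ->
  exists s : nat -> nat, (forall k, (s k < s k.+1)%N) /\
    cauchy_form ip (fun k => phi (s k) : V).
Proof.
move=> tphi sphi hM hG.
have M0 : 0 <= M by apply: le_trans (hG 0%N); exact: (grad_sqn_ge0 (tphi 0%N)).
have [rho] := @mollifier_exists R n.
have [G [UG Goo]] := ultraFilterLemma eventually_filter.
have Lp k : L2 setT (phi k) := test_fun_L2 measurableT (tphi k).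
suff key (e : R) : 0 < e -> exists2 A, G A & forall j k, A j -> A k ->
    ip (phi j - (phi k : V) : V) (phi j - (phi k : V) : V) <= e.
  have [|s [hs hT]] := ultra_subsequence UG Goo (T := fun m j k =>
      ip (phi j - (phi k : V) : V) (phi j - (phi k : V) : V) <= m.+1%:R^-1).
    by move=> m; apply: key; rewrite invr_gt0.
  exists s; split => // e e0.
  have /cvgrPdist_le/(_ e e0)[N _ hN] := @cvg_harmonic R.
  exists N => j k jN kN; apply: le_trans (hT N _ _ jN kN) _.
  have := hN N (leqnn N); rewrite sub0r normrN; exact: le_trans (ler_norm _).
move=> e0.
have hd0 : 0 < 16 * (n%:R * M) + e by rewrite ltr_wpDl// !mulr_ge0.
(* This scale gives 16 n d^2 M <= e; the summand e in the denominator covers M = 0. *)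
pose d := Num.sqrt (e / (16 * (n%:R * M) + e)).
have d0 : 0 < d by rewrite sqrtr_gt0 divr_gt0.
have hd : 16 * (n%:R * d ^+ 2 * M) <= e.
  rewrite sqr_sqrtr ?divr_ge0 ?(ltW e0) ?(ltW hd0)//.
  rewrite [n%:R * _ * M]mulrAC !mulrA -[16 * n%:R * M]mulrA.
  by rewrite ler_pdivrMr// mulrC ler_pM2l// lerDl ltW.
pose psi k := mollify rho d (phi k).
have tk := scaled_ker_test rho d0.
have [K K0 hK] : exists2 K, 0 < K & forall k x w, `|psi k (w + x) - psi k x| ^+ 2 <= K * `|w| ^+ 2.
  exists (M * (n%:R * grad_sqn (scaled_ker rho d)) + 1).
    by rewrite ltr_wpDl// mulr_ge0// mulr_ge0 ?(grad_sqn_ge0 tk).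
  move=> k x w; rewrite real_normK ?num_real//.
  apply: le_trans (conv_lipschitz w x tk (Lp k)) _.
  have wG : 0 <= n%:R * `|w| ^+ 2 * grad_sqn (scaled_ker rho d).
    by rewrite mulr_ge0 ?(grad_sqn_ge0 tk)// mulr_ge0// sqr_ge0.
  apply: le_trans (ler_wpM2r wG (hM k)) _; rewrite mulrDl mul1r.
  rewrite (_ : M * _ * `|w| ^+ 2 = M * (n%:R * `|w| ^+ 2 * grad_sqn (scaled_ker rho d))); last by ring.
  by rewrite lerDl sqr_ge0.
pose ball_r := [set x : 'rV[R]_n | `|x| <= r].
pose vol := fine (mu ball_r).
have vol0 : 0 <= vol by rewrite fine_ge0.
have [eta eta0 heta] : exists2 eta : R, 0 < eta & 16 * (4 * eta) ^+ 2 * vol <= e.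
  have h0 : 0 < 16 * vol + e by rewrite ltr_wpDl// mulr_ge0.
  exists (Num.sqrt (e / (16 * vol + e)) / 4); first by rewrite divr_gt0// sqrtr_gt0 divr_gt0.
  rewrite mulrC [4 * _]mulrC divfK// sqr_sqrtr ?divr_ge0 ?(ltW e0) ?(ltW h0)//.
  rewrite mulrCA mulrA mulrA.
  by rewrite ler_pdivrMr// mulrC ler_pM2l// lerDl ltW.
have [A GA hA] : exists2 A, G A & forall j k x, A j -> A k -> ball_r x -> `|psi j x - psi k x| <= 4 * eta.
  pose P (q : nat * nat) x := `|psi q.1 x - psi q.2 x| <= 4 * eta.
  (* Compactness of the box turns pointwise Cauchy estimates, valid near each point by the common
     Lipschitz bound, into one set of indices for the whole box. *)
  have cov : near_covering (cbox (const_mx (- r)) (const_mx r) : set 'rV[R]_n).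
    by apply/compact_near_coveringP; exact: compact_cbox.
  have [|[A1 A2] [/= GA1 GA2] hA] := cov _ (filter_prod G G) P _.
    move=> x _.
    have [|A GA hA] := ultra_bounded_cauchy UG (u := psi ^~ x) (B := Num.sqrt M * Num.sqrt (ip (scaled_ker rho d) (scaled_ker rho d))) _ eta0.
      move=> k; apply: le_trans (form_CS_abs L2S L2P (Lp k) (translate_L2 (- x) (test_fun_L2 measurableT tk))) _.
      have Lk := test_fun_L2 measurableT tk.
      by rewrite (ip2_translate _ Lk Lk) ler_wpM2r ?sqrtr_ge0// ler_wsqrtr.
    have c0 : 0 < eta / (K + 1) by rewrite divr_gt0// addr_gt0.
    have lip k y : ball x (Num.min eta (eta / (K + 1))) y -> `|psi k y - psi k x| <= eta.
      rewrite -ball_normE/= => /ltW; rewrite le_min => /andP[xy1 xy2].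
      rewrite -ler_sqr ?nnegrE ?(ltW eta0)//.
      have := hK k x (y - x); rewrite subrK => h; apply: le_trans h _.
      have h2 : `|y - x| ^+ 2 <= eta / (K + 1) * eta.
        by rewrite expr2 distrC; apply: ler_pM.
      apply: le_trans (ler_wpM2l (ltW K0) h2) _.
      rewrite mulrA expr2 ler_pM2r// mulrA ler_pdivrMr ?addr_gt0// mulrC ler_pM2l//.
      by rewrite lerDl.
    have m0 : 0 < Num.min eta (eta / (K + 1)) by rewrite lt_min eta0.
    exists (ball x (Num.min eta (eta / (K + 1))), A `*` A).
      split; first exact: nbhsx_ballx.
      by exists (A, A) => //; split.
    move=> [y [j k]] /= [xy [Aj Ak]]; rewrite /P/=.
    exact: (norm4 eta0 (lip j y xy) (hA j k Aj Ak) (lip k y xy)).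
  exists (A1 `&` A2); first exact: filterI.
  move=> j k x [Aj _] [_ Ak] xr; apply: (hA (j, k)) => //= i.
  by rewrite !mxE -ler_norml; apply: le_trans (ler_coord_norm x i) xr.
exists A => // j k Aj Ak.
pose D : V := phi j - (phi k : V).
have tD : test_fun setT D.
  have := test_funD (tphi j) (test_funZ (-1) (tphi k)).
  by congr (test_fun _ _); apply/funext => x; rewrite mulN1r.
have LD : L2 setT D := test_fun_L2 measurableT tD.
have DE : mollify rho d D = psi j - (psi k : V) by exact: mollifyB.
have [LM _] := mollify_L2 rho d0 LD.
have gD : grad_sqn D <= 4 * M.
  apply: le_trans (grad_sqnB (tphi j) (tphi k)) _.
  apply: (@le_trans _ _ (2 * M + 2 * M)); last by lra.
  by apply: lerD; rewrite ler_pM2l.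
have mb : measurable ball_r := measurable_norm_ball r.
(* D vanishes outside the ball, so pairing it with its mollification sees only the part in the ball,
   where the uniform bound holds. *)
pose h : V := fun x => \1_ball_r x * mollify rho d D x.
have h1 x : `|\1_ball_r x : R| <= 1 by rewrite indicE; case: (_ \in _); rewrite ?normr1 ?normr0.
have [Lh _] := ip2_bmul_le (measurable_indic mb) h1 LM.
have hDh : ip D (mollify rho d D) = ip D h.
  rewrite !ip2E; apply: eq_Rintegral => x _; rewrite /h.
  have [xr|xr] := leP `|x| r; first by rewrite indicE mem_set// mul1r.
  by rewrite /D -[(_ - _) x]/(phi j x - phi k x) !sphi// subrr !mul0r.
have nind x : r < `|x| -> \1_ball_r x = 0 :> R.
  by move=> xr; rewrite indicE memNset// => /(lt_le_trans xr); rewrite ltxx.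
have hh : ip h h <= (4 * eta) ^+ 2 * vol.
  apply: bsupp_L2_le; first exact: Lh.1.
    move=> x; rewrite /h; have [xr|xr] := leP `|x| r.
      by rewrite indicE mem_set// mul1r DE; exact: hA.
    rewrite (nind x xr) mul0r normr0; move: eta0; lra.
  by move=> x xr; rewrite /h (nind x xr) mul0r.
have LDM := L2B measurableT LD LM.
have y1 := form_young L2S L2P (t := 2^-1) _ LD LDM.
have y2 := form_young L2S L2P (t := 2^-1) _ LD Lh.
have hX := mollify_test_dist rho d0 tD.
rewrite (form_sqrBC L2S L2P LM LD) in hX.
have hX2 : n%:R * d ^+ 2 * grad_sqn D <= n%:R * d ^+ 2 * (4 * M).
  by rewrite ler_wpM2l// mulr_ge0// sqr_ge0.
rewrite invr_gt0 in y1 y2; have {}y1 := y1 (ltr0n R 2); have {}y2 := y2 (ltr0n R 2).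
rewrite (formBr L2S L2P LD LM LD) hDh invrK in y1; rewrite invrK in y2.
rewrite (_ : n%:R * d ^+ 2 * (4 * M) = 4 * (n%:R * d ^+ 2 * M)) in hX2; last by rewrite mulrCA.
rewrite -(mulrA 16) in heta.
exact: (rellich_arith y1 y2 hX hX2 hh heta hd e0).
Qed.

End rellich.

Section rellich_H10.
Context {R : realType} {n : nat}.
Local Notation mu := (lebesgue_rV R n).
Local Notation V := ('rV[R]_n -> R^o).
Variables (U : set 'rV[R]_n) (oU : open U).
Let mU : measurable U := open_measurable_rV oU.
Implicit Types u v : V.

Lemma test_fun_out phi x : test_fun U phi -> ~ U x -> phi x = 0 :> R.
Proof. by move=> [_ [K [_ KU] h]] nU; apply: h => /KU. Qed.

Lemma ip2_test_fun (phi : V) v : test_fun U phi -> ip2 U phi v = ip2 setT phi v.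
Proof.
move=> tphi; rewrite !ip2E [RHS](Rintegral_supp (subsetT U))// => x _ nU.
by rewrite (test_fun_out tphi nU) mul0r.
Qed.

Lemma weak_partial_test_fun i phi : test_fun U phi ->
  ae_eq_on U (weak_partial U i phi) (partial i phi).
Proof. by move=> tphi; apply: weak_partial_ae => //; exact: test_fun_is_weak_partial. Qed.

Lemma dot1_test_fun phi : test_fun U phi -> dot_a U (cst 1) phi phi = grad_sqn phi.
Proof.
move=> tphi; have hphi := test_fun_H1 oU tphi; rewrite dot1E//; apply: eq_bigr => i _.
have tp := test_fun_partial i tphi; rewrite -ip2_test_fun//.
have e := weak_partial_test_fun i tphi.
have w := weak_partial_L2 i hphi; have w' := test_fun_L2 mU tp.
exact: (ip2_ae_eq oU w.1 w.1 w'.1 w'.1 e e).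
Qed.

Let le_of_dist (x a b M t : R) : x <= 2 * a + 2 * b -> a < t -> b <= M -> t <= 1 -> x <= 2 * M + 2.
Proof. lra. Qed.

Let lt_third (x y a b c e : R) : x <= 2 * a + 2 * y -> y <= 2 * b + 2 * c ->
  a <= e / 16 -> b <= e / 16 -> c <= e / 16 -> 0 < e -> x <= e.
Proof. lra. Qed.

Theorem rellich_H10 (r M : R) (u_ : nat -> V) : (forall x, U x -> `|x| <= r) ->
  (forall k, H10 U (u_ k)) -> (forall k, ipH1 U (u_ k) (u_ k) <= M) ->
  exists s : nat -> nat, (forall k, (s k < s k.+1)%N) /\
    cauchy_form (ip2 U) (fun k => u_ (s k)).
Proof.
move=> Ur hu hM; have S1 := H1_subspace oU; have P1 := ipH1_psd oU.
have S2 := L2_subspace mU; have P2 := ip2_psd mU.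
have hu1 k : H1 U (u_ k) by case: (hu k).
have /choice[f hf] (k : nat) : exists phi, test_fun U phi /\
    ipH1 U (u_ k - (phi : V)) (u_ k - (phi : V)) < k.+1%:R^-1.
  have /H10P[//|_ /(_ k.+1%:R^-1)[|phi tphi h]] := hu k; first by rewrite invr_gt0.
  by exists phi.
have tf k : test_fun U (f k) := (hf k).1.
have tfT k : test_fun setT (f k) := test_funS (subsetT U) (tf k).
have hf1 k : H1 U (f k) := test_fun_H1 oU (tf k).
have fM k : ipH1 U (f k) (f k) <= 2 * M + 2.
  have := form_sqrD_le S1 P1 (subspaceB S1 (hf1 k) (hu1 k)) (hu1 k).
  rewrite subrK (form_sqrBC S1 P1 (hf1 k) (hu1 k)) => h.
  by apply: (le_of_dist h (hf k).2 (hM k)); rewrite invf_le1// ler1n.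
have g0 k : 0 <= dot_a U (cst 1) (f k) (f k) := form_ge0 (dot1_psd oU) (hf1 k).
have i0 k : 0 <= ip2 U (f k) (f k) := form_ge0 P2 (hf1 k).1.
have [||||s [hs cs]] := @rellich_test R n r (2 * M + 2) f.
- exact: tfT.
- move=> k x xr; apply: (test_fun_out (tf k)) => /Ur; rewrite leNgt xr//.
- by move=> k; rewrite -ip2_test_fun//; apply: le_trans (fM k); rewrite lerDl.
- by move=> k; rewrite -dot1_test_fun//; apply: le_trans (fM k); rewrite lerDr.
exists s; split => // e e0.
have e16 : 0 < e / 16 by rewrite divr_gt0.
have [N1 hN1] := cs _ e16.
have /cvgrPdist_le/(_ _ e16)[N2 _ hN2] := @cvg_harmonic R.
have sk k := leq_incr k hs.
have small k : (N2 <= k)%N -> ip2 U (u_ (s k) - (f (s k) : V)) (u_ (s k) - (f (s k) : V)) <= e / 16.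
  move=> kN; have h := hN2 (s k) (leq_trans kN (sk k)); rewrite sub0r normrN in h.
  apply: le_trans (le_trans (ler_norm _) h); apply: le_trans (ltW (hf (s k)).2).
  by rewrite lerDl; apply: (form_ge0 (dot1_psd oU)); exact: (subspaceB S1).
exists (N1 + N2)%N => j k jN kN.
have jN1 := leq_trans (leq_addr _ _) jN; have kN1 := leq_trans (leq_addr _ _) kN.
have jN2 := leq_trans (leq_addl _ _) jN; have kN2 := leq_trans (leq_addl _ _) kN.
have d1 := form_dist_le S2 P2 (hu1 (s j)).1 (hf1 (s j)).1 (hu1 (s k)).1.
have d2 := form_dist_le S2 P2 (hf1 (s j)).1 (hf1 (s k)).1 (hu1 (s k)).1.
have h3 := small k kN2; rewrite (form_sqrBC S2 P2 (hu1 (s k)).1 (hf1 (s k)).1) in h3.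
have h2 := hN1 j k jN1 kN1; rewrite -ip2_test_fun in h2; last first.
  have := test_funD (tf (s j)) (test_funZ (-1) (tf (s k))).
  by congr (test_fun _ _); apply/funext => x; rewrite mulN1r.
exact: (lt_third d1 d2 (small j jN2) h2 h3 e0).
Qed.

End rellich_H10.

Lemma cvg_seq_ge (R : realType) (u : nat -> R) (a c : R) : u @ \oo --> a ->
  (forall k, c <= u k) -> c <= a.
Proof.
move=> ua cu; rewrite -(cvg_lim (@Rhausdorff R) ua).
by apply: limr_ge; [apply/cvg_ex; exists a|exact: nearW].
Qed.

Lemma cvg_seq_le (R : realType) (u : nat -> R) (a c : R) : u @ \oo --> a ->
  (forall k, u k <= c) -> a <= c.
Proof.
move=> ua uc; rewrite -lerN2; apply: (cvg_seq_ge (u := fun k => - u k)); first exact: cvgN.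
by move=> k; rewrite lerN2.
Qed.

(** * Weak compactness from completeness *)

Section weak_compactness.
Context {R : realType} {V : lmodType R}.
Variables (H : set V) (A B : V -> V -> R).
Hypotheses (HS : subspace_like H) (HA : psd_form H A) (HB : psd_form H B).
Local Notation E := (fun u v => B u v + A u v).
Hypothesis HE : complete_form H E.
Hypothesis null_AB : forall u, H u -> B u u = 0 -> A u u = 0.
Hypothesis compactB : forall (u_ : nat -> V) (M : R), (forall k, H (u_ k)) ->
  (forall k, E (u_ k) (u_ k) <= M) ->
  exists s : nat -> nat, (forall k, (s k < s k.+1)%N) /\ cauchy_form B (fun k => u_ (s k)).

Let PE : psd_form H E. Proof. exact: psd_formD. Qed.

(** Dyadic convex combinations only: the parallelogram identity asks for no more than midpoints. *)
Inductive midpoint_hull (P : set V) : V -> Prop :=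
| hull_point u : P u -> midpoint_hull P u
| hull_mid u v : midpoint_hull P u -> midpoint_hull P v -> midpoint_hull P (2^-1 *: (u + v)).

Lemma midpoint_hull_sub (P Q : set V) : P `<=` Q ->
  (forall u v, Q u -> Q v -> Q (2^-1 *: (u + v))) -> midpoint_hull P `<=` Q.
Proof. by move=> PQ hQ w; elim => [u /PQ//|u v _ Qu _ Qv]; exact: hQ. Qed.

Let HM u v : H u -> H v -> H (2^-1 *: (u + v)).
Proof. by move=> hu hv; apply: (subspaceZ HS); exact: (subspaceD HS). Qed.

Let mid_sqr (D : V -> V -> R) (PD : psd_form H D) u v (e : R) : H u -> H v -> D u u <= e -> D v v <= e ->
  D (2^-1 *: (u + v)) (2^-1 *: (u + v)) <= e.
Proof.
move=> hu hv ue ve; have := form_parallelogram HS PD hu hv.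
have := form_ge0 PD (subspaceB HS hu hv).
by move: (D (u - v) _) (D (2^-1 *: _) _) => x y; lra.
Qed.

(* The limit is reached by almost minimal points of the midpoint hulls of the
   tails, which form a Cauchy sequence by the parallelogram identity. *)
Lemma hull_limit (u_ : nat -> V) (M : R) : (forall k, H (u_ k)) ->
  (forall k, E (u_ k) (u_ k) <= M) ->
  exists u (w_ : nat -> V), [/\ H u, cvg_form E w_ u, (forall k, H (w_ k)) &
    forall N, midpoint_hull [set w | exists2 k, (N <= k)%N & w = u_ k] (w_ N)].
Proof.
move=> hu uM; pose P N := [set w | exists2 k, (N <= k)%N & w = u_ k].
have hP N : midpoint_hull (P N) `<=` H.
  by apply: midpoint_hull_sub => // w [k _ ->].
have hPN N N' : (N <= N')%N -> midpoint_hull (P N') `<=` midpoint_hull (P N).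
  move=> NN; apply: midpoint_hull_sub => [w [k kN ->]|]; last exact: hull_mid.
  by apply: hull_point; exists k => //; exact: leq_trans kN.
pose X N := [set E w w | w in midpoint_hull (P N)].
have X0 N : has_inf (X N).
  split; first by exists (E (u_ N) (u_ N)), (u_ N) => //; apply: hull_point; exists N.
  by exists 0 => _ [w /hP hw <-]; exact: (form_ge0 PE).
pose d N := inf (X N).
have /choice[w hw] N : exists w, midpoint_hull (P N) w /\ E w w < d N + N.+1%:R^-1.
  have [|_ [w hw <-] h] := inf_adherent (eps := N.+1%:R^-1) _ (X0 N); first by rewrite invr_gt0.
  by exists w.
have dle N v : midpoint_hull (P N) v -> d N <= E v v.
  by move=> hv; apply: (inf_lbound (X0 N).2); exists v.
have dmono : {homo d : a b / (a <= b)%N >-> a <= b}.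
  move=> a b ab; apply: lb_le_inf; first exact: (X0 b).1.
  by move=> _ [v hv <-]; apply: dle; exact: hPN hv.
have dM N : d N <= M by apply: le_trans (uM N); apply: dle; apply: hull_point; exists N.
have cd : cvgn d.
  by apply: nondecreasing_is_cvgn => //; exists M => _ [N _ <-].
have Hw N : H (w N) by apply: (hP N); exact: (hw N).1.
have cw : cauchy_form E w.
  apply: (@cauchy_form_minimizing R V H E HS PE d (limn d) w _ Hw cd).
  - move=> k j kj; apply: dle; apply: hull_mid; first exact: (hw k).1.
    exact: hPN kj _ (hw j).1.
  - by move=> k; apply: ltW; exact: (hw k).2.
have [u Hu cu] := HE Hw cw.
by exists u, w; split => // N; exact: (hw N).1.
Qed.

(** A B-Cauchy subsequence has a hull limit u. If A(u_k, v) stayed away from A(u, v) along some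
    indices, the hulls of those terms would have a limit u' with A(u', v) different from A(u, v);
    but u and u' are the same B-limit, so u - u' is null for B and hence for A. *)
Lemma weak_compactness (u_ : nat -> V) (M : R) : (forall k, H (u_ k)) ->
  (forall k, E (u_ k) (u_ k) <= M) ->
  exists (s : nat -> nat) (u : V), [/\ forall k, (s k < s k.+1)%N, H u,
    cvg_form B (fun k => u_ (s k)) u &
    forall v, H v -> (fun k => A (u_ (s k)) v) @ \oo --> A u v].
Proof.
move=> hu uM; have [s [hs cs]] := compactB hu uM.
pose v_ k := u_ (s k).
have hv k : H (v_ k) by exact: hu.
have vM k : E (v_ k) (v_ k) <= M by exact: uM.
(* Balls of the form B are convex, so points in the hulls of the tails stay close to the Cauchy
   sequence itself, also when only the indices f k are used. *)
have Bc (f : nat -> nat) : (forall k, (k <= f k)%N) -> forall u w_, H u -> cvg_form E w_ u -> (forall k, H (w_ k)) ->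
    (forall N, midpoint_hull [set w | exists2 k, (N <= k)%N & w = v_ (f k)] (w_ N)) -> cvg_form B v_ u.
  move=> fk u w_ Hu cw Hw hw e e0; have e4 : 0 < e / 4 by rewrite divr_gt0.
  have [N1 hN1] := cs _ e4; have [N2 hN2] := cw _ e4.
  exists N1 => k kN1; pose N := maxn N1 N2.
  have h1 : B (w_ N - v_ k) (w_ N - v_ k) <= e / 4.
    suff /(_ _ (hw N)) [] : midpoint_hull [set w | exists2 k, (N <= k)%N & w = v_ (f k)] `<=`
      [set w | H w /\ B (w - v_ k) (w - v_ k) <= e / 4] by [].
    apply: midpoint_hull_sub.
      move=> _ [j jN ->]; split => //; apply: hN1 => //.
      by apply: leq_trans (fk j); apply: leq_trans jN; exact: leq_maxl.
    move=> a b [Ha ha] [Hb hb]; split; first exact: HM.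
    have -> : 2^-1 *: (a + b) - v_ k = 2^-1 *: ((a - v_ k) + (b - v_ k)).
      rewrite [in RHS]addrACA -opprD [RHS]scalerBr; congr (_ - _).
      by rewrite -[v_ k + v_ k]mulr2n -[v_ k *+ 2]scaler_nat scalerA mulVf// scale1r.
    by apply: mid_sqr => //; exact: (subspaceB HS).
  have h2 : B (w_ N - u) (w_ N - u) <= e / 4.
    apply: le_trans (hN2 N (leq_maxr _ _)); rewrite lerDl.
    exact: (form_ge0 HA (subspaceB HS (Hw N) Hu)).
  have := form_dist_le HS HB (hv k) (Hw N) Hu.
  rewrite (form_sqrBC HS HB (hv k) (Hw N)); move: h1 h2.
  by move: (B _ _) (B _ _) (B _ _) => x y z; lra.
have idk (k : nat) : (k <= id k)%N by [].
have [u [w_ [Hu cw Hw hw]]] := hull_limit hv vM.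
have cB := Bc id idk u w_ Hu cw Hw hw.
exists s, u; split => // v Hv.
have key v' (e : R) : H v' -> 0 < e ->
    ~ (forall N, exists k, (N <= k)%N /\ A u v' + e <= A (v_ k) v').
  move=> Hv' e0 /choice[g hg].
  have [u' [w' [Hu' cw' Hw' hw']]] := hull_limit (fun k => hv (g k)) (fun k => vM (g k)).
  have cB' := Bc g (fun k => (hg k).1) u' w' Hu' cw' Hw' hw'.
  have cA' : cvg_form A w' u'.
    move=> d d0; have [N hN] := cw' d d0; exists N => k /hN; apply: le_trans.
    by rewrite lerDr; exact: (form_ge0 HB (subspaceB HS (Hw' k) Hu')).
  have lA := cvg_form_linear HS HA Hw' Hu' Hv' cA'.
  have wA N : A u v' + e <= A (w' N) v'.
    suff /(_ _ (hw' N)) [] : midpoint_hull [set w | exists2 k, (N <= k)%N & w = v_ (g k)] `<=`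
      [set w | H w /\ A u v' + e <= A w v'] by [].
    apply: midpoint_hull_sub.
      by move=> _ [j jN ->]; split => //; exact: (hg j).2.
    move=> a b [Ha ha] [Hb hb]; split; first exact: HM.
    rewrite (formZl HA) ?(formDl HA)//; last exact: (subspaceD HS).
    by move: ha hb; move: (A a _) (A b _) (A u _) => x y z; lra.
  have h : A u v' + e <= A u' v'.
    exact: (cvg_seq_ge lA wA).
  have Huu := subspaceB HS Hu Hu'.
  have B0 : B (u - u') (u - u') = 0.
    apply/eqP; rewrite eq_le (form_ge0 HB Huu) andbT; apply/ler_addgt0Pr => d d0; rewrite add0r.
    have d4 : 0 < d / 4 by rewrite divr_gt0.
    have [N1 hN1] := cB _ d4; have [N2 hN2] := cB' _ d4.
    have k1 := hN1 _ (leq_maxl N1 N2); have k2 := hN2 _ (leq_maxr N1 N2).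
    have := form_dist_le HS HB Hu (hv (maxn N1 N2)) Hu'.
    rewrite (form_sqrBC HS HB Hu (hv _)); rewrite -/(v_ (maxn N1 N2)) in k1.
    by move: k1 k2; move: (B _ _) (B _ _) (B _ _) => x y z; lra.
  have := form_null HS HA Huu Hv' (null_AB Huu B0).
  rewrite (formBl HS HA)//; move: h e0; move: (A u _) (A u' _) => x y; lra.
apply/cvgrPdist_le => e e0; apply: contrapT => hno.
have io : forall N, exists k, (N <= k)%N /\ e < `|A u v - A (v_ k) v|.
  move=> N; apply: contrapT => h; apply: hno; exists N => // k /= Nk; rewrite leNgt; apply/negP => hk.
  by apply: h; exists k.
have /existsNP[N1 h1] := key v e Hv e0.
(* [key] excludes deviations from above; deviations from below are those from above for -v. *)
apply: (key (- v) e (subspaceN HS Hv) e0) => N2.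
have [k [Nk hk]] := io (maxn N1 N2); exists k; split; first by apply: leq_trans Nk; exact: leq_maxr.
rewrite !(formNr HA)//.
have [h|h] := leP (A u v + e) (A (v_ k) v).
  by exfalso; apply: h1; exists k; split => //; apply: leq_trans Nk; exact: leq_maxl.
move: hk h; rewrite ltr_normr; move: (A u v) (A (v_ k) v) => x y /orP[]; lra.
Qed.

End weak_compactness.

(** * Eigenvalues *)

Section span_null.
Context {R : realType} {V : lmodType R}.
Variables (H : set V) (B : V -> V -> R).
Hypotheses (HS : subspace_like H) (HB : psd_form H B).
Implicit Types (f g : nat -> V).

Lemma form_nullD u v : H u -> H v -> B u u = 0 -> B v v = 0 -> B (u + v) (u + v) = 0.
Proof. by move=> hu hv u0 v0; rewrite (form_sqrD HS HB)// u0 v0 (form_null HS HB hu hv u0) mulr0 !addr0. Qed.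

Lemma form_nullZ c u : H u -> B u u = 0 -> B (c *: u) (c *: u) = 0.
Proof. by move=> hu u0; rewrite (form_sqrZ HS HB)// u0 mulr0. Qed.

Lemma form0 : B 0 0 = 0. Proof. exact: (form0l HS HB (subspace0 HS)). Qed.

(** The span of the first m vectors together with all elements of B-norm zero, the abstract form of
    equality almost everywhere. *)
Definition span_null g m : set V := [set z | H z /\ exists k : nat -> R,
  B (z - \sum_(j < m) k j *: g j) (z - \sum_(j < m) k j *: g j) = 0].

Section span.
Variable g : nat -> V.
Hypothesis hg : forall j, H (g j).

Lemma lincomb_H m (k : nat -> R) : H (\sum_(j < m) k j *: g j).
Proof. by apply: (subspace_sum HS) => j _; exact: (subspaceZ HS). Qed.

Lemma span_nullS m z : span_null g m.+1 z <-> H z /\ exists c, span_null g m (z - c *: g m).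
Proof.
split=> -[hz].
  move=> [k]; rewrite big_ord_recr/= => h0; split => //.
  exists (k m); split; first by apply: (subspaceB HS) => //; exact: (subspaceZ HS).
  by exists k; rewrite -addrA -opprD [k m *: g m + _]addrC.
move=> [c [h [k hk]]]; split => //; exists (fun j => if (j < m)%N then k j else c).
rewrite big_ord_recr/= ltnn (eq_bigr (fun j : 'I_m => k j *: g j)) => [|j _]; last by rewrite ltn_ord.
by rewrite opprD addrA addrAC.
Qed.

Lemma span_null_subspace m : subspace_like (span_null g m).
Proof.
split.
- split; first exact: (subspace0 HS).
  exists (fun=> 0); rewrite big1 ?subr0 ?form0// => j _; exact: scale0r.
- move=> u v [hu [k hk]] [hv [l hl]]; split; first exact: (subspaceD HS).
  exists (fun j => k j + l j).
  rewrite (eq_bigr (fun j : 'I_m => k j *: g j + l j *: g j)); last by move=> j _; exact: scalerDl.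
  rewrite big_split/= opprD addrACA; apply: form_nullD => //;
    by apply: (subspaceB HS) => //; exact: lincomb_H.
- move=> c u [hu [k hk]]; split; first exact: (subspaceZ HS).
  exists (fun j => c * k j).
  rewrite (eq_bigr (fun j : 'I_m => c *: (k j *: g j))); last by move=> j _; rewrite scalerA.
  rewrite -scaler_sumr -scalerBr; apply: form_nullZ => //.
  by apply: (subspaceB HS) => //; exact: lincomb_H.
Qed.

Lemma span_null_gen m i : (i < m)%N -> span_null g m (g i).
Proof.
move=> im; split; first exact: hg.
exists (fun j => (j == i)%:R); rewrite (bigD1 (Ordinal im))//= eqxx scale1r big1 ?addr0 ?subrr ?form0//.
by move=> j /eqP ji; case: eqP => [e|_]; [case: ji; exact: val_inj|exact: scale0r].
Qed.

Lemma span_null_null m z : H z -> B z z = 0 -> span_null g m z.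
Proof.
move=> hz z0; split => //; exists (fun=> 0); rewrite big1 ?subr0// => j _; exact: scale0r.
Qed.

End span.

Definition orthonormal f m := forall i j, (i < m)%N -> (j < m)%N -> B (f i) (f j) = (i == j)%:R.
Definition oproj f m u := \sum_(j < m) B u (f j) *: f j.

Section orthonormal.
Variables (f : nat -> V) (m : nat).
Hypotheses (hf : forall j, H (f j)) (of_ : orthonormal f m).

Lemma oproj_H u : H (oproj f m u). Proof. exact: (lincomb_H hf m (fun j => B u (f j))). Qed.

Lemma lincomb_form (k : nat -> R) i : (i < m)%N -> B (\sum_(j < m) k j *: f j) (f i) = k i.
Proof.
move=> im; rewrite (form_suml HS HB) => [|j _|]; last 2 first.
- exact: (subspaceZ HS).
- exact: hf.
rewrite (bigD1 (Ordinal im))//= big1 ?addr0.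
  by rewrite (formZl HB)// of_// eqxx mulr1.
move=> j /eqP ji; rewrite (formZl HB)// of_//; case: eqP => [e|_]; last by rewrite mulr0.
by case: ji; exact: val_inj.
Qed.

Lemma oproj_form u i : (i < m)%N -> B (oproj f m u) (f i) = B u (f i).
Proof. exact: (lincomb_form (fun j => B u (f j))). Qed.

Lemma oproj_orth u i : H u -> (i < m)%N -> B (u - oproj f m u) (f i) = 0.
Proof.
by move=> hu im; rewrite (formBl HS HB)//; [rewrite oproj_form// subrr|exact: oproj_H].
Qed.

Lemma oproj_span u : span_null f m (oproj f m u).
Proof. by split; [exact: oproj_H|exists (fun j => B u (f j)); rewrite subrr form0]. Qed.

Lemma orth_span u z : H u -> (forall i, (i < m)%N -> B u (f i) = 0) -> span_null f m z -> B u z = 0.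
Proof.
move=> hu hi [hz [k hk]]; have hl := lincomb_H hf m k.
have := form_null HS HB (subspaceB HS hz hl) hu hk.
rewrite (formBl HS HB)// (form_suml HS HB) => [|j _|]//; last exact: (subspaceZ HS).
rewrite big1 ?subr0; first by rewrite (formC HB).
by move=> j _; rewrite (formZl HB)// (formC HB) hi ?mulr0.
Qed.

Lemma span_nullP z : H z -> span_null f m z <-> B (z - oproj f m z) (z - oproj f m z) = 0.
Proof.
move=> hz; split; last by move=> h; split => //; exists (fun j => B z (f j)).
move=> hs; have hp := oproj_H z; have h := subspaceB HS hz hp.
rewrite (formBr HS HB)//.
rewrite (orth_span h (fun i => oproj_orth hz) hs).
by rewrite (orth_span h (fun i => oproj_orth hz) (oproj_span z)) subrr.
Qed.

Lemma lincomb_sqr (k : nat -> R) : B (\sum_(j < m) k j *: f j) (\sum_(j < m) k j *: f j) = \sum_(j < m) k j ^+ 2.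
Proof.
rewrite (form_suml HS HB) => [|j _|]; last 2 first.
- exact: (subspaceZ HS).
- exact: lincomb_H.
by apply: eq_bigr => j _; rewrite (formZl HB) ?(formC HB (f j)) ?lincomb_form//; exact: lincomb_H.
Qed.

End orthonormal.

Lemma eq_lincomb m (f g : nat -> V) (k : nat -> R) : (forall j, (j < m)%N -> f j = g j) ->
  \sum_(j < m) k j *: f j = \sum_(j < m) k j *: g j.
Proof. by move=> h; apply: eq_bigr => j _; rewrite h. Qed.

Lemma eq_span_null m (f g : nat -> V) : (forall j, (j < m)%N -> f j = g j) ->
  span_null f m = span_null g m.
Proof.
move=> h; apply/seteqP; split=> z [hz [k hk]]; split => //; exists k.
  by rewrite -(eq_lincomb _ h).
by rewrite (eq_lincomb _ h).
Qed.

Lemma extend_orthonormal (f : nat -> V) m u : (forall j, H (f j)) -> orthonormal f m -> H u ->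
  ~ span_null f m u -> exists (f' : nat -> V) (t : R),
  [/\ forall j, H (f' j), orthonormal f' m.+1, forall j, (j < m)%N -> f' j = f j, t != 0 &
      f' m = t *: (u - oproj f m u)].
Proof.
move=> hf of_ hu nu; pose g := u - oproj f m u.
have hg : H g by apply: (subspaceB HS) => //; exact: oproj_H.
have g0 : 0 < B g g.
  rewrite lt_neqAle (form_ge0 HB hg) andbT; apply/eqP => g0; apply: nu.
  by apply/(span_nullP hf of_ hu); rewrite -/g -g0.
have t0 : 0 < Num.sqrt (B g g) by rewrite sqrtr_gt0.
pose f' j := if j == m then (Num.sqrt (B g g))^-1 *: g else f j.
have f'E j : (j < m)%N -> f' j = f j by move=> jm; rewrite /f' ltn_eqF.
have f'm : f' m = (Num.sqrt (B g g))^-1 *: g by rewrite /f' eqxx.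
exists f', (Num.sqrt (B g g))^-1; split => //; last by rewrite invr_eq0 gt_eqF.
- by move=> j; rewrite /f'; case: eqP => _ //; exact: (subspaceZ HS).
- have orth j : (j < m)%N -> B (f' m) (f j) = 0.
    by move=> jm; rewrite f'm (formZl HB)// oproj_orth ?mulr0.
  move=> i j; rewrite !ltnS [(i <= m)%N]leq_eqVlt [(j <= m)%N]leq_eqVlt.
  move=> /orP[/eqP ->|im] /orP[/eqP ->|jm].
  + rewrite f'm (form_sqrZ HS HB)// exprVn sqr_sqrtr ?(ltW g0)// eqxx mulVf// gt_eqF//.
  + by rewrite (f'E _ jm) orth// gtn_eqF.
  + by rewrite (f'E _ im) (formC HB) orth// ltn_eqF.
  + by rewrite !f'E// of_.
Qed.

End span_null.

Section eigenvalues.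
Context {R : realType} {V : lmodType R}.
Variables (H : set V) (A B : V -> V -> R).
Hypotheses (HS : subspace_like H) (HA : psd_form H A) (HB : psd_form H B).

Definition weakly_compact := forall (u_ : nat -> V) (M : R), (forall k, H (u_ k)) ->
  (forall k, B (u_ k) (u_ k) + A (u_ k) (u_ k) <= M) ->
  exists (s : nat -> nat) (u : V), [/\ forall k, (s k < s k.+1)%N, H u,
    cvg_form B (fun k => u_ (s k)) u &
    forall v, H v -> (fun k => A (u_ (s k)) v) @ \oo --> A u v].

Definition eigenvector (l : R) u := H u /\ forall v, H v -> A u v = l * B u v.

Definition eigensystem (lam : nat -> R) (e : nat -> V) :=
  [/\ 0 < lam 0%N, forall i j, (i <= j)%N -> lam i <= lam j,
      forall j, eigenvector (lam j) (e j) /\ B (e j) (e j) = 1,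
      forall m (k : nat -> R),
        B (\sum_(j < m) k j *: e j) (\sum_(j < m) k j *: e j) = 0 -> forall j, (j < m)%N -> k j = 0 &
      forall l u, eigenvector l u -> B u u != 0 -> exists m (k : nat -> R),
        let w := u - \sum_(j < m | lam j == l) k j *: e j in B w w = 0].

Hypothesis null_AB : forall u, H u -> B u u = 0 -> A u u = 0.
Hypothesis WC : weakly_compact.
Variables (lam : nat -> R) (e : nat -> V).
Hypothesis He : eigensystem lam e.

Let eH j : H (e j). Proof. by have [_ _ /(_ j)[[]]] := He. Qed.
Let eA j v : H v -> A (e j) v = lam j * B (e j) v.
Proof. by have [_ _ /(_ j)[[_ h] _] _ _] := He => hv; exact: h. Qed.

Lemma eigenvector_notin_span m : ~ span_null H B e m (e m).
Proof.
move=> [_ [k hk]]; have [_ _ _ ind _] := He.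
have := ind m.+1 (fun j => if (j < m)%N then - k j else 1).
rewrite big_ord_recr/= ltnn scale1r (eq_bigr (fun j : 'I_m => - (k j *: e j))); last first.
  by move=> j _; rewrite ltn_ord scaleNr.
rewrite sumrN addrC hk => /(_ erefl m (ltnSn m)); rewrite ltnn => h.
by have := @oner_eq0 R; rewrite h eqxx.
Qed.

(** Gram-Schmidt within the eigenvectors. The e j are normalized but those of one eigenvalue need
    not be orthogonal. *)
Lemma eigenbasis m : exists f : nat -> V, [/\ forall j, H (f j), orthonormal B f m,
  forall i, (i < m)%N -> eigenvector (lam i) (f i) & span_null H B f m = span_null H B e m].
Proof.
elim: m => [|m [f [hf of_ ef sf]]].
  by exists e; split.
have nu : ~ span_null H B f m (e m) by rewrite sf; exact: eigenvector_notin_span.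
have [f' [t [hf' of' f'E t0 f'm]]] := extend_orthonormal HS HB hf of_ (eH m) nu.
have hp : H (oproj B f m (e m)) := oproj_H B HS m hf (e m).
have Ap v : H v -> A (oproj B f m (e m)) v = lam m * B (oproj B f m (e m)) v.
  move=> hv; rewrite /oproj (form_suml HS HA) => [|j _|]//; last exact: (subspaceZ HS).
  rewrite (form_suml HS HB) => [|j _|]//; last exact: (subspaceZ HS).
  rewrite mulr_sumr; apply: eq_bigr => j _; rewrite (formZl HA)// (formZl HB)//.
  have [_ ej] := ef j (ltn_ord j); rewrite ej//.
  (* Components along other eigenvalues vanish, so the projection of e m is again an eigenvector for
     lam m and so is the new basis vector. *)
  have h : lam m * B (e m) (f j) = lam j * B (e m) (f j).
    by rewrite -eA// (formC HA) ej// (formC HB).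
  by rewrite mulrCA mulrA -h mulrA.
exists f'; split => //.
- move=> i; rewrite ltnS leq_eqVlt => /orP[/eqP ->|im]; last by rewrite f'E//; exact: ef.
  split=> // v hv; rewrite f'm.
  have hd := subspaceB HS (eH m) hp.
  rewrite (formZl HA)// (formZl HB)// (formBl HS HA)// (formBl HS HB)// eA// Ap//.
  by ring.
- have es : span_null H B f' m = span_null H B e m by rewrite -sf; exact: eq_span_null.
  have pin := oproj_span HS HB m hf (e m); rewrite sf in pin.
  have seP := span_null_subspace HS HB eH m.
  have zE z c : z - c *: f' m = (z - (c * t) *: e m) + (c * t) *: oproj B f m (e m).
    by rewrite f'm scalerA scalerBr opprB addrA addrAC.
  have nS := span_nullS B HS.
  apply/seteqP; split => z /nS[]//; last first.
    move=> hz [c hc]; apply/nS => //; split => //.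
    exists (c / t); rewrite es zE divfK//; apply: (subspaceD seP) => //.
    exact: (subspaceZ seP).
  move=> hz [c hc]; apply/nS => //; split => //.
  exists (c * t); rewrite es zE in hc.
  have := subspaceB seP hc (subspaceZ seP (c * t) pin).
  by rewrite addrK.
Qed.

Lemma weak_liminf (u_ : nat -> V) u (l : R) : (forall k, H (u_ k)) -> H u ->
  (forall v, H v -> (fun k => A (u_ k) v) @ \oo --> A u v) ->
  (fun k => A (u_ k) (u_ k)) @ \oo --> l -> A u u <= l.
Proof.
move=> hu_ hu wA cl.
have c2 : (fun k => A (u_ k) (u_ k) - 2 * A (u_ k) u) @ \oo --> l - 2 * A u u.
  by apply: cvgB => //; apply: cvgMr; exact: wA.
have h : - A u u <= l - 2 * A u u.
  apply: (cvg_seq_ge c2) => k.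
  have := form_ge0 HA (subspaceB HS (hu_ k) hu); rewrite (form_sqrB HS HA)//.
  by move: (A (u_ k) (u_ k)) (A (u_ k) u) (A u u) => x y z; lra.
by move: h; move: (A u u) => x; lra.
Qed.

Let quad_crit (q c : R) : (forall t : R, 0 <= 2 * (t * q) + t ^+ 2 * c) -> q = 0.
Proof.
move=> h; have cp : 0 < `|c| + 1 by rewrite ltr_wpDl.
have := h (- q / (`|c| + 1)).
rewrite (_ : _ + _ = - (q ^+ 2 * (2 * (`|c| + 1) - c) / (`|c| + 1) ^+ 2)); last by field; rewrite gt_eqF.
rewrite oppr_ge0 pmulr_lle0 ?invr_gt0 ?exprn_gt0// pmulr_lle0.
  by move=> q2; apply/eqP; rewrite -sqrf_eq0 eq_le q2 sqr_ge0.
by have := ler_norm c; move: (`|c|) cp => x; lra.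
Qed.

(** The infimum mu of the Rayleigh quotient on the orthogonal complement is attained, by weak
    compactness, at an eigenvector. Were mu below lam m, completeness of the enumeration would put
    it in the span of the first m eigenvectors, to which it is orthogonal. *)
Lemma spectral_gap m f v : (forall j, H (f j)) -> orthonormal B f m ->
  (forall i, (i < m)%N -> eigenvector (lam i) (f i)) -> span_null H B f m = span_null H B e m ->
  H v -> (forall i, (i < m)%N -> B v (f i) = 0) -> lam m * B v v <= A v v.
Proof.
move=> hf of_ ef sf hv v0.
pose X := [set A w w | w in [set w | [/\ H w, B w w = 1 & forall i, (i < m)%N -> B w (f i) = 0]]].
pose mu := inf X.
have muX w : H w -> (forall i, (i < m)%N -> B w (f i) = 0) -> mu * B w w <= A w w.
  move=> hw w0; have [Bw|Bw] := eqVneq (B w w) 0; first by rewrite Bw mulr0 (form_ge0 HA).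
  have Bw0 : 0 < B w w by rewrite lt_neqAle eq_sym Bw (form_ge0 HB).
  have : mu <= A ((Num.sqrt (B w w))^-1 *: w) ((Num.sqrt (B w w))^-1 *: w).
    apply: inf_lbound; first by exists 0 => _ [z [hz _ _] <-]; exact: (form_ge0 HA).
    exists ((Num.sqrt (B w w))^-1 *: w) => //; split; first exact: (subspaceZ HS).
      by rewrite (form_sqrZ HS HB)// exprVn sqr_sqrtr ?(ltW Bw0)// mulVf.
    by move=> i im; rewrite (formZl HB)// w0// mulr0.
  by rewrite (form_sqrZ HS HA)// exprVn sqr_sqrtr ?(ltW Bw0)// mulrC ler_pdivlMr.
have [Bv|Bv] := eqVneq (B v v) 0; first by rewrite Bv mulr0 (form_ge0 HA).
have Bv0 : 0 < B v v by rewrite lt_neqAle eq_sym Bv (form_ge0 HB).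
have iX : has_inf X.
  split; last by exists 0 => _ [w [hw _ _] <-]; exact: (form_ge0 HA).
  exists (A ((Num.sqrt (B v v))^-1 *: v) ((Num.sqrt (B v v))^-1 *: v)), ((Num.sqrt (B v v))^-1 *: v) => //.
  split; first exact: (subspaceZ HS).
    by rewrite (form_sqrZ HS HB)// exprVn sqr_sqrtr ?(ltW Bv0)// mulVf.
  by move=> i im; rewrite (formZl HB)// v0// mulr0.
suff lmu : lam m <= mu by apply: le_trans (muX v hv v0); rewrite ler_pM2r.
have /choice[w_ hw] (k : nat) : exists w, [/\ H w, B w w = 1, forall i, (i < m)%N -> B w (f i) = 0 & A w w < mu + k.+1%:R^-1].
  have [|_ [w [h1 h2 h3] <-] h] := inf_adherent (eps := k.+1%:R^-1) _ iX; first by rewrite invr_gt0.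
  by exists w.
have Hw k : H (w_ k) by have [] := hw k.
have [|s [u [hs hu cB wA]]] := @WC w_ (1 + (mu + 1)) Hw.
  move=> k; have [_ -> _ h] := hw k; rewrite lerD2l; apply: (le_trans (ltW h)); rewrite lerD2l.
  by rewrite invf_le1// ler1n.
have Hws k : H (w_ (s k)) by [].
have cst_cvg (g : nat -> R) (c l : R) : (forall k, g k = c) -> g @ \oo --> l -> l = c.
  by move=> gc gl; apply/eqP; rewrite eq_le (cvg_seq_le gl) ?(cvg_seq_ge gl)// => k; rewrite gc.
have Bu : B u u = 1.
  by apply: (cst_cvg _ _ _ _ (cvg_form_self HS HB Hws hu cB)) => k; have [] := hw (s k).
have u0 i : (i < m)%N -> B u (f i) = 0.
  by move=> im; apply: (cst_cvg _ _ _ _ (cvg_form_linear HS HB Hws hu (hf i) cB)) => k; have [_ _ ->] := hw (s k).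
have cA : (fun k => A (w_ (s k)) (w_ (s k))) @ \oo --> mu.
  apply/cvgrPdist_le => d d0; have /cvgrPdist_le/(_ d d0)[N _ hN] := @cvg_harmonic R.
  exists N => // k /= Nk; have [_ Bk ok Ak] := hw (s k).
  have := muX _ (Hws k) ok; rewrite Bk mulr1 => h.
  rewrite ler0_norm ?subr_le0// opprB lerBlDl; apply: le_trans (ltW Ak) _; rewrite lerD2l.
  have sk := leq_incr k hs.
  have := hN (s k) (leq_trans Nk sk); rewrite sub0r normrN; exact: le_trans (ler_norm _).
have Au : A u u = mu.
  apply/eqP; rewrite eq_le (weak_liminf Hws hu wA cA).
  by have := muX u hu u0; rewrite Bu mulr1.
have eu : eigenvector mu u.
  split=> // phi hphi.
  pose P := oproj B f m phi; have hP : H P := oproj_H B HS m hf phi.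
  have hd : H (phi - P) by exact: (subspaceB HS).
  have AP : A u P = 0.
    rewrite (formC HA) /P /oproj (form_suml HS HA) => [|j _|]//; last exact: (subspaceZ HS).
    rewrite big1// => j _; rewrite (formZl HA)//; have [_ ->//] := ef j (ltn_ord j).
    by rewrite (formC HB (f j)) u0// !mulr0.
  have BP : B u P = 0 by apply: (orth_span HS HB hf hu u0); exact: oproj_span.
  suff : A u (phi - P) - mu * B u (phi - P) = 0.
    by rewrite (formBr HS HA)// (formBr HS HB)// AP BP !subr0 => /eqP; rewrite subr_eq0 => /eqP.
  (* Variations are made only in the direction phi - P, which keeps u + t (phi - P) in the
     complement; in the direction P both forms vanish against u. *)
  apply: (quad_crit (c := A (phi - P) (phi - P) - mu * B (phi - P) (phi - P))) => t.
  have htd := subspaceZ HS t hd.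
  have := muX (u + t *: (phi - P)) (subspaceD HS hu htd).
  rewrite (form_sqrD HS HA)// (form_sqrD HS HB)// (form_sqrZ HS HA)// (form_sqrZ HS HB)//.
  rewrite (formZr HA)// (formZr HB)// Bu Au => h.
  have : mu * (1 + 2 * (t * B u (phi - P)) + t ^+ 2 * B (phi - P) (phi - P)) <=
     mu + 2 * (t * A u (phi - P)) + t ^+ 2 * A (phi - P) (phi - P).
    apply: h => i im; by rewrite (formDl HB)// (formZl HB)// u0// (oproj_orth HS HB hf of_)// mulr0 addr0.
  by move: (A u (phi - P)) (B u (phi - P)) (A (phi - P) _) (B (phi - P) _) => x y z w; lra.
have [_ lmono _ _ compl] := He.
have [|M [k /= hk]] := compl mu u eu; first by rewrite Bu oner_eq0.
rewrite leNgt; apply/negP => lm.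
have seP := span_null_subspace HS HB eH m.
pose S := \sum_(j < M | lam j == mu) k j *: e j.
have hS : H S by apply: (subspace_sum HS) => j _; exact: (subspaceZ HS).
have sS : span_null H B e m S.
  apply: (subspace_sum seP) => j /eqP lj; apply: (subspaceZ seP); apply: span_null_gen => //.
  rewrite ltnNge; apply/negP => /lmono; rewrite lj; by rewrite leNgt lm.
have := span_null_null e m (subspaceB HS hu hS) hk.
move=> /(subspaceD seP)/(_ sS); rewrite subrK -sf => su.
have := orth_span HS HB hf hu u0 su; rewrite Bu => /eqP; by rewrite oner_eq0.
Qed.

End eigenvalues.

(** * The abstract Nehari problem *)

Section rays.
Context {R : realType}.
Variables (n : nat) (hn : (3 <= n)%N).
Local Notation p := (crit_exp R n).
Let p0 : 0 < p := crit_exp_gt0 hn.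
Let p2 : 2 < p := crit_exp_gt2 hn.
Let n2 : 2 < n%:R :> R := natn_gt2 hn.

Lemma half_sub_inv_crit : 2^-1 - p^-1 = n%:R^-1.
Proof. by rewrite /crit_exp; field; apply/andP; split; move: n2; lra. Qed.

(** Young's inequality for X D with the conjugate exponents p/2 and n/2. *)
Lemma ray_max (D X : R) : 0 <= D -> 0 <= X ->
  D / 2 * X - p^-1 * X `^ (p / 2) <= n%:R^-1 * D `^ (n%:R / 2).
Proof.
move=> D0 X0; have n0 : 0 < n%:R / 2 :> R by rewrite divr_gt0//; move: n2; lra.
have p20 : 0 < p / 2 by rewrite divr_gt0.
have pE : 2 / p + 2 / n%:R = 1 by rewrite -(crit_exp_two_div hn) subrK.
move: (p) p20 pE => q q0 qE.
have := conjugate_powR X0 D0 q0 n0; rewrite !invf_div => /(_ qE) h.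
rewrite [D / 2 * X](_ : _ = X * D / 2); last by ring.
rewrite lerBlDr ler_pdivrMr//; apply: le_trans h _.
by rewrite le_eqVlt; apply/orP; left; apply/eqP; ring.
Qed.

(** t is the critical point of the energy along the ray, where t^(p-2) F = Q; the value is the
    equality case of [ray_max] with D = Q / F^(2/p). *)
Lemma ray_attain (Q F : R) : 0 < Q -> 0 < F -> let t := (Q / F) `^ (p - 2)^-1 in
  0 < t /\ t ^+ 2 * Q / 2 - p^-1 * (t `^ p * F) = n%:R^-1 * (Q / F `^ (2 / p)) `^ (n%:R / 2).
Proof.
move=> Q0 F0 t; have QF : 0 < Q / F by exact: divr_gt0.
have t0 : 0 < t by exact: powR_gt0.
have pm2 : p - 2 != 0 by rewrite gt_eqF// subr_gt0.
have tp : t `^ p = t ^+ 2 * (Q / F).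
  have <- : t `^ (p - 2) = Q / F by rewrite powRVK// ltW.
  rewrite -powR_mulrn ?(ltW t0)// -powRD; last by rewrite (gt_eqF t0) implybT.
  by congr (_ `^ _); ring.
have tQ : t ^+ 2 * Q = (Q / F `^ (2 / p)) `^ (n%:R / 2).
  rewrite -powR_mulrn ?(ltW t0)// -powRrM.
  have e1 : (p - 2)^-1 * 2 = n%:R / 2 - 1.
    by rewrite /crit_exp; field; apply/andP; split; move: n2; lra.
  rewrite e1 [in RHS]powRM ?(ltW Q0) ?invr_ge0 ?powR_ge0//.
  rewrite -powRN -powRrM.
  have e2 : - (2 / p) * (n%:R / 2) = - (n%:R / 2 - 1).
    by rewrite /crit_exp; field; apply/andP; split; move: n2; lra.
  rewrite e2 powRN powRM ?(ltW Q0) ?invr_ge0 ?(ltW F0)//.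
  rewrite -[F^-1 in LHS]powR_inv1 ?(ltW F0)// -powRrM mulN1r powRN mulrAC; congr (_ / _).
  rewrite -[X in _ * X = _](powRr1 (ltW Q0)) -powRD ?subrK//.
  by rewrite (gt_eqF Q0) implybT.
split=> //; rewrite tp -tQ.
rewrite (_ : t ^+ 2 * (Q / F) * F = t ^+ 2 * Q); last by field; rewrite gt_eqF.
by rewrite -half_sub_inv_crit mulrBl [2^-1 * _]mulrC.
Qed.

End rays.

Section nehari.
Context {R : realType} {V : lmodType R}.
Variables (H : set V) (A B : V -> V -> R).
Hypotheses (HS : subspace_like H) (HA : psd_form H A) (HB : psd_form H B).
Hypothesis null_AB : forall u, H u -> B u u = 0 -> A u u = 0.
Hypothesis WC : weakly_compact H A B.
Variables (lam : nat -> R) (e : nat -> V).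
Hypothesis He : eigensystem H A B lam e.
Variables (n : nat) (hn : (3 <= n)%N).
Local Notation p := (crit_exp R n).
Variables (F : V -> R) (dF : V -> V -> R) (Cb K : R).
Hypothesis F_ge0 : forall u, H u -> 0 <= F u.
Hypothesis FZ : forall c u, H u -> F (c *: u) = `|c| `^ p * F u.
Hypothesis Cb0 : 0 < Cb.
Hypothesis F_hoelder : forall u, H u -> B u u <= Cb * F u `^ (2 / p).
Hypothesis K0 : 0 < K.
(** Sharp in the leading term: [K] determines the threshold, and the lower order form B disappears
    along sequences that are B-null in the limit. *)
Hypothesis F_sobolev : forall d : R, 0 < d -> exists2 C, 0 < C & forall u, H u ->
  K * F u `^ (2 / p) <= (1 + d) * A u u + C * B u u.
(** [dF u v] stands for the derivative of F at u in direction v, divided by p. The inequality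
    compares the energy at u with that on the whole of R u + Z. *)
Hypothesis dF_nehari : forall s u w, H u -> H w ->
  (s ^+ 2 - 1) / 2 * F u + s * dF u (w - s *: u) + p^-1 * F u - p^-1 * F w <= 0.
Hypothesis dF_diag : forall u, H u -> dF u u = F u.
Hypothesis is_derive_F : forall u v, H u -> H v ->
  is_derive (0 : R) 1 (fun t : R => F (u + t *: v)) (p * dF u v).
(** One subsequence, on which convergence is almost everywhere, serves all t and w
    simultaneously. *)
Hypothesis F_brezis_lieb : forall (u_ : nat -> V) u M, (forall k, H (u_ k)) -> H u ->
  cvg_form B u_ u -> (forall k, F (u_ k - u) <= M) ->
  exists s : nat -> nat, (forall k, (s k < s k.+1)%N) /\ forall t w, H w ->
    (fun k => F (t *: (u_ (s k) - u) + w) - `|t| `^ p * F (u_ (s k) - u)) @ \oo --> F w.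

Let p0 : 0 < p := crit_exp_gt0 hn.
Let p2 : 2 < p := crit_exp_gt2 hn.

Let p20 : 0 < p / 2. Proof. by rewrite divr_gt0. Qed.
Let p2V : 0 < 2 / p. Proof. by rewrite divr_gt0. Qed.

Definition quadQ (l : R) u v : R := A u v - l * B u v.
Definition energy (l : R) u : R := 2^-1 * A u u - l / 2 * B u u - p^-1 * F u.

Lemma energyE l u : energy l u = quadQ l u u / 2 - p^-1 * F u.
Proof. by rewrite /energy /quadQ; field; rewrite gt_eqF. Qed.

Lemma F0 : F 0 = 0.
Proof. by have := FZ 0 (subspace0 HS); rewrite scale0r normr0 powR0 ?mul0r// gt_eqF. Qed.

Lemma sobolev_le (C : R) u : H u -> 0 <= C -> F u `^ (2 / p) <= C -> F u <= C `^ (p / 2).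
Proof.
move=> hu C0 /(le_powR (r := p / 2) _ (powR_ge0 _ _)); rewrite divr_ge0 ?(ltW p0)// => /(_ isT).
by rewrite -powRrM (_ : 2 / p * (p / 2) = 1) ?powRr1 ?F_ge0//; field; rewrite gt_eqF.
Qed.

Lemma F_gt0 u : H u -> 0 < B u u -> 0 < F u.
Proof.
move=> hu B0; rewrite lt_neqAle F_ge0// andbT; apply/eqP => Fu.
have := F_hoelder hu; by rewrite -Fu powR0 ?(gt_eqF p2V)// mulr0 leNgt B0.
Qed.

Lemma form_addnull (D : V -> V -> R) u y : psd_form H D -> H u -> H y -> D y y = 0 -> D (y + u) (y + u) = D u u.
Proof.
move=> PD hu hy y0; rewrite (form_sqrD HS PD)// y0 (form_null HS PD hy hu y0) mulr0 !add0r//.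
Qed.

(* Brezis-Lieb with vanishing remainder gives continuity for strong convergence. *)
Lemma F_cvg (u_ : nat -> V) u : (forall k, H (u_ k)) -> H u -> cvg_form B u_ u -> cvg_form A u_ u ->
  exists s : nat -> nat, (forall k, (s k < s k.+1)%N) /\ (fun k => F (u_ (s k))) @ \oo --> F u.
Proof.
move=> hu_ hu cB cA.
have hd k : H (u_ k - u) by exact: (subspaceB HS).
have [C C0 hC] := F_sobolev ltr01.
have cvB := cvg_form_sqr HS HB hu_ hu cB; have cvA := cvg_form_sqr HS HA hu_ hu cA.
pose g k := ((1 + 1) * A (u_ k - u) (u_ k - u) + C * B (u_ k - u) (u_ k - u)) / K.
have cg : g @ \oo --> (0 : R).
  have -> : (0 : R) = ((1 + 1) * 0 + C * 0) / K by rewrite !mulr0 addr0 mul0r.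
  by apply: cvgMl; apply: cvgD; apply: cvgMr.
have Fg k : F (u_ k - u) <= `|g k| `^ (p / 2).
  apply: sobolev_le => //; apply: le_trans (ler_norm _).
  by rewrite /g ler_pdivlMr// mulrC; exact: hC.
have c0 : (fun k => F (u_ k - u)) @ \oo --> (0 : R).
  apply/cvgrPdist_le => d d0.
  have d1 : 0 < d `^ (2 / p) by exact: powR_gt0.
  have /cvgrPdist_le/(_ _ d1)[N _ hN] := cg; exists N => // k /hN; rewrite !sub0r !normrN => h.
  rewrite ger0_norm ?F_ge0//; apply: le_trans (Fg k) _.
  have := le_powR (r := p / 2) _ (normr_ge0 _) h; rewrite divr_ge0 ?(ltW p0)// => /(_ isT) h2.
  apply: le_trans h2 _; rewrite -powRrM (_ : 2 / p * (p / 2) = 1) ?powRr1 ?(ltW d0)//.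
  by field; rewrite gt_eqF.
have [M hM] : exists M, forall k, F (u_ k - u) <= M.
  have [M [_ hM]] : bounded_fun (fun k => F (u_ k - u)) by apply: cvg_seq_bounded; apply/cvg_ex; exists 0.
  by exists (M + 1) => k; apply: le_trans (ler_norm _) _; apply: hM => //; rewrite ltrDl.
have [s [hs h]] := F_brezis_lieb hu_ hu cB hM.
exists s; split => //.
have cs : (fun k => F (u_ (s k) - u)) @ \oo --> (0 : R) := cvg_comp _ _ (incr_cvg_oo hs) c0.
have c1 : (fun k => F (1 *: (u_ (s k) - u) + u) - `|1| `^ p * F (u_ (s k) - u) + F (u_ (s k) - u)) @ \oo --> F u + 0.
  by apply: cvgD => //; exact: h.
move: c1; rewrite addr0 (_ : (fun k => _ + _) = (fun k => F (u_ (s k))))//.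
by apply/funext => k; rewrite normr1 powR1 mul1r scale1r !subrK.
Qed.

Section minimax.
Variables (m : nat) (f : nat -> V).
Hypotheses (hf : forall j, H (f j)) (of_ : orthonormal B f m).
Hypothesis ef : forall i, (i < m)%N -> eigenvector H A B (lam i) (f i).
Hypothesis sf : span_null H B f m = span_null H B e m.

Local Notation Z := (span_null H B e m).

Let eH j : H (e j). Proof. by have [_ _ /(_ j)[[]]] := He. Qed.
Let ZS : subspace_like Z := span_null_subspace HS HB eH m.
Let ZH z : Z z -> H z. Proof. by case. Qed.

(** Membership in [T m] written uniformly in m; for m = 0 the first condition is void. *)
Definition in_gap (l : R) := (forall i, (i < m)%N -> lam i <= l) /\ l < lam m.

Definition nehari (l : R) u := [/\ H u, ~ Z u, quadQ l u u = dF u u &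
  forall z, Z z -> quadQ l u z = dF u z].

Lemma span_form_le (g : nat -> V) k : (forall j, H (g j)) -> orthonormal B g k ->
  exists2 C : R, 0 <= C & forall z, span_null H B g k z -> A z z <= C * B z z.
Proof.
move=> hg og; exists (k%:R * \sum_(j < k) A (g j) (g j)).
  by rewrite mulr_ge0//; apply: sumr_ge0 => j _; exact: (form_ge0 HA).
move=> z hz; have Hz : H z by case: hz.
have hP := oproj_H B HS k hg z; have hd := subspaceB HS Hz hP.
have d0 := (span_nullP HS HB hg og Hz).1 hz.
rewrite -[z](subrK (oproj B g k z)) (form_addnull HA)// ?(null_AB hd)// (form_addnull HB)//.
apply: le_trans (form_sqr_sum_le HS HA (fun j : 'I_k => subspaceZ HS (B z (g j)) (hg j))) _.
rewrite /oproj (lincomb_sqr HS HB hg og (fun j => B z (g j))) -mulrA ler_wpM2l//.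
rewrite mulr_sumr; apply: ler_sum => j _; rewrite (form_sqrZ HS HA)// mulrC ler_wpM2r ?sqr_ge0//.
by rewrite (bigD1 j)//= lerDl; apply: sumr_ge0 => i _; exact: (form_ge0 HA).
Qed.

Lemma eigen_form_le (g : nat -> V) k (c : R) z : (forall j, H (g j)) -> orthonormal B g k ->
  (forall i, (i < k)%N -> eigenvector H A B (lam i) (g i)) -> (forall i, (i < k)%N -> lam i <= c) ->
  span_null H B g k z -> A z z <= c * B z z.
Proof.
move=> hg og eg lc hz; have Hz : H z by case: hz.
have hP := oproj_H B HS k hg z; have hd := subspaceB HS Hz hP.
have d0 := (span_nullP HS HB hg og Hz).1 hz.
rewrite -[z](subrK (oproj B g k z)) (form_addnull HA)// ?(null_AB hd)// (form_addnull HB)//.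
rewrite {3 4}/oproj (lincomb_sqr HS HB hg og (fun j => B z (g j))) {1}/oproj.
rewrite (form_suml HS HA) => [|j _|]//; last exact: (subspaceZ HS).
rewrite mulr_sumr; apply: ler_sum => j _; rewrite (formZl HA)//.
have [_ ->//] := eg j (ltn_ord j).
rewrite (formC HB (g j)) (oproj_form HS HB hg og)// mulrCA -expr2 ler_wpM2r ?sqr_ge0//; exact: lc.
Qed.

Lemma quadQ_le0 l z : in_gap l -> Z z -> quadQ l z z <= 0.
Proof.
by move=> [lT _]; rewrite -sf => /(eigen_form_le hf of_ ef lT); rewrite subr_le0.
Qed.

Lemma quadQC l u v : quadQ l u v = quadQ l v u.
Proof. by rewrite /quadQ (formC HA) (formC HB). Qed.

Lemma quadQ_sqrD l s u z : H u -> H z ->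
  quadQ l (s *: u + z) (s *: u + z) = s ^+ 2 * quadQ l u u + 2 * s * quadQ l u z + quadQ l z z.
Proof.
move=> hu hz; have hsu := subspaceZ HS s hu; rewrite /quadQ.
rewrite (form_sqrD HS HA)// (form_sqrD HS HB)// (form_sqrZ HS HA)// (form_sqrZ HS HB)//.
by rewrite (formZl HA)// (formZl HB)//; ring.
Qed.

(** By the Nehari identities the difference of the energies is half of quadQ l z z, which is
    nonpositive, plus the left side of [dF_nehari]. *)
Lemma energy_le_nehari l u s z : in_gap l -> nehari l u -> Z z ->
  energy l (s *: u + z) <= energy l u.
Proof.
move=> lT [hu _ Qu Qz] Zz; have hz := ZH Zz.
have hw := subspaceD HS (subspaceZ HS s hu) hz.
have := dF_nehari s hu hw; rewrite [s *: u + z]addrC addrK => h.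
rewrite [z + s *: u]addrC in h *; rewrite !energyE quadQ_sqrD// Qu (Qz z Zz) dF_diag//.
have := quadQ_le0 lT Zz; move: h.
move: (F (s *: u + z)) (quadQ l z z) (dF u z) (F u) (p^-1) => x y w v q.
lra.
Qed.

Lemma energy_nehari l u : nehari l u -> energy l u = n%:R^-1 * F u.
Proof.
move=> [hu _ Qu _]; rewrite energyE Qu dF_diag// -(half_sub_inv_crit hn) mulrBl; congr (_ - _).
exact: mulrC.
Qed.

Lemma nehari_gt0 l u : nehari l u -> 0 < F u.
Proof.
move=> [hu nZ _ _]; apply: F_gt0 => //; rewrite lt_neqAle (form_ge0 HB)// andbT; apply/eqP => B0.
by apply: nZ; apply: span_null_null.
Qed.

Lemma energyZ l (t : R) u : H u -> energy l (t *: u) = t ^+ 2 * quadQ l u u / 2 - p^-1 * (`|t| `^ p * F u).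
Proof.
move=> hu; rewrite energyE /quadQ (form_sqrZ HS HA)// (form_sqrZ HS HB)// FZ//.
by congr (_ / 2 - _); ring.
Qed.

Lemma energy_ray l u : H u -> 0 < quadQ l u u -> 0 < F u ->
  exists t : R, 0 < t /\ energy l (t *: u) = n%:R^-1 * (quadQ l u u / F u `^ (2 / p)) `^ (n%:R / 2).
Proof.
move=> hu Q0 Fu; have [t0 ht] := ray_attain hn Q0 Fu.
by exists ((quadQ l u u / F u) `^ (p - 2)^-1); split => //; rewrite energyZ// gtr0_norm.
Qed.

Lemma energy_le_bound l D u : 0 <= D -> H u -> quadQ l u u <= D * F u `^ (2 / p) ->
  energy l u <= n%:R^-1 * D `^ (n%:R / 2).
Proof.
move=> D0 hu QD; apply: le_trans (ray_max hn D0 (powR_ge0 (F u) (2 / p))).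
rewrite energyE -powRrM (_ : 2 / p * (p / 2) = 1) ?powRr1 ?F_ge0//; last by field; rewrite gt_eqF.
by rewrite lerD2r mulrAC ler_pM2r.
Qed.

Lemma is_derive_energy l u v : H u -> H v ->
  is_derive (0 : R) 1 (fun t : R => energy l (u + t *: v)) (quadQ l u v - dF u v).
Proof.
move=> hu hv.
pose q (t : R) := quadQ l u u / 2 + t * quadQ l u v + t ^+ 2 * (quadQ l v v / 2).
have dq : is_derive (0 : R) 1 q (quadQ l u v).
  have h1 := is_deriveZ (quadQ l u v) (is_derive_id (0 : R) (1 : R)).
  have h2 := is_deriveZ (quadQ l v v / 2) (is_deriveX 2 (is_derive_id (0 : R) (1 : R))).
  have := is_deriveD (is_deriveD (is_derive_cst (quadQ l u u / 2) (0 : R) (1 : R)) h1) h2.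
  rewrite (_ : 0 + _ + _ = quadQ l u v); last by rewrite /GRing.scale/= expr1; ring.
  congr (is_derive _ _ _ _).
  by apply/funext => t; rewrite /q [t * _]mulrC [t ^+ 2 * _]mulrC.
have dF_ := is_deriveZ p^-1 (is_derive_F hu hv).
have h := is_deriveB dq dF_.
rewrite (_ : (fun t => energy _ _) = q - p^-1 \*: (fun t : R => F (u + t *: v))).
  by apply: is_derive_eq h _; rewrite /GRing.scale/= mulrA mulVf ?mul1r// gt_eqF.
apply/funext => t; rewrite -[RHS]/(q t - p^-1 * F (u + t *: v)) energyE; congr (_ - _).
have := @quadQ_sqrD l t v u hv hu; rewrite addrC => ->; rewrite (quadQC l v u) /q; by field.
Qed.

Lemma crit_energy l u v : H u -> H v -> (forall t, energy l (u + t *: v) <= energy l u) ->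
  quadQ l u v = dF u v.
Proof.
move=> hu hv hmax.
have dg (t : R) : is_derive t 1 (fun t : R => energy l (u + t *: v)) (quadQ l (u + t *: v) v - dF (u + t *: v) v).
  have h := is_derive_energy l (subspaceD HS hu (subspaceZ HS t hv)) hv.
  have h' : is_derive (1 * t + - t) 1 (fun s : R => energy l (u + t *: v + s *: v)) (quadQ l (u + t *: v) v - dF (u + t *: v) v).
    by rewrite mul1r subrr.
  have := is_derive_affine h'; rewrite mul1r; congr (is_derive _ _ _ _).
  by apply/funext => s; rewrite mul1r -addrA -scalerDl [t + _]addrC subrK.
have [||||_ h0] := @derive1_at_max R (fun t : R => energy l (u + t *: v)) (-1) 1 0.
- by lra.
- by move=> t _; have [] := dg t.
- by rewrite in_itv/=; apply/andP; split; lra.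
- by move=> t _; rewrite scale0r addr0.
have [_ h] := is_derive_energy l hu hv.
by apply/eqP; rewrite -subr_eq0 -h h0.
Qed.

(** [ray_max] is applied with D + 1 instead of D; the surplus is half of F(u)^(2/p). *)
Lemma energy_coercive l D M u : 0 <= D -> H u -> quadQ l u u <= D * F u `^ (2 / p) ->
  - M <= energy l u -> F u `^ (2 / p) <= 2 * (M + n%:R^-1 * (D + 1) `^ (n%:R / 2)).
Proof.
move=> D0 hu QD; have D1 : 0 <= D + 1 by rewrite addr_ge0.
have := ray_max hn D1 (powR_ge0 (F u) (2 / p)).
rewrite energyE -powRrM (_ : 2 / p * (p / 2) = 1) ?powRr1 ?F_ge0//; last by field; rewrite gt_eqF.
move: (F u `^ (2 / p)) (_ `^ (n%:R / 2)) (p^-1 * F u) QD => X Y W QD h1 h2.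
have : quadQ l u u / 2 <= D * X / 2 by rewrite ler_pM2r.
move: (n%:R^-1 * Y) h1 => y h1 h3; lra.
Qed.

Lemma orth_gap l g : in_gap l -> H g -> 0 < B g g -> (forall i, (i < m)%N -> B g (f i) = 0) ->
  0 < quadQ l g g.
Proof.
move=> [_ lm] hg g0 go; have := spectral_gap HS HA HB WC He hf of_ ef sf hg go.
rewrite /quadQ subr_gt0; apply: lt_le_trans; by rewrite ltr_pM2r.
Qed.

Lemma cvg_energy l (u_ : nat -> V) u (x : R) : (forall k, H (u_ k)) -> H u -> cvg_form B u_ u -> cvg_form A u_ u ->
  (fun k => energy l (u_ k)) @ \oo --> x -> energy l u = x.
Proof.
move=> hu_ hu cB cA cx; have [s [hs cF]] := F_cvg hu_ hu cB cA.
have c1 : (fun k => energy l (u_ (s k))) @ \oo --> x := cvg_comp _ _ (incr_cvg_oo hs) cx.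
have cB' : (fun k => B (u_ (s k)) (u_ (s k))) @ \oo --> B u u := cvg_comp _ _ (incr_cvg_oo hs) (cvg_form_self HS HB hu_ hu cB).
have cA' : (fun k => A (u_ (s k)) (u_ (s k))) @ \oo --> A u u := cvg_comp _ _ (incr_cvg_oo hs) (cvg_form_self HS HA hu_ hu cA).
have c2 : (fun k => energy l (u_ (s k))) @ \oo --> energy l u.
  by rewrite /energy; apply: cvgB; [apply: cvgB|]; apply: cvgMr.
exact: (cvg_unique _ c2 c1).
Qed.

Lemma span_null_closed (g : nat -> V) k (u_ : nat -> V) u : (forall j, H (g j)) -> orthonormal B g k ->
  (forall i, span_null H B g k (u_ i)) -> H u -> cvg_form B u_ u -> span_null H B g k u.
Proof.
move=> hg og su hu cB; apply/(span_nullP HS HB hg og hu).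
have hu_ i : H (u_ i) by case: (su i).
have hP := oproj_H B HS k hg u; have hd := subspaceB HS hu hP.
have od i : (i < k)%N -> B (u - oproj B g k u) (g i) = 0 by exact: (oproj_orth HS HB hg og).
rewrite (formBr HS HB)// (orth_span HS HB hg hd od (oproj_span HS HB k hg u)) subr0.
rewrite (formC HB); have := cvg_form_linear HS HB hu_ hu hd cB.
rewrite (_ : (fun i => _) = cst 0); last first.
  by apply/funext => i; rewrite (formC HB) (orth_span HS HB hg hd od (su i)).
by move=> h; apply: (cvg_unique _ h) => //; exact: cvg_cst.
Qed.

(** Direct method on W = R u + Z: there A is bounded by a multiple of B and B by F^(2/p), so the
    energy is bounded above, maximizing sequences are bounded, and B-convergence implies
    A-convergence. *)
Lemma minimax l u : in_gap l -> H u -> ~ Z u -> exists w (s : R) z,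
  [/\ nehari l w, Z z, w = s *: u + z &
      forall (s' : R) z', Z z' -> energy l (s' *: u + z') <= energy l w].
Proof.
move=> lT hu nu; have nu' : ~ span_null H B f m u by rewrite sf.
have [f' [t [hf' of' f'E t0 f'm]]] := extend_orthonormal HS HB hf of_ hu nu'.
have ZE : span_null H B f' m = Z by rewrite -sf; exact: eq_span_null.
have ZP : Z (oproj B f m u) by rewrite -sf; exact: oproj_span.
pose W := span_null H B f' m.+1.
have W1 x : W x -> exists (s : R) z, Z z /\ x = s *: u + z.
  move=> /(span_nullS B HS hf' m x)[hx [c hc]]; rewrite ZE in hc.
  exists (c * t), (x - c *: f' m - (c * t) *: oproj B f m u); split.
    by apply: (subspaceB ZS) => //; exact: (subspaceZ ZS).
  by rewrite f'm scalerA scalerBr -[x - _ - _]addrA -opprD subrK [RHS]addrC subrK.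
have W2 (s : R) z : Z z -> W (s *: u + z).
  move=> Zz; apply/(span_nullS B HS hf' m _); split; first by apply: (subspaceD HS) (ZH Zz); exact: (subspaceZ HS).
  exists (s / t); rewrite ZE f'm scalerA divfK// scalerBr opprB addrA addrAC.
  rewrite [s *: u + z]addrC -[z + _ - _]addrA subrr addr0 addrC.
  by apply: (subspaceD ZS) => //; exact: (subspaceZ ZS).
have WS : subspace_like W := span_null_subspace HS HB hf' m.+1.
have WH x : W x -> H x by case.
have [C C0 hC] := span_form_le hf' of'.
pose D := (C + `|l|) * Cb; have D0 : 0 <= D by rewrite mulr_ge0 ?addr_ge0// ltW.
have QD x : W x -> quadQ l x x <= D * F x `^ (2 / p).
  move=> Wx; have hx := WH _ Wx; rewrite -mulrA; apply: (@le_trans _ _ ((C + `|l|) * B x x)).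
    rewrite /quadQ mulrDl; apply: lerD; first exact: hC.
    by rewrite -mulNr ler_wpM2r ?(form_ge0 HB)// -normrN ler_norm.
  by rewrite ler_wpM2l ?addr_ge0//; exact: F_hoelder.
pose X := [set energy l x | x in W]; pose E := sup X.
have W0 : W 0 := subspace0 WS.
have sX : has_sup X.
  split; first by exists (energy l 0), 0.
  exists (n%:R^-1 * D `^ (n%:R / 2)) => _ [x Wx <-].
  by apply: energy_le_bound => //; [exact: WH|exact: QD].
have leE x : W x -> energy l x <= E.
  by move=> Wx; apply: sup_upper_bound => //; exists x.
(* The part of u orthogonal to Z has positive [quadQ] by the spectral gap, so some multiple of it
   has positive energy. *)
have E0 : 0 < E.
  have Wf : W (f' m) by exact: span_null_gen.
  have Bf : B (f' m) (f' m) = 1 by rewrite of' // eqxx.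
  have Q0 : 0 < quadQ l (f' m) (f' m).
    apply: orth_gap => //; first by rewrite Bf.
    by move=> i im; rewrite -(f'E i im) of' ?ltnS ?(ltnW im)// gtn_eqF.
  have F0' : 0 < F (f' m) by apply: F_gt0 => //; rewrite Bf.
  have [r [r0 hr]] := energy_ray (hf' m) Q0 F0'.
  apply: lt_le_trans (leE _ (subspaceZ WS r Wf)); rewrite hr mulr_gt0 ?invr_gt0 ?ltr0n ?(ltn_trans _ hn)//.
  by rewrite powR_gt0// divr_gt0// powR_gt0.
have /choice[x_ hx_] (k : nat) : exists x, W x /\ E - k.+1%:R^-1 < energy l x.
  have [|_ [x Wx <-] h] := sup_adherent (eps := k.+1%:R^-1) _ sX; first by rewrite invr_gt0.
  by exists x.
have Wx_ k : W (x_ k) by have [] := hx_ k.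
have hxk k : H (x_ k) by exact: WH.
have bd k : B (x_ k) (x_ k) + A (x_ k) (x_ k) <= (1 + C) * (Cb * (2 * (1 + n%:R^-1 * (D + 1) `^ (n%:R / 2)))).
  apply: (@le_trans _ _ ((1 + C) * B (x_ k) (x_ k))).
    by rewrite mulrDl mul1r lerD2l; exact: (hC _ (Wx_ k)).
  rewrite ler_wpM2l ?addr_ge0//; apply: le_trans (F_hoelder (hxk k)) _; rewrite ler_pM2l//.
  apply: (energy_coercive (l := l)) => //; first exact: QD.
  have [_ h] := hx_ k; apply/ltW/(lt_trans _ h); rewrite ltrBrDl.
  by apply: le_lt_trans E0; rewrite subr_le0 invf_le1// ler1n.
have [s [x [hs hx cB wA]]] := WC hxk bd.
have Wx : W x by apply: (span_null_closed hf' of') cB => // k; exact: Wx_.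
have cA : cvg_form A (fun k => x_ (s k)) x.
  move=> d d0; have [N hN] := cB (d / (C + 1)) (divr_gt0 d0 (ltr_wpDl C0 ltr01)).
  exists N => k Nk; apply: le_trans (hC _ (subspaceB WS (Wx_ _) Wx)) _.
  have := hN k Nk; rewrite ler_pdivlMr ?ltr_wpDl// mulrC; apply: le_trans.
  by rewrite mulrDl mul1r lerDl (form_ge0 HB)//; exact: (subspaceB HS).
have Ex : energy l x = E.
  apply: (cvg_energy (fun k => hxk (s k)) hx cB cA).
  apply/cvgrPdist_le => d d0; have /cvgrPdist_le/(_ d d0)[N _ hN] := @cvg_harmonic R.
  exists N => // k /= Nk; have [_ h] := hx_ (s k); have h2 := leE _ (Wx_ (s k)).
  rewrite ger0_norm ?subr_ge0// lerBlDr -lerBlDl; apply: le_trans (ltW h); rewrite lerD2l lerN2.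
  have sk := leq_incr k hs.
  have := hN (s k) (leq_trans Nk sk); rewrite sub0r normrN; exact: le_trans (ler_norm _).
have [r [z [Zz xE]]] := W1 x Wx.
have crit v : W v -> quadQ l x v = dF x v.
  move=> Wv; apply: crit_energy => //; first exact: WH.
  by move=> q; rewrite Ex; apply: leE; apply: (subspaceD WS) => //; exact: (subspaceZ WS).
exists x, r, z; split => //; last by move=> s' z' Zz'; rewrite Ex; exact/leE/W2.
split => //.
(* On Z the energy is nonpositive, whereas the maximum is positive. *)
- move=> Zx; have := quadQ_le0 lT Zx; have := F_ge0 hx; move: E0; rewrite -Ex energyE.
  have : 0 < p^-1 by rewrite invr_gt0.
  by move: (p^-1) (F x) (quadQ l x x) => i y q; nra.
- exact: crit.
- by move=> z' Zz'; apply: crit; rewrite -[z']add0r -(scale0r u); exact: W2.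
Qed.
Definition level_min l : R := inf [set energy l u | u in nehari l].

Let n0 : 0 < n%:R :> R. Proof. by rewrite ltr0n (ltn_trans _ hn). Qed.

Let em_notin : ~ Z (e m) := eigenvector_notin_span He (m := m).

Lemma nehari_has_inf l : in_gap l -> has_inf [set energy l u | u in nehari l].
Proof.
move=> lT; split; first by have [w [s [z [nw _ _ _]]]] := minimax lT (eH m) em_notin; exists (energy l w), w.
exists 0 => _ [u nu <-]; rewrite (energy_nehari nu) mulr_ge0 ?invr_ge0 ?(ltW n0)// ltW//.
exact: (nehari_gt0 nu).
Qed.

Lemma level_min_le l u : in_gap l -> nehari l u -> level_min l <= energy l u.
Proof. by move=> lT nu; apply: ge_inf; [have [] := nehari_has_inf lT|exists u]. Qed.

Lemma level_min_ge l (M : R) : in_gap l -> (forall u, nehari l u -> M <= energy l u) -> M <= level_min l.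
Proof.
move=> lT h; apply: lb_le_inf; first by have [] := nehari_has_inf lT.
by move=> _ [u nu <-]; exact: h.
Qed.

Lemma level_min_ray l (M : R) u : in_gap l -> H u -> ~ Z u ->
  (forall (s : R) z, Z z -> energy l (s *: u + z) <= M) -> level_min l <= M.
Proof.
move=> lT hu nu h; have [w [s [z [nw Zz wE _]]]] := minimax lT hu nu.
by apply: le_trans (level_min_le lT nw) _; rewrite wE; exact: h.
Qed.

Lemma energy_shift l l' u : energy l u = energy l' u + (l' - l) / 2 * B u u.
Proof. by rewrite /energy; move: (p^-1 * F u) => q; field. Qed.

(** A Nehari point for l is in general none for l', but the energy for l' is smaller on all of R u +
    Z, which contains a Nehari point for l'. *)
Lemma level_min_monotone l l' : in_gap l -> in_gap l' -> l <= l' -> level_min l' <= level_min l.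
Proof.
move=> lT lT' ll; apply: level_min_ge => // u nu; have [hu Zu _ _] := nu.
apply: (level_min_ray lT' hu Zu) => s z Zz; apply: le_trans (energy_le_nehari s lT nu Zz).
rewrite (energy_shift l l') lerDl mulr_ge0 ?divr_ge0 ?subr_ge0// (form_ge0 HB)//.
by apply: (subspaceD HS) (ZH Zz); exact: (subspaceZ HS).
Qed.

Let gap_const (d lm l C a b : R) : 0 <= d -> d <= 2^-1 -> 0 <= b -> lm * b <= a ->
  d * (2 * lm + C) <= lm - l -> d * ((1 + 1) * a + C * b) <= a - l * b.
Proof.
move=> d0 d2 b0 ab h; have h1 : d * (2 * lm + C) * b <= (lm - l) * b by rewrite ler_wpM2r.
have : (1 - 2 * d) * (lm * b) <= (1 - 2 * d) * a by rewrite ler_wpM2l//; lra.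
move=> h2; nra.
Qed.

(** Test with multiples of the part of u orthogonal to Z: there the spectral gap and the Sobolev
    inequality bound quadQ l below by d K F^(2/p), uniformly in u. *)
Lemma level_min_gt0 l : in_gap l -> 0 < level_min l.
Proof.
move=> lT; have [_ lm] := lT.
have lm0 : 0 < lam m by have [h0 h _ _ _] := He; exact: lt_le_trans h0 (h _ _ _).
have [C C0 hC] := F_sobolev ltr01.
have C1 : 0 < 2 * lam m + C by rewrite addr_gt0// mulr_gt0.
(* The two bounds are what [gap_const] asks for: 1 - 2 d is nonnegative, and the gap lam m - l pays
   for the lower order term. *)
pose d := Num.min 2^-1 ((lam m - l) / (2 * lam m + C)).
have d0 : 0 < d by rewrite lt_min invr_gt0 ltr0n/= divr_gt0// subr_gt0.
have d2 : d <= 2^-1 by rewrite ge_min lexx.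
have d3 : d * (2 * lam m + C) <= lam m - l by rewrite -ler_pdivlMr// ge_min lexx orbT.
have dK : 0 < d * K by exact: mulr_gt0.
apply: (@lt_le_trans _ _ (n%:R^-1 * (d * K) `^ (n%:R / 2))).
  by rewrite mulr_gt0 ?invr_gt0// powR_gt0.
apply: level_min_ge => // u nu; have [hu Zu _ _] := nu.
pose P := oproj B f m u; have hP : H P := oproj_H B HS m hf u.
have ZP : Z P by rewrite -sf; exact: oproj_span.
have hg : H (u - P) by exact: (subspaceB HS).
have g0 : 0 < B (u - P) (u - P).
  rewrite lt_neqAle (form_ge0 HB)// andbT; apply/eqP => g0; apply: Zu.
  by rewrite -sf; apply/(span_nullP HS HB hf of_ hu); rewrite -/P -g0.
have go i : (i < m)%N -> B (u - P) (f i) = 0 by exact: (oproj_orth HS HB hf of_).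
have Q0 := orth_gap lT hg g0 go; have F0' := F_gt0 hg g0.
have [t [t0 ht]] := energy_ray hg Q0 F0'.
have := energy_le_nehari t lT nu (subspaceZ ZS (- t) ZP).
rewrite scaleNr -scalerBr ht; apply: le_trans; rewrite ler_pM2l ?invr_gt0//.
apply: le_powR; rewrite ?(ltW dK) ?divr_ge0 ?(ltW n0)//.
rewrite ler_pdivlMr ?powR_gt0// -mulrA.
apply: (@le_trans _ _ (d * ((1 + 1) * A (u - P) (u - P) + C * B (u - P) (u - P)))).
  by rewrite ler_pM2l//; exact: hC.
apply: (gap_const (ltW d0) d2 (ltW g0) _ d3).
exact: (spectral_gap HS HA HB WC He hf of_ ef sf hg go).
Qed.

Lemma level_min_le_kappa l : in_gap l ->
  (forall eta : R, 0 < eta -> exists u, [/\ H u, ~ Z u & forall (s : R) z, Z z ->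
     let w := s *: u + z in quadQ l w w <= (K + eta) * F w `^ (2 / p)]) ->
  level_min l <= n%:R^-1 * K `^ (n%:R / 2).
Proof.
move=> lT conc; have L0 := level_min_gt0 lT; have nh : 0 < n%:R / 2 :> R by rewrite divr_gt0.
(* After taking the power 2/n the bound K + eta is affine in eta, so eta can tend to 0. *)
suff h : (n%:R * level_min l) `^ (n%:R / 2)^-1 <= K.
  rewrite mulrC ler_pdivlMr// mulrC.
  have := le_powR (r := n%:R / 2) _ (powR_ge0 _ _) h; rewrite (ltW nh) => /(_ isT).
  by rewrite powRVK ?gt_eqF ?mulr_ge0 ?(ltW L0) ?(ltW n0).
apply/ler_addgt0Pr => eta eta0; have [u [hu Zu h]] := conc eta eta0.
have Ke : 0 < K + eta by rewrite addr_gt0.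
have : level_min l <= n%:R^-1 * (K + eta) `^ (n%:R / 2).
  apply: (level_min_ray lT hu Zu) => s z Zz; apply: energy_le_bound; rewrite ?(ltW Ke)//.
    by apply: (subspaceD HS) (ZH Zz); exact: (subspaceZ HS).
  exact: h.
rewrite mulrC ler_pdivlMr// mulrC => /(le_powR (r := (n%:R / 2)^-1)).
rewrite invr_ge0 (ltW nh) mulr_ge0 ?(ltW n0) ?(ltW L0)// => /(_ isT isT).
by rewrite powRK ?gt_eqF ?(ltW Ke).
Qed.

(** For u on the Nehari set of l', the maximizer w for l on R u + Z satisfies energy l' w <= energy
    l' u. The energies at w differ by (l' - l) B(w, w) / 2, and B(w, w) is bounded by the energy of
    w, since F w = n energy l w. *)
Lemma level_min_lipschitz : exists2 C : R, 0 < C & forall l l', in_gap l -> in_gap l' -> l <= l' ->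
  level_min l <= level_min l' + C * (l' - l) * (1 + level_min l).
Proof.
exists (Cb * n%:R); first by rewrite mulr_gt0.
move=> l l' lT lT' ll; have L0 := level_min_gt0 lT.
set C := Cb * n%:R; have C0 : 0 < C by rewrite mulr_gt0.
have d0 : 0 <= l' - l by rewrite subr_ge0.
(* If C (l' - l) exceeds 1 the claim is trivial; otherwise the resulting estimate is monotone in the
   energy of w, which may be replaced by the smaller level. *)
have [dC|dC] := ltP 1 (C * (l' - l)).
  rewrite -[X in X <= _]add0r lerD ?(ltW (level_min_gt0 lT'))//.
  apply: (@le_trans _ _ (1 * (1 + level_min l))); first by rewrite mul1r lerDr.
  by rewrite ler_wpM2r ?(ltW dC)// addr_ge0 ?(ltW L0).
rewrite -lerBlDr; apply: level_min_ge => // u nu; have [hu Zu _ _] := nu.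
have [w [s [z [nw Zz wE _]]]] := minimax lT hu Zu; have [hw _ _ _] := nw.
have h1 : energy l' w <= energy l' u by rewrite wE; exact: energy_le_nehari.
have Fw : n%:R * energy l w = F w by rewrite (energy_nehari nw) mulrA divff ?mul1r// gt_eqF.
have Xge := level_min_le lT nw.
have h3 : F w `^ (2 / p) <= 1 + F w.
  have [F1|F1] := leP (F w) 1.
    apply: (@le_trans _ _ 1); last by rewrite lerDl F_ge0.
    have := le_powR (r := 2 / p) (ltW p2V) (F_ge0 hw) F1; by rewrite powR1.
  apply: (@le_trans _ _ (F w)); last by rewrite lerDr.
  by rewrite -[X in _ <= X](powRr1 (F_ge0 hw)) ler_powR ?(ltW F1)// ler_pdivrMr// mul1r ltW.
have h4 : B w w <= Cb * (1 + F w).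
  by apply: le_trans (F_hoelder hw) _; rewrite ler_pM2l.
have h5 : (l' - l) / 2 * B w w <= C * (l' - l) * (1 + energy l w).
  apply: (@le_trans _ _ ((l' - l) / 2 * (Cb * (1 + F w)))).
    by rewrite ler_wpM2l// divr_ge0.
  have n1 : 1 <= n%:R :> R by rewrite ler1n (leq_trans _ hn).
  rewrite -Fw /C.
  rewrite [X in X <= _](_ : _ = Cb * (l' - l) * ((1 + n%:R * energy l w) / 2)); last by field.
  rewrite [X in _ <= X](_ : _ = Cb * (l' - l) * (n%:R * (1 + energy l w))); last by ring.
  rewrite ler_wpM2l ?mulr_ge0 ?(ltW Cb0)//.
  have : 0 <= n%:R * energy l w by rewrite Fw F_ge0.
  have aux (N y : R) : 1 <= N -> 0 <= y -> (1 + y) / 2 <= N + y by lra.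
  by move=> y0; rewrite [X in _ <= X]mulrDr mulr1; exact: aux.
have h2 := energy_shift l l' w.
have h6 : energy l w <= energy l' u + C * (l' - l) * (1 + energy l w).
  by rewrite [X in X <= _]h2; exact: lerD.
rewrite lerBlDr; move: h6 Xge dC; move: (C * (l' - l)) (energy l w) (energy l' u) (level_min l) => c X Y Lv.
by move=> h6 Xge dC; nra.
Qed.

(** Test with the next eigenvector [e m]: on the span of the first m + 1 eigenvectors quadQ l is at
    most (lam m - l) B. *)
Lemma level_min_endpoint l : in_gap l ->
  level_min l <= n%:R^-1 * (Cb * (lam m - l)) `^ (n%:R / 2).
Proof.
move=> lT; have [_ lm] := lT; have [g [hg og eg sg]] := eigenbasis HS HA HB He m.+1.
have [_ lmono _ _ _] := He.
apply: (level_min_ray lT (eH m) em_notin) => s z Zz.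
have hw : H (s *: e m + z) by apply: (subspaceD HS) (ZH Zz); exact: (subspaceZ HS).
apply: energy_le_bound => //; first by rewrite mulr_ge0 ?(ltW Cb0)// subr_ge0 ltW.
have sw : span_null H B g m.+1 (s *: e m + z).
  by rewrite sg; apply/(span_nullS B HS eH m _); split => //; exists s; rewrite addrAC subrr add0r.
have := eigen_form_le hg og eg (fun i im => lmono i m im) sw.
rewrite /quadQ => h; rewrite [Cb * _]mulrC -mulrA.
apply: (@le_trans _ _ ((lam m - l) * B (s *: e m + z) (s *: e m + z))); first by rewrite mulrBl lerD2r.
by rewrite ler_wpM2l ?subr_ge0 ?(ltW lm)//; exact: F_hoelder.
Qed.

Lemma level_min_strict l l' u : in_gap l -> in_gap l' -> l < l' -> nehari l u -> energy l u = level_min l ->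
  level_min l' < level_min l.
Proof.
move=> lT lT' ll nu uE; have [hu Zu _ _] := nu.
have [w [s [z [nw Zz wE _]]]] := minimax lT' hu Zu; have [hw Zw _ _] := nw.
apply: le_lt_trans (level_min_le lT' nw) _; rewrite -uE.
have := energy_le_nehari s lT nu Zz; rewrite -wE; apply: lt_le_trans.
rewrite (energy_shift l l') ltrDl mulr_gt0 ?divr_gt0 ?subr_gt0// lt_neqAle (form_ge0 HB)// andbT.
by apply/eqP => B0; apply: Zw; exact: span_null_null.
Qed.
(* A minimizing sequence u_k converges weakly to u; alpha and beta are the limits
   of A(u_k - u) and F(u_k - u), and the maximality of u_k on R u_k + Z passes to
   the limit by the Brezis-Lieb splitting. *)
Lemma minimizing_limit l : in_gap l -> exists (u : V) (alpha beta : R),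
  [/\ H u, 0 <= beta, K * beta `^ (2 / p) <= alpha,
      energy l u + alpha / 2 - p^-1 * beta = level_min l &
      forall (s : R) z, Z z ->
        energy l (s *: u + z) + s ^+ 2 * (alpha / 2) - p^-1 * (`|s| `^ p * beta) <= level_min l].
Proof.
move=> lT; have iX := nehari_has_inf lT; set L := level_min l.
have /choice[u_ hu_] (k : nat) : exists u, nehari l u /\ energy l u < L + k.+1%:R^-1.
  have [|_ [u nu <-] h] := inf_adherent (eps := k.+1%:R^-1) _ iX; first by rewrite invr_gt0.
  by exists u.
have nu k : nehari l (u_ k) by have [] := hu_ k.
have Hk k : H (u_ k) by have [] := nu k.
have Ek k : energy l (u_ k) <= L + k.+1%:R^-1 by have [_ /ltW] := hu_ k.
have FE k : F (u_ k) = n%:R * energy l (u_ k) by rewrite (energy_nehari (nu k)) mulrA divff ?mul1r// gt_eqF.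
have Fb k : F (u_ k) <= n%:R * (L + 1).
  rewrite FE ler_pM2l//; apply: le_trans (Ek k) _; by rewrite lerD2l invf_le1// ler1n.
have L0 := level_min_gt0 lT; rewrite -/L in L0.
pose M1 := Cb * (n%:R * (L + 1)) `^ (2 / p).
have Bb k : B (u_ k) (u_ k) <= M1.
  by apply: le_trans (F_hoelder (Hk k)) _; rewrite ler_pM2l//; apply: le_powR; rewrite ?(ltW p2V)// F_ge0.
have AE k : A (u_ k) (u_ k) = F (u_ k) + l * B (u_ k) (u_ k).
  by have [_ _ + _] := nu k; rewrite dF_diag// /quadQ => <-; rewrite subrK.
pose M2 := n%:R * (L + 1) + `|l| * M1.
have Ab k : A (u_ k) (u_ k) <= M2.
  rewrite AE lerD//; apply: (@le_trans _ _ (`|l| * B (u_ k) (u_ k))).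
    by rewrite ler_wpM2r ?(form_ge0 HB)// ler_norm.
  by rewrite ler_wpM2l.
have [s [u [hs hu cB wA]]] := WC Hk (fun k => lerD (Bb k) (Ab k)).
have [C C0 hC] := F_sobolev ltr01.
pose v_ k := u_ (s k).
have Hv k : H (v_ k) by exact: Hk.
have Hd k : H (v_ k - u) by exact: (subspaceB HS).
have Fd k : F (v_ k - u) <= (((1 + 1) * (2 * M2 + 2 * A u u) + C * (2 * M1 + 2 * B u u)) / K) `^ (p / 2).
  have hD (D : V -> V -> R) (M : R) w : psd_form H D -> H w -> D w w <= M ->
      D (w - u) (w - u) <= 2 * M + 2 * D u u.
    move=> PD hw DM; have := form_sqrD_le HS PD hw (subspaceN HS hu).
    have -> : D (- u) (- u) = D u u by rewrite -scaleN1r (form_sqrZ HS PD)// sqrrN expr1n mul1r.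
    by move: (D (w - u) _) (D w w) (D u u) DM => x y z; lra.
  have h1 := hD A M2 (v_ k) HA (Hv k) (Ab (s k)); have h2 := hD B M1 (v_ k) HB (Hv k) (Bb (s k)).
  have h3 : (1 + 1) * A (v_ k - u) (v_ k - u) + C * B (v_ k - u) (v_ k - u) <= (1 + 1) * (2 * M2 + 2 * A u u) + C * (2 * M1 + 2 * B u u).
    by apply: lerD; rewrite ler_wpM2l// ltW.
  have h4 := le_trans (hC _ (Hd k)) h3.
  apply: sobolev_le => //; last by rewrite ler_pdivlMr// mulrC.
  rewrite divr_ge0 ?(ltW K0)//; apply: le_trans h4; by rewrite mulr_ge0 ?powR_ge0// ltW.
have [s2 [hs2 hBL]] := F_brezis_lieb Hv hu cB Fd.
pose w_ k := v_ (s2 k); pose d_ k := w_ k - u.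
have hw k : H (w_ k) by exact: Hk.
have hd k : H (d_ k) by exact: (subspaceB HS).
have cs2 := incr_cvg_oo hs2.
have cL : (fun k => energy l (w_ k)) @ \oo --> L.
  have c0 : (fun k => energy l (u_ k)) @ \oo --> L.
    apply/cvgrPdist_le => d d0; have /cvgrPdist_le/(_ d d0)[N _ hN] := @cvg_harmonic R.
    exists N => // k /= Nk; have h := level_min_le lT (nu k); have h2 := Ek k.
    rewrite ler0_norm ?subr_le0// opprB lerBlDl; apply: le_trans h2 _; rewrite lerD2l.
    by have := hN k Nk; rewrite sub0r normrN; exact: le_trans (ler_norm _).
  exact: (cvg_comp _ _ cs2 (cvg_comp _ _ (incr_cvg_oo hs) c0)).
have cF : (fun k => F (w_ k)) @ \oo --> n%:R * L.
  by rewrite (_ : (fun k => _) = (fun k => n%:R * energy l (w_ k))); [exact: cvgMr|apply/funext => k; exact: FE].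
have cBw : cvg_form B w_ u.
  move=> e0 /cB[N hN]; exists N => k Nk; apply: hN; apply: (leq_trans Nk).
  exact: leq_incr.
have cBs := cvg_form_self HS HB hw hu cBw; have cBd := cvg_form_sqr HS HB hw hu cBw.
have wA2 v : H v -> (fun k => A (w_ k) v) @ \oo --> A u v.
  by move=> hv; exact: (cvg_comp _ _ cs2 (wA v hv)).
pose alpha := n%:R * L + l * B u u - A u u; pose beta := n%:R * L - F u.
have cA : (fun k => A (w_ k) (w_ k)) @ \oo --> n%:R * L + l * B u u.
  rewrite (_ : (fun k => _) = (fun k => F (w_ k) + l * B (w_ k) (w_ k))); last by apply/funext => k; exact: AE.
  by apply: cvgD => //; exact: cvgMr.
have cAd : (fun k => A (d_ k) (d_ k)) @ \oo --> alpha.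
  have -> : alpha = n%:R * L + l * B u u - 2 * A u u + A u u by rewrite /alpha; ring.
  rewrite (_ : (fun k => _) = (fun k => A (w_ k) (w_ k) - 2 * A (w_ k) u + A u u)); last first.
    by apply/funext => k; exact: (form_sqrB HS HA).
  by apply: cvgD; [apply: cvgB => //; apply: cvgMr; exact: wA2|exact: cvg_cst].
have cFd : (fun k => F (d_ k)) @ \oo --> beta.
  have h := hBL 1 u hu.
  rewrite (_ : (fun k => _) = (fun k => F (w_ k) - (F (1 *: (v_ (s2 k) - u) + u) - `|1| `^ p * F (v_ (s2 k) - u)))).
    exact: cvgB.
  by apply/funext => k; rewrite normr1 powR1 mul1r scale1r subrK opprB addrC subrK.
have cE (t : R) z : H z -> (fun k => energy l (t *: d_ k + z)) @ \oo -->
    energy l z + t ^+ 2 * (alpha / 2) - p^-1 * (`|t| `^ p * beta).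
  move=> hz.
  (* The zeros mark the limits of B(d_k, d_k) and of the cross terms A(d_k, z) and B(d_k, z). *)
  have -> : energy l z + t ^+ 2 * (alpha / 2) - p^-1 * (`|t| `^ p * beta) =
    (t ^+ 2 * (alpha - l * 0) + 2 * t * (0 - l * 0) + quadQ l z z) / 2 - p^-1 * (F z + `|t| `^ p * beta).
    by rewrite energyE; move: (quadQ l z z) (F z) => q w; move: (_ `^ _) => x; field; rewrite gt_eqF.
  rewrite (_ : (fun k => _) = (fun k => (t ^+ 2 * (A (d_ k) (d_ k) - l * B (d_ k) (d_ k)) + 2 * t * ((A (w_ k) z - A u z) - l * (B (w_ k) z - B u z)) + quadQ l z z) / 2 - p^-1 * ((F (t *: (v_ (s2 k) - u) + z) - `|t| `^ p * F (v_ (s2 k) - u)) + `|t| `^ p * F (d_ k)))); last first.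
    apply/funext => k; rewrite energyE quadQ_sqrD//; congr (_ / 2 - p^-1 * _).
      by rewrite /quadQ -(formBl HS HA (hw k) hu hz) -(formBl HS HB (hw k) hu hz).
    by rewrite subrK.
  apply: cvgB; last by apply: cvgMr; apply: cvgD; [exact: hBL|exact: cvgMr].
  apply: cvgMl; apply: cvgD; last exact: cvg_cst.
  apply: cvgD; first by apply: cvgMr; apply: cvgB => //; exact: cvgMr.
  apply: cvgMr; apply: cvgB.
    by rewrite -[X in _ --> X](subrr (A u z)); apply: cvgB; [exact: wA2|exact: cvg_cst].
  apply: cvgMr; rewrite -[X in _ --> X](subrr (B u z)); apply: cvgB; last exact: cvg_cst.
  exact: (cvg_form_linear HS HB hw hu hz cBw).
exists u, alpha, beta; split => //.
- by apply: (cvg_seq_ge cFd) => k; exact: F_ge0.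
- have a0 : 0 <= alpha by apply: (cvg_seq_ge cAd) => k; exact: (form_ge0 HA).
  apply/ler_addgt0Pr => eta eta0; pose d := eta / (alpha + 1).
  have d0 : 0 < d by rewrite divr_gt0// ltr_wpDl.
  have [C' C'0 hC'] := F_sobolev d0.
  apply: (@le_trans _ _ ((1 + d) * alpha)); last first.
    rewrite mulrDl mul1r lerD2l /d mulrAC ler_pdivrMr ?ltr_wpDl//.
    by rewrite ler_pM2l// lerDl.
  have x0 : 0 <= (1 + d) * alpha / K by rewrite divr_ge0 ?(ltW K0)// mulr_ge0// addr_ge0// ltW.
  suff h : beta <= ((1 + d) * alpha / K) `^ (p / 2).
    have b0 : 0 <= beta by apply: (cvg_seq_ge cFd) => k; exact: F_ge0.
    have := le_powR (r := 2 / p) (ltW p2V) b0 h.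
    rewrite -powRrM (_ : p / 2 * (2 / p) = 1) ?powRr1//; last by field; rewrite gt_eqF.
    by rewrite ler_pdivlMr// mulrC.
  rewrite leNgt; apply/negP => hb.
  (* A value strictly between: F(d_k) eventually exceeds it, so the Sobolev inequality holds for g
     and contradicts its choice. *)
  pose g := (((1 + d) * alpha / K) `^ (p / 2) + beta) / 2.
  have [g1 g2] : ((1 + d) * alpha / K) `^ (p / 2) < g /\ g < beta.
    by rewrite /g; move: (_ `^ _) hb => y hb; split; lra.
  have g0 : 0 <= g by apply: le_trans (ltW g1); exact: powR_ge0.
  have : K * g `^ (2 / p) <= (1 + d) * alpha + C' * 0.
    have c : (fun k => (1 + d) * A (d_ k) (d_ k) + C' * B (d_ k) (d_ k)) @ \oo --> (1 + d) * alpha + C' * 0.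
      by apply: cvgD; apply: cvgMr.
    rewrite -(cvg_lim (@Rhausdorff R) c); apply: limr_ge; first by apply/cvg_ex; exists ((1 + d) * alpha + C' * 0).
    have /cvgrPdist_lt/(_ (beta - g)) := cFd; rewrite subr_gt0 => /(_ g2)[N _ hN].
    exists N => // k /= /hN; rewrite ltr_norml => /andP[_ h].
    apply: le_trans (hC' _ (hd k)); rewrite ler_pM2l//; apply: le_powR; rewrite ?(ltW p2V)//.
    by move: h; move: (F (d_ k)) => y; lra.
  rewrite mulr0 addr0 mulrC -ler_pdivlMr// => /(le_powR (r := p / 2)).
  rewrite (ltW p20) powR_ge0 => /(_ isT isT).
  rewrite -powRrM (_ : 2 / p * (p / 2) = 1) ?powRr1//; last by field; rewrite gt_eqF.
  by rewrite leNgt g1.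
- have aux (x y f' w q : R) : (x - l * y) / 2 - q * f' + (w + l * y - x) / 2 - q * (w - f') = (2^-1 - q) * w by field.
  by rewrite energyE /quadQ aux (half_sub_inv_crit hn) mulrA mulVf ?mul1r// gt_eqF.
- move=> t z Zz; have hz := ZH Zz.
  rewrite -subr_ge0; apply: (cvg_seq_ge (cvgB cL (cE t _ (subspaceD HS (subspaceZ HS t hu) hz)))) => k.
  by rewrite subr_ge0 addrA -scalerDr subrK; exact: (energy_le_nehari t lT (nu _) Zz).
Qed.
(** A lost part with be > 0 carries, at its own ray maximum s0, more than the level, so all s0 u + z
    have negative energy. This is refuted by z = -s0 u if u is in Z and otherwise by a multiple of a
    Nehari point on R u + Z. Then be = 0, al = 0 follows, and u itself is the minimizer. *)
Lemma level_min_attained l : in_gap l -> level_min l < n%:R^-1 * K `^ (n%:R / 2) ->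
  exists2 u, nehari l u & energy l u = level_min l.
Proof.
move=> lT Lk; have [u [al [be [hu be0 KS Leq Lle]]]] := minimizing_limit lT.
have L0 := level_min_gt0 lT; set L := level_min l in L0 Lk Leq Lle *.
have al0 : 0 <= al by apply: le_trans KS; rewrite mulr_ge0 ?powR_ge0// ltW.
have E0 : energy l 0 = 0 by have := energyZ l 0 (subspace0 HS); rewrite scale0r normr0 expr0n/= !mul0r powR0 ?mul0r ?mulr0 ?subrr// gt_eqF.
have hE0 z : Z z -> energy l z <= 0.
  move=> Zz; have := quadQ_le0 lT Zz; have := F_ge0 (ZH Zz); rewrite energyE.
  have : 0 < p^-1 by rewrite invr_gt0.
  by move: (p^-1) (F z) (quadQ l z z) => i y q; nra.
have s_neq0 w (s : R) z : nehari l w -> Z z -> w = s *: u + z -> s != 0.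
  by move=> [_ Zw _ _] Zz wE; apply/eqP => s0; apply: Zw; rewrite wE s0 scale0r add0r.
have pm2 : 0 < p - 2 by rewrite subr_gt0.
have powS (t : R) : 0 < t -> t `^ p = t ^+ 2 * t `^ (p - 2).
  move=> t0; rewrite -powR_mulrn ?(ltW t0)// -powRD; last by rewrite (gt_eqF t0) implybT.
  by congr (_ `^ _); ring.
have be_eq0 : be = 0.
  apply/eqP; rewrite eq_le be0 andbT leNgt; apply/negP => be1.
  have al1 : 0 < al by apply: lt_le_trans KS; rewrite mulr_gt0 ?powR_gt0.
  have [s0_gt0 s0E] := ray_attain hn al1 be1; set s0 := (al / be) `^ (p - 2)^-1 in s0_gt0 s0E.
  have gk : L < s0 ^+ 2 * (al / 2) - p^-1 * (s0 `^ p * be).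
    rewrite mulrA s0E; apply: (lt_le_trans Lk); rewrite ler_pM2l ?invr_gt0//.
    apply: le_powR; rewrite ?(ltW K0) ?divr_ge0 ?(ltW n0)//.
    by rewrite ler_pdivlMr ?powR_gt0.
  have neg z : Z z -> energy l (s0 *: u + z) < 0.
    move=> /(Lle s0); rewrite gtr0_norm// => h.
    by move: gk h; move: (energy _ _) (s0 ^+ 2 * _) (p^-1 * (_ * be)) => x y q; lra.
  have [Zu|nZu] := pselect (Z u).
    have := neg (- s0 *: u) (subspaceZ ZS (- s0) Zu).
    by rewrite scaleNr subrr E0 ltxx.
  have [w [s [z [nw Zz wE _]]]] := minimax lT hu nZu; have hw : H w by case: nw.
  have s_0 : 0 < `|s| by rewrite normr_gt0 (s_neq0 _ _ _ nw Zz wE).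
  (* The Nehari point w = s u + z already has energy at least the level, so the lost part cannot
     contribute a positive amount at s. *)
  have h1 : s ^+ 2 * (al / 2) - p^-1 * (`|s| `^ p * be) <= 0.
    have := Lle s z Zz; rewrite -wE; have := level_min_le lT nw; rewrite -/L.
    by move: (energy l w) (s ^+ 2 * _) (p^-1 * (_ * be)) => x y q; lra.
  have h2 : al / 2 <= p^-1 * (`|s| `^ (p - 2) * be).
    rewrite -(ler_pM2l (exprn_gt0 2 s_0)) -subr_le0; move: h1.
    rewrite (powS _ s_0) -(real_normK (num_real s)) /=.
    by move: (p^-1) (`|s| `^ _) (`|s| ^+ 2) => x y q; rewrite [q * (x * _)](_ : _ = x * (q * y * be)); last by ring.
  pose t := s0 / s.
  have tw : t *: w = s0 *: u + t *: z.
    by rewrite wE scalerDr scalerA /t divfK// (s_neq0 _ _ _ nw Zz wE).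
  have := neg (t *: z) (subspaceZ ZS t Zz); rewrite -tw energyZ//.
  have -> : quadQ l w w = F w by have [_ _ -> _] := nw; rewrite dF_diag.
  have t0 : 0 < `|t| by rewrite /t normrM normfV mulr_gt0 ?invr_gt0// gtr0_norm.
  rewrite (powS _ t0) -(real_normK (num_real t)) /=.
  have Fw := nehari_gt0 nw.
  (* [h2] says |s|^(p-2) >= (p/2) s0^(p-2). The energy of t w is t^2 F(w) (1/2 - |t|^(p-2)/p), so
     the bound makes it positive because p > 2. *)
  have h3 : `|t| `^ (p - 2) <= 2 / p.
    have tE : `|t| `^ (p - 2) = al / be / `|s| `^ (p - 2).
      rewrite /t normrM normfV gtr0_norm// powRM ?invr_ge0 ?(ltW s0_gt0)//.
      rewrite (_ : `|s|^-1 `^ (p - 2) = (`|s| `^ (p - 2))^-1); last first.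
        by rewrite -(powR_inv1 (ltW s_0)) -powRrM mulN1r powRN.
      by rewrite /s0 powRVK ?gt_eqF ?divr_ge0 ?(ltW al1).
    rewrite tE ler_pdivrMr ?powR_gt0// ler_pdivrMr//.
    move: h2; rewrite ler_pdivrMr//; congr (_ <= _).
    by move: (`|s| `^ _) => x; field; rewrite gt_eqF.
  have h4 : `|t| `^ (p - 2) / p < 2^-1.
    rewrite ltr_pdivrMr//; apply: le_lt_trans h3 _; rewrite ltr_pdivrMr//.
    by move: (p) p2 => q q2; nra.
  have tt : 0 < `|t| ^+ 2 * F w by rewrite mulr_gt0// exprn_gt0.
  move: tt h4; move: (`|t| `^ _) (`|t| ^+ 2) (F w) => x y q tt h4.
  rewrite (_ : _ - _ = (y * q) * (2^-1 - x / p)); last by field; rewrite gt_eqF.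
  by rewrite pmulr_rlt0// subr_lt0 ltNge (ltW h4).
rewrite be_eq0 mulr0 subr0 in Leq.
have Lle' (s : R) z : Z z -> energy l (s *: u + z) + s ^+ 2 * (al / 2) <= L.
  by move=> /(Lle s); rewrite be_eq0 !mulr0 subr0.
have nZu : ~ Z u.
  move=> Zu.
  (* With be = 0 and s u in Z, the term s^2 al / 2 would be unbounded in s; then only energy l u <=
     0 is left for the positive level. *)
  have al00 : al = 0.
    apply/eqP; rewrite eq_le al0 andbT leNgt; apply/negP => al1.
    have := Lle' (Num.sqrt (2 * (L + 1) / al)) (- Num.sqrt (2 * (L + 1) / al) *: u) (subspaceZ ZS _ Zu).
    rewrite scaleNr subrr E0 add0r sqr_sqrtr; last by rewrite divr_ge0 ?mulr_ge0 ?addr_ge0 ?(ltW L0) ?(ltW al1).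
    rewrite (_ : _ * _ = L + 1); last by field; rewrite gt_eqF.
    by rewrite leNgt ltrDl ltr01.
  by move: L0; rewrite -Leq al00 mul0r addr0 ltNge hE0.
have [w [s [z [nw Zz wE _]]]] := minimax lT hu nZu.
have s0 := s_neq0 _ _ _ nw Zz wE.
have al00 : al = 0.
  apply/eqP; rewrite eq_le al0 andbT; have := Lle' s z Zz; rewrite -wE.
  have := level_min_le lT nw; rewrite -/L => h h2.
  have h3 : s ^+ 2 * (al / 2) <= 0 by move: h h2; move: (energy l w) (s ^+ 2 * _) => x y; lra.
  by move: h3; rewrite pmulr_rle0 ?exprn_even_gt0// ler_pdivrMr// mul0r.
rewrite al00 mul0r addr0 in Leq.
have mx v : (v = u \/ Z v) -> forall t, energy l (u + t *: v) <= energy l u.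
  move=> hv t; rewrite Leq; have [s' [z' [Zz' ->]]] : exists (s' : R) z', Z z' /\ u + t *: v = s' *: u + z'.
    case: hv => [->|Zv].
      by exists (1 + t), 0; rewrite scalerDl scale1r addr0; split => //; exact: (subspace0 ZS).
    by exists 1, (t *: v); rewrite scale1r; split => //; exact: (subspaceZ ZS).
  by have := Lle' s' z' Zz'; rewrite al00 mul0r mulr0 addr0.
exists u => //; split => //.
- by apply: crit_energy => //; apply: mx; left.
- by move=> v Zv; apply: crit_energy; [exact: hu|exact: ZH|apply: mx; right].
Qed.
Lemma span_form_CS : exists2 C : R, 0 <= C & forall z v, Z z -> H v ->
  `|A z v| <= C * (Num.sqrt (B z z) * Num.sqrt (B v v)).
Proof.
exists (\sum_(j < m) `|lam j|); first exact: sumr_ge0.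
move=> z v Zz hv; have hz := ZH Zz; have hP := oproj_H B HS m hf z.
have hd := subspaceB HS hz hP.
have d0 : B (z - oproj B f m z) (z - oproj B f m z) = 0.
  by apply/(span_nullP HS HB hf of_ hz); rewrite sf.
have -> : A z v = A (oproj B f m z) v.
  have := form_null HS HA hd hv (null_AB hd d0); rewrite (formBl HS HA)// => /eqP.
  by rewrite subr_eq0 => /eqP.
rewrite /oproj (form_suml HS HA) => [|j _|]//; last exact: (subspaceZ HS).
apply: le_trans (ler_norm_sum _ _ _) _; rewrite mulr_suml; apply: ler_sum => j _.
rewrite (formZl HA)//; have [_ ->//] := ef (ltn_ord j).
rewrite mulrCA normrM ler_wpM2l// normrM; apply: ler_pM => //.
  have := form_CS_abs HS HB hz (hf j).
  by rewrite of_// eqxx sqrtr1 mulr1.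
have := form_CS_abs HS HB (hf j) hv.
by rewrite of_// eqxx sqrtr1 mul1r.
Qed.

Hypothesis F_add : forall d : R, 0 < d -> exists2 C : R, 0 < C & forall u h, H u -> H h ->
  `|F (u + h) - F u| <= d * F u + C * F h.

(* If the estimate failed along the concentrating sequence, normalized
   counterexamples s_k u_k + z_k would converge weakly to some z in Z and, by
   Brezis-Lieb, F (s_k u_k + z_k) would tend to lim |s_k|^p + F z. *)
Lemma concentration l (eta : R) (u_ : nat -> V) : in_gap l -> 0 < eta -> (forall k, H (u_ k)) ->
  (forall k, F (u_ k) = 1) -> (forall k, A (u_ k) (u_ k) <= K + eta / 2) ->
  (fun k => B (u_ k) (u_ k)) @ \oo --> (0 : R) ->
  exists u, [/\ H u, ~ Z u & forall (s : R) z, Z z ->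
     let w := s *: u + z in quadQ l w w <= (K + eta) * F w `^ (2 / p)].
Proof.
move=> lT eta0 hu Fu Au cBu; apply: contrapT => /forallNP hbad.
have [C C0 hC] := span_form_le hf of_; have [C1 C10 hC1] := F_sobolev ltr01.
have [C2 C20 hC2] := span_form_CS.
have Ke : 0 < K + eta by rewrite addr_gt0.
have B0 k : 0 <= B (u_ k) (u_ k) by exact: (form_ge0 HB).
(* On Z the forms A and F^(2/p) are bounded by B, which tends to 0 along u_k although F(u_k) = 1. *)
have [N hN] : exists N, forall k, (N <= k)%N -> ~ Z (u_ k).
  pose D := (1 + 1) * C + C1; have D0 : 0 < D by rewrite ltr_wpDl// mulr_ge0.
  have KD : 0 < K / (D * 2) by rewrite divr_gt0// mulr_gt0.
  have /cvgrPdist_le/(_ _ KD)[N _ hN] := cBu; exists N => k /hN; rewrite sub0r normrN ger0_norm// => h Zk.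
  have := hC1 _ (hu k); rewrite Fu powR1 mulr1.
  have := hC (u_ k); rewrite sf => /(_ Zk) h1 h2.
  have : K <= D * B (u_ k) (u_ k).
    apply: le_trans h2 _; rewrite [D * _]mulrDl lerD2r -mulrA ler_wpM2l//.
  move=> h3; have : D * B (u_ k) (u_ k) <= K / 2.
    by move: h; rewrite ler_pdivlMr ?mulr_gt0// => h; rewrite ler_pdivlMr//; apply: le_trans h; rewrite le_eqVlt; apply/orP; left; apply/eqP; ring.
  by move: h3 K0; move: (D * _) => x; lra.
(* Both sides of the estimate are homogeneous of degree 2, so counterexamples may be normalized; s^2
   + B(z, z) cannot vanish, since on Z the estimate holds. *)
have /choice[s_ /choice[z_ hz_]] (k : nat) : exists (s : R) z, [/\ Z z, s ^+ 2 + B z z = 1 &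
    (K + eta) * F (s *: u_ (k + N)%N + z) `^ (2 / p) <= quadQ l (s *: u_ (k + N)%N + z) (s *: u_ (k + N)%N + z)].
  set u := u_ (k + N)%N; have hu' : H u by exact: hu.
  have [s [z [Zz bad]]] : exists (s : R) z, Z z /\
      (K + eta) * F (s *: u + z) `^ (2 / p) < quadQ l (s *: u + z) (s *: u + z).
    apply: contrapT => /forallNP no; apply: (hbad u); split => //; first by apply: hN; exact: leq_addl.
    move=> s z Zz /=; rewrite leNgt; apply/negP => h.
    by have /forallNP/(_ z) := no s; apply.
  have hz := ZH Zz.
  pose r := s ^+ 2 + B z z.
  have r0 : 0 < r.
    rewrite lt_neqAle addr_ge0 ?sqr_ge0 ?(form_ge0 HB)// andbT eq_sym; apply/eqP => r0.
    have s2 : s ^+ 2 = 0.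
      apply/eqP; rewrite eq_le sqr_ge0 andbT -r0 lerDl; exact: (form_ge0 HB).
    move: bad; have -> : s = 0 by apply/eqP; rewrite -sqrf_eq0 s2.
    rewrite scale0r add0r ltNge; apply/negP; rewrite negbK; apply: le_trans (quadQ_le0 lT Zz) _.
    by rewrite mulr_ge0 ?powR_ge0// ltW.
  pose t := (Num.sqrt r)^-1; have t0 : 0 < t by rewrite invr_gt0 sqrtr_gt0.
  have tr : t ^+ 2 * r = 1 by rewrite exprVn sqr_sqrtr ?(ltW r0)// mulVf// gt_eqF.
  exists (t * s), (t *: z); split; first exact: (subspaceZ ZS).
    by rewrite exprMn (form_sqrZ HS HB)// -mulrDr.
  have hw : H (s *: u + z) by exact: (subspaceD HS (subspaceZ HS s hu') hz).
  rewrite -scalerA -scalerDr FZ// /quadQ (form_sqrZ HS HA)// (form_sqrZ HS HB)//.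
  rewrite powRM ?powR_ge0 ?F_ge0// -powRrM (_ : p * (2 / p) = 2); last by field; rewrite gt_eqF.
  rewrite powR_mulrn// real_normK ?num_real// mulrCA [l * _]mulrCA -mulrBr ler_pM2l ?exprn_gt0//.
  exact: ltW.
pose U k := u_ (k + N)%N.
have hU k : H (U k) by exact: hu.
have Zz k : Z (z_ k) by have [] := hz_ k.
have hz k : H (z_ k) by exact: ZH.
have sz k : s_ k ^+ 2 + B (z_ k) (z_ k) = 1 by have [] := hz_ k.
have Bz1 k : B (z_ k) (z_ k) <= 1 by rewrite -(sz k) lerDr sqr_ge0.
have s1 k : s_ k ^+ 2 <= 1 by rewrite -(sz k) lerDl (form_ge0 HB).
have Az k : B (z_ k) (z_ k) + A (z_ k) (z_ k) <= 1 + C.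
  rewrite lerD//; apply: le_trans (hC _ _) _; first by rewrite sf.
  by rewrite -[X in _ <= X]mulr1 ler_wpM2l.
have [i [z [hi Hz cz _]]] := WC hz Az.
have {Zz}Zi k : Z (z_ (i k)) by [].
have hzi k : H (z_ (i k)) by [].
have Z_z : Z z by rewrite -sf; apply: (span_null_closed hf of_) cz => // k; rewrite sf.
have cU : (fun k => B (U k) (U k)) @ \oo --> (0 : R) by exact: (cvg_comp _ _ (cvg_addnr N) cBu).
pose sg := Num.sqrt (1 - B z z).
have cBz := cvg_form_self HS HB hzi Hz cz.
have cs2 : (fun k => s_ (i k) ^+ 2) @ \oo --> 1 - B z z.
  rewrite (_ : (fun k => _) = (fun k => 1 - B (z_ (i k)) (z_ (i k)))); first by apply: cvgB => //; exact: cvg_cst.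
  by apply/funext => k; rewrite -(sz (i k)) addrK.
have sg2 : sg ^+ 2 = 1 - B z z.
  by rewrite sqr_sqrtr//; apply: (cvg_seq_ge cs2) => k; exact: sqr_ge0.
have csg : (fun k => `|s_ (i k)|) @ \oo --> sg.
  rewrite (_ : (fun k => _) = (fun k => Num.sqrt (s_ (i k) ^+ 2))); last by apply/funext => k; rewrite sqrtr_sqr.
  exact: (cvg_comp _ _ cs2 (@sqrt_continuous R (1 - B z z))).
have csp : (fun k => `|s_ (i k)| `^ p) @ \oo --> sg `^ p.
  have := cvg_comp _ _ csg (@continuous_apow R p p2 sg).
  rewrite /apow ger0_norm ?sqrtr_ge0// => h; apply: cvg_trans h.
  by apply: near_eq_cvg; apply: nearW => k /=; rewrite normr_id.
pose h k := z_ (i k) - z; have hh k : H (h k) by exact: (subspaceB HS).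
pose v k := s_ (i k) *: U (i k) + h k.
have hsU k : H (s_ (i k) *: U (i k)) by exact: (subspaceZ HS).
have hv k : H (v k) by exact: (subspaceD HS).
have ci := incr_cvg_oo hi.
have cUi : (fun k => B (U (i k)) (U (i k))) @ \oo --> (0 : R) := cvg_comp _ _ ci cU.
have cBh : (fun k => B (h k) (h k)) @ \oo --> (0 : R) := cvg_form_sqr HS HB hzi Hz cz.
have cBv : cvg_form B v 0.
  move=> e0 e00; have e4 : 0 < e0 / 4 by rewrite divr_gt0.
  have /cvgrPdist_le/(_ _ e4)[N1 _ h1] := cUi; have /cvgrPdist_le/(_ _ e4)[N2 _ h2] := cBh.
  exists (N1 + N2)%N => k Nk; rewrite subr0.
  have := h1 k (leq_trans (leq_addr _ _) Nk); have := h2 k (leq_trans (leq_addl _ _) Nk).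
  rewrite !sub0r !normrN !ger0_norm ?(form_ge0 HB)// => g1 g2.
  apply: le_trans (form_sqrD_le HS HB (hsU k) (hh k)) _; rewrite (form_sqrZ HS HB)//.
  have g3 : s_ (i k) ^+ 2 * B (U (i k)) (U (i k)) <= e0 / 4.
    by apply: le_trans g2; rewrite ler_piMl// (form_ge0 HB).
  by move: g1 g3; move: (B (h k) (h k)) (_ * B _ _) => x y; lra.
have cFh : (fun k => F (h k)) @ \oo --> (0 : R).
  apply/cvgrPdist_le => e0 e00.
  pose D := (1 + 1) * C + C1; have D0 : 0 < D by rewrite ltr_wpDl// mulr_ge0.
  have e1 : 0 < K * e0 `^ (2 / p) / D by rewrite divr_gt0// mulr_gt0// powR_gt0.
  have /cvgrPdist_le/(_ _ e1)[N1 _ h1] := cBh; exists N1 => // k /h1.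
  rewrite !sub0r !normrN !ger0_norm ?(form_ge0 HB) ?F_ge0// => g1.
  have Zh : Z (h k) by exact: (subspaceB ZS).
  have g2 : K * F (h k) `^ (2 / p) <= K * e0 `^ (2 / p).
    apply: le_trans (hC1 _ (hh k)) _; apply: (@le_trans _ _ (D * B (h k) (h k))).
      rewrite [D * _]mulrDl lerD2r -mulrA ler_wpM2l//; apply: hC; by rewrite sf.
    by rewrite mulrC -ler_pdivlMr.
  have g3 : F (h k) `^ (2 / p) <= e0 `^ (2 / p) by rewrite -(ler_pM2l K0).
  apply: le_trans (sobolev_le (hh k) (powR_ge0 _ _) g3) _.
  by rewrite -powRrM (_ : 2 / p * (p / 2) = 1) ?powRr1 ?(ltW e00)//; field; rewrite gt_eqF.
have cFv : (fun k => F (v k)) @ \oo --> sg `^ p.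
  have FsU k : F (s_ (i k) *: U (i k)) = `|s_ (i k)| `^ p by rewrite FZ// Fu mulr1.
  have sp1 k : `|s_ (i k)| `^ p <= 1.
    have h1 : `|s_ (i k)| <= 1 by rewrite -(@ler_pXn2r _ 2)// ?nnegrE// real_normK ?num_real// expr1n.
    by have := le_powR (ltW p0) (normr_ge0 _) h1; rewrite powR1.
  have c0 : (fun k => F (v k) - `|s_ (i k)| `^ p) @ \oo --> (0 : R).
    apply/cvgrPdist_le => e0 e00; have e2 : 0 < e0 / 2 by rewrite divr_gt0.
    have [Cd Cd0 hCd] := F_add e2; have e3 : 0 < e0 / 2 / Cd by rewrite divr_gt0.
    have /cvgrPdist_le/(_ _ e3)[N1 _ h1] := cFh; exists N1 => // k /h1.
    rewrite !sub0r !normrN (ger0_norm (F_ge0 (hh k))) ler_pdivlMr// mulrC => g1.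
    rewrite -FsU; apply: le_trans (hCd _ _ (hsU k) (hh k)) _; rewrite FsU [X in _ <= X]splitr lerD//.
    by rewrite ler_piMr// ltW.
  rewrite (_ : (fun k => _) = (fun k => F (v k) - `|s_ (i k)| `^ p + `|s_ (i k)| `^ p)).
    by rewrite -[X in _ --> X]add0r; exact: (cvgD c0 csp).
  by apply/funext => k; rewrite subrK.
have [M hM] : exists M, forall k, F (v k - 0) <= M.
  have [M [_ hM]] : bounded_fun (fun k => F (v k)) by apply: cvg_seq_bounded; apply/cvg_ex; exists (sg `^ p).
  by exists (M + 1) => k; rewrite subr0; apply: le_trans (ler_norm _) _; apply: hM => //; rewrite ltrDl.
have [j [hj hBL]] := F_brezis_lieb hv (subspace0 HS) cBv hM.
have cj := incr_cvg_oo hj.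
pose w k := v (j k) + z; pose ij k := i (j k).
have wE k : w k = s_ (ij k) *: U (ij k) + z_ (ij k) by rewrite /w /v /h -addrA subrK.
have hw k : H (w k) by exact: (subspaceD HS).
have cFw : (fun k => F (w k)) @ \oo --> sg `^ p + F z.
  have h1 := hBL 1 z Hz.
  have h2 : (fun k => F (v (j k))) @ \oo --> sg `^ p := cvg_comp _ _ cj cFv.
  rewrite (_ : (fun k => _) = (fun k => F (1 *: (v (j k) - 0) + z) - `|1| `^ p * F (v (j k) - 0) + F (v (j k)))).
    by rewrite addrC; exact: (cvgD h1 h2).
  by apply/funext => k; rewrite subr0 scale1r normr1 powR1 mul1r subrK.
pose x k := s_ (ij k) ^+ 2 * (K + eta / 2) + `|l| * B (U (ij k)) (U (ij k)) + 2 * ((C2 + `|l|) * Num.sqrt (B (U (ij k)) (U (ij k)))).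
have cUij : (fun k => B (U (ij k)) (U (ij k))) @ \oo --> (0 : R) := cvg_comp _ _ cj cUi.
have cx : x @ \oo --> (1 - B z z) * (K + eta / 2).
  have -> : (1 - B z z) * (K + eta / 2) = (1 - B z z) * (K + eta / 2) + `|l| * 0 + 2 * ((C2 + `|l|) * Num.sqrt 0).
    by rewrite sqrtr0 !mulr0 !addr0.
  apply: cvgD.
    by apply: cvgD; [apply: cvgMl; exact: (cvg_comp _ _ cj cs2)|exact: cvgMr].
  do 2 apply: cvgMr; exact: (cvg_comp _ _ cUij (@sqrt_continuous R 0)).
have hx k : (K + eta) * F (w k) `^ (2 / p) <= x k.
  have [_ _ h1] := hz_ (ij k); rewrite -/(U _) -wE in h1; apply: le_trans h1 _.
  rewrite wE quadQ_sqrD//.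
  have q1 : quadQ l (U (ij k)) (U (ij k)) <= K + eta / 2 + `|l| * B (U (ij k)) (U (ij k)).
    rewrite /quadQ lerD ?Au// -mulNr ler_wpM2r ?(form_ge0 HB)//.
    by rewrite -normrN ler_norm.
  have q2 : `|quadQ l (U (ij k)) (z_ (ij k))| <= (C2 + `|l|) * Num.sqrt (B (U (ij k)) (U (ij k))).
    have sz1 : Num.sqrt (B (z_ (ij k)) (z_ (ij k))) <= 1 by rewrite -sqrtr1 ler_wsqrtr.
    rewrite quadQC /quadQ mulrDl; apply: le_trans (ler_normB _ _) _; apply: lerD.
      apply: le_trans (hC2 _ _ (Zi (j k)) (hU _)) _; rewrite ler_wpM2l//.
      by rewrite ler_piMl ?sqrtr_ge0.
    rewrite normrM ler_wpM2l//; apply: le_trans (form_CS_abs HS HB (hz _) (hU _)) _.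
    by rewrite ler_piMl ?sqrtr_ge0.
  have q3 := quadQ_le0 lT (Zi (j k)).
  have sa : `|s_ (ij k)| <= 1 by rewrite -(@ler_pXn2r _ 2)// ?nnegrE// real_normK ?num_real// expr1n.
  rewrite /x; set bb := B (U _) (U _); set y := (C2 + _) * _.
  have y0 : 0 <= y by rewrite mulr_ge0 ?addr_ge0 ?sqrtr_ge0.
  have q4 : s_ (ij k) * quadQ l (U (ij k)) (z_ (ij k)) <= y.
    apply: le_trans (ler_norm _) _; rewrite normrM -[X in _ <= X]mul1r; exact: ler_pM.
  have q5 : s_ (ij k) ^+ 2 * quadQ l (U (ij k)) (U (ij k)) <= s_ (ij k) ^+ 2 * (K + eta / 2) + `|l| * bb.
    apply: (@le_trans _ _ (s_ (ij k) ^+ 2 * (K + eta / 2 + `|l| * bb))); first by rewrite ler_wpM2l ?sqr_ge0.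
    rewrite mulrDr lerD2l ler_piMl// mulr_ge0// (form_ge0 HB)//.
  have aux (r1 r2 r3 r4 a1 a2 : R) : r3 <= 0 -> r2 <= r4 -> r1 <= a1 + a2 -> r1 + 2 * r2 + r3 <= a1 + a2 + 2 * r4 by lra.
  by rewrite -[2 * s_ _ * _]mulrA; exact: aux.
have Phi0 : 0 <= sg `^ p + F z by rewrite addr_ge0 ?powR_ge0 ?F_ge0.
have key : (K + eta) * (sg `^ p + F z) `^ (2 / p) <= (1 - B z z) * (K + eta / 2).
  apply/ler_addgt0Pr => e0 e00; set X := _ + e0.
  have /cvgrPdist_le/(_ _ e00)[N1 _ h1] := cx.
  have X0 : 0 <= X by rewrite addr_ge0 ?(ltW e00)// -sg2 mulr_ge0 ?sqr_ge0// addr_ge0 ?divr_ge0 ?(ltW eta0) ?(ltW K0).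
  have hle : sg `^ p + F z <= (X / (K + eta)) `^ (p / 2).
    have c' : (fun k => F (w (k + N1)%N)) @ \oo --> sg `^ p + F z by exact: (cvg_comp _ _ (cvg_addnr N1) cFw).
    apply: (cvg_seq_le c') => k; apply: sobolev_le => //; first by rewrite divr_ge0// ltW.
    rewrite ler_pdivlMr// mulrC; apply: le_trans (hx _) _.
    have := h1 (k + N1)%N (leq_addl _ _); rewrite ler_norml => /andP[+ _].
    by rewrite /X; move: (x _) (_ * _) => a1 a2; lra.
  have := le_powR (r := 2 / p) (ltW p2V) Phi0 hle.
  by rewrite -powRrM (_ : p / 2 * (2 / p) = 1) ?powRr1 ?divr_ge0 ?(ltW Ke)//; [rewrite ler_pdivlMr// mulrC|field; rewrite gt_eqF].
have sgE : sg ^+ 2 <= (sg `^ p + F z) `^ (2 / p).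
  have h1 : sg `^ p <= sg `^ p + F z by rewrite lerDl F_ge0.
  have := le_powR (r := 2 / p) (ltW p2V) (powR_ge0 _ _) h1.
  by rewrite -powRrM (_ : p * (2 / p) = 2) ?powR_mulrn ?sqrtr_ge0//; field; rewrite gt_eqF.
rewrite -sg2 in key.
(* The right side of [key] has the smaller constant K + eta / 2, which forces sg = 0. Then B(z, z) =
   1, so F z > 0, against the same inequality. *)
have sg0 : sg ^+ 2 = 0.
  apply/eqP; rewrite eq_le sqr_ge0 andbT.
  have h1 : (K + eta) * sg ^+ 2 <= sg ^+ 2 * (K + eta / 2) by apply: le_trans key; rewrite ler_pM2l.
  have h2 : eta / 2 * sg ^+ 2 <= 0 by move: h1; move: (sg ^+ 2) => y; lra.
  by move: h2; rewrite pmulr_rle0// divr_gt0.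
have Bz : B z z = 1 by apply/eqP; rewrite eq_sym -subr_eq0 -sg2 sg0.
have : (sg `^ p + F z) `^ (2 / p) <= 0 by rewrite -(pmulr_rle0 _ Ke) (le_trans key)// sg0 mul0r.
have Fz0 := F_gt0 Hz; rewrite Bz in Fz0; apply/negP; rewrite -ltNge powR_gt0//.
by rewrite ltr_wpDl ?powR_ge0// Fz0.
Qed.

End minimax.

End nehari.

(** * The critical term *)

Section power_integral.
Context {d : measure_display} {T : measurableType d} {R : realType}.
Variables (mu : {measure set T -> \bar R}) (D : set T) (p c0 c1 : R) (c : T -> R).
Hypotheses (mD : measurable D) (p2 : 2 < p) (mc : measurable_fun D c) (c00 : 0 < c0).
Hypothesis hc : forall x, D x -> c0 <= c x <= c1.
Local Notation apow := (apow p).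
Local Notation dapow := (dapow p).
Implicit Types u v w g : T -> R.

Let p0 : 0 < p. Proof. by move: p2; lra. Qed.
Let pn0 : p != 0. Proof. by rewrite gt_eqF. Qed.

Definition Lpow u := measurable_fun D u /\ mu.-integrable D (EFin \o (fun x => apow (u x))).
Definition pint u : R := \int[mu]_(x in D) (c x * apow (u x)).
Definition dpint u v : R := \int[mu]_(x in D) (c x * (dapow (u x) * v x)).

Lemma integrable_dom (f g : T -> R) : measurable_fun D f -> (forall x, D x -> `|f x| <= g x) ->
  mu.-integrable D (EFin \o g) -> mu.-integrable D (EFin \o f).
Proof.
move=> mf fg ig; apply: (le_integrable mD _ _ ig); first exact/measurable_EFinP.
by move=> x Dx /=; rewrite lee_fin; apply: le_trans (fg x Dx) (ler_norm _).
Qed.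

Lemma integrableDR f g : mu.-integrable D (EFin \o f) -> mu.-integrable D (EFin \o g) ->
  mu.-integrable D (EFin \o (fun x => f x + g x)).
Proof. by move=> i1 i2; exact: (integrableD mD i1 i2). Qed.

Lemma integrableZR k f : mu.-integrable D (EFin \o f) -> mu.-integrable D (EFin \o (fun x => k * f x)).
Proof. by move=> i1; exact: (integrableZl mD k i1). Qed.

Lemma integrable_weight g : mu.-integrable D (EFin \o g) -> mu.-integrable D (EFin \o (fun x => c x * g x)).
Proof.
move=> ig; have mg : measurable_fun D g by apply/measurable_EFinP; exact: (measurable_int mu ig).
apply: (le_integrable mD _ _ (integrableZl mD c1 ig)).
  by apply/measurable_EFinP; exact: measurable_funM.
move=> x Dx /=; rewrite lee_fin !normrM ler_wpM2r//.
have /andP[h1 h2] := hc Dx; have c0' := lt_le_trans c00 h1.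
by rewrite (gtr0_norm c0') (gtr0_norm (lt_le_trans c0' h2)).
Qed.

Lemma measurable_apow_comp u : measurable_fun D u -> measurable_fun D (fun x => apow (u x)).
Proof. by move=> mu_; apply: (measurableT_comp (measurable_apow p)). Qed.

Lemma measurable_dapow_comp u : measurable_fun D u -> measurable_fun D (fun x => dapow (u x)).
Proof.
move=> mu_; rewrite /dapow; apply: measurable_funM => //.
apply: (measurableT_comp (measurable_powR (p - 2))).
by apply: measurableT_comp => //; exact: normr_measurable.
Qed.

Lemma LpowD u v : Lpow u -> Lpow v -> Lpow (fun x => u x + v x).
Proof.
move=> [mu_ iu] [mv iv]; have mD_ : measurable_fun D (fun x => u x + v x) by exact: measurable_funD.
split=> //; apply: (integrable_dom (g := fun x => 2 `^ p * (apow (u x) + apow (v x)))).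
- exact: measurable_apow_comp.
- by move=> x _; rewrite ger0_norm ?apow_ge0// apowD_le.
- exact: (integrableZl mD _ (integrableD mD iu iv)).
Qed.

Lemma LpowZ k u : Lpow u -> Lpow (fun x => k * u x).
Proof.
move=> [mu_ iu]; have mk : measurable_fun D (fun x => k * u x) by exact: measurable_funM.
split=> //; apply: (integrable_dom (g := fun x => `|k| `^ p * apow (u x))).
- exact: measurable_apow_comp.
- by move=> x _; rewrite ger0_norm ?apow_ge0// apowM.
- exact: (integrableZl mD _ iu).
Qed.

Lemma integrable_pint u : Lpow u -> mu.-integrable D (EFin \o (fun x => c x * apow (u x))).
Proof. by move=> [_]; exact: integrable_weight. Qed.

Lemma integrable_dapow u v : Lpow u -> Lpow v -> mu.-integrable D (EFin \o (fun x => dapow (u x) * v x)).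
Proof.
move=> [mu_ iu] [mv iv].
apply: (integrable_dom (g := fun x => 2 `^ p * (apow (u x) + apow (v x)) + apow (v x))).
- by apply: measurable_funM => //; exact: measurable_dapow_comp.
- by move=> x _; have := @dapow_bound R p p2 0 (u x) (v x); rewrite normr0 mul0r addr0; apply; exact: ler01.
- exact: (integrableD mD (integrableZl mD _ (integrableD mD iu iv)) iv).
Qed.

Lemma pint_ge0 u : 0 <= pint u.
Proof.
apply: Rintegral_ge0 => x Dx; rewrite mulr_ge0 ?apow_ge0//.
by have /andP[h _] := hc Dx; exact: le_trans (ltW c00) h.
Qed.

Lemma pintZ k u : Lpow u -> pint (fun x => k * u x) = `|k| `^ p * pint u.
Proof.
move=> Lu; rewrite /pint -RintegralZl//; last exact: integrable_pint.
by apply: eq_Rintegral => x _; rewrite apowM// mulrCA.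
Qed.

Lemma dpint_diag u : dpint u u = pint u.
Proof. by apply: eq_Rintegral => x _; rewrite dapow_mul. Qed.

Lemma pint_nehari s u w : Lpow u -> Lpow w ->
  (s ^+ 2 - 1) / 2 * pint u + s * dpint u (fun x => w x - s * u x) + p^-1 * pint u - p^-1 * pint w <= 0.
Proof.
move=> Lu Lw; have iu := integrable_pint Lu; have iw := integrable_pint Lw.
have Lws : Lpow (fun x => w x - s * u x).
  have := LpowD Lw (LpowZ (- s) Lu); congr Lpow.
  by apply/funext => x; rewrite mulNr.
have id_ := integrable_weight (integrable_dapow Lu Lws).
have i1 := integrableZR ((s ^+ 2 - 1) / 2) iu; have i2 := integrableZR s id_.
have i3 := integrableZR p^-1 iu; have i4 := integrableZR (- p^-1) iw.
have i12 := integrableDR i1 i2; have i123 := integrableDR i12 i3.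
rewrite -mulNr /pint /dpint -(RintegralZl _ mD iu) -(RintegralZl _ mD id_) -(RintegralZl _ mD iu) -(RintegralZl _ mD iw).
rewrite -(RintegralD mD i1 i2) -(RintegralD mD i12 i3) -(RintegralD mD i123 i4).
have /= := RintegralZl (- 1) mD (integrableDR i123 i4).
rewrite mulN1r -oppr_ge0 => <-.
apply: Rintegral_ge0 => x Dx.
have /andP[h _] := hc Dx; have cx := le_trans (ltW c00) h.
have := apow_nehari p2 s (u x) (w x) => /(ler_wpM2l cx); rewrite mulr0 => hh.
by rewrite mulN1r oppr_ge0; apply: le_trans hh; rewrite le_eqVlt; apply/orP; left; apply/eqP; ring.
Qed.

(** Differentiation under the integral for |t| < 1; the derivative is dominated through
    [dapow_bound]. *)
Lemma is_derive_pint u v : Lpow u -> Lpow v ->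
  is_derive (0 : R) 1 (fun t : R => pint (fun x => u x + t * v x)) (p * dpint u v).
Proof.
move=> Lu Lv; have [mu_ iu] := Lu; have [mv iv] := Lv.
have c1_0 x : D x -> 0 <= c x <= c1.
  by move=> Dx; have /andP[h ->] := hc Dx; rewrite (le_trans (ltW c00) h).
pose f t x := c x * apow (u x + t * v x).
have df (t : R) x : is_derive t 1 (f^~ x) (c x * (p * dapow (u x + t * v x) * v x)).
  rewrite /f; have h1 : is_derive (v x * t + u x) 1 apow (p * dapow (v x * t + u x)) by exact: is_derive_apow.
  have h2 := is_deriveZ (c x) (is_derive_affine h1).
  rewrite (_ : (fun t => _) = c x \*: (fun s => apow (v x * s + u x))); last first.
    by apply/funext => s; rewrite [u x + _]addrC [s * _]mulrC.
  apply: is_derive_eq h2 _.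
  by rewrite /GRing.scale/= [u x + _]addrC [t * _]mulrC; ring.
have := cvg_differentiation_under_integral (f := f) (mu := mu) mD (a := 0) (u := -1) (v := 1).
pose G x := c1 * (p * (2 `^ p * (apow (u x) + apow (v x)) + apow (v x))).
have h0 : (`]-1, 1[%classic : set R) 0 by rewrite /= in_itv/=; apply/andP; split; lra.
move=> /(_ h0) hd.
have d1 t x : partial1of2 f t x = c x * (p * dapow (u x + t * v x) * v x) by rewrite /partial1of2 derive1E; have [_] := df t x.
have hc1 : (fun h : R => h^-1 *: ((fun t : R => \int[mu]_(x in D) f t x) (h + 0) - \int[mu]_(x in D) f 0 x)) @ 0^' -->
    \int[mu]_(x in D) partial1of2 f 0 x.
  apply: (hd _ _ (fun x => `|G x|)) => //.
  - move=> t _; apply: integrable_weight; exact: (LpowD Lu (LpowZ t Lv)).2.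
  - rewrite (_ : EFin \o _ = (fun x => `|(EFin \o G) x|%E)); last by apply/funext.
    apply: integrable_abse.
    exact: (integrableZR c1 (integrableZR p (integrableDR (integrableZR _ (integrableDR iu iv)) iv))).
  - move=> t x; rewrite /= in_itv/= => /andP[t1 t2] Dx; apply: le_trans (ler_norm _).
    rewrite d1 /G -mulrA normrM.
    have /andP[cx cx1] := c1_0 x Dx; rewrite (ger0_norm cx) ler_pM ?normr_ge0//.
    rewrite normrM (gtr0_norm p0) ler_pM2l//; apply: dapow_bound => //.
    by rewrite ler_norml (ltW t1) (ltW t2).
have e1 : \int[mu]_(x in D) partial1of2 f 0 x = p * dpint u v.
  rewrite /dpint -RintegralZl//; last exact: (integrable_weight (integrable_dapow Lu Lv)).
  by apply: eq_Rintegral => x _; rewrite d1 mul0r addr0; ring.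
rewrite e1 in hc1.
pose F (t : R) := pint (fun x => u x + t * v x).
have hc2 : (fun h : R => h^-1 *: (F (h *: (1 : R) + 0) - F 0)) @ 0^' --> p * dpint u v.
  rewrite (_ : (fun h : R => _) = (fun h : R => h^-1 *: (F (h + 0) - F 0))); first exact: hc1.
  by apply/funext => h; rewrite -[h *: 1]/(h * 1) mulr1.
split; first by apply/cvg_ex; exists (p * dpint u v).
exact: (cvg_lim (@Rhausdorff R) hc2).
Qed.

Lemma pint_add (e : R) : 0 < e -> exists2 C, 0 < C & forall u h, Lpow u -> Lpow h ->
  `|pint (fun x => u x + h x) - pint u| <= e * pint u + C * pint h.
Proof.
move=> e0; have [C C0 hC] := apow_BL p2 e0; exists C => // u h Lu Lh.
have iu := integrable_pint Lu; have ih := integrable_pint Lh; have iuh := integrable_pint (LpowD Lu Lh).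
have idf : mu.-integrable D (EFin \o (fun x => c x * apow (u x + h x) - c x * apow (u x))).
  have := integrableDR iuh (integrableZR (- 1) iu).
  by congr (_.-integrable _ _); apply/funext => x /=; rewrite mulN1r.
rewrite /pint -(RintegralB mD iuh iu); apply: le_trans (le_normr_Rintegral mD idf) _.
have i1 := integrableZR e iu; have i2 := integrableZR C ih.
rewrite -(RintegralZl _ mD iu) -(RintegralZl _ mD ih) -(RintegralD mD i1 i2).
apply: le_Rintegral => //.
- by have := integrable_abse idf; congr (_.-integrable _ _); apply/funext.
- exact: integrableDR.
- move=> x Dx; have /andP[h1 _] := hc Dx; have cx := le_trans (ltW c00) h1.
  rewrite -mulrBr normrM (ger0_norm cx) mulrCA [C * _]mulrCA -mulrDr ler_wpM2l//; exact: hC.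
Qed.

(** The bound x^2 <= 1 + |x|^p at x = s / t. Choosing t only after integration replaces Hölder's
    inequality. *)
Lemma sqr_le_apow (t s : R) : 0 < t -> s ^+ 2 <= t ^+ 2 * (1 + apow s / t `^ p).
Proof.
move=> t0; have := apowM p t^-1 s; rewrite gtr0_norm ?invr_gt0// => h.
have h2 : t^-1 `^ p = (t `^ p)^-1 by rewrite -(powR_inv1 (ltW t0)) -powRrM mulN1r powRN.
rewrite [_ / _]mulrC -h2 -h -ler_pdivrMl ?exprn_gt0// -exprVn -exprMn.
move: (_ * _) => x; rewrite -real_normK ?num_real// /apow.
have [x1|x1] := leP `|x| 1.
  by apply: (@le_trans _ _ 1); [rewrite expr_le1|rewrite lerDl powR_ge0].
apply: (@le_trans _ _ (`|x| `^ p)); last by rewrite lerDr.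
by rewrite -powR_mulrn// ler_powR ?(ltW x1)//= ltW.
Qed.

Hypothesis fD : (mu D < +oo)%E.

Let i1 : mu.-integrable D (EFin \o (fun=> 1)).
Proof.
apply/integrableP; split; first exact: measurable_cst.
by under eq_integral do rewrite /= normr1; rewrite integral_cst// mul1e.
Qed.

Lemma Lpow_integrable_sqr u : Lpow u -> mu.-integrable D (EFin \o (fun x => u x ^+ 2)).
Proof.
move=> [mu_ iu]; apply: (integrable_dom (g := fun x => 1 + apow (u x))).
- exact: measurable_funX.
- move=> x _; rewrite ger0_norm ?sqr_ge0//; have := @sqr_le_apow 1 (u x) ltr01.
  by rewrite expr1n mul1r powR1 divr1.
- exact: (integrableDR i1 iu).
Qed.

Lemma integral_sqr_le_pint u : Lpow u ->
  \int[mu]_(x in D) (u x ^+ 2) <= (fine (mu D) + c0^-1) * pint u `^ (2 / p).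
Proof.
move=> Lu; have [mu_ iu] := Lu; have is_ := Lpow_integrable_sqr Lu.
have h (t : R) : 0 < t -> \int[mu]_(x in D) (u x ^+ 2) <= t ^+ 2 * (fine (mu D) + c0^-1 * pint u / t `^ p).
  move=> t0; apply: (@le_trans _ _ (\int[mu]_(x in D) (t ^+ 2 * (1 + (t `^ p)^-1 * apow (u x))))).
    apply: le_Rintegral => //.
      exact: (integrableZR _ (integrableDR i1 (integrableZR _ iu))).
    by move=> x _; apply: le_trans (sqr_le_apow _ t0) _; rewrite [_^-1 * _]mulrC.
  rewrite (RintegralZl _ mD (integrableDR i1 (integrableZR (t `^ p)^-1 iu))).
  rewrite (RintegralD mD i1 (integrableZR (t `^ p)^-1 iu)).
  rewrite RintegralZl// ler_pM2l ?exprn_gt0// Rintegral_cst// mul1r lerD2l mulrC ler_pM2r ?invr_gt0 ?powR_gt0//.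
  rewrite -ler_pdivrMl ?invr_gt0// invrK -RintegralZl//; apply: le_Rintegral => //.
  - exact: integrableZR.
  - exact: integrable_pint.
  - by move=> x Dx; rewrite ler_wpM2r ?apow_ge0//; have /andP[] := hc Dx.
have [X0|X0] := eqVneq (pint u) 0.
  rewrite X0 powR0 ?mulr0; last by rewrite mulf_neq0// invr_eq0.
  apply/ler_addgt0Pl => e e0; rewrite addr0.
  pose t := Num.sqrt (e / (fine (mu D) + 1)).
  have m1 : 0 < fine (mu D) + 1 by rewrite ltr_wpDl// fine_ge0.
  have t0 : 0 < t by rewrite sqrtr_gt0 divr_gt0.
  apply: le_trans (h t t0) _; rewrite X0 mulr0 mul0r addr0 sqr_sqrtr; last by rewrite divr_ge0 ?(ltW e0) ?(ltW m1).
  by rewrite mulrAC ler_pdivrMr// ler_pM2l// lerDl.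
have X1 : 0 < pint u by rewrite lt_neqAle eq_sym X0 pint_ge0.
(* With t^p equal to the integral, the second summand becomes the constant 1 / c0. *)
have := h (pint u `^ p^-1) (powR_gt0 _ X1).
rewrite -powRrM mulVf// (powRr1 (ltW X1)) -mulrA divff// mulr1.
by rewrite -powR_mulrn ?powR_ge0// -powRrM mulrC [p^-1 * _]mulrC.
Qed.

(** What exceeds e' |a_k|^p in the splitting defect is dominated by a multiple of |w|^p and tends to
    zero almost everywhere; the subtracted part is at most e' M in total. *)
Lemma brezis_lieb (a_ : nat -> T -> R) w M : (forall k, Lpow (a_ k)) -> Lpow w ->
  {ae mu, forall x, D x -> (fun k => a_ k x) @ \oo --> (0 : R)} -> (forall k, pint (a_ k) <= M) ->
  (fun k => pint (fun x => a_ k x + w x) - pint (a_ k)) @ \oo --> pint w.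
Proof.
move=> La Lw ae0 aM; have [mw iw] := Lw.
apply/cvgrPdist_le => e e0.
have M0 : 0 <= M by exact: le_trans (pint_ge0 (a_ 0%N)) (aM 0%N).
pose e' := e / (2 * (M + 1)); have e'0 : 0 < e' by rewrite divr_gt0// mulr_gt0// ltr_wpDl.
have [C C0 hC] := apow_BL p2 e'0.
pose g k x := Num.max 0 (`|apow (a_ k x + w x) - apow (a_ k x) - apow (w x)| - e' * apow (a_ k x)).
have ma k : measurable_fun D (a_ k) by have [] := La k.
have mg k : measurable_fun D (g k).
  apply: measurable_maxr; first exact: measurable_cst.
  apply: measurable_funB; last by apply: measurable_funM => //; exact: measurable_apow_comp.
  apply: measurableT_comp; first exact: normr_measurable.
  apply: measurable_funB; last exact: measurable_apow_comp.
  by apply: measurable_funB; apply: measurable_apow_comp => //; exact: measurable_funD.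
have g0 k x : 0 <= g k x by rewrite le_max lexx.
have gle k x : g k x <= (C + 1) * apow (w x).
  rewrite ge_max mulr_ge0 ?apow_ge0 ?addr_ge0// ?(ltW C0)//= lerBlDr.
  apply: le_trans (ler_normB _ _) _; have := hC (a_ k x) (w x).
  rewrite (ger0_norm (apow_ge0 p (w x))); move: (`|_ - _|) => y; lra.
have cg : {ae mu, forall x, D x -> (fun k => g k x) @ \oo --> (0 : R)}.
  apply: filterS ae0 => x hx Dx; have cx := hx Dx.
  have c1' : (fun k => apow (a_ k x + w x)) @ \oo --> apow (w x).
    have h : (fun k => a_ k x + w x) @ \oo --> w x.
      by rewrite -[X in _ --> X](add0r (w x)); apply: cvgD => //; exact: cvg_cst.
    exact: (cvg_comp _ _ h (@continuous_apow R p p2 (w x))).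
  have c2 : (fun k => apow (a_ k x)) @ \oo --> (0 : R).
    by rewrite -(apow0 p2); exact: (cvg_comp _ _ cx (@continuous_apow R p p2 0)).
  have c3 : (fun k => `|apow (a_ k x + w x) - apow (a_ k x) - apow (w x)|) @ \oo --> (0 : R).
    rewrite -(normr0 R); apply: cvg_norm; rewrite -[X in _ --> X](subrr (apow (w x))).
    apply: cvgB; last exact: cvg_cst.
    by rewrite -[X in _ --> X]subr0; exact: cvgB.
  have := squeeze_cvgr _ (cvg_cst (0 : R)) c3; apply; apply: nearW => k.
  by rewrite g0 ge_max normr_ge0/= lerBlDr lerDl mulr_ge0 ?apow_ge0 ?(ltW e'0).
have c_ge0 x : D x -> 0 <= c x by move=> Dx; have /andP[h _] := hc Dx; exact: le_trans (ltW c00) h.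
have c_le x : D x -> c x <= c1 by move=> Dx; have /andP[_ h] := hc Dx.
have igk k : mu.-integrable D (EFin \o g k).
  apply: (integrable_dom (g := fun x => (C + 1) * apow (w x))) => //; last exact: integrableZR.
  by move=> x _; rewrite ger0_norm.
have cI : (\int[mu]_(x in D) (c x * g k x)%:E)%E @[k --> \oo] --> (0%E : \bar R).
  have m1 k : measurable_fun D (fun x => (c x * g k x)%:E).
    exact: (measurable_int mu (integrable_weight (igk k))).
  have m2 : {ae mu, forall x, D x -> (fun k => (c x * g k x)%:E) @ \oo --> (0%E : \bar R)}.
    apply: filterS cg => x hx Dx; apply: cvg_EFin; first exact: nearW.
    by rewrite -(mulr0 (c x)); apply: cvgMr; exact: hx.
  have m3 : mu.-integrable D (EFin \o (fun x => c1 * ((C + 1) * apow (w x)))) by do 2 apply: integrableZR.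
  have m4 : {ae mu, forall x, forall k, D x -> (`|(c x * g k x)%:E| <= (EFin \o (fun x => c1 * ((C + 1) * apow (w x)))%R) x)%E}.
    apply: aeW => x k Dx; rewrite /= lee_fin normrM (ger0_norm (c_ge0 x Dx)) (ger0_norm (g0 k x)).
    by apply: ler_pM => //; [exact: c_ge0|exact: c_le].
  have [_ _ h] := dominated_convergence mD m1 (measurable_cst (0%E : \bar R)) m2 m3 m4.
  by move: h; rewrite integral0.
have cI' : (fun k => \int[mu]_(x in D) (c x * g k x)) @ \oo --> (0 : R).
  by apply: fine_cvg.
have /cvgrPdist_le/(_ (e / 2)) := cI'; rewrite divr_gt0// => /(_ isT)[N _ hN].
exists N => // k /= /hN; rewrite sub0r normrN => hk.
have iw' := integrable_pint Lw; have ia := integrable_pint (La k).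
have law := LpowD (La k) Lw; have iaw := integrable_pint law.
pose dk x := apow (a_ k x + w x) - apow (a_ k x) - apow (w x).
have ik : mu.-integrable D (EFin \o (fun x => c x * dk x)).
  have := integrableDR (integrableDR iaw (integrableZR (- 1) ia)) (integrableZR (- 1) iw').
  congr (_.-integrable _ _); apply/funext => x; rewrite /dk /=; congr (_%:E); ring.
have -> : pint w - (pint (fun x => a_ k x + w x) - pint (a_ k)) = - \int[mu]_(x in D) (c x * dk x).
  have -> : \int[mu]_(x in D) (c x * dk x) = pint (fun x => a_ k x + w x) - pint (a_ k) - pint w.
    rewrite /pint -(RintegralB mD iaw ia) -(RintegralB mD _ iw'); last first.
      have := integrableDR iaw (integrableZR (- 1) ia).
      by congr (_.-integrable _ _); apply/funext => x /=; rewrite mulN1r.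
    by apply: eq_Rintegral => x _; rewrite /dk; ring.
  by rewrite [RHS]opprB.
rewrite normrN; apply: le_trans (le_normr_Rintegral mD ik) _.
have iga := integrable_weight (igk k); have iea := integrableZR e' ia.
apply: (@le_trans _ _ (\int[mu]_(x in D) (c x * g k x + e' * (c x * apow (a_ k x))))).
  apply: le_Rintegral => //.
  - have := integrable_abse ik; by congr (_.-integrable _ _); apply/funext.
  - exact: integrableDR.
  - move=> x Dx; rewrite normrM (ger0_norm (c_ge0 x Dx)) mulrCA -mulrDr ler_wpM2l ?c_ge0//.
    by rewrite -lerBlDr /g le_max lexx orbT.
rewrite (RintegralD mD iga iea) (RintegralZl _ mD ia) [e]splitr; apply: lerD.
  exact: le_trans (ler_norm _) hk.
apply: (@le_trans _ _ (e' * M)); first by rewrite ler_pM2l//; exact: aM.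
have M1 : 0 < M + 1 by rewrite ltr_wpDl.
rewrite (_ : e' * M = e / 2 * (M / (M + 1))); last by rewrite /e'; field; rewrite gt_eqF.
rewrite ger_pMr ?divr_gt0// ler_pdivrMr// mul1r lerDl.
exact: ler01.
Qed.

End power_integral.

Lemma psd_formS (R : realType) (V : lmodType R) (H H' : set V) (D : V -> V -> R) :
  H' `<=` H -> psd_form H D -> psd_form H' D.
Proof.
move=> sH [h1 h2 h3 h4]; split => //.
- by move=> u v w /sH hu /sH hv /sH hw; exact: h2.
- by move=> c u v /sH hu /sH hv; exact: h3.
- by move=> u /sH; exact: h4.
Qed.

Lemma complete_form_equiv (R : realType) (V : lmodType R) (H : set V) (D E : V -> V -> R) (k1 k2 : R) :
  subspace_like H -> 0 < k1 -> 0 < k2 -> (forall u, H u -> k1 * D u u <= E u u <= k2 * D u u) ->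
  complete_form H D -> complete_form H E.
Proof.
move=> HS k10 k20 hDE cD u_ hu cu.
have [|u Hu cvu] := cD u_ hu.
  move=> e e0; have [N hN] := cu (k1 * e) (mulr_gt0 k10 e0); exists N => i j iN jN.
  rewrite -(ler_pM2l k10); apply: le_trans (hN i j iN jN).
  by have /andP[] := hDE _ (subspaceB HS (hu i) (hu j)).
exists u => // e e0; have [N hN] := cvu (e / k2) (divr_gt0 e0 k20); exists N => i iN.
have /andP[_ h] := hDE _ (subspaceB HS (hu i) Hu); apply: le_trans h _.
by rewrite mulrC -ler_pdivlMr//; exact: hN.
Qed.

(** * Weighted forms on a bounded domain *)

Section weighted_forms.
Context {R : realType} {n : nat}.
Local Notation mu := (lebesgue_rV R n).
Local Notation V := ('rV[R]_n -> R^o).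
Variables (U : set 'rV[R]_n) (oU : open U) (r : R).
Hypothesis Ur : forall x, U x -> `|x| <= r.
Let mU : measurable U := open_measurable_rV oU.
Implicit Types (u v phi : V).

Lemma wip_bounds (w : 'rV[R]_n -> R) (w0 w1 : R) u : measurable_fun U w -> 0 <= w0 ->
  (forall x, U x -> w0 <= w x <= w1) -> L2 U u ->
  w0 * ip2 U u u <= wip mu U w u u <= w1 * ip2 U u u.
Proof.
move=> mw w00 hw hu.
have wC x : U x -> `|w x| <= w1.
  by move=> /hw/andP[h1 h2]; rewrite ger0_norm//; exact: le_trans h1.
have iw := integrable_wip mU mw wC hu hu.
have i1 : mu.-integrable U (EFin \o (fun x => u x * u x)) := integrable_ip oU hu hu.
rewrite !ip2E -(RintegralZl w0 mU i1) -(RintegralZl w1 mU i1).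
apply/andP; split; apply: le_Rintegral => //; try exact: (integrableZl mU _ i1).
- by move=> x Ux; rewrite -mulrA ler_wpM2r -?expr2 ?sqr_ge0//; have /andP[] := hw x Ux.
- by move=> x Ux; rewrite -mulrA ler_wpM2r -?expr2 ?sqr_ge0//; have /andP[] := hw x Ux.
Qed.

Lemma dot_bounds (w : 'rV[R]_n -> R) (w0 w1 : R) u : measurable_fun U w -> 0 <= w0 ->
  (forall x, U x -> w0 <= w x <= w1) -> H1 U u ->
  w0 * dot_a U (cst 1) u u <= dot_a U w u u <= w1 * dot_a U (cst 1) u u.
Proof.
move=> mw w00 hw hu.
have hw' x : U x -> 0 <= w x <= w1 by move=> /hw/andP[h1 ->]; rewrite (le_trans w00 h1).
rewrite (dot_aE oU mw hw' hu hu) (dot1E oU hu hu) !mulr_sumr.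
by apply/andP; split; apply: ler_sum => i _;
  have /andP[] := wip_bounds mw w00 hw (weak_partial_L2 i hu).
Qed.

Lemma dot1_null u : H1 U u -> ip2 U u u = 0 -> dot_a U (cst 1) u u = 0.
Proof.
move=> hu u0; have ae0 := ip2_eq0_ae oU hu.1 u0.
rewrite (dot1E oU hu hu) big1// => i _.
have L0 : L2 U (cst 0 : V) by exact: (subspace0 (L2_subspace mU)).
have h : is_weak_partial U i u (cst 0).
  apply: (is_weak_partial_ae_eq oU (u := cst 0) (g := cst 0)) => //.
  - exact: hu.1.1.
  - exact: ae_eq_on_sym.
  - exact: ae_eq_on_refl.
  - apply/is_weak_partialE; split => // phi tphi.
    have L1 : L2 U phi := test_fun_L2 mU tphi.
    have L2' : L2 U (partial i phi) := test_fun_L2 mU (test_fun_partial i tphi).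
    have z1 : ip2 U (cst 0) (partial i phi) = 0 := form0l (L2_subspace mU) (ip2_psd mU) L2'.
    have z2 : ip2 U (cst 0) phi = 0 := form0l (L2_subspace mU) (ip2_psd mU) L1.
    by rewrite z1 z2 oppr0.
have h2 := weak_partial_ae oU h; have hw := weak_partial_L2 i hu.
rewrite (ip2_ae_eq (u' := cst 0) (v' := cst 0) oU)//; try exact: hw.1.
by rewrite (form0l (L2_subspace mU) (ip2_psd mU)).
Qed.

Lemma H10_approx u : H10 U u -> exists phi : nat -> V,
  [/\ forall k, test_fun U (phi k), {ae mu, forall x, U x -> (fun k => phi k x) @ \oo --> u x} &
      cvg_form (ipH1 U) phi u].
Proof.
move=> hu; have S1 := H1_subspace oU; have P1 := ipH1_psd oU.
have /H10P[//|hu1 hd] := hu.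
have /choice[f hf] (k : nat) : exists phi, test_fun U phi /\
    ipH1 U (u - (phi : V)) (u - (phi : V)) < k.+1%:R^-1.
  have [|phi tphi h] := hd k.+1%:R^-1; first by rewrite invr_gt0.
  by exists phi.
have hf1 k : H1 U (f k) := test_fun_H1 oU (hf k).1.
have cf : cvg_form (ipH1 U) (f : nat -> V) u.
  move=> e e0; have /cvgrPdist_le/(_ e e0)[N _ hN] := @cvg_harmonic R.
  exists N => k /hN; rewrite sub0r normrN (form_sqrBC S1 P1 (hf1 k) hu1) => h.
  by apply: le_trans (ltW (hf k).2) _; apply: le_trans (ler_norm _) h.
have [||s [hs ae]] := @sqn_cvg_subseq_ae _ _ _ mu U mU (fun k => f k) u (fun k => (hf1 k).1.1).
- exact: hu1.1.1.
- move=> e e0; have [N hN] := cf e e0; exists N => k /hN h.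
  have -> : sqn mu U (fun x => f k x - u x) = (ip2 U ((f k : V) - u) ((f k : V) - u))%:E.
    by rewrite -(ip2_sqn (L2B mU (hf1 k).1 hu1.1)).
  rewrite lee_fin; apply: le_trans h; rewrite lerDl.
  by apply: (form_ge0 (dot1_psd oU)); exact: (subspaceB S1).
exists (fun k => f (s k)); split; [by move=> k; exact: (hf (s k)).1|exact: ae|].
move=> e /cf[N hN]; exists N => k Nk; apply: hN; apply: (leq_trans Nk).
exact: leq_incr.
Qed.

Lemma dot_a_test_fun (a : 'rV[R]_n -> R) (a1 : R) (phi : V) : measurable_fun U a ->
  (forall x, U x -> 0 <= a x <= a1) -> test_fun U phi ->
  dot_a U a phi phi = \sum_i wip mu U a (partial i phi) (partial i phi).
Proof.
move=> ma ha tphi; have Hphi := test_fun_H1 oU tphi.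
rewrite (dot_aE oU ma ha Hphi Hphi); apply: eq_bigr => i _.
have mw := (weak_partial_L2 i Hphi).1; have mp := (test_fun_L2 mU (test_fun_partial i tphi)).1.
by apply: (wip_ae_eq mU); [exact: measurable_mul3|exact: measurable_mul3|exact: weak_partial_test_fun..].
Qed.

Section power_bound.
Hypothesis hn : (3 <= n)%N.
Local Notation p := (crit_exp R n).
Let p2 : 2 < p := crit_exp_gt2 hn.
Let p0 : 0 < p := crit_exp_gt0 hn.
Variables (c : 'rV[R]_n -> R) (c0 c1 : R).
Hypotheses (mc : measurable_fun U c) (c00 : 0 < c0) (hc : forall x, U x -> c0 <= c x <= c1).

Lemma test_fun_Lpow phi : test_fun U phi -> Lpow mu U p phi.
Proof.
move=> tphi; have tT := test_funS (subsetT U) tphi; split; first by have [] := test_fun_L2 mU tphi.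
exact: (integrableS measurableT mU (subsetT _) (test_fun_powR_integrable hn tT)).
Qed.

(** Fatou's lemma along test functions, which also yields the integrability of |u|^p. [D] is
    arbitrary so as to cover combinations of A and B. *)
Lemma power_bound_H10 (D : V -> V -> R) (K M : R) : psd_form (H10 U) D -> 0 < K ->
  0 < M -> (forall u, H10 U u -> D u u <= M * ipH1 U u u) ->
  (forall phi, test_fun U phi -> K * pint mu U p c phi `^ (2 / p) <= D phi phi) ->
  forall u, H10 U u -> Lpow mu U p u /\ K * pint mu U p c u `^ (2 / p) <= D u u.
Proof.
move=> PD K0 M0 DM hK u hu; have [f [tf ae cf]] := H10_approx hu.
have HS := H10_subspace oU; have hu1 := H10_sub_H1 hu.
have tH k : H10 U (f k) := test_fun_H10 oU (tf k).
have cD : cvg_form D f u.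
  move=> e e0; have [N hN] := cf _ (divr_gt0 e0 M0); exists N => k /hN.
  have h1 := DM _ (subspaceB HS (tH k) hu).
  by rewrite ler_pdivlMr// mulrC => h2; exact: le_trans h1 h2.
have cDs := cvg_form_self HS PD tH hu cD.
have p20 : 0 < p / 2 by rewrite divr_gt0.
have mu_ : measurable_fun U u := hu1.1.1.
have c_ge0 x : U x -> 0 <= c x by move=> /hc/andP[h _]; exact: le_trans (ltW c00) h.
have mf v : measurable_fun U v -> measurable_fun U (fun x => c x * apow p (v x)).
  by move=> mv; apply: measurable_funM => //; exact: measurable_apow_comp.
have D0 : 0 <= D u u by exact: (form_ge0 PD).
have key (e : R) : 0 < e -> (\int[mu]_(x in U) (c x * apow p (u x))%:E <= (((D u u + e) / K) `^ (p / 2))%:E)%E.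
  move=> e0; have /cvgrPdist_le/(_ e e0)[N _ hN] := cDs.
  apply: (@fatou_bound _ _ _ mu U mU (fun k x => c x * apow p (f (k + N)%N x))) => //.
  - by move=> k; apply: mf; have [] := test_fun_L2 mU (tf (k + N)%N).
  - exact: mf.
  - by move=> k x Ux; rewrite mulr_ge0 ?apow_ge0 ?c_ge0.
  - by move=> x Ux; rewrite mulr_ge0 ?apow_ge0 ?c_ge0.
  - apply: filterS ae => x hx Ux; apply: cvgMr.
    have hx' : (fun k => f (k + N)%N x) @ \oo --> u x by exact: (cvg_comp _ _ (cvg_addnr N) (hx Ux)).
    exact: (cvg_comp _ _ hx' (@continuous_apow R p p2 (u x))).
  move=> k; have Lf := test_fun_Lpow (tf (k + N)%N).
  have ip' := integrable_pint mU mc c00 hc Lf.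
  rewrite -[X in (X <= _)%E]fineK ?integrable_fin_num// lee_fin.
  have h1 : pint mu U p c (f (k + N)%N) `^ (2 / p) <= (D u u + e) / K.
    rewrite ler_pdivlMr// mulrC; apply: le_trans (hK _ (tf _)) _.
    have := hN (k + N)%N (leq_addl _ _); rewrite distrC => h.
    by rewrite -lerBlDl; apply: le_trans h; exact: ler_norm.
  have := le_powR (r := p / 2) (ltW p20) (powR_ge0 _ _) h1.
  rewrite -powRrM (_ : 2 / p * (p / 2) = 1) ?powRr1//; last by field; rewrite gt_eqF.
  exact: (pint_ge0 mu p c00 hc).
have fin : (\int[mu]_(x in U) (c x * apow p (u x))%:E < +oo)%E by apply: le_lt_trans (key 1 ltr01) _; rewrite ltry.
have Lu : Lpow mu U p u.
  split=> //; have ic : mu.-integrable U (EFin \o (fun x => c x * apow p (u x))).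
    apply/integrableP; split; first by apply/measurable_EFinP; exact: mf.
    rewrite (eq_integral (fun x => (c x * apow p (u x))%:E))// => x /set_mem Ux.
    by rewrite /= ger0_norm// mulr_ge0 ?apow_ge0 ?c_ge0.
  apply: (integrable_dom (g := fun x => c0^-1 * (c x * apow p (u x))) mU).
  - exact: measurable_apow_comp.
  - move=> x Ux; rewrite ger0_norm ?apow_ge0// mulrA ler_peMl ?apow_ge0//.
    by rewrite mulrC ler_pdivlMr// mul1r; have /andP[] := hc Ux.
  - exact: (integrableZl mU _ ic).
split=> //; apply/ler_addgt0Pr => e e0; have := key e e0.
rewrite -[X in (X <= _)%E]fineK ?integrable_fin_num//; last exact: (integrable_pint mU mc c00 hc Lu).
rewrite lee_fin => h1.
have := le_powR (r := 2 / p) _ (pint_ge0 mu p c00 hc u) h1; rewrite divr_ge0 ?(ltW p0)// => /(_ isT).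
rewrite -powRrM (_ : p / 2 * (2 / p) = 1); last by field; rewrite gt_eqF.
rewrite powRr1; last by rewrite divr_ge0 ?(ltW K0)// addr_ge0// ltW.
by rewrite ler_pdivlMr// mulrC.
Qed.

End power_bound.

End weighted_forms.

(** * The local Sobolev inequality and concentration *)

Section local_sobolev.
Context {R : realType} {n : nat}.
Hypothesis hn : (3 <= n)%N.
Local Notation mu := (lebesgue_rV R n).
Local Notation V := ('rV[R]_n -> R^o).
Local Notation p := (crit_exp R n).
Local Notation delta i := (delta_mx ord0 i : 'rV[R]_n).
Variables (U : set 'rV[R]_n) (oU : open U) (a : 'rV[R]_n -> R) (a0 a1 G : R).
Hypotheses (a00 : 0 < a0) (ha : forall x, U x -> a0 <= a x <= a1) (Ca : Ck 1 U a).
Hypotheses (G0 : 0 <= G) (hG : forall i x, U x -> `|partial i a x| <= G).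
Let mU : measurable U := open_measurable_rV oU.
Let p2 : 2 < p := crit_exp_gt2 hn.
Let p0 : 0 < p := crit_exp_gt0 hn.
Implicit Types phi : 'rV[R]_n -> R.

Let ax0 x : U x -> 0 < a x. Proof. by move=> /ha/andP[h _]; exact: lt_le_trans h. Qed.

Definition sqrt_mul phi : 'rV[R]_n -> R := fun x => Num.sqrt (a x) * phi x.
Definition sqrt_mul_partial phi i : 'rV[R]_n -> R :=
  fun x => partial i a x / (2 * Num.sqrt (a x)) * phi x + Num.sqrt (a x) * partial i phi x.

Lemma continuous_off K U' (f : 'rV[R]_n -> R) : compact K -> K `<=` U' -> (forall x, ~ K x -> f x = 0) ->
  (forall x, U' x -> {for x, continuous f}) -> continuous f.
Proof.
move=> cK KU f0 fU x; have [Kx|Kx] := pselect (K x); first by apply: fU; exact: KU.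
have nf : \near x, cst 0 x = f x.
  have := closed_openC (compact_closed_rV cK); rewrite openE => /(_ _ Kx); apply: filterS => y Ky.
  by rewrite f0.
by rewrite /continuous_at f0//; apply: cvg_trans (near_eq_cvg nf) _; exact: cvg_cst.
Qed.

(** Since [a] is assumed C^1 on [U] only, sqrt a * phi need not be a test function; being C^1 with
    compact support is enough for it to lie in H^1 with its classical derivatives. *)
Lemma sqrt_mulP phi : test_fun U phi ->
  [/\ Ck 1 setT (sqrt_mul phi), forall i, partial i (sqrt_mul phi) = sqrt_mul_partial phi i &
      exists2 K, compact K /\ K `<=` U & forall x, ~ K x -> phi x = 0 /\ forall i, partial i phi x = 0].
Proof.
move=> tphi; have [sphi [K [cK KU] h]] := tphi.
have hp i x : ~ K x -> partial i phi x = 0.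
  by move=> Kx; apply: (partial_out _ (compact_closed_rV cK) h Kx).
have [acont ad] := Ca.
have sqc x : U x -> {for x, continuous (fun y => Num.sqrt (a y))}.
  move=> Ux; apply: (continuous_at_comp (f := a) (g := Num.sqrt)); first exact: acont.
  exact: sqrt_continuous.
have c1 : continuous (sqrt_mul phi).
  apply: (continuous_off cK KU) => [x Kx|x Ux]; first by rewrite /sqrt_mul h ?mulr0.
  by apply: (continuousM (sqc x Ux)); exact: smooth_continuous sphi x.
have dv i x : is_derive x (delta i) (sqrt_mul phi) (sqrt_mul_partial phi i x).
  have [Kx|Kx] := pselect (K x); last first.
    rewrite /sqrt_mul_partial h// hp// !mulr0 addr0.
    have nf : \near x, cst 0 x = sqrt_mul phi x.
      have := closed_openC (compact_closed_rV cK); rewrite openE => /(_ _ Kx); apply: filterS => y Ky.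
      by rewrite /sqrt_mul h ?mulr0.
    apply: (near_eq_is_derive nf); exact: is_derive_cst.
  have Ux := KU x Kx.
  have da : is_derive x (delta i) a (partial i a x).
    by split => //; exact: (ad i).1.
  have dsa := is_derive_comp_line (is_derive1_sqrt (ax0 Ux)) da.
  have := is_deriveM dsa (smooth_is_derive i x sphi).
  move=> hh; apply: is_derive_eq hh _; rewrite /sqrt_mul_partial /GRing.scale/=.
  rewrite [RHS]addrC; congr (_ + _); rewrite mulrC; congr (_ * _); exact: mulrC.
have c2 i : continuous (sqrt_mul_partial phi i).
  apply: (continuous_off cK KU) => [x Kx|x Ux]; first by rewrite /sqrt_mul_partial h// hp// !mulr0 addr0.
  have cpa : {for x, continuous (partial i a)} by have [_ [+ _]] := ad i; apply.
  apply: continuousD; apply: continuousM.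
  - apply: continuousM => //; apply: continuousV; first by rewrite mulf_neq0// gt_eqF// sqrtr_gt0 ax0.
    by apply: (continuousM (s := cst 2)); [exact: cst_continuous|exact: sqc].
  - exact: smooth_continuous sphi x.
  - exact: sqc.
  - exact: smooth_continuous (smooth_partial i sphi) x.
split; last by exists K => // x Kx; split; [exact: h|move=> i; exact: hp].
- apply: (@CkSI _ _ 0 _ (sqrt_mul_partial phi)) => // i; split => // x _; exact: c2.
- by move=> i; apply/funext => x; apply: partialE; exact: dv.
Qed.

Let sqr_weighted (d s t : R) : 0 < d -> (s + t) ^+ 2 <= (1 + d) * t ^+ 2 + (1 + d^-1) * s ^+ 2.
Proof.
move=> d0; rewrite -subr_ge0.
rewrite (_ : _ - _ = d * (t - s / d) ^+ 2); last by field; rewrite gt_eqF.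
by rewrite mulr_ge0 ?sqr_ge0// ltW.
Qed.

(* Apply the Sobolev inequality on R^n to sqrt a * phi. *)
Lemma local_sobolev_test (c : 'rV[R]_n -> R) (c0 c1 K0 d : R) : measurable_fun U c -> 0 < c0 ->
  (forall x, U x -> c0 <= c x <= c1) -> 0 < K0 -> (forall x, U x -> K0 * c x `^ (2 / p) <= a x) -> 0 < d ->
  exists2 C, 0 < C & forall phi, test_fun U phi ->
    K0 * sobolev_const R n * pint mu U p c phi `^ (2 / p) <= (1 + d) * dot_a U a phi phi + C * ip2 U phi phi.
Proof.
move=> mc c00 hc K00 hK d0.
(* The derivative of sqrt a has square at most G^2 / (4 a0); the factor 1 + 1/d comes from splitting
   the square of the product rule. *)
pose C1 := (1 + d^-1) * (G ^+ 2 / (4 * a0)).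
have C10 : 0 <= C1 by rewrite mulr_ge0 ?addr_ge0 ?invr_ge0 ?(ltW d0)// divr_ge0 ?sqr_ge0// mulr_ge0// ltW.
exists (n%:R * C1 + 1); first by rewrite ltr_wpDl// mulr_ge0.
move=> phi tphi; have [C1v vp [K [cK KU] hKo]] := sqrt_mulP tphi.
have tT := test_funS (subsetT U) tphi.
set v := sqrt_mul phi in C1v vp; have cv := Ck_continuous C1v.
have cvp i : continuous (partial i v) := Ck_continuous (Ck_partial i C1v).
have vo x : ~ K x -> v x = 0 by move=> /hKo[h _]; rewrite /v /sqrt_mul h mulr0.
have vpo i x : ~ K x -> partial i v x = 0.
  by move=> /hKo[h1 h2]; rewrite vp /sqrt_mul_partial h1 h2 !mulr0 addr0.
have [r r0 Kr] := compact_ball_norm cK.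
have out x : r < `|x| -> ~ K x by move=> h /Kr; rewrite ltNge (ltW h).
have L2c (f : 'rV[R]_n -> R) : continuous f -> (forall x, ~ K x -> f x = 0) -> L2 setT f.
  move=> cf f0; have [M M0 hM] := continuous_bsupp_bounded cf cK f0.
  apply: (bounded_bsupp_L2 (M := M) (r := r)) => //; first exact: continuous_measurable_rV.
  by move=> x /out; exact: f0.
have wpv i : is_weak_partial setT i v (partial i v).
  by apply: Ck1_is_weak_partial => //; apply: L2c => //; exact: vpo.
have Hv : H1 setT v by split; [exact: L2c|move=> i; exists (partial i v)].
have := sobolev_ineq hn Hv; rewrite (wgrad_sqnE wpv) => sob.
have Uo x : ~ U x -> ~ K x by move=> h /KU.
have Lphi := test_fun_Lpow oU hn tphi.
have iphi := integrable_pint mU mc c00 hc Lphi.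
have ivp : mu.-integrable U (EFin \o (fun x => apow p (v x))).
  have h : mu.-integrable setT (EFin \o (fun x => apow p (v x))).
    apply: (continuous_bsupp_integrable (r := r)).
      by move=> x; apply: (continuous_at_comp (f := v) (g := apow p)); [exact: cv|exact: continuous_apow].
    by move=> x /out h; rewrite vo// apow0.
  exact: (integrableS measurableT mU (subsetT _) h).
have I1 : \int[mu]_x (`|v x| `^ p) = \int[mu]_(x in U) apow p (v x).
  by apply: Rintegral_supp => // x _ /Uo h; rewrite vo// normr0 powR0// gt_eqF.
have le1 : K0 * pint mu U p c phi `^ (2 / p) <= (\int[mu]_x (`|v x| `^ p)) `^ (2 / p).
  have h : K0 `^ (p / 2) * pint mu U p c phi <= \int[mu]_x (`|v x| `^ p).
    rewrite I1 /pint -(RintegralZl _ mU iphi); apply: le_Rintegral => //.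
      exact: (integrableZl mU _ iphi).
    move=> x Ux; rewrite /v /sqrt_mul apowM mulrA ler_wpM2r ?apow_ge0//.
    have cx : 0 < c x by have /andP[h _] := hc x Ux; exact: lt_le_trans h.
    rewrite ger0_norm ?sqrtr_ge0//.
    have h1 : (K0 * c x `^ (2 / p)) `^ (p / 2) <= a x `^ (p / 2).
      by apply: le_powR (hK x Ux); [rewrite divr_ge0// ltW|rewrite mulr_ge0 ?powR_ge0// ltW].
    rewrite powRM ?powR_ge0 ?(ltW K00)// -powRrM (_ : 2 / p * (p / 2) = 1) in h1; last by field; rewrite gt_eqF.
    rewrite powRr1 ?(ltW cx)// in h1; apply: le_trans h1 _; rewrite le_eqVlt; apply/orP; left; apply/eqP.
    rewrite -[in LHS](sqr_sqrtr (ltW (ax0 Ux))) -powR_mulrn ?sqrtr_ge0// -powRrM; congr (_ `^ _).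
    by field.
  have := le_powR (r := 2 / p) _ _ h; rewrite divr_ge0 ?(ltW p0)// mulr_ge0 ?powR_ge0 ?(pint_ge0 mu p c00 hc)//.
  move=> /(_ isT isT); rewrite powRM ?powR_ge0 ?(pint_ge0 mu p c00 hc)// -powRrM (_ : p / 2 * (2 / p) = 1); last by field; rewrite gt_eqF.
  by rewrite powRr1 ?(ltW K00).
have ma : measurable_fun U a by apply: continuous_in_measurable_rV => //; case: Ca.
have ha' x : U x -> 0 <= a x <= a1 by move=> Ux; have /andP[h ->] := ha Ux; rewrite (le_trans (ltW a00) h).
have aC x : U x -> `|a x| <= a1 by move=> Ux; have /andP[h1 h2] := ha' x Ux; rewrite ger0_norm.
have dE := dot_a_test_fun oU ma ha' tphi.
have le2 i : ip2 setT (partial i v) (partial i v) <=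
    (1 + d) * wip mu U a (partial i phi) (partial i phi) + C1 * ip2 U phi phi.
  have Lp := test_fun_L2 mU (test_fun_partial i tphi); have L0 := test_fun_L2 mU tphi.
  have j1 := integrable_wip mU ma aC Lp Lp; have j2 := integrable_ip oU L0 L0.
  have Lv : L2 setT (partial i v) by apply: L2c => //; exact: vpo.
  have j3 : mu.-integrable U (EFin \o (fun x => partial i v x * partial i v x)).
    exact: (integrableS measurableT mU (subsetT _) (integrable_ip openT Lv Lv)).
  rewrite !ip2E /wip.
  have -> : \int[mu]_x (partial i v x * partial i v x) = \int[mu]_(x in U) (partial i v x * partial i v x).
    by apply: Rintegral_supp => // x _ /Uo h; rewrite vpo// mul0r.
  have j1' := integrableZl mU (1 + d) j1; have j2' := integrableZl mU C1 j2.
  rewrite -(RintegralZl _ mU j1) -(RintegralZl _ mU j2) -(RintegralD mU j1' j2').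
  apply: le_Rintegral => //; first exact: (integrableD mU j1' j2').
  move=> x Ux; rewrite -!expr2 vp /sqrt_mul_partial; apply: le_trans (sqr_weighted _ _ d0) _.
  rewrite exprMn sqr_sqrtr ?(ltW (ax0 Ux))// -[a x * _ * _]mulrA -expr2 lerD2l /C1 -[X in _ <= X]mulrA ler_wpM2l//.
    by rewrite addr_ge0// invr_ge0 ltW.
  rewrite exprMn ler_wpM2r ?sqr_ge0// expr_div_n exprMn sqr_sqrtr ?(ltW (ax0 Ux))//.
  have /andP[h _] := ha Ux.
  rewrite -natrX; apply: ler_pM => //.
  - exact: sqr_ge0.
  - by rewrite invr_ge0 mulr_ge0// ltW// ax0.
  - by rewrite -(real_normK (num_real (partial i a x))) lerXn2r ?nnegrE//; exact: hG.
  - by rewrite lef_pV2 ?posrE ?mulr_gt0 ?ax0// ler_pM2l.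
have S0 := sobolev_const_gt0 (R := R) hn.
apply: (@le_trans _ _ (sobolev_const R n * (\int[mu]_x (`|v x| `^ p)) `^ (2 / p))).
  by rewrite mulrAC mulrC ler_pM2l.
apply: le_trans sob _; apply: le_trans (ler_sum _ (fun i _ => le2 i)) _.
have i0 := form_ge0 (ip2_psd mU) (test_fun_L2 mU tphi).
rewrite big_split/= -mulr_sumr -dE sumr_const card_ord -[C1 * _ *+ n]mulr_natl mulrA lerD2l.
by rewrite [X in _ <= X]mulrDl mul1r lerDl.
Qed.

End local_sobolev.

Section concentrating.
Context {R : realType} {n : nat}.
Hypothesis hn : (3 <= n)%N.
Local Notation mu := (lebesgue_rV R n).
Local Notation V := ('rV[R]_n -> R^o).
Local Notation p := (crit_exp R n).
Local Notation S := (sobolev_const R n).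
Local Notation delta i := (delta_mx ord0 i : 'rV[R]_n).
Variables (U : set 'rV[R]_n) (oU : open U).
Let mU : measurable U := open_measurable_rV oU.
Let p2 : 2 < p := crit_exp_gt2 hn.
Let p0 : 0 < p := crit_exp_gt0 hn.

Lemma wip_supp_le (w : 'rV[R]_n -> R) (w1 M : R) (psi : V) : measurable_fun U w ->
  (forall x, U x -> 0 <= w x <= w1) -> test_fun U psi -> (forall x, psi x != 0 -> w x <= M) ->
  wip mu U w psi psi <= M * ip2 setT psi psi.
Proof.
move=> mw hw tpsi hM; have L := test_fun_L2 mU tpsi.
have wC x : U x -> `|w x| <= w1 by move=> /hw/andP[h1 h2]; rewrite ger0_norm.
rewrite -(ip2_test_fun psi tpsi) ip2E /wip; have i1 := integrable_ip oU L L.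
rewrite -(RintegralZl _ mU i1); apply: le_Rintegral => //.
- exact: (integrable_wip mU mw wC L L).
- exact: (integrableZl mU _ i1).
- move=> x Ux; rewrite -mulrA; have [->|px] := eqVneq (psi x) 0; first by rewrite !mulr0.
  by rewrite ler_wpM2r ?hM// -expr2 sqr_ge0.
Qed.

Definition rescale (s : R) (x0 : 'rV[R]_n) (phi : 'rV[R]_n -> R) : V := fun x => phi (s *: x + - (s *: x0)).

Section rescaling.
Variables (phi : 'rV[R]_n -> R) (x0 : 'rV[R]_n) (s d r : R).
Hypotheses (tphi : test_fun setT phi) (s0 : 0 < s) (d0 : 0 < d) (r0 : 0 < r).
Hypothesis (phir : forall x, r <= `|x| -> phi x = 0) (hr : r / s < d).
Hypothesis ballU : ball x0 d `<=` U.

Lemma rescale_neq0 x : rescale s x0 phi x != 0 -> `|x - x0| < r / s.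
Proof.
move=> h; rewrite ltNge; apply/negP => h2; case/eqP: h; apply: phir.
by rewrite -scalerBr normrZ gtr0_norm// mulrC -ler_pdivrMr.
Qed.

Lemma test_fun_rescale : test_fun U (rescale s x0 phi).
Proof.
have [sphi _] := tphi; split; first exact: smooth_affine.
exists (cbox (x0 - const_mx (r / s)) (x0 + const_mx (r / s))).
  split; first exact: compact_cbox.
  move=> x hx; apply/ballU/(rV_ballP _ _ d0) => i; apply: le_lt_trans hr.
  by rewrite distrC ler_distl; have := hx i; rewrite !mxE.
move=> x hx; apply/eqP; apply: contrapT => /negP/rescale_neq0 h; apply: hx => i.
rewrite !mxE -ler_distl; apply/ltW; apply: le_lt_trans h.
by have := ler_coord_norm (x - x0) i; rewrite !mxE.
Qed.

Lemma partial_rescale i : partial i (rescale s x0 phi) = (fun x => s * rescale s x0 (partial i phi) x).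
Proof.
apply/funext => x; apply: partialE; apply: is_derive_rV_affine.
by apply: smooth_is_derive; have [] := tphi.
Qed.

Lemma ip2_rescale (psi : 'rV[R]_n -> R) : test_fun setT psi ->
  ip2 setT (rescale s x0 psi) (rescale s x0 psi) = s^-1 ^+ n * ip2 setT (psi : V) (psi : V).
Proof.
move=> tpsi; rewrite !ip2E; have L := test_fun_L2 measurableT tpsi.
rewrite -(@Rintegral_affine R n (fun x => psi x * psi x) s (- (s *: x0)))//.
  by apply: measurable_funM; exact: L.1.
exact: (integrable_ip openT L L).
Qed.

Lemma grad_rescale : \sum_i ip2 setT (partial i (rescale s x0 phi)) (partial i (rescale s x0 phi)) =
  s^-1 ^+ (n - 2) * grad_sqn phi.
Proof.
rewrite /grad_sqn mulr_sumr; apply: eq_bigr => i _; rewrite partial_rescale.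
have tp := test_fun_partial i tphi; have L := test_fun_L2 measurableT tp.
have h := ip2_rescale tp.
rewrite (form_sqrZ (L2_subspace measurableT) (ip2_psd measurableT) s (u := rescale s x0 (partial i phi))); last exact: (affine_L2 _ s0 L).
rewrite h mulrA; congr (_ * _).
have -> : s^-1 ^+ n = s^-1 ^+ 2 * s^-1 ^+ (n - 2) by rewrite -exprD subnKC// ltnW.
by rewrite mulrA -exprMn divff ?expr1n ?mul1r// gt_eqF.
Qed.

Lemma pint_rescale (c : 'rV[R]_n -> R) (c0 c1 m : R) : measurable_fun U c -> 0 < c0 ->
  (forall x, U x -> c0 <= c x <= c1) -> (forall x, rescale s x0 phi x != 0 -> m <= c x) ->
  m * (s^-1 ^+ n * \int[mu]_x (`|phi x| `^ p)) <= pint mu U p c (rescale s x0 phi).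
Proof.
move=> mc c00 hc hm; have tr := test_fun_rescale.
have Lr := test_fun_Lpow oU hn tr; have [_ ir] := Lr.
have ip' := test_fun_powR_integrable hn tphi.
rewrite -(@Rintegral_affine R n (fun x => `|phi x| `^ p) s (- (s *: x0)))//; last first.
  by apply: measurable_powR_norm => //; have [] := test_fun_L2 measurableT tphi.
have -> : \int[mu]_x (`|phi (s *: x + - (s *: x0))| `^ p) = \int[mu]_(x in U) apow p (rescale s x0 phi x).
  apply: Rintegral_supp => // x _ Ux.
  by have := test_fun_out tr Ux; rewrite /rescale => ->; rewrite normr0 powR0// gt_eqF.
rewrite -(RintegralZl _ mU ir); apply: le_Rintegral => //.
- exact: (integrableZl mU _ ir).
- exact: (integrable_pint mU mc c00 hc Lr).
- move=> x Ux; have [->|px] := eqVneq (rescale s x0 phi x) 0; first by rewrite (apow0 p2) !mulr0.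
  by rewrite ler_wpM2r ?apow_ge0// hm.
Qed.

End rescaling.

Lemma pow_crit (y : R) : 0 <= y -> (y ^+ n) `^ (2 / p) = y ^+ (n - 2).
Proof.
move=> y0; rewrite -!powR_mulrn// -powRrM; congr (_ `^ _).
rewrite natrB ?(ltnW hn)// /crit_exp; field.
have := natn_gt2 (R := R) hn; move: (n%:R) => N N2; apply/andP; split; lra.
Qed.

(** The cube pays for three simultaneous losses of a factor 1 + t. For t <= 1 the cube is at most 1
    + 7 t, whence the 7. *)
Lemma small_power (x K : R) : 0 < x -> x < K -> exists2 t, 0 < t & x * (1 + t) ^+ 3 <= K.
Proof.
move=> x0 xK; exists (Num.min 1 ((K / x - 1) / 7)).
  by rewrite lt_min ltr01/= divr_gt0// subr_gt0 ltr_pdivlMr// mul1r.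
set t := Num.min _ _.
have t0 : 0 <= t by rewrite le_min ler01/= divr_ge0// subr_ge0 ler_pdivlMr// mul1r ltW.
have t1 : t <= 1 by rewrite ge_min lexx.
have t2 : 7 * t <= K / x - 1 by rewrite mulrC -ler_pdivlMr// ge_min lexx orbT.
rewrite mulrC -ler_pdivlMr//; move: t t0 t1 t2 => t t0 t1 t2.
have h : (1 + t) ^+ 3 <= 1 + 7 * t.
  rewrite -subr_ge0 (_ : _ - _ = t * (4 - 3 * t - t ^+ 2)); last by ring.
  by rewrite mulr_ge0//; nra.
by apply: le_trans h _; lra.
Qed.

(** Under x -> s (x - x0) the gradient form and F^(2/p) both scale like s^(2-n), B only like s^-n:
    after normalizing F to 1, A stays bounded and B is of order s^-2. The three factors 1 + t cover
    near optimality and the oscillation of a and c near x0. *)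
Lemma concentrating_sequence (a b c : 'rV[R]_n -> R) (a1 b1 c0 c1 K : R) (x0 : 'rV[R]_n) :
  measurable_fun U a -> (forall x, U x -> 0 <= a x <= a1) ->
  measurable_fun U b -> (forall x, U x -> 0 <= b x <= b1) ->
  measurable_fun U c -> 0 < c0 -> (forall x, U x -> c0 <= c x <= c1) ->
  U x0 -> {for x0, continuous a} -> {for x0, continuous c} -> 0 < a x0 ->
  S * (a x0 / c x0 `^ (2 / p)) < K ->
  exists u_ : nat -> V, [/\ forall k, H10 U (u_ k), forall k, pint mu U p c (u_ k) = 1,
    forall k, dot_a U a (u_ k) (u_ k) <= K & (fun k => wip mu U b (u_ k) (u_ k)) @ \oo --> (0 : R)].
Proof.
move=> ma ha mb hb mc c00 hc Ux0 ca cc a0 hK.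
have S0 := sobolev_const_gt0 (R := R) hn.
have cx0 : 0 < c x0 by have /andP[h _] := hc x0 Ux0; exact: lt_le_trans h.
have cp0 : 0 < c x0 `^ (2 / p) by exact: powR_gt0.
have [t t0 ht] : exists2 t : R, 0 < t & S * (a x0 / c x0 `^ (2 / p)) * (1 + t) ^+ 3 <= K.
  by apply: small_power => //; rewrite mulr_gt0// divr_gt0.
have t1 : 0 < 1 + t by rewrite addr_gt0.
have [phi tphi [I0 gI]] := sobolev_const_approx hn (mulr_gt0 t0 S0).
set I := \int[mu]_x _ in I0 gI.
have [r r0 phir] := test_fun_bsupp tphi.
have [d d0 hd] : exists2 d, 0 < d & forall x, ball x0 d x -> [/\ U x, a x <= (1 + t) * a x0 & c x0 / (1 + t) <= c x].
  have nU : \forall x \near x0, U x by exact: open_nbhs_nbhs.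
  have e1 : 0 < t * a x0 by rewrite mulr_gt0.
  have e2 : 0 < c x0 - c x0 / (1 + t) by rewrite subr_gt0 ltr_pdivrMr// ltr_pMr// ltrDl.
  have /cvgrPdist_lt/(_ _ e1) na := ca; have /cvgrPdist_lt/(_ _ e2) nc := cc.
  have [d d0 hd] := (nbhs_ballP _ _).1 (filterI (filterI nU na) nc).
  exists d => // x /hd[[Ux] /=]; rewrite !ltr_norml => /andP[h1 _] /andP[_ h2]; split => //.
  - by move: h1; rewrite mulrDl mul1r; move: (t * a x0) (a x) => y z; lra.
  - by move: h2; rewrite ltrD2l ltrN2 => /ltW.
have ballU : ball x0 d `<=` U by move=> x /hd[].
(* Already for k = 0 the rescaled support, of radius r / s, lies in the ball of radius d. *)
pose s k : R := k.+1%:R * ((r + 1) / d).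
have rd : 0 < (r + 1) / d by rewrite divr_gt0// addr_gt0.
have s0 k : 0 < s k by rewrite mulr_gt0.
have hr k : r / s k < d.
  have h1 : (r + 1) / d <= s k by rewrite /s ler_peMl ?(ltW rd)// ler1n.
  rewrite ltr_pdivrMr// mulrC -ltr_pdivrMr//; apply: lt_le_trans h1.
  by rewrite ltr_pM2r ?invr_gt0// ltrDl.
pose psi k : V := rescale (s k) x0 phi.
have tpsi k : test_fun U (psi k) := test_fun_rescale tphi (s0 k) d0 phir (hr k) ballU.
have inball k x : `|x - x0| <= r / s k -> [/\ U x, a x <= (1 + t) * a x0 & c x0 / (1 + t) <= c x].
  move=> h; apply: hd; apply/(rV_ballP _ _ d0) => i.
  have := ler_coord_norm (x - x0) i; rewrite !mxE distrC => h1.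
  exact: le_lt_trans h1 (le_lt_trans h (hr k)).
have supp k x : psi k x != 0 -> [/\ U x, a x <= (1 + t) * a x0 & c x0 / (1 + t) <= c x].
  by move=> /(rescale_neq0 (s0 k) phir)/ltW; exact: inball.
have supp' k i x : partial i (psi k) x != 0 -> a x <= (1 + t) * a x0.
  rewrite (partial_rescale x0 (s k) tphi) => h; have [|_ h' _] := @inball k x; last exact: h'.
  rewrite leNgt; apply/negP => h2; case/eqP: h; rewrite /rescale.
  rewrite (partial_out (K := [set x : 'rV[R]_n | `|x| <= r])) ?mulr0//; first exact: closed_norm_ball.
    by move=> y /= /negP; rewrite -ltNge => /ltW; exact: phir.
  apply/negP; rewrite -ltNge -scalerBr normrZ gtr0_norm//.
  by rewrite mulrC -ltr_pdivrMr.
have y0 k : 0 < (s k)^-1 by rewrite invr_gt0.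
pose m := c x0 / (1 + t); have m0 : 0 < m by rewrite divr_gt0.
pose P k := pint mu U p c (psi k).
have Pge k : m * ((s k)^-1 ^+ n * I) <= P k.
  by apply: (pint_rescale tphi (s0 k) d0 phir (hr k) ballU mc c00 hc) => x /supp[].
have P0 k : 0 < P k by apply: lt_le_trans (Pge k); exact: (mulr_gt0 m0 (mulr_gt0 (exprn_gt0 n (y0 k)) I0)).
pose X := m `^ (2 / p) * I `^ (2 / p).
have X0 : 0 < X by rewrite mulr_gt0// powR_gt0.
have Pp k : (s k)^-1 ^+ (n - 2) * X <= P k `^ (2 / p).
  have z0 : 0 <= m * ((s k)^-1 ^+ n * I) by exact: (ltW (mulr_gt0 m0 (mulr_gt0 (exprn_gt0 n (y0 k)) I0))).
  have := le_powR (r := 2 / p) _ z0 (Pge k); rewrite divr_ge0 ?(ltW p0)// => /(_ isT).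
  rewrite powRM ?(ltW m0) ?mulr_ge0 ?exprn_ge0 ?(ltW (y0 k)) ?(ltW I0)//.
  have -> : ((s k)^-1 ^+ n * I) `^ (2 / p) = (s k)^-1 ^+ (n - 2) * I `^ (2 / p).
    by rewrite powRM ?(ltW I0) ?exprn_ge0 ?(ltW (y0 k))// pow_crit ?(ltW (y0 k)).
  by rewrite mulrCA.
pose u_ k : V := (P k `^ - p^-1) *: psi k.
have lam2 k : (P k `^ - p^-1) ^+ 2 = (P k `^ (2 / p))^-1.
  by rewrite -powR_mulrn ?powR_ge0// -powRrM -powRN; congr (_ `^ _); ring.
have HS := H10_subspace oU.
have Hpsi k : H10 U (psi k) := test_fun_H10 oU (tpsi k).
have PA := psd_formS (@H10_sub_H1 R n U) (dot_a_psd oU ma ha).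
have PB : psd_form (L2 U : set V) (wip mu U b) := wip_psd mU mb hb.
have Agr k : dot_a U a (psi k) (psi k) <= (1 + t) * a x0 * ((s k)^-1 ^+ (n - 2) * grad_sqn phi).
  rewrite (dot_a_test_fun oU ma ha (tpsi k)) -(grad_rescale x0 tphi (s0 k)) mulr_sumr.
  apply: ler_sum => i _; apply: (wip_supp_le ma ha (test_fun_partial i (tpsi k))).
  by move=> x; exact: supp'.
exists u_; split.
- by move=> k; exact: (subspaceZ HS).
- move=> k; rewrite (pintZ mU mc c00 hc (P k `^ - p^-1) (test_fun_Lpow oU hn (tpsi k))).
  rewrite ger0_norm ?powR_ge0// -powRrM -/(P k) mulNr mulVf ?gt_eqF// powR_inv1 ?(ltW (P0 k))//.
  by rewrite mulVf// gt_eqF.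
- move=> k; have := form_sqrZ HS PA (P k `^ - p^-1) (Hpsi k).
  rewrite lam2 -/(u_ k) => ->; rewrite mulrC ler_pdivrMr; last exact: (powR_gt0 _ (P0 k)).
  have KS : (1 + t) * a x0 * ((1 + t) * S * I `^ (2 / p)) <= K * X.
    have cm : c x0 `^ (2 / p) <= (1 + t) * m `^ (2 / p).
      have -> : c x0 = (1 + t) * m by rewrite /m mulrC divfK// gt_eqF.
      rewrite powRM ?(ltW m0) ?(ltW t1)// ler_wpM2r ?powR_ge0//.
      rewrite -[X in _ <= X](powRr1 (ltW t1)) ler_powR ?lerDl ?(ltW t0)//.
      by rewrite ler_pdivrMr// mul1r ltW.
    have : S * (a x0 / c x0 `^ (2 / p)) * (1 + t) ^+ 3 * X <= K * X by rewrite ler_pM2r.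
    apply: le_trans; rewrite /X.
    have h : (1 + t) ^+ 2 * (S * a x0) * I `^ (2 / p) * c x0 `^ (2 / p) <= (1 + t) ^+ 2 * (S * a x0) * I `^ (2 / p) * ((1 + t) * m `^ (2 / p)).
      by apply: ler_wpM2l cm; exact: (mulr_ge0 (mulr_ge0 (sqr_ge0 _) (ltW (mulr_gt0 S0 a0))) (powR_ge0 _ _)).
    have cx : c x0 `^ (2 / p) != 0 by rewrite gt_eqF.
    rewrite -(ler_pM2r cp0); move: h; congr (_ <= _); first by ring.
    by field.
  apply: le_trans (Agr k) _; apply: (@le_trans _ _ (K * ((s k)^-1 ^+ (n - 2) * X))); last first.
    rewrite ler_wpM2l//; apply/ltW; apply: le_lt_trans hK.
    by rewrite mulr_ge0 ?divr_ge0 ?(ltW S0) ?(ltW a0) ?(ltW cp0).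
  have gI' : grad_sqn phi <= (1 + t) * S * I `^ (2 / p) by rewrite mulrDl mul1r.
  rewrite mulrCA [K * _]mulrCA ler_wpM2l ?exprn_ge0 ?(ltW (y0 k))//.
  by apply: le_trans KS; rewrite ler_wpM2l// mulr_ge0// ltW.
- pose D := b1 * ip2 setT (phi : V) (phi : V) / X.
  have b10 : 0 <= b1 by have /andP[h1 h2] := hb x0 Ux0; exact: le_trans h1 h2.
  have L0 := test_fun_L2 measurableT tphi.
  have i0 := form_ge0 (ip2_psd measurableT) L0.
  have HL : H10 U `<=` (L2 U : set V) by move=> v /H10_sub_H1[].
  have PB' := psd_formS HL PB.
  have Bk k : wip mu U b (u_ k) (u_ k) <= D * (d / (r + 1)) ^+ 2 * k.+1%:R^-1.
    have := form_sqrZ HS PB' (P k `^ - p^-1) (Hpsi k).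
    rewrite lam2 -/(u_ k) => ->; rewrite mulrC ler_pdivrMr; last exact: (powR_gt0 _ (P0 k)).
    have h1 : wip mu U b (psi k) (psi k) <= b1 * ((s k)^-1 ^+ n * ip2 setT (phi : V) (phi : V)).
      rewrite -(ip2_rescale x0 (s0 k) tphi); apply: (wip_supp_le mb hb (tpsi k)) => x /supp[Ux _ _].
      by have /andP[] := hb x Ux.
    apply: le_trans h1 _.
    have h2 : D * (d / (r + 1)) ^+ 2 * k.+1%:R^-1 * ((s k)^-1 ^+ (n - 2) * X) <= D * (d / (r + 1)) ^+ 2 * k.+1%:R^-1 * P k `^ (2 / p).
      apply: ler_wpM2l (Pp k); rewrite mulr_ge0 ?invr_ge0// mulr_ge0 ?sqr_ge0//.
      by apply: divr_ge0 (ltW X0); exact: mulr_ge0.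
    apply: le_trans h2; have -> : (s k)^-1 ^+ n = (s k)^-1 ^+ 2 * (s k)^-1 ^+ (n - 2) by rewrite -exprD subnKC// ltnW.
    have h3 : (s k)^-1 ^+ 2 <= (d / (r + 1)) ^+ 2 * k.+1%:R^-1.
      rewrite /s invfM invf_div exprMn mulrC ler_wpM2l ?sqr_ge0//.
      by rewrite expr2 ler_piMl ?invr_ge0// invf_le1// ler1n.
    have h4 : D * X = b1 * ip2 setT (phi : V) (phi : V) by rewrite /D mulfVK// gt_eqF.
    rewrite [X in _ <= X](_ : _ = (D * X) * (s k)^-1 ^+ (n - 2) * ((d / (r + 1)) ^+ 2 * k.+1%:R^-1)); last by ring.
    rewrite h4 [X in X <= _](_ : _ = b1 * ip2 setT (phi : V) (phi : V) * (s k)^-1 ^+ (n - 2) * (s k)^-1 ^+ 2); last by ring.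
    by apply: ler_wpM2l h3; rewrite mulr_ge0 ?exprn_ge0 ?(ltW (y0 k))// mulr_ge0.
  have c1' : (fun k : nat => D * (d / (r + 1)) ^+ 2 * k.+1%:R^-1) @ \oo --> (0 : R).
    by rewrite -(mulr0 (D * (d / (r + 1)) ^+ 2)); apply: cvgMr; exact: cvg_harmonic.
  apply: (squeeze_cvgr _ (cvg_cst (0 : R)) c1'); apply: nearW => k.
  by rewrite Bk (form_ge0 PB')//; exact: (subspaceZ HS).
Qed.

End concentrating.

(** * The variational problem *)

Section continuity_on_closure.
Context {R : realType} {n : nat}.
Variables (U : set 'rV[R]_n).
Hypotheses (oU : open U) (nU : U !=set0) (bU : bounded_set U).
Implicit Types f : 'rV[R]_n -> R.

Lemma compact_closure : compact (closure U).
Proof.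
apply: bounded_closed_compact; last exact: closed_closure.
have [M [Mr hM]] := bU; exists (M + 1); split; first exact: num_real.
move=> r Mr1 x cx; have h : closed [set x : 'rV[R]_n | `|x| <= r] := closed_norm_ball (r := r).
have : closure U `<=` closure [set x : 'rV[R]_n | `|x| <= r].
  apply: closureS => y Uy /=; apply: hM => //.
  by apply: lt_trans Mr1; rewrite ltrDl.
by rewrite -((closure_id _).1 h) => hs; exact: (hs x cx).
Qed.

Lemma sub_closure : U `<=` closure U. Proof. exact: subset_closure. Qed.

Let cl0 : closure U !=set0. Proof. by have [x Ux] := nU; exists x; exact: sub_closure. Qed.

Lemma C0_closure_bounds f : C0_closure U f -> (forall x, closure U x -> 0 < f x) ->
  exists f0 f1 : R, 0 < f0 /\ forall x, closure U x -> f0 <= f x <= f1.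
Proof.
move=> cf f_gt0.
have [x0 /set_mem hx0 h0] := compact_EVT_min cl0 compact_closure cf.
have [x1 /set_mem hx1 h1] := compact_EVT_max cl0 compact_closure cf.
exists (f x0), (f x1); split; first exact: f_gt0.
by move=> x hx; rewrite h0 ?h1// inE.
Qed.

Lemma C0_closure_norm_bound f : C0_closure U f -> exists M : R, forall x, closure U x -> `|f x| <= M.
Proof.
move=> cf.
have [x0 /set_mem hx0 h0] := compact_EVT_min cl0 compact_closure cf.
have [x1 /set_mem hx1 h1] := compact_EVT_max cl0 compact_closure cf.
exists (`|f x0| + `|f x1|) => x hx.
have xc : x \in closure U by rewrite inE.
have := h0 x xc; have := h1 x xc; have := ler_norm (f x1); have := ler_norm (- f x0); rewrite normrN.
have := normr_ge0 (f x0); have := normr_ge0 (f x1).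
move: (`|f x0|) (`|f x1|) => A B A0 B0 h2 h3 h4 h5.
by rewrite ler_norml; apply/andP; split; lra.
Qed.

Lemma C0_closure_continuous f x : C0_closure U f -> U x -> {for x, continuous f}.
Proof.
move=> cf Ux; have h := continuous_subspaceW sub_closure cf.
by move: h; rewrite continuous_open_subspace// => /(_ x); apply; rewrite inE.
Qed.

Lemma C0_closure_measurable f : C0_closure U f -> measurable_fun U f.
Proof. by move=> cf; apply: continuous_in_measurable_rV => // x Ux; exact: C0_closure_continuous. Qed.

(** The minimum in [kappa] may be approached only at the boundary, whereas the concentrating
    functions need an interior point. *)
Lemma closure_approx f g y (d : R) : C0_closure U f -> C0_closure U g -> closure U y -> 0 < d ->
  exists x, [/\ U x, `|f y - f x| < d & `|g y - g x| < d].
Proof.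
move=> /subspace_continuousP cf /subspace_continuousP cg cy d0.
have /cvgrPdist_lt/(_ d d0) nf := cf y cy; have /cvgrPdist_lt/(_ d d0) ng := cg y cy.
have [x [Ux h]] := cy _ (filterI nf ng).
by have [h1 h2] := h (sub_closure Ux); exists x; split.
Qed.

End continuity_on_closure.
Section variational_problem.
Context {R : realType} {n : nat}.
Hypothesis hn : (3 <= n)%N.
Local Notation mu := (lebesgue_rV R n).
Local Notation V := ('rV[R]_n -> R^o).
Local Notation p := (crit_exp R n).
Local Notation S := (sobolev_const R n).
Variables (Theta : set 'rV[R]_n) (a b c : 'rV[R]_n -> R).
Variables (lam : nat -> R) (e : nat -> 'rV[R]_n -> R).
Hypotheses (hTheta : bounded_smooth_domain Theta).
Hypotheses (ha : C1_closure Theta a) (hb : C0_closure Theta b) (hc : C0_closure Theta c).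
Hypothesis a_gt0 : forall x, closure Theta x -> 0 < a x.
Hypothesis b_gt0 : forall x, closure Theta x -> 0 < b x.
Hypothesis c_gt0 : forall x, closure Theta x -> 0 < c x.
Hypothesis hlam : eigen_enumeration Theta a b lam e.
Implicit Types (u v z : V).

Let p2 : 2 < p := crit_exp_gt2 hn.
Let p0 : 0 < p := crit_exp_gt0 hn.
Let oU : open Theta. Proof. by case: hTheta. Qed.
Let nU : Theta !=set0. Proof. by case: hTheta. Qed.
Let bU : bounded_set Theta. Proof. by case: hTheta. Qed.
Let mU : measurable Theta := open_measurable_rV oU.

Let a_C0 : C0_closure Theta a. Proof. by case: ha. Qed.
Let ma : measurable_fun Theta a := C0_closure_measurable oU a_C0.
Let mb : measurable_fun Theta b := C0_closure_measurable oU hb.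
Let mc : measurable_fun Theta c := C0_closure_measurable oU hc.

Lemma weight_bounds f : C0_closure Theta f -> (forall x, closure Theta x -> 0 < f x) ->
  exists f0 f1 : R, 0 < f0 /\ forall x, Theta x -> f0 <= f x <= f1.
Proof.
move=> cf f_gt0; have [f0 [f1 [h0 h]]] := C0_closure_bounds nU bU cf f_gt0.
by exists f0, f1; split => // x Tx; apply: h; exact: subset_closure.
Qed.

Local Notation A := (dot_a Theta a : V -> V -> R).
Local Notation B := (dot_b Theta b : V -> V -> R).
Local Notation H := (H10 Theta : set V).
Local Notation F := (pint mu Theta p c : V -> R).
Local Notation dF := (dpint mu Theta p c : V -> V -> R).

Let HS : subspace_like H := H10_subspace oU.

Let H1sub : H `<=` (H1 Theta : set V) := @H10_sub_H1 R n Theta.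
Let L2sub : H `<=` (L2 Theta : set V). Proof. by move=> u /H1sub[]. Qed.

Let HA : psd_form H A.
Proof.
have [a0 [a1 [a00 h]]] := weight_bounds a_C0 a_gt0.
apply: (psd_formS H1sub); apply: (dot_a_psd oU ma (C := a1)) => x Tx.
by have /andP[h1 ->] := h x Tx; rewrite (le_trans (ltW a00) h1).
Qed.

Let PB : psd_form (L2 Theta : set V) B.
Proof.
have [b0 [b1 [b00 h]]] := weight_bounds hb b_gt0.
apply: (wip_psd mU mb (C := b1)) => x Tx.
by have /andP[h1 ->] := h x Tx; rewrite (le_trans (ltW b00) h1).
Qed.

Let HB : psd_form H B := psd_formS L2sub PB.

Lemma dot_b_equiv : exists b0 b1 : R, 0 < b0 /\ forall u, L2 Theta u ->
  b0 * ip2 Theta u u <= B u u <= b1 * ip2 Theta u u.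
Proof.
have [b0 [b1 [b00 h]]] := weight_bounds hb b_gt0.
by exists b0, b1; split => // u hu; exact: (wip_bounds oU mb (ltW b00) h).
Qed.

Lemma dot_b_null u : L2 Theta u -> (B u u = 0 <-> ae_eq_on Theta u (cst 0)).
Proof.
move=> hu; have [b0 [b1 [b00 h]]] := dot_b_equiv; have /andP[h1 h2] := h u hu.
have i0 := form_ge0 (ip2_psd mU) hu.
split.
  move=> Bu; apply: (ip2_eq0_ae oU hu); apply/eqP; rewrite eq_le i0 andbT.
  by move: h1; rewrite Bu pmulr_rle0.
move=> u0; have L0 : L2 Theta (cst 0 : V) := subspace0 (L2_subspace mU).
have ip0 : ip2 Theta u u = 0.
  rewrite (ip2_ae_eq oU hu.1 hu.1 L0.1 L0.1 u0 u0).
  exact: (form0l (L2_subspace mU) (ip2_psd mU) L0).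
by apply/eqP; rewrite eq_le (form_ge0 PB hu) andbT; move: h2; rewrite ip0 mulr0.
Qed.

Let E_equiv : exists k1 k2 : R, [/\ 0 < k1, 0 < k2 & forall u, H u ->
  k1 * ipH1 Theta u u <= B u u + A u u <= k2 * ipH1 Theta u u].
Proof.
have [a0 [a1 [a00 ha0]]] := weight_bounds a_C0 a_gt0.
have [b0 [b1 [b00 hb0]]] := weight_bounds hb b_gt0.
have [x0 Tx0] := nU.
have a10 : 0 < a1 by have /andP[h1 h2] := ha0 x0 Tx0; exact: lt_le_trans a00 (le_trans h1 h2).
exists (Num.min a0 b0), (Num.max a1 b1); rewrite lt_min a00 b00 lt_max a10; split => // u hu.
have /andP[g1 g2] := wip_bounds oU mb (ltW b00) hb0 (L2sub hu).
have /andP[g3 g4] := dot_bounds oU ma (ltW a00) ha0 (H1sub hu).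
have i0 := form_ge0 (ip2_psd mU) (L2sub hu); have i1 := form_ge0 (dot1_psd oU) (H1sub hu).
rewrite /ipH1 !mulrDr; apply/andP; split; apply: lerD.
- by apply: le_trans g1; rewrite ler_wpM2r// ge_min lexx orbT.
- by apply: le_trans g3; rewrite ler_wpM2r// ge_min lexx.
- by apply: le_trans g2 _; rewrite ler_wpM2r// le_max lexx orbT.
- by apply: le_trans g4 _; rewrite ler_wpM2r// le_max lexx.
Qed.

Let null_AB u : H u -> B u u = 0 -> A u u = 0.
Proof.
move=> hu Bu; have [a0 [a1 [a00 ha0]]] := weight_bounds a_C0 a_gt0.
have /andP[_ h] := dot_bounds oU ma (ltW a00) ha0 (H1sub hu).
have [b0 [b1 [b00 hb0]]] := dot_b_equiv; have /andP[h1 _] := hb0 u (L2sub hu).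
have ip0 : ip2 Theta u u = 0.
  apply/eqP; rewrite eq_le (form_ge0 (ip2_psd mU) (L2sub hu)) andbT.
  by move: h1; rewrite Bu pmulr_rle0.
apply/eqP; rewrite eq_le (form_ge0 HA hu) andbT; move: h.
by rewrite (dot1_null oU (H1sub hu) ip0) mulr0.
Qed.

Let radius : exists r : R, forall x, Theta x -> `|x| <= r.
Proof.
have [M [Mr hM]] := bU; exists (M + 1) => x Tx; apply: hM => //; by rewrite ltrDl.
Qed.

Let WC : weakly_compact H A B.
Proof.
have [k1 [k2 [k10 k20 hk]]] := E_equiv.
apply: weak_compactness => //.
  by apply: (complete_form_equiv HS k10 k20 hk); exact: H10_complete.
move=> u_ M hu hM; have [r Tr] := radius.
have [|s [hs cs]] := @rellich_H10 R n Theta oU r (M / k1) u_ Tr hu.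
  move=> k; rewrite ler_pdivlMr// mulrC; apply: le_trans (hM k).
  by have /andP[] := hk _ (hu k).
exists s; split => // d d0.
have [b0 [b1 [b00 hb0]]] := dot_b_equiv.
have b2 : 0 < `|b1| + 1 by rewrite ltr_wpDl.
have [N hN] := cs (d / (`|b1| + 1)) (divr_gt0 d0 b2).
exists N => i j iN jN; have hd := L2sub (subspaceB HS (hu (s i)) (hu (s j))).
have /andP[_ h] := hb0 _ hd; apply: le_trans h _.
have := hN i j iN jN; rewrite ler_pdivlMr// mulrC; apply: le_trans.
rewrite ler_wpM2r ?(form_ge0 (ip2_psd mU) hd)//.
by apply: le_trans (ler_norm _) _; rewrite lerDl.
Qed.
(* inf X ^ (2 / n) is the infimum of a / c ^ (2 / p); multiplied by S it is the
   constant of the Sobolev inequality for A and F, up to lower order terms. *)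
Let X : set R := [set a x `^ (n%:R / 2) / c x `^ ((n%:R - 2) / 2) | x in closure Theta].
Let K0 : R := inf X `^ (2 / n%:R).
Let K : R := K0 * S.

Let n2 : 2 < n%:R :> R := natn_gt2 hn.
Let nh : 0 < n%:R / 2 :> R. Proof. by rewrite divr_gt0//; move: n2; lra. Qed.

Let X_ratio x : closure Theta x ->
  (a x `^ (n%:R / 2) / c x `^ ((n%:R - 2) / 2)) `^ (2 / n%:R) = a x / c x `^ (2 / p).
Proof.
move=> cx; have ax := a_gt0 cx; have cx0 := c_gt0 cx.
rewrite powRM ?powR_ge0 ?invr_ge0 ?powR_ge0// -powRrM.
rewrite (_ : n%:R / 2 * (2 / n%:R) = 1); last by field; rewrite gt_eqF//; move: n2; lra.
rewrite powRr1 ?(ltW ax)//; congr (_ * _).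
rewrite -powRN -powRrM -powRN; congr (_ `^ _); rewrite /crit_exp; field.
by apply/andP; split; rewrite gt_eqF//; move: n2; lra.
Qed.

Let X_inf : has_inf X.
Proof.
split; last by exists 0 => _ [x cx <-]; rewrite mulr_ge0 ?invr_ge0 ?powR_ge0.
by have [x Tx] := nU; exists (a x `^ (n%:R / 2) / c x `^ ((n%:R - 2) / 2)), x => //; exact: subset_closure.
Qed.

Let X_gt0 : 0 < inf X.
Proof.
have [a0 [a1 [a00 ha0]]] := C0_closure_bounds nU bU a_C0 a_gt0.
have [c0 [c1 [c00 hc0]]] := C0_closure_bounds nU bU hc c_gt0.
have [x0 Tx0] := nU; have c10 : 0 < c1.
  by have /andP[h1 h2] := hc0 x0 (subset_closure Tx0); exact: lt_le_trans c00 (le_trans h1 h2).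
have e0 : 0 <= (n%:R - 2) / 2 :> R by rewrite divr_ge0// subr_ge0 ltW.
apply: (@lt_le_trans _ _ (a0 `^ (n%:R / 2) / c1 `^ ((n%:R - 2) / 2))).
  by rewrite divr_gt0 ?powR_gt0.
apply: lb_le_inf; first exact: X_inf.1.
move=> _ [x cx <-]; have /andP[h1 _] := ha0 x cx; have /andP[h2 h3] := hc0 x cx.
apply: ler_pM; rewrite ?powR_ge0 ?invr_ge0 ?powR_ge0//.
  by apply: le_powR => //; exact: ltW.
rewrite lef_pV2 ?posrE ?powR_gt0 ?c_gt0//; apply: le_powR => //.
exact: ltW (c_gt0 cx).
Qed.

Let S0 : 0 < S := sobolev_const_gt0 (R := R) hn.
Let K00 : 0 < K0 := powR_gt0 (2 / n%:R) X_gt0.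
Let K_gt0 : 0 < K := mulr_gt0 K00 S0.

Let K0_le x : closure Theta x -> K0 * c x `^ (2 / p) <= a x.
Proof.
move=> cx; rewrite -ler_pdivlMr ?powR_gt0 ?c_gt0// -X_ratio//.
by apply: le_powR; rewrite ?(ltW X_gt0)//; apply: (inf_lbound X_inf.2); exists x.
Qed.

Lemma kappaE : kappa Theta a c = n%:R^-1 * K `^ (n%:R / 2).
Proof.
rewrite /K powRM ?(ltW K00) ?(ltW S0)// /K0 -powRrM (_ : 2 / n%:R * (n%:R / 2) = 1); last first.
  by field; rewrite gt_eqF//; move: n2; lra.
by rewrite powRr1 ?(ltW X_gt0)// /kappa mulrCA.
Qed.

Let c_bounds : exists c0 c1 : R, 0 < c0 /\ forall x, Theta x -> c0 <= c x <= c1 := weight_bounds hc c_gt0.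

Let E_le : exists2 M : R, 0 < M & forall u, H u -> B u u + A u u <= M * ipH1 Theta u u.
Proof. by have [k1 [k2 [_ k20 h]]] := E_equiv; exists k2 => // u hu; have /andP[] := h u hu. Qed.

Let local_sobolev (d : R) : 0 < d -> exists2 C : R, 0 < C & forall u, H u -> Lpow mu Theta p u /\
  K * F u `^ (2 / p) <= (1 + d) * A u u + C * B u u.
Proof.
move=> d0; have [a0 [a1 [a00 ha0]]] := weight_bounds a_C0 a_gt0.
have [c0 [c1 [c00 hc0]]] := c_bounds; have [b0 [b1 [b00 hb0]]] := dot_b_equiv.
have [_ Ca hg] := ha.
have [G G0 hG] : exists2 G : R, 0 <= G & forall i x, Theta x -> `|partial i a x| <= G.
  have /choice[M hM] (i : 'I_n) : exists M : R, forall x, Theta x -> `|partial i a x| <= M.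
    have [g cg ge] := hg i; have [M hM] := C0_closure_norm_bound nU bU cg.
    by exists M => x Tx; rewrite -ge ?inE//; apply: hM; exact: subset_closure.
  exists (\sum_i `|M i|); first exact: sumr_ge0.
  move=> i x Tx; apply: le_trans (hM i x Tx) _; apply: le_trans (ler_norm _) _.
  by rewrite (bigD1 i)//= lerDl sumr_ge0.
have KT x : Theta x -> K0 * c x `^ (2 / p) <= a x by move=> /subset_closure; exact: K0_le.
have [C C0 hC] := local_sobolev_test hn oU a00 ha0 Ca G0 hG mc c00 hc0 K00 KT d0.
have d1 : 0 < 1 + d by rewrite addr_gt0.
have Cb : 0 < C / b0 by rewrite divr_gt0.
exists (C / b0) => //.
pose D u v := (1 + d) * A u v + (C / b0) * B u v.
have psdZ (k : R) (G' : V -> V -> R) : 0 <= k -> psd_form H G' -> psd_form H (fun u v => k * G' u v).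
  move=> k0 [h1 h2 h3 h4]; split.
  - by move=> u v; rewrite h1.
  - by move=> u v w hu hv hw; rewrite h2// mulrDr.
  - by move=> r u v hu hv; rewrite h3// mulrCA.
  - by move=> u hu; rewrite mulr_ge0// h4.
have PD : psd_form H D := psd_formD (psdZ _ _ (ltW d1) HA) (psdZ _ _ (ltW Cb) HB).
have [M M0 hM] := E_le.
apply: (power_bound_H10 oU hn mc c00 hc0 PD K_gt0 (M := (1 + d + C / b0) * M)).
- by rewrite mulr_gt0// addr_gt0.
- move=> u hu; rewrite -mulrA; apply: (@le_trans _ _ ((1 + d + C / b0) * (B u u + A u u))); last first.
    by rewrite ler_wpM2l ?hM// addr_ge0 ?ltW.
  have gA := form_ge0 HA hu; have gB := form_ge0 HB hu.
  rewrite /D; move: (C / b0) (1 + d) (A u u) (B u u) Cb d1 gA gB => x y z w; nra.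
- move=> phi tphi; apply: le_trans (hC phi tphi) _; rewrite lerD2l.
  have /andP[h _] := hb0 phi (test_fun_L2 mU tphi).
  by rewrite mulrAC ler_pdivlMr// -mulrA ler_pM2l// mulrC.
Qed.

Let LpH u : H u -> Lpow mu Theta p u.
Proof. by have [C _ h] := local_sobolev ltr01 => /h[]. Qed.

Let F_ge0 u : H u -> 0 <= F u.
Proof. by have [c0 [c1 [c00 hc0]]] := c_bounds => _; exact: (pint_ge0 mu p c00 hc0). Qed.

Let FZ (k : R) u : H u -> F (k *: u) = `|k| `^ p * F u.
Proof. by have [c0 [c1 [c00 hc0]]] := c_bounds => hu; exact: (pintZ mU mc c00 hc0 k (LpH hu)). Qed.

Let F_sobolev (d : R) : 0 < d -> exists2 C : R, 0 < C & forall u, H u ->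
  K * F u `^ (2 / p) <= (1 + d) * A u u + C * B u u.
Proof. by move=> /local_sobolev[C C0 h]; exists C => // u /h[]. Qed.

Let finU : (mu Theta < +oo)%E := lebesgue_rV_bounded mU bU.

Let F_hoelder0 : exists2 Cb : R, 0 < Cb & forall u, H u -> B u u <= Cb * F u `^ (2 / p).
Proof.
have [c0 [c1 [c00 hc0]]] := c_bounds; have [b0 [b1 [b00 hb0]]] := dot_b_equiv.
exists ((`|b1| + 1) * (fine (mu Theta) + c0^-1)).
  by rewrite mulr_gt0 ?ltr_wpDl ?fine_ge0 ?invr_gt0.
move=> u hu; have /andP[_ h] := hb0 u (L2sub hu); apply: le_trans h _.
have i0 := form_ge0 (ip2_psd mU) (L2sub hu); rewrite -mulrA.
apply: (@le_trans _ _ ((`|b1| + 1) * ip2 Theta u u)).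
  by rewrite ler_wpM2r//; apply: le_trans (ler_norm _) _; rewrite lerDl.
rewrite ler_wpM2l ?addr_ge0//; apply: le_trans (integral_sqr_le_pint mU p2 mc c00 hc0 finU (LpH hu)).
by rewrite ip2E le_eqVlt; apply/orP; left; apply/eqP; apply: eq_Rintegral => x _; rewrite expr2.
Qed.

Let dF_nehari s u w : H u -> H w ->
  (s ^+ 2 - 1) / 2 * F u + s * dF u (w - s *: u) + p^-1 * F u - p^-1 * F w <= 0.
Proof.
by have [c0 [c1 [c00 hc0]]] := c_bounds => hu hw; exact: (pint_nehari mU p2 mc c00 hc0 s (LpH hu) (LpH hw)).
Qed.

Let dF_diag u : H u -> dF u u = F u. Proof. by move=> _; exact: dpint_diag. Qed.

Let is_derive_F u v : H u -> H v ->
  is_derive (0 : R) 1 (fun t : R => F (u + t *: v)) (p * dF u v).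
Proof.
by have [c0 [c1 [c00 hc0]]] := c_bounds => hu hv; exact: (is_derive_pint mU p2 mc c00 hc0 (LpH hu) (LpH hv)).
Qed.

Let F_add (d : R) : 0 < d -> exists2 C : R, 0 < C & forall u h, H u -> H h ->
  `|F (u + h) - F u| <= d * F u + C * F h.
Proof.
have [c0 [c1 [c00 hc0]]] := c_bounds => d0; have [C C0 h] := pint_add mu mU p2 mc c00 hc0 d0.
exists C; first exact: C0.
move=> u v hu hv; have := h u v (LpH hu) (LpH hv).
by rewrite (_ : (fun x => u x + v x) = (u + v : V)).
Qed.

Let F_brezis_lieb (u_ : nat -> V) u M : (forall k, H (u_ k)) -> H u ->
  cvg_form B u_ u -> (forall k, F (u_ k - u) <= M) ->
  exists s : nat -> nat, (forall k, (s k < s k.+1)%N) /\ forall (t : R) w, H w ->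
    (fun k => F (t *: (u_ (s k) - u) + w) - `|t| `^ p * F (u_ (s k) - u)) @ \oo --> F w.
Proof.
move=> hu_ hu cB hM; have [c0 [c1 [c00 hc0]]] := c_bounds; have [b0 [b1 [b00 hb0]]] := dot_b_equiv.
have hd k : H (u_ k - u) := subspaceB HS (hu_ k) hu.
have [||s [hs ae]] := @sqn_cvg_subseq_ae _ _ _ mu Theta mU (fun k => u_ k) u (fun k => (L2sub (hu_ k)).1).
- exact: (L2sub hu).1.
- move=> d d0; have [N hN] := cB (b0 * d) (mulr_gt0 b00 d0); exists N => k /hN h.
  have -> : sqn mu Theta (fun x => u_ k x - u x) = (ip2 Theta (u_ k - u) (u_ k - u))%:E.
    by rewrite -(ip2_sqn (L2sub (hd k))).
  rewrite lee_fin -(ler_pM2l b00); apply: le_trans h; have /andP[] := hb0 _ (L2sub (hd k)); by [].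
exists s; split => // t w hw.
have La k : Lpow mu Theta p (t *: (u_ (s k) - u)) by exact: (LpH (subspaceZ HS t (hd (s k)))).
have Fa k : F (t *: (u_ (s k) - u)) = `|t| `^ p * F (u_ (s k) - u) := FZ t (hd (s k)).
have := @brezis_lieb _ _ _ mu Theta p c0 c1 c mU p2 mc c00 hc0 (fun k => t *: (u_ (s k) - u)) w (`|t| `^ p * M) La (LpH hw).
rewrite (_ : (fun k => _) = (fun k => F (t *: (u_ (s k) - u) + w) - `|t| `^ p * F (u_ (s k) - u))); last first.
  by apply/funext => k; rewrite -Fa.
apply.
- apply: filterS ae => x hx Tx; rewrite -(mulr0 t); apply: cvgMr.
  rewrite -(subrr (u x)); apply: cvgB; [exact: hx|exact: cvg_cst].
- by move=> k; rewrite Fa ler_wpM2l ?powR_ge0.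
Qed.
Let sumE N (P : pred 'I_N) (k : 'I_N -> R) :
  (\sum_(j < N | P j) k j *: (e j : V)) = (fun x => \sum_(j < N | P j) k j * e j x).
Proof. by rewrite fct_sumE. Qed.

Let sumE_nat N (P : pred 'I_N) (k : 'I_N -> R) : exists k' : nat -> R,
  (\sum_(j < N | P j) k' j *: (e j : V)) = (fun x => \sum_(j < N | P j) k j * e j x).
Proof.
exists (fun j => oapp k 0 (insub j)); rewrite -sumE; apply: eq_bigr => j _.
by rewrite valK.
Qed.

Let eH j : H (e j).
Proof. by have [_ /(_ j)[[]]] := hlam. Qed.

Let ae_sub u v : ae_eq_on Theta u v <-> ae_eq_on Theta (u - v : V) (cst 0).
Proof.
split=> h; apply: filterS h => x hx Tx.
  by rewrite -[LHS]/(u x - v x) hx// subrr.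
by have := hx Tx; rewrite -[LHS]/(u x - v x) => /eqP; rewrite subr_eq0 => /eqP.
Qed.

Let He : eigensystem H A B lam e.
Proof.
have [[l0 _ lmono] hev hind hspan] := hlam; split => //.
- move=> i j; elim: j => [|j IH]; first by rewrite leqn0 => /eqP ->.
  by rewrite leq_eqVlt => /orP[/eqP -> //|/IH h]; exact: le_trans h (lmono j).
- move=> j; have [[h1 h2 h3] h4] := hev j; split; first by split.
  have : norm_b Theta b (e j) ^+ 2 = 1 by rewrite h4 expr1n.
  have BE : \int[mu]_(x in Theta) (b x * e j x ^+ 2) = B (e j) (e j).
    by apply: eq_Rintegral => x _; rewrite expr2 mulrA.
  by rewrite /norm_b BE sqr_sqrtr ?(form_ge0 HB (eH j)).
- move=> m k; set w := \sum_(j < m) _ => Bw j jm.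
  have hw : H w by exact: (lincomb_H HS eH m k).
  have := (dot_b_null (L2sub hw)).1 Bw; rewrite /w (@sumE m xpredT (fun i => k i)) => ae.
  by have := hind m (fun i => k i) ae (Ordinal jm).
- move=> l u [hu eu] Bu; have [|N [k hk]] := hspan l u.
    by split => // /(dot_b_null (L2sub hu)) h; rewrite h eqxx in Bu.
  have [k' kE] := @sumE_nat N (fun j => lam j == l) k.
  exists N, k' => /=; apply/dot_b_null; last by rewrite kE; exact: ((ae_sub _ _).1 hk).
  apply/L2sub/(subspaceB HS hu); apply: (subspace_sum HS) => j _.
  exact: (subspaceZ HS (k' j) (eH j)).
Qed.

Lemma Z_span m : (Z Theta e m : set V) = span_null H B e m.
Proof.
apply/seteqP; split => z [hz [k hk]]; split => //.
  have [k' kE] := @sumE_nat m xpredT k; exists k'.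
  apply/dot_b_null; last by rewrite kE; exact: ((ae_sub _ _).1 hk).
  by apply/L2sub/(subspaceB HS hz); exact: (lincomb_H HS eH m k').
exists (fun j => k j); rewrite -(@sumE m xpredT); apply/(ae_sub _ _).2/(dot_b_null _).1 => //.
by apply/L2sub/(subspaceB HS hz); exact: (lincomb_H HS eH m k).
Qed.

Lemma J_energy l u : H u -> J Theta a b c l u = energy A B n F l u.
Proof.
move=> hu; rewrite /J /energy /norm_a sqr_sqrtr ?(form_ge0 HA hu)//.
have BE : \int[mu]_(x in Theta) (b x * u x ^+ 2) = B u u.
  by apply: eq_Rintegral => x _; rewrite expr2 mulrA.
rewrite /norm_b BE sqr_sqrtr ?(form_ge0 HB hu)//; congr (_ - _ * _).
by rewrite /norm_c -powRrM mulVf ?gt_eqF// powRr1//; exact: F_ge0.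
Qed.

Lemma dJ_energy l u v : H u -> H v -> dJ Theta a b c l u v = quadQ A B l u v - dF u v.
Proof.
move=> hu hv; have [_ <-] := is_derive_energy HS HA HB hn is_derive_F l hu hv.
have fE : (fun t : R => J Theta a b c l (fun x => u x + t * v x)) = (fun t : R => energy A B n F l (u + t *: v)).
  by apply/funext => t; exact: (J_energy l (subspaceD HS hu (subspaceZ HS t hv))).
by rewrite /dJ fE derive1E.
Qed.

Lemma Nehari_nehari m l : (Nehari Theta a b c e m l : set V) = nehari H A B e dF m l.
Proof.
have hz z : Z Theta e m z -> H z by case.
have eqv u v : H u -> H v -> dJ Theta a b c l u v = 0 <-> quadQ A B l u v = dF u v.
  move=> hu hv; rewrite dJ_energy//; split=> [h|->]; last by rewrite subrr.
  by apply/eqP; rewrite -subr_eq0 h.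
rewrite /nehari -Z_span; apply/seteqP; split => u [hu nZ h1 h2]; split; [exact: hu|exact: nZ| | |exact: hu|exact: nZ| |].
- exact: (eqv u u hu hu).1.
- by move=> z Zz; exact: ((eqv u z hu (hz z Zz)).1 (h2 z Zz)).
- exact: (eqv u u hu hu).2.
- by move=> z Zz; exact: ((eqv u z hu (hz z Zz)).2 (h2 z Zz)).
Qed.

Lemma T_in_gap m l : T lam m l <-> in_gap lam m l.
Proof.
have [_ lmono _ _ _] := He; case: m => [|m] /=; rewrite in_itv/=.
  by split=> [h|[]]//; split.
split=> [/andP[h1 h2]|[h1 h2]]; last by rewrite h2 h1.
by split=> // i; rewrite ltnS => im; exact: le_trans (lmono i m im) h1.
Qed.

Local Notation L := (level_min H A B e n F dF).

Section level.
Variable m : nat.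

Let basis : exists f : nat -> V, [/\ forall j, H (f j), orthonormal B f m,
  forall i, (i < m)%N -> eigenvector H A B (lam i) (f i) & span_null H B f m = span_null H B e m].
Proof. exact: (eigenbasis HS HA HB He). Qed.

(** The extended infimum is the real one because the set of energies is nonempty and bounded
    below. *)
Lemma ell_level l : T lam m l -> ell Theta a b c e m l = (L m l)%:E.
Proof.
move=> /T_in_gap lT; have [f [hf of_ ef sf]] := basis; have [Cb Cb0 hCb] := F_hoelder0.
have iX := nehari_has_inf HS HA HB null_AB WC He hn F_ge0 FZ Cb0 hCb K_gt0 F_sobolev dF_diag is_derive_F F_brezis_lieb hf of_ ef sf lT.
rewrite /ell /level_min -(ereal_inf_EFin iX.2 iX.1); congr ereal_inf.
rewrite Nehari_nehari; apply/seteqP; split => y.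
  move=> [u nu <-]; exists (energy A B n F l u); first by exists u.
  by rewrite J_energy//; case: nu.
move=> [_ [u nu <-] <-]; exists u => //; by rewrite J_energy//; case: nu.
Qed.

Lemma attained_level l : T lam m l ->
  attained Theta a b c e m l <-> exists2 u, nehari H A B e dF m l u & energy A B n F l u = L m l.
Proof.
move=> lT; rewrite /attained ell_level// Nehari_nehari; split => -[u nu hu]; exists u => //.
  by case: hu; rewrite J_energy//; case: nu.
by rewrite J_energy ?hu//; case: nu.
Qed.

Lemma level_monotone l l' : T lam m l -> T lam m l' -> l <= l' -> L m l' <= L m l.
Proof.
move=> /T_in_gap lT /T_in_gap lT'; have [f [hf of_ ef sf]] := basis; have [Cb Cb0 hCb] := F_hoelder0.
exact: (level_min_monotone HS HA HB null_AB WC He hn F_ge0 FZ Cb0 hCb K_gt0 F_sobolev dF_nehari dF_diag is_derive_F F_brezis_lieb hf of_ ef sf lT lT').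
Qed.

Lemma level_gt0 l : T lam m l -> 0 < L m l.
Proof.
move=> /T_in_gap lT; have [f [hf of_ ef sf]] := basis; have [Cb Cb0 hCb] := F_hoelder0.
exact: (level_min_gt0 HS HA HB null_AB WC He hn F_ge0 FZ Cb0 hCb K_gt0 F_sobolev dF_nehari dF_diag is_derive_F F_brezis_lieb hf of_ ef sf lT).
Qed.

Lemma level_attained l : T lam m l -> L m l < kappa Theta a c -> attained Theta a b c e m l.
Proof.
move=> lT; rewrite kappaE => h; apply/attained_level => //; move/T_in_gap : lT => lT.
have [f [hf of_ ef sf]] := basis; have [Cb Cb0 hCb] := F_hoelder0.
exact: (level_min_attained HS HA HB null_AB WC He hn F_ge0 FZ Cb0 hCb K_gt0 F_sobolev dF_nehari dF_diag is_derive_F F_brezis_lieb hf of_ ef sf lT h).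
Qed.

Lemma level_strict l l' : T lam m l -> T lam m l' -> l < l' -> attained Theta a b c e m l -> L m l' < L m l.
Proof.
move=> lT lT' ll /(attained_level lT)[u nu uE]; move/T_in_gap : lT => lT; move/T_in_gap : lT' => lT'.
have [f [hf of_ ef sf]] := basis; have [Cb Cb0 hCb] := F_hoelder0.
exact: (level_min_strict HS HA HB null_AB WC He hn F_ge0 FZ Cb0 hCb K_gt0 F_sobolev dF_nehari dF_diag is_derive_F F_brezis_lieb hf of_ ef sf lT lT' ll nu uE).
Qed.

Lemma level_lipschitz : exists2 C : R, 0 < C & forall l l', T lam m l -> T lam m l' -> l <= l' ->
  L m l <= L m l' + C * (l' - l) * (1 + L m l).
Proof.
have [f [hf of_ ef sf]] := basis; have [Cb Cb0 hCb] := F_hoelder0.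
have [C C0 h] := level_min_lipschitz HS HA HB null_AB WC He hn F_ge0 FZ Cb0 hCb K_gt0 F_sobolev dF_nehari dF_diag is_derive_F F_brezis_lieb hf of_ ef sf.
by exists C => // l l' /T_in_gap lT /T_in_gap lT'; exact: h.
Qed.

Lemma level_endpoint : exists2 C : R, 0 < C & forall l, T lam m l ->
  L m l <= n%:R^-1 * (C * (lam m - l)) `^ (n%:R / 2).
Proof.
have [f [hf of_ ef sf]] := basis; have [Cb Cb0 hCb] := F_hoelder0.
exists Cb => // l /T_in_gap lT.
exact: (level_min_endpoint HS HA HB null_AB WC He hn F_ge0 FZ Cb0 hCb K_gt0 F_sobolev dF_diag is_derive_F F_brezis_lieb hf of_ ef sf lT).
Qed.

Lemma level_le_kappa l : T lam m l -> L m l <= kappa Theta a c.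
Proof.
move=> /T_in_gap lT; rewrite kappaE.
have [f [hf of_ ef sf]] := basis; have [Cb Cb0 hCb] := F_hoelder0.
have [c0 [c1 [c00 hc0]]] := c_bounds.
have [a0 [a1 [a00 ha0]]] := weight_bounds a_C0 a_gt0.
have [b0 [b1 [b00 hb0]]] := weight_bounds hb b_gt0.
apply: (level_min_le_kappa HS HA HB null_AB WC He hn F_ge0 FZ Cb0 hCb K_gt0 F_sobolev dF_nehari dF_diag is_derive_F F_brezis_lieb hf of_ ef sf lT).
move=> eta eta0.
have [x0 [Tx0 hx0]] : exists x0, Theta x0 /\ S * (a x0 / c x0 `^ (2 / p)) < K + eta / 2.
  (* One factor 1 + t for an almost minimal point y of the closure, and one each for a and c when y
     is moved into the domain. *)
  have [t t0 ht] : exists2 t : R, 0 < t & S * K0 * (1 + t) ^+ 3 <= K + eta / 4.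
    apply: small_power; first exact: mulr_gt0.
    by rewrite /K [S * _]mulrC ltrDl divr_gt0.
  have t10 : 0 < 1 + t by rewrite addr_gt0.
  have pow_le (x q : R) : 0 <= q -> q <= 1 -> 0 <= x -> ((1 + t) * x) `^ q <= (1 + t) * x `^ q.
    move=> q0 q1 x1; rewrite powRM ?(ltW t10)// ler_wpM2r ?powR_ge0//.
    by rewrite -[X in _ <= X](powRr1 (ltW t10)) ler_powR// lerDl ltW.
  have [_ [y cy <-] hy] := inf_adherent (mulr_gt0 t0 X_gt0) X_inf.
  have ay := a_gt0 cy; have cy0 := c_gt0 cy.
  have rho_y : a y / c y `^ (2 / p) <= (1 + t) * K0.
    have n20 : 0 <= 2 / n%:R :> R by rewrite divr_ge0.
    have n21 : 2 / n%:R <= 1 :> R by rewrite ler_pdivrMr ?mul1r ?(ltW n2)//; move: n2; lra.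
    rewrite -(X_ratio cy); apply: le_trans (pow_le (inf X) _ n20 n21 (ltW X_gt0)).
    apply: le_powR => //; first by rewrite mulr_ge0 ?invr_ge0 ?powR_ge0.
    by apply: ltW; move: hy; rewrite [(1 + t) * _]mulrDl mul1r.
  pose d := Num.min (t * a y) (t * c y / (1 + t)).
  have d0 : 0 < d by rewrite lt_min mulr_gt0//= divr_gt0// mulr_gt0.
  have [x0 [Tx0 h1 h2]] := closure_approx a_C0 hc cy d0.
  have cx0 := c_gt0 (subset_closure Tx0).
  have ax : a x0 <= (1 + t) * a y.
    have h3 : d <= t * a y by rewrite ge_min lexx.
    by move: h1; rewrite ltr_norml => /andP[h1 _]; rewrite mulrDl mul1r; move: h1 h3; move: (t * a y) => z; lra.
  have cx : c y <= (1 + t) * c x0.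
    have h3 : d <= t * c y / (1 + t) by rewrite ge_min lexx orbT.
    move: h2; rewrite ltr_norml => /andP[_ h2].
    rewrite mulrC -ler_pdivrMr//; apply: (@le_trans _ _ (c y - t * c y / (1 + t))).
      by rewrite le_eqVlt; apply/orP; left; apply/eqP; field; rewrite gt_eqF.
    by move: h2 h3; move: (t * c y / _) => z; lra.
  exists x0; split => //; apply: (@le_lt_trans _ _ (K + eta / 4)); last by rewrite ltrD2l ltr_pM2l// ltf_pV2 ?posrE// ltr_nat.
  apply: le_trans ht; rewrite -mulrA ler_pM2l// ler_pdivrMr ?powR_gt0//.
  have q1 : 2 / p <= 1 by rewrite ler_pdivrMr// mul1r ltW.
  have q0 : 0 <= 2 / p by rewrite divr_ge0// ltW.
  have cq : c y `^ (2 / p) <= (1 + t) * c x0 `^ (2 / p).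
    apply: le_trans (pow_le _ _ q0 q1 (ltW cx0)); apply: le_powR => //; exact: ltW.
  have h4 : a y <= (1 + t) * K0 * ((1 + t) * c x0 `^ (2 / p)).
    move: rho_y; rewrite ler_pdivrMr ?powR_gt0// => h; apply: le_trans h _.
    by rewrite ler_pM2l// mulr_gt0.
  apply: le_trans ax _; apply: (@le_trans _ _ ((1 + t) * ((1 + t) * K0 * ((1 + t) * c x0 `^ (2 / p))))).
    by rewrite ler_pM2l.
  by rewrite le_eqVlt; apply/orP; left; apply/eqP; ring.
have ha' x : Theta x -> 0 <= a x <= a1 by move=> Tx; have /andP[h1 ->] := ha0 x Tx; rewrite (le_trans (ltW a00) h1).
have hb' x : Theta x -> 0 <= b x <= b1 by move=> Tx; have /andP[h1 ->] := hb0 x Tx; rewrite (le_trans (ltW b00) h1).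
have [u_ [hu Fu Au cB]] := concentrating_sequence hn oU ma ha' mb hb' mc c00 hc0 Tx0
  (C0_closure_continuous oU a_C0 Tx0) (C0_closure_continuous oU hc Tx0) (a_gt0 (subset_closure Tx0)) hx0.
exact: (concentration HS HA HB null_AB WC He hn F_ge0 FZ hCb K_gt0 F_sobolev F_brezis_lieb hf of_ ef sf F_add lT eta0 hu Fu Au cB).
Qed.

Lemma T_upper l l' : T lam m l -> l <= l' -> l' < lam m -> T lam m l'.
Proof. by move=> /T_in_gap[h _] ll lm; apply/T_in_gap; split => // i /h/le_trans; apply. Qed.

Lemma T_lt l : T lam m l -> l < lam m. Proof. by move=> /T_in_gap[]. Qed.

Lemma kappa_gt0 : 0 < kappa Theta a c.
Proof. by rewrite kappaE mulr_gt0 ?powR_gt0// invr_gt0; move: n2; lra. Qed.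

(** Since all levels are at most [kappa], the estimate [level_lipschitz] has the uniform constant C
    (1 + kappa). *)
Lemma ell_continuous : {within T lam m, continuous (ell Theta a b c e m)}.
Proof.
apply/subspace_continuousP => l0 Tl0.
suff h : ell Theta a b c e m l @[l --> within (T lam m) (nbhs l0)] --> ell Theta a b c e m l0 by exact: h.
rewrite (ell_level Tl0).
have eqL : {near within (T lam m) (nbhs l0), EFin \o L m =1 ell Theta a b c e m}.
  by rewrite near_withinE; apply: nearW => l Tl; rewrite /= ell_level.
apply: cvg_trans (near_eq_cvg eqL) _; apply: cvg_EFin; first exact: nearW.
have [C C0 hC] := level_lipschitz; have k0 := kappa_gt0.
apply/cvgrPdist_le => d d0; rewrite near_withinE.
pose D := C * (1 + kappa Theta a c); have D0 : 0 < D by rewrite mulr_gt0// addr_gt0.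
apply/nbhs_ballP; exists (d / D); first exact: divr_gt0.
move=> l; rewrite /ball/= => hl Tl.
have key l1 l2 : T lam m l1 -> T lam m l2 -> l1 <= l2 -> `|l1 - l2| < d / D -> `|L m l1 - L m l2| <= d.
  move=> T1 T2 l12; rewrite ler0_norm ?subr_le0// opprB ltr_pdivlMr// => h.
  have h1 := level_monotone T1 T2 l12; have h2 := hC l1 l2 T1 T2 l12; have h3 := level_le_kappa T1.
  rewrite ger0_norm ?subr_ge0// lerBlDl; apply: le_trans h2 _; rewrite lerD2l; apply: ltW.
  apply: le_lt_trans h; rewrite [C * _]mulrC -mulrA; apply: ler_wpM2l; first by rewrite subr_ge0.
  by rewrite /D ler_pM2l// lerD2l.
have [ll|/ltW ll] := leP l0 l; first exact: key.
by rewrite distrC; apply: key => //; rewrite distrC.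
Qed.

Lemma level_small (d : R) : T lam m !=set0 -> 0 < d ->
  \forall l \near (lam m)^'-, T lam m l /\ L m l <= d.
Proof.
move=> [l0 Tl0] d0; have [C C0 hC] := level_endpoint.
have n0 : 0 < n%:R :> R by move: n2; lra.
(* Within distance y of the endpoint the bound of [level_endpoint] is at most d. *)
pose y := (n%:R * d) `^ (n%:R / 2)^-1 / C.
have y0 : 0 < y by rewrite divr_gt0// powR_gt0// mulr_gt0.
have h1 := nbhs_left_gt (T_lt Tl0); have h2 := nbhs_left_lt (lam m); have h3 := nbhs_left_ltBl (lam m) y0.
apply: filterS (filterI (filterI h1 h2) h3) => l [[g1 g2] g3].
have Tl : T lam m l by apply: (T_upper Tl0) => //; exact: ltW.
split => //; apply: le_trans (hC l Tl) _.
rewrite mulrC ler_pdivrMr// [d * _]mulrC; move: g3; rewrite ltr_pdivlMr// [_ * C]mulrC => g3.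
have z0 : 0 <= C * (lam m - l) by rewrite mulr_ge0 ?(ltW C0)// subr_ge0 ltW.
have := le_powR (ltW nh) z0 (ltW g3).
by rewrite (powRVK (ltW (mulr_gt0 n0 d0)) (lt0r_neq0 nh)).
Qed.

Lemma ell_cvg0 : T lam m !=set0 -> ell Theta a b c e m l @[l --> (lam m)^'-] --> 0%E.
Proof.
move=> T0.
have eqL : {near (lam m)^'-, EFin \o L m =1 ell Theta a b c e m}.
  by apply: filterS (level_small T0 ltr01) => l [Tl _]; rewrite /= ell_level.
apply: cvg_trans (near_eq_cvg eqL) _; apply: cvg_EFin; first exact: nearW.
apply/cvgrPdist_le => d d0; apply: filterS (level_small T0 d0) => l [Tl h].
by rewrite sub0r normrN ger0_norm// ltW// level_gt0.
Qed.

Lemma lambda_star_le l : T lam m l -> L m l < kappa Theta a c ->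
  (lambda_star Theta a b c lam e m <= l%:E)%E.
Proof.
by move=> Tl h; apply: ereal_inf_lbound; exists l => //; split => //; rewrite ell_level// lte_fin.
Qed.

Lemma lambda_star_lt : T lam m !=set0 -> (lambda_star Theta a b c lam e m < (lam m)%:E)%E.
Proof.
move=> T0; have k2 : 0 < kappa Theta a c / 2 by rewrite divr_gt0// kappa_gt0.
have [l [Tl h]] := @filter_ex _ (lam m)^'- (at_left_proper_filter (lam m)) _ (level_small T0 k2).
apply: (@le_lt_trans _ _ l%:E); last by rewrite lte_fin T_lt.
apply: lambda_star_le => //; apply: le_lt_trans h _; have := kappa_gt0; lra.
Qed.

(** If the level were attained at l, it would be below [kappa] at every larger l', so [lambda_star]
    would be at most the midpoint between l and itself. *)
Lemma not_attained_below l : T lam m l -> (l%:E < lambda_star Theta a b c lam e m)%E ->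
  ~ attained Theta a b c e m l.
Proof.
move=> Tl ls al; have ll := lambda_star_lt (ex_intro _ l Tl).
have h l' : l < l' -> l' < lam m -> (lambda_star Theta a b c lam e m <= l'%:E)%E.
  move=> ll' lm'; have Tl' := T_upper Tl (ltW ll') lm'.
  by apply: lambda_star_le => //; apply: lt_le_trans (level_strict Tl Tl' ll' al) _; exact: level_le_kappa.
move: ls ll h; case: (lambda_star Theta a b c lam e m) => [r||]//; rewrite !lte_fin => lr rm.
move=> h; have : (r%:E <= ((l + r) / 2)%:E)%E by apply: h; lra.
by rewrite lee_fin; lra.
Qed.

Lemma attained_above l : (lambda_star Theta a b c lam e m < l%:E)%E -> l < lam m ->
  attained Theta a b c e m l.
Proof.
move=> /ereal_inf_lt[_ [l0 [Tl0 h] <-]]; rewrite lte_fin => l0l lm.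
have Tl := T_upper Tl0 (ltW l0l) lm; apply: level_attained => //.
apply: le_lt_trans (level_monotone Tl0 Tl (ltW l0l)) _.
by move: h; rewrite ell_level// lte_fin.
Qed.

Lemma T_lower l : (if m is k.+1 then lam k <= l else true) -> l < lam m -> T lam m l.
Proof. by case: (m) => [|k] h lm; rewrite /= in_itv/= ?h ?lm. Qed.

End level.

End variational_problem.

Theorem theorem2p1 (R : realType) (n : nat) (Theta : set 'rV[R]_n)
    (a b c : 'rV[R]_n -> R) (lam : nat -> R) (e : nat -> 'rV[R]_n -> R)
    (hn : (3 <= n)%N)
    (hTheta : bounded_smooth_domain Theta)
    (ha : C1_closure Theta a) (hb : C0_closure Theta b) (hc : C0_closure Theta c)
    (a_gt0 : forall x, closure Theta x -> 0 < a x)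
    (b_gt0 : forall x, closure Theta x -> 0 < b x)
    (c_gt0 : forall x, closure Theta x -> 0 < c x)
    (hlam : eigen_enumeration Theta a b lam e)
    (m : nat) :
  let ell_ := ell Theta a b c e m in
  let kap := (kappa Theta a c)%:E in
  let lstar := lambda_star Theta a b c lam e in
  let attained_ := attained Theta a b c e m in
  (* (a) *)
  [/\ (forall l l', T lam m l -> T lam m l' -> l <= l' -> (ell_ l' <= ell_ l)%E) /\
      (forall l, T lam m l -> (0 < ell_ l <= kap)%E),
  (* (b) *)
      (forall l, T lam m l -> (ell_ l < kap)%E -> attained_ l),
  (* (c); [T lam m] is empty when the (m+1)-st eigenvalue equals the m-th *)
      {within T lam m, continuous ell_} /\
      (T lam m !=set0 ->
        ell_ l @[l --> (lam m)^'-] --> 0%E /\ (lstar m < (lam m)%:E)%E) &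
  (* (d) *)
      T lam m !=set0 ->
        (forall l, (if m is k.+1 then lam k <= l else true) ->
          (l%:E < lstar m)%E -> ~ attained_ l) /\
        (forall l, (lstar m < l%:E)%E -> l < lam m -> attained_ l)].
Proof.
move=> ell_ kap lstar attained_.
have ellE l (Tl : T lam m l) := ell_level hn hTheta ha hb hc a_gt0 b_gt0 c_gt0 hlam Tl.
split.
- split=> [l l' Tl Tl' ll|l Tl].
    by rewrite /ell_ !ellE// lee_fin; exact: (level_monotone hn hTheta ha hb hc a_gt0 b_gt0 c_gt0 hlam).
  rewrite /ell_ ellE// lte_fin lee_fin (level_gt0 hn hTheta ha hb hc a_gt0 b_gt0 c_gt0 hlam)//=.
  exact: (level_le_kappa hn hTheta ha hb hc a_gt0 b_gt0 c_gt0 hlam).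
- move=> l Tl; rewrite /ell_ ellE// lte_fin.
  exact: (level_attained hn hTheta ha hb hc a_gt0 b_gt0 c_gt0 hlam Tl).
- split; first exact: (ell_continuous hn hTheta ha hb hc a_gt0 b_gt0 c_gt0 hlam).
  move=> T0; split; first exact: (ell_cvg0 hn hTheta ha hb hc a_gt0 b_gt0 c_gt0 hlam T0).
  exact: (lambda_star_lt hn hTheta ha hb hc a_gt0 b_gt0 c_gt0 hlam T0).
- move=> T0; split=> [l lk ls|l]; last exact: (attained_above hn hTheta ha hb hc a_gt0 b_gt0 c_gt0 hlam).
  (* The nonexistence claim assumes only l < [lstar m]; that this stays below the endpoint comes
     from the limit zero there. *)
  have lm : l < lam m.
    have := lambda_star_lt hn hTheta ha hb hc a_gt0 b_gt0 c_gt0 hlam T0.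
    by rewrite -lte_fin; exact: lt_trans.
  exact: (not_attained_below hn hTheta ha hb hc a_gt0 b_gt0 c_gt0 hlam (T_lower lk lm)).
Qed.
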